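(* Let $X$ and $Y$ be smooth irreducible projective varieties over $\mathbf k$, let $i: Y \hookrightarrow \mathbf P^N$ be an embedding, let $\pi: X \to Y$ be a finite morphism of degree $n \ge 2$ with trace-zero module $\mathcal E$, let $\varphi = i\circ\pi: X \to \mathbf P^N$, and let $\mathcal I$ be the ideal sheaf of $i(Y)$ in $\mathbf P^N$. Let $T$ be a smooth irreducible algebraic curve and let $0$ be a closed point of $T$. Let $\Phi: \mathcal X \to \mathbf P^N_T$ be a flat family of morphisms over $T$ such that (1) $\mathcal X$ is irreducible and reduced; (2) $\mathcal X_t$ is smooth, irreducible and projective for all $t \in T$; (3) $\mathcal X_0 = X$ and $\Phi_0 = \varphi$. Let $\Delta$ be the first infinitesimal neighborhood of $0$ in $T$, let $\widetilde X = \mathcal X_\Delta$, $\widetilde\varphi = \Phi_\Delta$, and let $\nu$ be the element of $H^0(\mathcal N_\varphi)$ corresponding to $\widetilde\varphi$. If $\Psi_2(\nu) \in \mathrm{Hom}(\mathcal I/\mathcal I^2, \mathcal E)$ is a surjective homomorphism, then, shrinking $T$ (to an open neighborhood of $0$) if necessary, $\Phi_t$ is a closed immersion for any $t \in T$, $t \ne 0$.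
   Context: The base field $\mathbf k$ is algebraically closed of characteristic $0$. Trace-zero module: for a finite morphism $\pi: X\to Y$ of degree $n$ between smooth varieties, the trace map splits $\pi_*\mathcal O_X = \mathcal O_Y \oplus \mathcal E$; the vector bundle $\mathcal E$ on $Y$, of rank $n-1$, is the trace-zero module of $\pi$. Flat family of morphisms over $T$: a $T$-morphism $\Phi: \mathcal X \to \mathbf P^N_T=\mathbf P^N\times T$ for which $\mathcal X \to T$ is proper, flat and surjective. For $t\in T$ (or a subscheme of $T$) a subscript denotes restriction (base change) over it. Normal sheaf: $\mathcal N_\varphi$ is the cokernel in $0 \to \mathcal T_X \to \varphi^*\mathcal T_{\mathbf P^N} \to \mathcal N_\varphi \to 0$. The space $H^0(\mathcal N_\varphi)$ parametrizes first order infinitesimal deformations $\widetilde\varphi: \widetilde X\to \mathbf P^N_\Delta$ of $\varphi$ (with $X$ allowed to deform and $\mathbf P^N$ fixed), where $\Delta = \mathrm{Spec}(\mathbf k[\epsilon]/\epsilon^2)$. The maps $\Psi$, $\Psi_2$: the composite $\varphi^*\mathcal T_{\mathbf P^N} = \pi^*(\mathcal T_{\mathbf P^N}|_Y) \to \pi^*\mathcal N_{i(Y),\mathbf P^N}$ kills $\mathcal T_X$, so it induces $\mathcal N_\varphi \to \pi^*\mathcal N_{i(Y),\mathbf P^N}$. Taking global sections gives $$\Psi: H^0(\mathcal N_\varphi) \to \mathrm{Hom}(\pi^*(\mathcal I/\mathcal I^2), \mathcal O_X) = \mathrm{Hom}(\mathcal I/\mathcal I^2, \pi_*\mathcal O_X)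 = \mathrm{Hom}(\mathcal I/\mathcal I^2, \mathcal O_Y)\oplus \mathrm{Hom}(\mathcal I/\mathcal I^2, \mathcal E),$$ where $\mathcal I/\mathcal I^2$ is regarded as a sheaf on $Y$ via $i$. $\Psi_2: H^0(\mathcal N_\varphi)\to \mathrm{Hom}(\mathcal I/\mathcal I^2,\mathcal E)$ is the second component of $\Psi$. *)

(* Defs.v *)
From HB Require Import structures.
From mathcomp Require Import all_boot all_order all_algebra.
From mathcomp Require Import boolp classical_sets topology.
(* [mpoly] is not imported: its notations clash with those of [topology] *)
From mathcomp Require mpoly.

Set Implicit Arguments.
Unset Strict Implicit.
Unset Printing Implicit Defensive.

Import GRing.Theory.
Local Open Scope classical_set_scope.
Local Open Scope ring_scope.

Section CommutativeAlgebra.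
Variable R : comNzRingType.
Implicit Types (I P : set R) (a b : R).

Definition isunit a := exists b, a * b = 1.

Definition ring_ideal I :=
  [/\ I 0, forall a b, I a -> I b -> I (a + b) & forall a b, I b -> I (a * b)].

Definition prime_ideal P :=
  [/\ ring_ideal P, ~ P 1 & forall a b, P (a * b) -> P a \/ P b].

Definition spanned n (g : 'I_n -> R) : set R :=
  [set a | exists c : 'I_n -> R, a = \sum_(i < n) c i * g i].

Definition noetherian :=
  forall I, ring_ideal I -> exists n (g : 'I_n -> R), I = spanned g.

Definition prime_chain d :=
  exists P : nat -> set R,
    (forall i, (i <= d)%N -> prime_ideal (P i)) /\
    (forall i, (i < d)%N -> P i `<` P i.+1).

Definition krull_dim d := prime_chain d /\ ~ prime_chain d.+1.

(* The maximal ideal; used for local rings only. *)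
Definition nonunits : set R := [set a | ~ isunit a].

Definition sq_ideal I : set R :=
  [set a | exists n (u v : 'I_n -> R),
    (forall i, I (u i) /\ I (v i)) /\ a = \sum_(i < n) u i * v i].

Definition regular_local_ring :=
  noetherian /\ exists d (g : 'I_d -> R), krull_dim d /\ nonunits = spanned g.

End CommutativeAlgebra.

Arguments nonunits R : clear implicits.

Section Flatness.
Variables (A B : comNzRingType) (f : {rmorphism A -> B}).

Definition balanced (M : lmodType A) (Z : zmodType) (beta : M -> B -> Z) :=
  [/\ forall m m' b, beta (m + m') b = beta m b + beta m' b,
      forall m b b', beta m (b + b') = beta m b + beta m b' &
      forall a m b, beta (a *: m) b = beta m (f a * b)].

(* sum_i m_i (x) b_i = 0 in the tensor product of M and B over A *)
Definition tensor_zero (M : lmodType A) n (m : 'I_n -> M) (b : 'I_n -> B) :=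
  forall (Z : zmodType) (beta : M -> B -> Z), balanced beta ->
    \sum_(i < n) beta (m i) (b i) = 0.

Definition flat_ring :=
  forall (M N : lmodType A) (g : {linear M -> N}), injective g ->
  forall n (m : 'I_n -> M) (b : 'I_n -> B),
    tensor_zero (fun i => g (m i)) b -> tensor_zero m b.

End Flatness.

(* A sheaf of local k-algebras is presented by its espace etale: the stalks,
   together with the predicate "s : forall x, stk x is a continuous section
   of the espace etale in a neighbourhood of x".  The sections of O_X over an
   open U are the functions s that are regular at every point of U, two such
   functions being identified when they agree on U. *)
Record lrspace (k : fieldType) := LRSpace {
  space :> topologicalType;
  stk : space -> comAlgType k;
  reg : forall x : space, (forall x, stk x) -> Prop;
  stk_local : forall x (a : stk x), isunit a \/ isunit (1 - a);
  reg_near : forall x s, reg x s -> \forall y \near x, reg y s;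
  reg_ext : forall x s t,
    (\forall y \near x, s y = t y) -> reg x s -> reg x t;
  reg_germ : forall x (a : stk x), exists2 s, reg x s & s x = a;
  reg_inj : forall x s t, reg x s -> reg x t -> s x = t x ->
    \forall y \near x, s y = t y;
  reg_const : forall x (c : k), reg x (fun y => c%:A);
  reg_sub : forall x s t, reg x s -> reg x t -> reg x (fun y => s y - t y);
  reg_mul : forall x s t, reg x s -> reg x t -> reg x (fun y => s y * t y)
}.

Section Affine.
Variables (k : fieldType) (X : lrspace k).
Implicit Types (U : set X) (s t : forall x : X, stk x).

Definition reg_on U s := forall x, U x -> reg x s.

Definition eq_on U s t := forall x, U x -> s x = t x.

Definition Dset U s : set X := [set x | U x /\ isunit (s x)].

(* a prime ideal of the ring of sections over U *)
Definition prime_section_ideal U (p : (forall x : X, stk x) -> Prop) :=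
  [/\ (forall s, p s -> reg_on U s) /\
      (forall s t, eq_on U s t -> reg_on U t -> p s -> p t),
      p (fun=> 0),
      forall s t, p s -> p t -> p (fun x => s x + t x),
      forall s t, reg_on U s -> p t -> p (fun x => s x * t x) &
      ~ p (fun=> 1) /\
      forall s t, reg_on U s -> reg_on U t -> p (fun x => s x * t x) ->
        p s \/ p t].

(* The canonical morphism from the open subspace U to the spectrum of
   A = O_X(U), x |-> {s in A | s x is not a unit}, is an isomorphism: it is
   bijective, the D(s) form a basis of the topology of U, and
   O_X(D(s)) = A_s. *)
Definition affine_open U :=
  [/\ open U,
      forall x y, U x -> U y ->
        (forall s, reg_on U s -> isunit (s x) <-> isunit (s y)) -> x = y,
      forall p, prime_section_ideal U p ->
        exists2 x, U x & forall s, reg_on U s -> p s <-> ~ isunit (s x),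
      forall V x, open V -> U x -> V x ->
        exists s, [/\ reg_on U s, Dset U s x & Dset U s `<=` V] &
      forall s, reg_on U s ->
        (forall t, reg_on (Dset U s) t -> exists n t', reg_on U t' /\
           eq_on (Dset U s) t' (fun x => s x ^+ n * t x)) /\
        (forall t, reg_on U t -> eq_on (Dset U s) t (fun=> 0) ->
           exists n, eq_on U (fun x => s x ^+ n * t x) (fun=> 0))].

End Affine.

Record scheme (k : fieldType) := Scheme {
  lrs :> lrspace k;
  scheme_affine : forall x : lrs, exists2 U : set lrs, affine_open U & U x
}.

Record mor (k : fieldType) (X Y : scheme k) := Mor {
  fpt :> X -> Y;
  fstk : forall x, {rmorphism stk (fpt x) -> stk x};
  fpt_continuous : continuous fpt;
  fstk_const : forall x (c : k), fstk x c%:A = c%:A;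
  fstk_local : forall x (a : stk (fpt x)), isunit (fstk x a) -> isunit a;
  fstk_reg : forall x s, reg (fpt x) s -> reg x (fun y => fstk y (s (fpt y)))
}.

Section Morphisms.
Variable k : fieldType.
Implicit Types X Y Z : scheme k.

Definition pull X Y (f : mor X Y) (s : forall y : Y, stk y) :
  forall x : X, stk x := fun x => fstk f x (s (f x)).

Definition eqm X Y (f g : mor X Y) :=
  (forall x, f x = g x) /\ (forall s x, pull f s x = pull g s x).

Program Definition idm X : mor X X :=
  @Mor k X X id (fun x => idfun) _ _ _ _.
Next Obligation. by move=> X x. Qed.
Next Obligation. by []. Qed.
Next Obligation. by []. Qed.
Next Obligation. by []. Qed.

Program Definition mcomp X Y Z (g : mor Y Z) (f : mor X Y) : mor X Z :=
  @Mor k X Z (fun x => g (f x)) (fun x => fstk f x \o fstk g (f x)) _ _ _ _.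
Next Obligation.
move=> X Y Z g f x.
by apply: continuous_comp; apply: fpt_continuous.
Qed.
Next Obligation. by move=> X Y Z g f x c /=; rewrite !fstk_const. Qed.
Next Obligation.
by move=> X Y Z g f x a /= /fstk_local /fstk_local.
Qed.
Next Obligation.
by move=> X Y Z g f x s /= /fstk_reg /fstk_reg.
Qed.

Definition is_pullback X Y Z W (f : mor X Z) (g : mor Y Z)
    (p : mor W X) (q : mor W Y) :=
  eqm (mcomp f p) (mcomp g q) /\
  forall V (a : mor V X) (b : mor V Y), eqm (mcomp f a) (mcomp g b) ->
    (exists h : mor V W, eqm (mcomp p h) a /\ eqm (mcomp q h) b) /\
    (forall h h' : mor V W, eqm (mcomp p h) (mcomp p h') ->
       eqm (mcomp q h) (mcomp q h') -> eqm h h').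

End Morphisms.

Section SpecField.
Variable k : fieldType.

Let pt := initial_topology (fun _ : unit => true).

Lemma pt_near (x : pt) (P : pt -> Prop) : (\forall y \near x, P y) <-> P x.
Proof.
split=> [/nbhs_singleton//|Px].
by apply: filterS (@filterT _ (nbhs x) _) => y _; case: y; case: x Px.
Qed.

Program Definition Spec_lrspace : lrspace k :=
  @LRSpace k pt (fun=> k^o) (fun _ _ => True) _ _ _ _ _ _ _ _.
Next Obligation.
move=> x a; have [->|a0] := eqVneq a 0; last by left; exists a^-1; exact: mulfV.
by right; exists 1; rewrite subr0 mulr1.
Qed.
Next Obligation. by move=> x s _; apply/pt_near. Qed.
Next Obligation. by []. Qed.
Next Obligation. by move=> x a; exists (fun=> a). Qed.
Next Obligation. by move=> x s t _ _ st; apply/pt_near. Qed.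
Next Obligation. by []. Qed.
Next Obligation. by []. Qed.
Next Obligation. by []. Qed.

Lemma Spec_affine : affine_open (setT : set Spec_lrspace).
Proof.
have kunit (a : k^o) : isunit a <-> a != 0.
  split=> [[b ab]|a0]; last by exists a^-1; exact: mulfV.
  by apply/eqP => a0; move: ab; rewrite a0 mul0r => /esym/eqP; rewrite oner_eq0.
split.
- exact: openT.
- by move=> [] [].
- move=> p [[_ pE] p0 _ pM [p1 _]]; exists tt => // s _; split.
    move=> ps /kunit s0; apply: p1.
    have := pM (fun x => (s x)^-1 : k^o) s (fun _ _ => I) ps.
    by apply: pE => // -[] _ /=; rewrite mulVf.
  move=> s0; apply: pE p0 => // -[] _.
  by apply/eqP; rewrite eq_sym; apply/negPn/negP => /kunit.
- move=> V x _ _ Vx; exists (fun=> 1); split=> //.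
    by split=> //; apply/kunit; exact: oner_neq0.
  by move=> y _; case: y; case: x Vx.
- move=> s _; split=> [t _|t _ t0].
    exists 1%N, (fun x => s x ^+ 1 * t x); by split.
  have [s0|s0] := eqVneq (s tt) 0.
    by exists 1%N => -[] _; rewrite s0 expr1 mul0r.
  exists 0%N => -[] _; rewrite (t0 tt) ?mulr0 //.
  by split=> //; apply/kunit.
Qed.

Definition Spec : scheme k :=
  @Scheme k Spec_lrspace (fun x => ex_intro2 _ _ setT Spec_affine I).

Program Definition to_Spec (X : scheme k) : mor X Spec :=
  @Mor k X Spec (fun=> tt) (fun x => in_alg (stk x)) _ _ _ _.
Next Obligation. by move=> X x; exact: cst_continuous. Qed.
Next Obligation. by move=> X x c /=; rewrite [c%:A]mulr1. Qed.
Next Obligation.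
move=> X x a [b ab]; have [a0|a0] := eqVneq a 0.
  by move: ab; rewrite /= a0 scale0r mul0r => /esym/eqP; rewrite oner_eq0.
by exists a^-1; exact: mulfV.
Qed.
Next Obligation. by move=> X x s _; exact: reg_const. Qed.

End SpecField.

Section Properties.
Variable k : fieldType.
Implicit Types X Y Z W S T D : scheme k.

Definition closed_map X Y (f : mor X Y) :=
  forall C : set X, closed C -> closed (f @` C).

Definition closed_immersion X Y (f : mor X Y) :=
  [/\ injective f, closed_map f &
      forall x (a : stk x), exists b, fstk f x b = a].

Definition separated_mor X Y (f : mor X Y) :=
  forall W (p q : mor W X), is_pullback f f p q ->
  forall d : mor X W, eqm (mcomp p d) (idm X) -> eqm (mcomp q d) (idm X) ->
    closed_immersion d.

Definition universally_closed X Y (f : mor X Y) :=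
  forall Z W (g : mor Z Y) (p : mor W X) (q : mor W Z),
    is_pullback f g p q -> closed_map q.

(* O_X(U) is an O_Y(V)-algebra of finite type; here U is in f^-1(V) *)
Definition fin_gen_alg X Y (f : mor X Y) (U : set X) (V : set Y) :=
  exists m (g : 'I_m -> forall x : X, stk x),
    (forall j, reg_on U (g j)) /\
    forall s, reg_on U s ->
      exists r (c : 'I_r -> forall y : Y, stk y) (e : 'I_r -> 'I_m -> nat),
        (forall i, reg_on V (c i)) /\
        eq_on U s (fun x =>
          \sum_(i < r) pull f (c i) x * \prod_(j < m) g j x ^+ e i j).

Definition finite_type_mor X Y (f : mor X Y) :=
  forall y, exists V : set Y, [/\ affine_open V, V y &
    exists r (U : 'I_r -> set X),
      (forall i, affine_open (U i) /\ fin_gen_alg f (U i) V) /\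
      f @^-1` V = \bigcup_(i in [set: 'I_r]) U i].

Definition proper_mor X Y (f : mor X Y) :=
  [/\ separated_mor f, finite_type_mor f & universally_closed f].

Definition finite_mor X Y (f : mor X Y) :=
  forall y, exists V : set Y, [/\ affine_open V, V y,
    affine_open (f @^-1` V) &
    exists m (e : 'I_m -> forall x : X, stk x),
      (forall j, reg_on (f @^-1` V) (e j)) /\
      forall s, reg_on (f @^-1` V) s ->
        exists c : 'I_m -> forall y : Y, stk y,
          (forall j, reg_on V (c j)) /\
          eq_on (f @^-1` V) s (fun x => \sum_(j < m) pull f (c j) x * e j x)].

Definition flat_mor X Y (f : mor X Y) := forall x, flat_ring (fstk f x).

Definition surjective_mor X Y (f : mor X Y) := forall y, exists x, f x = y.

Definition irreducible_set (T : topologicalType) (A : set T) :=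
  A !=set0 /\ forall F G : set T, closed F -> closed G ->
    A `<=` F `|` G -> A `<=` F \/ A `<=` G.

Definition irreducible_scheme X := irreducible_set [set: X].

Definition reduced_scheme X :=
  forall (x : X) (a : stk x) n, a ^+ n = 0 -> a = 0.

Definition dimension X (d : nat) :=
  let chain e := exists F : nat -> set X,
    (forall i, (i <= e)%N -> closed (F i) /\ irreducible_set (F i)) /\
    (forall i, (i < e)%N -> F i `<` F i.+1) in
  chain d /\ ~ chain d.+1.

(* Only used when S is the spectrum of a field of characteristic 0, hence
   perfect, where smoothness is regularity of the local rings. *)
Definition smooth_mor X S (f : mor X S) :=
  finite_type_mor f /\ forall x : X, regular_local_ring (stk x).

(* P is the projective N-space over k: x i j is the function X_j / X_i on
   the open subset U i = {X_i <> 0}, whose coordinate ring is the polynomial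
   ring in the x i j, j <> i. *)
Definition proj_space N (P : scheme k) :=
  exists (U : 'I_N.+1 -> set P) (x : 'I_N.+1 -> 'I_N.+1 -> forall p : P, stk p),
  [/\ (forall i, affine_open (U i)) /\ (forall p, exists i, U i p),
      forall i j, reg_on (U i) (x i j),
      forall i, eq_on (U i) (x i i) (fun=> 1),
      (forall i j p, U i p -> (U j p <-> isunit (x i j p))) /\
      (forall i j l p, U i p -> U j p -> x i j p * x j l p = x i l p) &
      forall i s, reg_on (U i) s ->
        exists! q : mpoly.mpoly N k,
          eq_on (U i) s (fun p =>
            mpoly.mmap (in_alg (stk p)) (fun j => x i (lift i j) p) q)].

Definition is_product X Y W (p : mor W X) (q : mor W Y) :=
  is_pullback (to_Spec X) (to_Spec Y) p q.

Definition projective_mor X S (f : mor X S) :=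
  exists M (P PS : scheme k) (pr1 : mor PS P) (pr2 : mor PS S) (h : mor X PS),
    [/\ proj_space M P, is_product pr1 pr2, closed_immersion h &
        eqm (mcomp pr2 h) f].

Definition smooth_proj_var X :=
  [/\ smooth_mor (to_Spec X), irreducible_scheme X & projective_mor (to_Spec X)].

Definition smooth_curve X :=
  [/\ separated_mor (to_Spec X), smooth_mor (to_Spec X), irreducible_scheme X, reduced_scheme X &
      dimension X 1].

(* tau : S -> T is the inclusion of the spectrum of the residue field of t *)
Definition residue_point S T (t : T) (tau : mor S T) :=
  [/\ exists s : S, forall s', s' = s, forall s, tau s = t,
      forall s (a : stk s), exists b, fstk tau s b = a &
      forall s (b : stk (tau s)), fstk tau s b = 0 <-> ~ isunit b].

(* j : D -> T is the inclusion of the closed subscheme with support {t}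
   defined by the square of the maximal ideal of O_{T,t} *)
Definition first_inf_nbhd D T (t : T) (j : mor D T) :=
  [/\ exists d : D, forall d', d' = d, forall d, j d = t,
      forall d (a : stk d), exists b, fstk j d b = a &
      forall d (b : stk (j d)),
        fstk j d b = 0 <-> sq_ideal (nonunits (stk (j d))) b].

(* When D is the first infinitesimal neighbourhood of a point of a smooth
   curve, such an eps identifies D with Spec (k[eps]/eps^2). *)
Definition dual_param D (eps : forall d : D, stk d) :=
  forall d, eps d <> 0 /\ nonunits (stk d) = [set a | exists c, a = c * eps d].

End Properties.

Section TraceZero.
Variable k : fieldType.
Variables (X Y : scheme k) (f : mor X Y).

Definition generic_point (Z : scheme k) (z : Z) := closure [set z] = setT.

(* e is a basis of the function field of X over that of Y, where x is the
   generic point of X *)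
Definition field_basis (x : X) n (e : 'I_n -> stk x) :=
  forall a, exists! c : {ffun 'I_n -> stk (f x)},
    a = \sum_(i < n) fstk f x (c i) * e i.

Definition degree_mor n :=
  exists x : X, [/\ generic_point x, generic_point (f x) &
    exists e : 'I_n -> stk x, field_basis e].

(* b is the trace of a for the extension of function fields *)
Definition field_trace (x : X) (a : stk x) (b : stk (f x)) :=
  exists n (e : 'I_n -> stk x) (M : 'M[stk (f x)]_n),
    [/\ field_basis e,
        forall j, a * e j = \sum_(i < n) fstk f x (M i j) * e i &
        b = \tr M].

(* Sections over V of the trace-zero module, the kernel of the trace map
   f_*O_X -> O_Y.  As Y is normal, this map is the restriction of the trace
   of function fields. *)
Definition trace_zero (V : set Y) (e : forall x : X, stk x) :=
  reg_on (f @^-1` V) e /\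
  forall x, generic_point x -> V (f x) -> field_trace (e x) 0.

End TraceZero.

Section NormalSheaf.
Variable k : fieldType.

(* Section over U of the sheaf Der_k(f^-1 O_Y, O_X).  It is T_X for f = id,
   and f^* T_Y = Hom(f^* Omega_Y, O_X) when Y is smooth. *)
Definition der_section (X Y : scheme k) (f : mor X Y) (U : set X)
    (D : forall x : X, stk (f x) -> stk x) :=
  forall x, U x ->
  [/\ forall a b, D x (a + b) = D x a + D x b,
      forall c : k, D x c%:A = 0,
      forall a b, D x (a * b) = fstk f x a * D x b + fstk f x b * D x a &
      forall s, reg (f x) s -> reg x (fun y => D y (s (f y)))].

Arguments der_section [X Y] f U D.

Definition tangent_section (X : scheme k) := der_section (idm X).

Variables (X P : scheme k) (phi : mor X P).

Definition normal_eq_at (x : X) (D D' : forall x : X, stk (phi x) -> stk x) :=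
  exists (W : set X) theta, [/\ open W, W x, tangent_section W theta &
    forall y, W y -> forall a, D' y a = D y a + theta y (fstk phi y a)].

(* A global section of N_phi, the cokernel of T_X -> phi^* T_P, given by all
   the pairs (U, D) where D is a section of phi^* T_P over U that maps to its
   restriction to U. *)
Record H0_normal := H0Normal {
  lifts : set X -> (forall x : X, stk (phi x) -> stk x) -> Prop;
  lifts_der : forall U D, lifts U D -> open U /\ der_section phi U D;
  lifts_cover : forall x, exists D, exists2 U, lifts U D & U x;
  lifts_compat : forall U U' D D' x, lifts U D -> lifts U' D' ->
    U x -> U' x -> normal_eq_at x D D';
  lifts_sat : forall U D, open U -> der_section phi U D ->
    (forall x, U x -> exists U' D', [/\ lifts U' D', U' x &
       normal_eq_at x D' D]) -> lifts U D
}.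

(* A trivialisation over V of a deformation Xt of X: a k-algebra section, on
   V, of O_Xt -> O_X, where c : X -> Xt is the inclusion. *)
Definition splitting_on (Xt : scheme k) (c : mor X Xt) (V : set X)
    (sigma : forall x : X, stk x -> stk (c x)) :=
  forall x, V x ->
  [/\ forall a, fstk c x (sigma x a) = a,
      (forall a b, sigma x (a + b) = sigma x a + sigma x b) /\
      (forall a b, sigma x (a * b) = sigma x a * sigma x b),
      forall l : k, sigma x l%:A = l%:A &
      forall s, reg x s -> exists2 t, reg (c x) t &
        \forall y \near x, t (c y) = sigma y (s y)].

(* nu is the section of N_phi that corresponds to the first order deformation
   phit : Xt -> P of phi; eps is the parameter of the base, pulled back to
   Xt.  A trivialisation sigma over V identifies phit^# with phi^# + eps D. *)
Definition corresponds (Xt : scheme k) (c : mor X Xt) (phit : mor Xt P)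
    (eps : forall z : Xt, stk z) (nu : H0_normal) :=
  forall U D, lifts nu U D <->
    [/\ open U, der_section phi U D &
        forall x, U x -> exists (V : set X) sigma,
          [/\ open V, V x, splitting_on (c := c) V sigma &
              forall y, V y -> U y -> forall s : forall p : P, stk p,
                pull phit s (c y) = sigma y (pull phi s y) +
                  eps (c y) * sigma y (D y (s (phi y)))]].

End NormalSheaf.

Section Psi.
Variable k : fieldType.
Variables (X Y P : scheme k) (i : mor Y P) (pi : mor X Y).
Variable nu : H0_normal (mcomp i pi).

(* sections over W of the ideal sheaf of i(Y) *)
Definition ideal_section (W : set P) (s : forall p : P, stk p) :=
  reg_on W s /\ eq_on (i @^-1` W) (pull i s) (fun=> 0).

(* Psi nu as a homomorphism from the ideal sheaf I of i(Y) to pi_*O_X (it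
   kills I^2).  On sections of I it does not depend on the chosen lift, see
   [PsiE]. *)
Definition Psi (s : forall p : P, stk p) : forall x : X, stk x :=
  fun x => sval (cid (lifts_cover nu x)) x (s (mcomp i pi x)).

Lemma PsiE W s U D x : ideal_section W s -> W (i (pi x)) ->
  lifts nu U D -> U x -> Psi s x = D x (s (mcomp i pi x)).
Proof.
move=> [_ s0] Wx lD Ux; rewrite /Psi; case: cid => D' /= [U' lD' U'x].
have [V [theta [_ Vx /(_ _ Vx) [thD _ _ _] ->//]]] :=
  lifts_compat lD lD' Ux U'x.
have /= -> : fstk i (pi x) (s (i (pi x))) = 0 by exact: s0.
rewrite rmorph0 -[RHS]addr0; congr (_ + _).
by have := thD 0 0; rewrite addr0 => /esym/eqP; rewrite -subr_eq0 addrK => /eqP.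
Qed.

(* e is the component of Psi nu s in the trace-zero module, in the
   decomposition of pi_*O_X into O_Y and the trace-zero module, over V *)
Definition Psi2 (V : set Y) (s : forall p : P, stk p)
    (e : forall x : X, stk x) :=
  trace_zero pi V e /\
  exists2 b : forall y : Y, stk y, reg_on V b &
    eq_on (pi @^-1` V) (Psi s) (fun x => pull pi b x + e x).

(* Psi2 nu, from I/I^2 to the trace-zero module, is an epimorphism of sheaves
   on Y. *)
Definition Psi2_surjective :=
  forall (V : set Y) e y, open V -> V y -> trace_zero pi V e ->
  exists (W : set P) (V' : set Y) s,
    [/\ open W /\ ideal_section W s, open V', V' y, V' `<=` V `&` i @^-1` W &
        Psi2 V' s e].

End Psi.

(* Main.v *)
(* Let tau be a parameter of T at 0 and f a function on an open subset of P^N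
   that vanishes on Y.  Then Phi^# f is divisible by tau, and the restriction
   to X of the quotient is Psi f.  As Y is normal and the characteristic is 0,
   every function on X is, locally on Y, the sum of a function on Y and of a
   section of the trace-zero module; so, when Psi_2 is surjective, the
   coordinates xi of P^N together with finitely many quotients (Phi^# f) / tau
   generate the functions on X.  By properness the graph of these coordinates
   is closed, which makes every germ of function on XX at a point over 0
   integral over the local ring generated by the coordinates, and the latter
   is everything by Nakayama.  For t <> 0, tau is invertible and the quotients
   come from P^N_T as well: Phi_t separates the points and is surjective on
   the stalks. *)
Require Import Defs.
From HB Require Import structures.
From mathcomp Require Import all_boot all_order all_algebra.
From mathcomp Require Import boolp classical_sets topology.
From mathcomp Require Import ring zify.
From mathcomp Require Import -(notations) mpoly.

Set Implicit Arguments.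
Unset Strict Implicit.
Unset Printing Implicit Defensive.

Import GRing.Theory.
Local Open Scope classical_set_scope.
Local Open Scope ring_scope.

(** * Localisation *)

(** The properness of [p] is used through universal closedness after base change to affine M-space
    over T: the closure of the graph of finitely many functions has closed image there, and a point
    outside this image is cut off by one polynomial with coefficients on T. The obstacle is that the
    quotients by tau live only over a chart of P^N, which is not proper over T. It is overcome
    because at the boundary of the chart an affine coordinate has a pole, so that the closure adds
    no point to the graph. The integrality of a germ b comes from the same argument with 1/b as an
    extra coordinate, reducedness turning a nowhere invertible function into zero. Since fibres and
    products are given by universal properties, their points and stalks are read off explicit
    models, built as affine spaces over locally closed pieces of a scheme. The regularity of the
    trace of a regular function rests on regular local rings being completely integrally closed, a
    property that is lifted along a regular system of parameters, starting from the residue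
    field. *)

Section Localisation.
Variable R : comNzRingType.

Record loc_data := LocData {
  loc_q : set R;
  loc_J : set R;
  loc_prime : prime_ideal loc_q;
  loc_ideal : ring_ideal loc_J;
  loc_sub : loc_J `<=` loc_q
}.

Variable d : loc_data.
Local Notation q := (loc_q d).
Local Notation J := (loc_J d).

(* This presents the localisation of R / loc_J at loc_q in one step. *)
Definition loc_eq (x y : R * R) :=
  exists2 u, ~ q u & J (u * (x.1 * y.2 - y.1 * x.2)).

Definition loc := {A : set (R * R) |
  exists2 x : R * R, ~ q x.2 & A = [set y | ~ q y.2 /\ loc_eq x y]}.

HB.instance Definition _ := gen_eqMixin loc.
HB.instance Definition _ := gen_choiceMixin loc.

Lemma locq1 : ~ q 1. Proof. by case: (loc_prime d). Qed.

Lemma locqM a b : ~ q a -> ~ q b -> ~ q (a * b).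
Proof. by case: (loc_prime d) => _ _ qM qa qb /qM []. Qed.

Lemma locJD a b : J a -> J b -> J (a + b).
Proof. by case: (loc_ideal d) => _ + _; apply. Qed.

Lemma locJM a b : J b -> J (a * b).
Proof. by case: (loc_ideal d) => _ _; apply. Qed.

Lemma locJ0 : J 0. Proof. by case: (loc_ideal d). Qed.

Lemma loc_eqC x y : loc_eq x y -> loc_eq y x.
Proof.
move=> [u qu Ju]; exists u => //.
rewrite (_ : _ * _ = (-1) * (u * (x.1 * y.2 - y.1 * x.2))); first exact: locJM.
by ring.
Qed.

Lemma loc_eqT x y z : ~ q y.2 -> loc_eq x y -> loc_eq y z -> loc_eq x z.
Proof.
move=> qy [u qu Ju] [v qv Jv]; exists (y.2 * (u * v)).
  by do 2 ?apply: locqM.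
rewrite (_ : _ * _ = (v * z.2) * (u * (x.1 * y.2 - y.1 * x.2)) +
  (u * x.2) * (v * (y.1 * z.2 - z.1 * y.2))); last by ring.
by apply: locJD; apply: locJM.
Qed.

Lemma frac_subproof (a s : R) : exists2 x : R * R, ~ q x.2 &
  [set y | ~ q y.2 /\ loc_eq (if pselect (q s) then (0, 1) else (a, s)) y] =
  [set y | ~ q y.2 /\ loc_eq x y].
Proof.
exists (if pselect (q s) then (0, 1) else (a, s)) => //.
by case: pselect => //= _; apply: locq1.
Qed.

(* The junk value is 0 when s is in loc_q. *)
Definition frac a s : loc := exist _ _ (frac_subproof a s).

Lemma frac_val a s : ~ q s ->
  sval (frac a s) = [set y | ~ q y.2 /\ loc_eq (a, s) y].
Proof. by rewrite /=; case: (pselect (q s)). Qed.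

Lemma frac_inj a s b t : ~ q s -> ~ q t ->
  frac a s = frac b t <-> exists2 u, ~ q u & J (u * (a * t - b * s)).
Proof.
move=> qs qt; split.
  move=> /(congr1 sval); rewrite !frac_val //.
  move=> /(congr1 (fun A => A (b, t))) /= e.
  have : ~ q t /\ loc_eq (b, t) (b, t).
    split=> //; exists 1; first exact: locq1.
    by rewrite subrr mulr0; exact: locJ0.
  by rewrite -e => -[_].
move=> e; apply: eq_exist; rewrite -[LHS]/(sval (frac a s)) -[RHS]/(sval (frac b t)).
rewrite !frac_val //.
apply/seteqP; split=> y /= [qy exy]; split=> //.
  by apply: loc_eqT exy => //; apply: loc_eqC.
exact: loc_eqT exy.
Qed.

Lemma fracP (x : loc) : exists a s, ~ q s /\ x = frac a s.
Proof.
case: x => A [[a s] qs AE]; exists a, s; split=> //.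
by apply: eq_exist; rewrite -[RHS]/(sval (frac a s)) frac_val.
Qed.

Definition num x : R := sval (cid (fracP x)).
Definition den x : R := sval (cid (svalP (cid (fracP x)))).

Lemma denP x : ~ q (den x).
Proof. by case: (svalP (cid (svalP (cid (fracP x))))). Qed.

Lemma fracE x : x = frac (num x) (den x).
Proof. by case: (svalP (cid (svalP (cid (fracP x))))). Qed.

Lemma num_den a s : ~ q s ->
  exists2 u, ~ q u & J (u * (a * den (frac a s) - num (frac a s) * s)).
Proof.
move=> qs; apply/frac_inj => //; first exact: denP.
by rewrite -fracE.
Qed.

Definition loc_add x y := frac (num x * den y + num y * den x) (den x * den y).
Definition loc_mul x y := frac (num x * num y) (den x * den y).
Definition loc_opp x := frac (- num x) (den x).

Lemma loc_addE a s b t : ~ q s -> ~ q t ->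
  loc_add (frac a s) (frac b t) = frac (a * t + b * s) (s * t).
Proof.
move=> qs qt; have [u qu Ju] := num_den a qs; have [v qv Jv] := num_den b qt.
rewrite /loc_add; move: (@denP (frac a s)) (@denP (frac b t)) Ju Jv.
set a' := num _; set s' := den _; set b' := num _; set t' := den _.
move=> qs' qt' Ju Jv; apply/frac_inj; [exact: locqM|exact: locqM|].
exists (u * v); first exact: locqM.
rewrite (_ : _ * _ = (- v * t * t') * (u * (a * s' - a' * s)) +
  (- u * s * s') * (v * (b * t' - b' * t))); last by ring.
by apply: locJD; apply: locJM.
Qed.

Lemma loc_mulE a s b t : ~ q s -> ~ q t ->
  loc_mul (frac a s) (frac b t) = frac (a * b) (s * t).
Proof.
move=> qs qt; have [u qu Ju] := num_den a qs; have [v qv Jv] := num_den b qt.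
rewrite /loc_mul; move: (@denP (frac a s)) (@denP (frac b t)) Ju Jv.
set a' := num _; set s' := den _; set b' := num _; set t' := den _.
move=> qs' qt' Ju Jv; apply/frac_inj; [exact: locqM|exact: locqM|].
exists (u * v); first exact: locqM.
rewrite (_ : _ * _ = (- v * b' * t) * (u * (a * s' - a' * s)) +
  (- u * a * s') * (v * (b * t' - b' * t))); last by ring.
by apply: locJD; apply: locJM.
Qed.

Lemma loc_oppE a s : ~ q s -> loc_opp (frac a s) = frac (- a) s.
Proof.
move=> qs; have [u qu Ju] := num_den a qs.
rewrite /loc_opp; move: (@denP (frac a s)) Ju.
set a' := num _; set s' := den _ => qs' Ju.
apply/frac_inj => //; exists u => //.
by rewrite (_ : _ * _ = u * (a * s' - a' * s)) //; ring.
Qed.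

Lemma frac_eq a s b t : ~ q s -> ~ q t -> a * t = b * s -> frac a s = frac b t.
Proof.
move=> qs qt e; apply/frac_inj => //; exists 1; first exact: locq1.
by rewrite e subrr mulr0; exact: locJ0.
Qed.

Lemma frac_mulr a s t : ~ q s -> ~ q t -> frac (a * t) (s * t) = frac a s.
Proof. by move=> qs qt; apply: frac_eq; [exact: locqM| |ring]. Qed.

Local Ltac locsolve :=
  rewrite ?(loc_addE, loc_mulE, loc_oppE) //;
  do ?[exact: locq1 | apply: locqM => //];
  try (apply: frac_eq; do ?[exact: locq1 | apply: locqM => //]; try done; ring).

Fact loc_addA : associative loc_add.
Proof.
move=> x y z; have [a [s [qs ->]]] := fracP x; have [b [t [qt ->]]] := fracP y.
by have [c [r [qr ->]]] := fracP z; locsolve.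
Qed.

Fact loc_addC : commutative loc_add.
Proof.
move=> x y; have [a [s [qs ->]]] := fracP x; have [b [t [qt ->]]] := fracP y.
by locsolve.
Qed.

Fact loc_add0 : left_id (frac 0 1) loc_add.
Proof.
move=> x; have [a [s [qs ->]]] := fracP x.
by have q1 := locq1; locsolve.
Qed.

Fact loc_addN : left_inverse (frac 0 1) loc_opp loc_add.
Proof.
by move=> x; have [a [s [qs ->]]] := fracP x; have q1 := locq1; locsolve.
Qed.

HB.instance Definition _ :=
  GRing.isZmodule.Build loc loc_addA loc_addC loc_add0 loc_addN.

Fact loc_mulA : associative loc_mul.
Proof.
move=> x y z; have [a [s [qs ->]]] := fracP x; have [b [t [qt ->]]] := fracP y.
by have [c [r [qr ->]]] := fracP z; locsolve.
Qed.

Fact loc_mulC : commutative loc_mul.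
Proof.
move=> x y; have [a [s [qs ->]]] := fracP x; have [b [t [qt ->]]] := fracP y.
by locsolve.
Qed.

Fact loc_mul1 : left_id (frac 1 1) loc_mul.
Proof.
move=> x; have [a [s [qs ->]]] := fracP x.
by have q1 := locq1; locsolve.
Qed.

Fact loc_mulD : left_distributive loc_mul loc_add.
Proof.
move=> x y z; have [a [s [qs ->]]] := fracP x; have [b [t [qt ->]]] := fracP y.
by have [c [r [qr ->]]] := fracP z; locsolve.
Qed.

Fact loc_1neq0 : frac 1 1 != 0 :> loc.
Proof.
apply/eqP => /(@frac_inj 1 1 0 1 locq1 locq1)[u qu].
by rewrite mul0r !mulr1 subr0 mulr1 => /loc_sub.
Qed.

HB.instance Definition _ := GRing.Zmodule_isComNzRing.Build loc
  loc_mulA loc_mulC loc_mul1 loc_mulD loc_1neq0.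

Lemma fracD a s b t : ~ q s -> ~ q t ->
  frac a s + frac b t = frac (a * t + b * s) (s * t).
Proof. exact: loc_addE. Qed.

Lemma fracM a s b t : ~ q s -> ~ q t ->
  frac a s * frac b t = frac (a * b) (s * t).
Proof. exact: loc_mulE. Qed.

Lemma fracN a s : ~ q s -> - frac a s = frac (- a) s.
Proof. exact: loc_oppE. Qed.

Definition tofrac a := frac a 1.

Fact tofrac_additive : additive tofrac.
Proof.
move=> a b; have q1 := locq1; rewrite /tofrac fracN // fracD //.
by apply: frac_eq; rewrite ?mulr1.
Qed.

Fact tofrac_multiplicative : multiplicative tofrac.
Proof. by split=> // a b; have q1 := locq1; rewrite /tofrac fracM // mulr1. Qed.

HB.instance Definition _ :=
  GRing.isAdditive.Build R loc tofrac tofrac_additive.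
HB.instance Definition _ :=
  GRing.isMultiplicative.Build R loc tofrac tofrac_multiplicative.

Lemma frac_mulK a s : ~ q s -> tofrac s * frac a s = tofrac a.
Proof.
move=> qs; have q1 := locq1; rewrite /tofrac fracM // mul1r.
by apply: frac_eq; rewrite ?mulr1 // mulrC.
Qed.

Lemma frac_cross a b f s : ~ q s ->
  tofrac (a * (b * s)) * frac f s = tofrac (b * (a * f)).
Proof.
move=> qs; have q1 := locq1; rewrite /tofrac fracM // mul1r.
by apply: frac_eq => //; ring.
Qed.

Lemma tofrac_eq0 a : tofrac a = 0 <-> exists2 u, ~ q u & J (u * a).
Proof.
rewrite /tofrac -[0]/(frac 0 1); have q1 := locq1.
by split=> [/frac_inj|] => [/(_ q1 q1)|] [u qu Ju]; [|apply/frac_inj => //];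
  exists u => //; move: Ju; rewrite mul0r subr0 mulr1.
Qed.

Lemma frac_unit a s : ~ q s -> isunit (frac a s) <-> ~ q a.
Proof.
move=> qs; have q1 := locq1; split=> [[x]|qa].
  have [b [t [qt ->]]] := fracP x; rewrite fracM //.
  move=> /(@frac_inj _ _ _ _ (locqM qs qt) q1)[u qu].
  rewrite mulr1 mul1r => /loc_sub Ju qa.
  have qst := locqM qu (locqM qs qt); apply: qst.
  have [[q0 qD qM] _ _] := loc_prime d.
  have -> : u * (s * t) = (u * b) * a + (-1) * (u * (a * b - s * t)) by ring.
  by apply: qD; apply: qM.
exists (frac s a); rewrite fracM //; apply: frac_eq => //; first exact: locqM.
by ring.
Qed.

Lemma tofrac_unit a : isunit (tofrac a) <-> ~ q a.
Proof. by apply: frac_unit; apply: locq1. Qed.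

Lemma loc_local (x : loc) : isunit x \/ isunit (1 - x).
Proof.
have [a [s [qs ->]]] := fracP x; have q1 := locq1.
have [qa|/(frac_unit _ qs)] := EM (q a); last by left.
right; rewrite -[1]/(frac 1 1) fracN // fracD // frac_unit; last exact: locqM.
rewrite mul1r mulr1 => qsa; apply: qs.
by rewrite -(subrK a s); have [[_ qD _] _ _] := loc_prime d; apply: qD.
Qed.

Section Lift.
Variables (B : comNzRingType) (g : {rmorphism R -> B}).
Hypothesis gJ : forall a, J a -> g a = 0.
Hypothesis gq : forall a, ~ q a -> isunit (g a).

Definition uinv (b : B) : B :=
  if pselect (isunit b) is left h then sval (cid h) else 0.

Lemma mulruV b : isunit b -> b * uinv b = 1.
Proof. by rewrite /uinv; case: pselect => // h _; case: cid. Qed.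

(** The universal property of the localisation. The representative is chosen; [loc_liftE], stated
    without division, shows that the choice is immaterial. *)
Definition loc_lift x := g (num x) * uinv (g (den x)).

Lemma loc_liftE a s : ~ q s -> g s * loc_lift (frac a s) = g a.
Proof.
move=> qs; have [u qu] := num_den a qs; move: (@denP (frac a s)).
rewrite /loc_lift; set a' := num _; set s' := den _ => qs' /gJ.
have /mulruV gu := gq qu; have /mulruV := gq qs'.
rewrite rmorphM rmorphB !rmorphM /= => gs' e.
have {e} : g a * g s' = g a' * g s.
  apply/eqP; rewrite -subr_eq0; apply/eqP.
  by rewrite -[LHS]mul1r -gu mulrAC e mul0r.
by move=> e; rewrite mulrA [g s * _]mulrC -e -mulrA gs' mulr1.
Qed.

Lemma isunit_inj (b x y : B) : isunit b -> b * x = b * y -> x = y.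
Proof.
move=> [c bc] e; rewrite -[x]mul1r -[y]mul1r -bc.
by rewrite [b * c]mulrC -!mulrA e.
Qed.

Fact loc_lift_additive : additive loc_lift.
Proof.
move=> x y; have [a [s [qs ->]]] := fracP x; have [b [t [qt ->]]] := fracP y.
rewrite fracN // fracD //; have qst := locqM qs qt.
apply: (isunit_inj (gq qst)); rewrite loc_liftE // rmorphM mulrBr.
rewrite mulrAC loc_liftE // -!mulrA loc_liftE // [in RHS]mulrC -!rmorphM -rmorphB.
by congr (g _); ring.
Qed.

Fact loc_lift_multiplicative : multiplicative loc_lift.
Proof.
split=> [x y|]; last first.
  have := @loc_liftE 1 1 locq1.
  by rewrite rmorph1 mul1r.
have [a [s [qs ->]]] := fracP x; have [b [t [qt ->]]] := fracP y.
rewrite fracM //; have qst := locqM qs qt.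
apply: (isunit_inj (gq qst)); rewrite loc_liftE // !rmorphM.
by rewrite mulrACA !loc_liftE.
Qed.

HB.instance Definition _ :=
  GRing.isAdditive.Build loc B loc_lift loc_lift_additive.
HB.instance Definition _ :=
  GRing.isMultiplicative.Build loc B loc_lift loc_lift_multiplicative.

Definition loc_liftr : {rmorphism loc -> B} := loc_lift.

Lemma loc_liftrE a s : ~ q s -> g s * loc_liftr (frac a s) = g a.
Proof. exact: loc_liftE. Qed.

Lemma loc_lift_tofrac a : loc_liftr (tofrac a) = g a.
Proof. by have := loc_liftE a locq1; rewrite rmorph1 mul1r. Qed.

End Lift.
End Localisation.

(** * Sections and affine open sets *)

Section SubringIdeals.
Variable R : comNzRingType.
Implicit Types (A I p G : set R).

(** Rings of sections are handled as subsets of the ring of all families of germs; ideals and primes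
    are therefore relative to a subset [A] closed under the operations. *)
Definition subring A :=
  [/\ A 1, forall a b, A a -> A b -> A (a - b) &
      forall a b, A a -> A b -> A (a * b)].

Definition ideal_in A I :=
  [/\ I `<=` A, I 0, forall a b, I a -> I b -> I (a + b) &
      forall a b, A a -> I b -> I (a * b)].

Definition prime_in A p :=
  [/\ ideal_in A p, ~ p 1 &
      forall a b, A a -> A b -> p (a * b) -> p a \/ p b].

Lemma subring0 A : subring A -> A 0.
Proof. by case=> A1 AB _; rewrite -(subrr 1); apply: AB. Qed.

Lemma subringN A a : subring A -> A a -> A (- a).
Proof.
by move=> As Aa; rewrite -sub0r; case: (As) => _ + _; apply=> //; apply: subring0.
Qed.

Lemma subringD A a b : subring A -> A a -> A b -> A (a + b).
Proof.
move=> As Aa Ab; rewrite -[b]opprK; case: (As) => _ + _; apply=> //.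
exact: subringN.
Qed.

Lemma subringM A a b : subring A -> A a -> A b -> A (a * b).
Proof. by case=> _ _; apply. Qed.

Lemma subringX A a n : subring A -> A a -> A (a ^+ n).
Proof.
move=> As Aa; elim: n => [|n IH]; first by rewrite expr0; case: As.
by rewrite exprS; apply: subringM.
Qed.

Lemma subring_sum A (J : Type) (r : seq J) (P : pred J) (F : J -> R) :
  subring A -> (forall i, P i -> A (F i)) -> A (\sum_(i <- r | P i) F i).
Proof.
move=> As AF; elim/big_rec: _ => [|i x Pi Ax]; first exact: subring0.
by apply: subringD => //; exact: AF.
Qed.

Lemma subring_prod A (J : Type) (r : seq J) (P : pred J) (F : J -> R) :
  subring A -> (forall i, P i -> A (F i)) -> A (\prod_(i <- r | P i) F i).
Proof.
move=> As AF; elim/big_rec: _ => [|i x Pi Ax]; first by case: As.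
by apply: subringM => //; exact: AF.
Qed.

Definition idl A G : set R :=
  [set a | exists n (d c : 'I_n -> R),
    (forall i, A (d i) /\ G (c i)) /\ a = \sum_(i < n) d i * c i].

Lemma idl_ideal A G : subring A -> G `<=` A -> ideal_in A (idl A G).
Proof.
move=> As GA; split.
- move=> _ [n [d [c [dc ->]]]]; apply: subring_sum => // i _.
  by have [Ad /GA Ac] := dc i; apply: subringM.
- exists 0%N, (fun=> 0), (fun=> 0); split; first by case.
  by rewrite big_ord0.
- move=> _ _ [n [d [c [dc ->]]]] [m [d' [c' [dc' ->]]]].
  exists (n + m)%N, (fun i => match split i with inl j => d j | inr j => d' j end),
    (fun i => match split i with inl j => c j | inr j => c' j end); split.
    by move=> i; case: split.
  rewrite big_split_ord /=; congr (_ + _); apply: eq_bigr => i _.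
    by have := unsplitK (inl i : 'I_n + 'I_m)%type; rewrite /unsplit => ->.
  by have := unsplitK (inr i : 'I_n + 'I_m)%type; rewrite /unsplit => ->.
- move=> a _ Aa [n [d [c [dc ->]]]].
  exists n, (fun i => a * d i), c; split.
    by move=> i; have [Ad Gc] := dc i; split=> //; apply: subringM.
  by rewrite mulr_sumr; apply: eq_bigr => i _; rewrite mulrA.
Qed.

Lemma idl_mem A G a : subring A -> G a -> idl A G a.
Proof.
move=> [A1 _ _] Ga; exists 1%N, (fun=> 1), (fun=> a); split=> //.
by rewrite big_ord1 mul1r.
Qed.

(** An ideal of [A] that is maximal among those containing [I] and avoiding the powers of [s] is
    prime. *)
Lemma prime_avoid A I s : subring A -> ideal_in A I -> A s ->
  (forall n, ~ I (s ^+ n)) ->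
  exists p, [/\ prime_in A p, I `<=` p & ~ p s].
Proof.
move=> As II sA Is.
(* The union with [I] makes the empty set admissible: Zorn's lemma is applied here in a form that
   also takes the union of the empty chain. *)
pose P X := ideal_in A (X `|` I) /\ forall n, ~ (X `|` I) (s ^+ n).
have [] := @Zorn_bigcup R P.
  move=> F FP Ftot; have [[X FX]|F0] := EM (exists X, F X); last first.
    rewrite /P (_ : _ `|` I = I) //; apply/seteqP; split=> x; last by right.
    by case=> // -[X FX]; case: F0; exists X.
  have XI Y : F Y -> Y `<=` \bigcup_(X in F) X by move=> FY y Yy; exists Y.
  split; last by move=> n [[Y FY Yn]|//]; [have [_ /(_ n)] := FP _ FY; apply; left|exact: Is].
  split.
  - move=> x [[Y FY Yx]|]; last by case: II => + _ _ _; apply.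
    by have [[+ _ _ _] _] := FP _ FY; apply; left.
  - by right; case: II.
  - have main Y a b : F Y -> (Y `|` I) a -> (Y `|` I) b ->
        (\bigcup_(X in F) X `|` I) (a + b).
      move=> FY Ya Yb; have [[_ _ ID _] _] := FP _ FY.
      by have [|] := ID _ _ Ya Yb; [left; exists Y|right].
    move=> a b [[Y FY Ya]|Ia] [[Z FZ Zb]|Ib].
    + have [YZ|ZY] := Ftot _ _ FY FZ.
        by apply: (main Z) => //; left => //; apply: YZ.
      by apply: (main Y) => //; left => //; apply: ZY.
    + by apply: (main Y) => //; [left|right].
    + by apply: (main Z) => //; [right|left].
    + by apply: (main X) => //; right.
  - move=> a b Aa [[Y FY Yb]|Ib]; last by right; case: II => _ _ _; apply.
    have [[_ _ _ YM] _] := FP _ FY.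
    by have [Yab|Iab] := YM a b Aa (or_introl Yb); [left; exists Y|right].
move=> X [[[XA X0 XD XM] Xs] Xmax]; pose p := X `|` I; exists p; split.
- split=> //; first by have := Xs 0%N; rewrite expr0.
  move=> a b Aa Ab pab; apply: contrapT => /not_orP[pa pb].
  (* By maximality, enlarging [p] by any [c] outside it captures a power of [s]; if [a * b] is in
     [p], the two powers obtained from [a] and [b] multiply into [p]. *)
  have ext c : A c -> ~ p c -> exists n u d, [/\ p u, A d & s ^+ n = u + d * c].
    move=> Ac pc; pose B := [set x | exists u d, [/\ p u, A d & x = u + d * c]].
    have Bid : ideal_in A B.
      split.
      - move=> _ [u [d [pu Ad ->]]]; apply: subringD => //; first exact: XA.
        exact: subringM.
      - by exists 0, 0; split; rewrite ?mul0r ?addr0 //; apply: subring0.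
      - move=> _ _ [u [d [pu Ad ->]]] [u' [d' [pu' Ad' ->]]].
        exists (u + u'), (d + d'); split; [exact: XD|exact: subringD|].
        by rewrite mulrDl addrACA.
      - move=> e _ Ae [u [d [pu Ad ->]]]; exists (e * u), (e * d).
        by split; [exact: XM|exact: subringM|rewrite mulrDr mulrA].
    have pB : p `<=` B.
      move=> x px; exists x, 0; split; rewrite ?mul0r ?addr0 //.
      exact: subring0.
    have BI : B `|` I = B.
      by apply/seteqP; split=> x; [case=> // Ix; apply: pB; right|left].
    apply: contrapT => nB; apply: (Xmax B).
      split; first by move=> x Xx; apply: pB; left.
      move=> BX; apply: pc; left; apply: BX; exists 0, 1.
      by split=> //; rewrite ?add0r ?mul1r //; case: As.
    rewrite /P BI; split=> // n [u [d [pu Ad e]]]; apply: nB.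
    by exists n, u, d.
  have [n [u [d [pu Ad e]]]] := ext a Aa pa.
  have [m [v [c [pv Ac f]]]] := ext b Ab pb.
  apply: (Xs (n + m)%N); rewrite exprD e f mulrDl.
  apply: (XD); first by rewrite mulrC; apply: (XM) => //; apply: subringD;
    [done|exact: XA|exact: subringM].
  rewrite mulrDr; apply: (XD); first by apply: (XM) => //; apply: subringM.
  by rewrite mulrACA; apply: XM => //; apply: subringM.
- by move=> x; right.
- by have := Xs 1%N; rewrite expr1.
Qed.

End SubringIdeals.

Section Units.
Variable R : comNzRingType.
Implicit Types a b : R.

Lemma isunit1 : isunit (1 : R). Proof. by exists 1; rewrite mulr1. Qed.

Lemma sub_frac (x y z w : R) : x * y * (z - w) = y * (x * z) - x * (y * w).
Proof. by ring. Qed.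

Lemma add_frac (x y z w : R) : x * y * (z + w) = y * (x * z) + x * (y * w).
Proof. by ring. Qed.

Lemma mulr_sub1 (x y z : R) : x * y = 1 -> x * z - 1 = x * (z - y).
Proof. by move=> xy; rewrite mulrBr xy. Qed.

Lemma isunitM a b : isunit (a * b) <-> isunit a /\ isunit b.
Proof.
split=> [[c abc]|[[c ac] [d bd]]].
  by split; [exists (b * c); rewrite mulrA|exists (a * c); rewrite mulrCA mulrA].
by exists (c * d); rewrite mulrACA ac bd mulr1.
Qed.

Lemma isunitX a n : isunit a -> isunit (a ^+ n).
Proof.
by move=> ua; elim: n => [|n IH]; rewrite ?expr0 ?exprS; [exact: isunit1|apply/isunitM].
Qed.

Lemma isunitX_inv a n : isunit (a ^+ n.+1) -> isunit a.
Proof. by rewrite exprS => /isunitM[]. Qed.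

Lemma nunit0 : ~ isunit (0 : R).
Proof. by move=> [b]; rewrite mul0r => /esym/eqP; rewrite oner_eq0. Qed.

Lemma isunit_rmorph (S : comNzRingType) (f : {rmorphism R -> S}) a :
  isunit a -> isunit (f a).
Proof. by move=> [b ab]; exists (f b); rewrite -rmorphM ab rmorph1. Qed.

End Units.

Section Sections.
Variables (k : fieldType) (X : lrspace k).

Lemma nunitD (x : X) (a b : stk x) :
  ~ isunit a -> ~ isunit b -> ~ isunit (a + b).
Proof.
move=> ua ub [c abc]; have [|] := stk_local (a * c); first by case/isunitM.
by rewrite -abc mulrDl [a * c + _]addrC addrK => /isunitM[].
Qed.

Lemma nunit_sub1 (x : X) (a : stk x) : ~ isunit a -> isunit (a - 1).
Proof.
move=> na; have [//|[b ab]] := stk_local a.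
by exists (- b); rewrite mulrN -mulNr opprB.
Qed.

Lemma nunit_sum (x : X) (J : Type) (r : seq J) (P : pred J) (F : J -> stk x) :
  (forall i, P i -> ~ isunit (F i)) -> ~ isunit (\sum_(i <- r | P i) F i).
Proof.
move=> uF; elim/big_rec: _ => [|i y Pi uy]; first exact: nunit0.
by apply: nunitD => //; exact: uF.
Qed.

(* The point x0 only serves to ensure 1 <> 0. *)
Definition psec (x0 : X) := forall x : X, stk x.

Section Psec.
Variable x0 : X.
Local Notation S := (psec x0).

HB.instance Definition _ := gen_eqMixin S.
HB.instance Definition _ := gen_choiceMixin S.

Definition psec_add (s t : S) : S := fun x => s x + t x.
Definition psec_opp (s : S) : S := fun x => - s x.
Definition psec_mul (s t : S) : S := fun x => s x * t x.
Definition psec_zero : S := fun x => 0.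
Definition psec_one : S := fun x => 1.

Local Lemma ext (s t : S) : (forall x, s x = t x) -> s = t.
Proof. by move=> e; apply: functional_extensionality_dep. Qed.

Fact psec_addA : associative psec_add.
Proof. by move=> s t u; apply: ext => x; apply: addrA. Qed.
Fact psec_addC : commutative psec_add.
Proof. by move=> s t; apply: ext => x; apply: addrC. Qed.
Fact psec_add0 : left_id psec_zero psec_add.
Proof. by move=> s; apply: ext => x; apply: add0r. Qed.
Fact psec_addN : left_inverse psec_zero psec_opp psec_add.
Proof. by move=> s; apply: ext => x; apply: addNr. Qed.
HB.instance Definition _ :=
  GRing.isZmodule.Build S psec_addA psec_addC psec_add0 psec_addN.

Fact psec_mulA : associative psec_mul.
Proof. by move=> s t u; apply: ext => x; apply: mulrA. Qed.
Fact psec_mulC : commutative psec_mul.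
Proof. by move=> s t; apply: ext => x; apply: mulrC. Qed.
Fact psec_mul1 : left_id psec_one psec_mul.
Proof. by move=> s; apply: ext => x; apply: mul1r. Qed.
Fact psec_mulD : left_distributive psec_mul psec_add.
Proof. by move=> s t u; apply: ext => x; apply: mulrDl. Qed.
Fact psec_1neq0 : psec_one != psec_zero.
Proof.
apply/eqP => /(congr1 (fun s : S => s x0)) /eqP.
by rewrite /psec_one /psec_zero oner_eq0.
Qed.
HB.instance Definition _ := GRing.Zmodule_isComNzRing.Build S
  psec_mulA psec_mulC psec_mul1 psec_mulD psec_1neq0.

Definition pev (x : X) (s : S) : stk x := s x.
Fact pev_additive x : additive (@pev x). Proof. by []. Qed.
Fact pev_multiplicative x : multiplicative (@pev x). Proof. by split. Qed.
HB.instance Definition _ x :=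
  GRing.isAdditive.Build S (stk x) (@pev x) (pev_additive x).
HB.instance Definition _ x :=
  GRing.isMultiplicative.Build S (stk x) (@pev x) (pev_multiplicative x).

Lemma psecD (s t : S) x : (s + t) x = s x + t x. Proof. by []. Qed.
Lemma psecB (s t : S) x : (s - t) x = s x - t x. Proof. by []. Qed.
Lemma psecM (s t : S) x : (s * t) x = s x * t x. Proof. by []. Qed.
Lemma psec1 x : (1 : S) x = 1. Proof. by []. Qed.
Lemma psec0 x : (0 : S) x = 0. Proof. by []. Qed.
Lemma psecX (s : S) n x : (s ^+ n) x = s x ^+ n.
Proof. by rewrite -[LHS]/(pev x (s ^+ n)) rmorphXn. Qed.
Lemma psec_sum (J : Type) (r : seq J) (P : pred J) (F : J -> S) x :
  (\sum_(i <- r | P i) F i) x = \sum_(i <- r | P i) F i x.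
Proof. by rewrite -[LHS]/(pev x _) rmorph_sum. Qed.
Lemma psec_prod (J : Type) (r : seq J) (P : pred J) (F : J -> S) x :
  (\prod_(i <- r | P i) F i) x = \prod_(i <- r | P i) F i x.
Proof. by rewrite -[LHS]/(pev x _) rmorph_prod. Qed.

Lemma reg_subring (x : X) : subring [set s : S | reg x s].
Proof.
split=> [|s t /= rs rt|s t /= rs rt]; last 2 first.
- exact: reg_sub.
- exact: reg_mul.
- have := reg_const x 1; apply: reg_ext; apply: nearW => y.
  by rewrite scale1r.
Qed.

Lemma reg_on_subring (U : set X) : subring [set s : S | reg_on U s].
Proof.
split=> [x _|s t /= rs rt x Ux|s t /= rs rt x Ux].
- by case: (reg_subring x).
- by apply: reg_sub; [exact: rs|exact: rt].
- by apply: reg_mul; [exact: rs|exact: rt].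
Qed.

End Psec.

Implicit Types (U V W : set X) (s t : forall x : X, stk x).

Lemma reg_1 (x : X) : reg x (fun y => 1).
Proof. by case: (reg_subring x x). Qed.

Lemma reg_0 (x : X) : reg x (fun y => 0).
Proof. exact: (subring0 (reg_subring x x)). Qed.

Lemma reg_add (x : X) s t : reg x s -> reg x t -> reg x (fun y => s y + t y).
Proof. exact: (subringD (reg_subring x x)). Qed.

Lemma reg_exp (x : X) s n : reg x s -> reg x (fun y => s y ^+ n).
Proof.
move=> rs; have := subringX n (reg_subring x x) rs.
by congr reg; apply: functional_extensionality_dep => y; rewrite psecX.
Qed.

Lemma unit_near (x : X) s : reg x s -> isunit (s x) ->
  \forall y \near x, isunit (s y).
Proof.
move=> rs [b sb]; have [t rt tb] := reg_germ b.
have := reg_inj (reg_mul rs rt) (reg_1 x); rewrite tb => /(_ sb).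
by apply: filterS => y e; exists (t y).
Qed.

Definition sinv s : forall x : X, stk x := fun x => uinv (s x).

Lemma reg_inv (x : X) s : reg x s -> isunit (s x) -> reg x (sinv s).
Proof.
move=> rs us; have [b sb] := us; have [t rt tb] := reg_germ b.
have := reg_inj (reg_mul rs rt) (reg_1 x); rewrite tb => /(_ sb) st1.
apply: reg_ext rt; apply: filterS st1 => y e.
have uy : isunit (s y) by exists (t y).
by apply: (isunit_inj uy); rewrite e mulruV.
Qed.

Lemma reg_onW U V s : V `<=` U -> reg_on U s -> reg_on V s.
Proof. by move=> VU rs x /VU; exact: rs. Qed.

Lemma Dset_open U s : open U -> reg_on U s -> open (Dset U s).
Proof.
move=> oU rs; rewrite openE => x [Ux ux]; rewrite /interior.
by near=> y; split; near: y; [exact: open_nbhs_nbhs|exact: unit_near (rs _ Ux) ux].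
Unshelve. all: by end_near. Qed.

End Sections.

(** * A criterion for affineness *)

Section Criterion.
Variables (k : fieldType) (L : lrspace k) (x0 : L) (W : set L).
Local Notation S := (psec x0).
Variable A : set S.

Hypothesis oW : open W.
Hypothesis As : subring A.
Hypothesis Areg : forall s, A s -> reg_on W s.
Hypothesis Asep : forall x y, W x -> W y ->
  (forall s, A s -> isunit (s x) <-> isunit (s y)) -> x = y.
Hypothesis Aprime : forall p, prime_in A p ->
  (forall s, A s -> eq_on W s (fun=> 0) -> p s) -> exists2 x, W x & forall s, A s -> p s <-> ~ isunit (s x).
Hypothesis Abasis : forall V x, open V -> W x -> V x ->
  exists s, [/\ A s, Dset W s x & Dset W s `<=` V].
Hypothesis Afrac : forall x (g : stk x), W x ->
  exists a b, [/\ A a, A b, isunit (b x) & b x * g = a x].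
Hypothesis Azero : forall x a, W x -> A a -> a x = 0 ->
  exists b, [/\ A b, isunit (b x) & forall y, W y -> b y * a y = 0].

(** Quasi-compactness of D(s): a prime that contains [I] and avoids [s] would be a point of D(s) at
    which no element of [I] is invertible. *)
Lemma crit_avoid (I : set S) s : ideal_in A I -> A s ->
  (forall s, A s -> eq_on W s (fun=> 0) -> I s) ->
  (forall x, W x -> isunit (s x) -> exists2 b, I b & isunit (b x)) ->
  exists n, I (s ^+ n).
Proof.
move=> II sA I0 Ip; apply: contrapT => /forallNP nI.
have [p [pp Isub ps]] := prime_avoid As II sA nI.
have [x Wx px] := Aprime pp (fun s sA s0 => Isub _ (I0 s sA s0)).
have ux : isunit (s x) by apply: contrapT => ux; apply: ps; apply/px.
have [b Ib ub] := Ip _ Wx ux.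
have Ab : A b by case: II => + _ _ _; apply.
by have /(px _ Ab) := Isub _ Ib; apply.
Qed.

(** [crit_avoid] for the annihilator of [e] on [W]: at each point of D(c) the germ of [e] is zero,
    hence [e] is killed by an element invertible there. *)
Lemma crit_zero c e : A c -> A e -> (forall x, Dset W c x -> e x = 0) ->
  exists n, forall x, W x -> c x ^+ n * e x = 0.
Proof.
move=> Ac Ae e0; pose I := [set b | A b /\ forall x, W x -> b x * e x = 0].
have II : ideal_in A I.
  split=> [b [] //||a b [Aa a0] [Ab b0]|a b Aa [Ab b0]].
  - by split=> [|x _]; [exact: subring0|rewrite psec0 mul0r].
  - split=> [|x Wx]; first exact: subringD.
    by rewrite psecD mulrDl a0 // b0 // addr0.
  - split=> [|x Wx]; first exact: subringM.
    by rewrite psecM -mulrA b0 // mulr0.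
have [||n [_ cn]] := crit_avoid II Ac.
- by move=> s sA s0; split=> // x Wx; rewrite s0 ?mul0r.
- move=> x Wx ux; have [b [Ab ub b0]] := Azero Wx Ae (e0 x (conj Wx ux)).
  by exists b.
by exists n => x Wx; rewrite -psecX cn.
Qed.

(** The gluing of local fractions: [t] is a_i / c_i on D(c_i), a power of [s] is a combination of
    powers of the c_i, and the numerators are combined with the same coefficients. *)
Lemma crit_frac s t : A s -> reg_on (Dset W s) t ->
  exists n t', A t' /\ eq_on (Dset W s) t' (fun x => s x ^+ n * t x).
Proof.
move=> sA rt.
pose G := [set c | [/\ A c, Dset W c `<=` Dset W s &
  exists2 a, A a & forall x, Dset W c x -> c x * t x = a x]].
have GA : G `<=` A by move=> c [].
have [||n [r [d [c [dc sn]]]]] := crit_avoid (idl_ideal As GA) sA.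
- move=> g gA g0; apply: idl_mem => //; split=> //.
    by move=> x [Wx]; rewrite g0 // => /nunit0.
  by exists 0; [exact: subring0|move=> x [Wx]; rewrite g0 // => /nunit0].
- move=> x Wx ux; have Dx : Dset W s x by [].
  have [a [b [Aa Ab ub e]]] := Afrac (t x) Wx.
  have e' : \forall y \near x, b y * t y = a y.
    by apply: reg_inj e; [apply: reg_mul; [exact: Areg|exact: rt]|exact: Areg].
  have := nbhs_singleton (nbhs_interior e').
  set V := interior _ => Vx.
  have oV : open (V `&` Dset W s).
    by apply: openI; [exact: open_interior|exact: Dset_open (Areg sA)].
  have [c [Ac cx cV]] := Abasis oV Wx (conj Vx Dx).
  exists (c * b); last by rewrite psecM; apply/isunitM; case: cx.
  apply: idl_mem => //; split; first exact: subringM.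
  - by move=> y [Wy]; rewrite psecM => /isunitM[cy _]; case: (cV y (conj Wy cy)).
  - exists (c * a); first exact: subringM.
    move=> y [Wy]; rewrite !psecM => /isunitM[cy _].
    have [/interior_subset Vy _] := cV y (conj Wy cy).
    by rewrite -mulrA Vy.
have cG i : G (c i) by case: (dc i).
have cA i : A (c i) by apply: GA.
have /choice[a aP] : forall i, exists a, A a /\
    forall x, Dset W (c i) x -> c i x * t x = a x.
  by move=> i; have [_ _ [a Aa ca]] := cG i; exists a.
have /choice[N NP] : forall ij, exists n, forall x, W x ->
    (c ij.1 * c ij.2) x ^+ n * (a ij.1 * c ij.2 - a ij.2 * c ij.1) x = 0.
  move=> [i j] /=; apply: crit_zero.
  - exact: subringM.
  - have [[Aai _] [Aaj _]] := (aP i, aP j).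
    by have [_ AB AM] := As; apply: AB; apply: AM.
  - move=> x [Wx /isunitM[ui uj]]; rewrite psecB !psecM.
    have [[_ ei] [_ ej]] := (aP i, aP j).
    by rewrite -ei // -ej // [c j x * _ * _]mulrAC [c j x * _]mulrC mulrAC subrr.
(* One exponent for all pairs: after replacing c_i by c_i^(M+1) and a_i by a_i c_i^M, the relations
   a_i c_j = a_j c_i hold on the whole of [W]. *)
pose M := (\max_(ij : 'I_r * 'I_r) N ij)%N.
pose c' i := c i ^+ M.+1; pose a' i := a i * c i ^+ M.
have c'A i : A (c' i) by apply: subringX.
have a'A i : A (a' i) by apply: subringM => //; [case: (aP i)|exact: subringX].
have comm i j x : W x -> a' i x * c' j x = a' j x * c' i x.
  move=> Wx; apply/eqP; rewrite -subr_eq0 /a' /c' !psecM !psecX.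
  have := NP (i, j) x Wx; rewrite /= psecB !psecM.
  have : (N (i, j) <= M)%N by exact: (leq_bigmax (i, j)).
  move=> /subnK <-; set m := (M - _)%N; move: (N _) => l.
  move: (a i x) (a j x) (c i x) (c j x) => ai aj ci cj e.
  rewrite (_ : _ - _ = (ci * cj) ^+ m * ((ci * cj) ^+ l * (ai * cj - aj * ci))).
    by rewrite e mulr0.
  by rewrite !exprS !exprD !exprMn; ring.
(* Functions vanishing on [W] are added to the generators because [crit_avoid] asks for them in the
   ideal. *)
pose G' := [set g | A g /\ ((exists i, g = c' i) \/ eq_on W g (fun=> 0))].
have G'A : G' `<=` A by move=> g [].
have [||n' [r' [d' [g [dg sn']]]]] := crit_avoid (idl_ideal As G'A) sA.
- by move=> h hA h0; apply: idl_mem => //; split=> //; right.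
- move=> x Wx ux; apply: contrapT => nu.
  have ui i : ~ isunit (c i x).
    move=> ui; apply: nu; exists (c' i).
      by apply: idl_mem => //; split=> //; left; exists i.
    by rewrite /c' psecX; exact: isunitX.
  have := isunitX n ux; rewrite -psecX sn psec_sum; apply: nunit_sum => i _.
  by move=> /isunitM[_]; exact: ui.
have /choice[f fP] : forall l, exists b, A b /\
    forall j x, W x -> b x * c' j x = a' j x * g l x.
  move=> l; have [_ [_ [[i ->]|g0]]] := dg l.
    by exists (a' i); split=> // j x; exact: comm.
  exists 0; split=> [|j x Wx]; first exact: subring0.
  by rewrite psec0 mul0r g0 ?mulr0.
exists n', (\sum_(l < r') d' l * f l); split.
  by apply: subring_sum => // l _; apply: subringM => //; [case: (dg l)|case: (fP l)].
move=> x [Wx ux].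
have [j uj] : exists j, isunit (c' j x).
  apply: contrapT => /forallNP nu; have := isunitX n' ux.
  rewrite -psecX sn' psec_sum; apply: nunit_sum => l _.
  have [_ [_ [[i ->]|g0]]] := dg l; first by move=> /isunitM[_]; exact: nu.
  by rewrite psecM g0 // mulr0; exact: nunit0.
apply: (isunit_inj uj); rewrite mulrCA.
have -> : c' j x * t x = a' j x.
  have [_ ej] := aP j; rewrite /c' /a' psecM !psecX exprSr -mulrA ej 1?mulrC //.
  by split=> //; move: uj; rewrite /c' psecX => /isunitX_inv.
rewrite -psecX sn' !psec_sum mulr_sumr mulr_suml; apply: eq_bigr => l _.
have [_ fl] := fP l; rewrite !psecM mulrCA -mulrA; congr (_ * _).
by rewrite mulrC fl // mulrC.
Qed.

Lemma crit_glob t : reg_on W t -> exists2 t', A t' & eq_on W t' t.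
Proof.
move=> rt; have [||n [t' [At' e]]] := @crit_frac 1 t.
- by case: As.
- by move=> x [Wx _]; exact: rt.
exists t' => // x Wx; rewrite e; first by rewrite psec1 expr1n mul1r.
by split=> //; exact: isunit1.
Qed.

(** By [crit_frac] with [s = 1], every section over [W] agrees on [W] with an element of [A], so the
    properties of [A] pass to the ring of sections. *)
Lemma affine_crit : affine_open W.
Proof.
split=> //.
- move=> x y Wx Wy e; apply: Asep => // s /Areg; exact: e.
- move=> p [[preg peq] p0 pD pM [p1 pp]].
  have pA : prime_in A [set s | A s /\ p s].
    split=> [|[_ //]|a b Aa Ab [_ /pp[]]]; [|exact: Areg|exact: Areg|by left|by right].
    split=> [s []//||a b [Aa pa] [Ab pb]|a b Aa [Ab pb]].
    + by split=> //; exact: subring0.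
    + by split; [exact: subringD|exact: pD].
    + by split; [exact: subringM|apply: pM => //; exact: Areg].
  have [|x Wx px] := Aprime pA.
    by move=> s sA s0; split=> //; apply: peq p0; [move=> y Wy; rewrite s0|exact: Areg].
  exists x => // s rs.
  have [t At ts] := crit_glob rs; rewrite -ts //; split=> [ps|nu].
    by apply/(px _ At); split=> //; apply: peq ps; [by move=> y Wy; rewrite ts|exact: Areg].
  by have /(px _ At)[_] := nu; apply: peq.
- by move=> V x oV Wx Vx; have [s [sA sx sV]] := Abasis oV Wx Vx;
    exists s; split=> //; exact: Areg.
- move=> s rs; have [s' As' ss'] := crit_glob rs.
  have D : Dset W s = Dset W s'.
    by apply/seteqP; split=> x [Wx]; [rewrite -ss'|rewrite ss'].
  rewrite D; split=> [t rt|t rt t0].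
    have [n [t' [At' e]]] := crit_frac As' rt.
    exists n, t'; split; first exact: Areg.
    by move=> x Dx; rewrite e // -ss' //; case: Dx.
  have [t' At' tt'] := crit_glob rt.
  have [|n e] := crit_zero As' At'.
    by move=> x Dx; rewrite tt' ?t0 //; case: Dx.
  by exists n => x Wx; rewrite -ss' // -tt' // e.
Qed.

End Criterion.

(** * Working in an affine open set *)

Section AffineOpen.
Variables (k : fieldType) (X : lrspace k) (U : set X).
Hypothesis aU : affine_open U.
Implicit Types s t : forall x : X, stk x.

Lemma aff_open : open U. Proof. by case: aU. Qed.

Lemma aff_sep x y : U x -> U y ->
  (forall s, reg_on U s -> isunit (s x) <-> isunit (s y)) -> x = y.
Proof. by case: aU => _ + _ _ _; apply. Qed.

Lemma aff_basis V x : open V -> U x -> V x ->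
  exists s, [/\ reg_on U s, Dset U s x & Dset U s `<=` V].
Proof. by case: aU => _ _ _ + _; apply. Qed.

Lemma aff_frac s t : reg_on U s -> reg_on (Dset U s) t ->
  exists n t', reg_on U t' /\ eq_on (Dset U s) t' (fun x => s x ^+ n * t x).
Proof. by case: aU => _ _ _ _ h /h[+ _]; apply. Qed.

Lemma aff_zero s t : reg_on U s -> reg_on U t -> eq_on (Dset U s) t (fun=> 0) ->
  exists n, eq_on U (fun x => s x ^+ n * t x) (fun=> 0).
Proof. by case: aU => _ _ _ _ h /h[_]; apply. Qed.

(** D(s) is empty, so the section 1 vanishes on it and is killed by a power of [s]. *)
Lemma aff_nil s : reg_on U s -> (forall x, U x -> ~ isunit (s x)) ->
  exists n, forall x, U x -> s x ^+ n = 0.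
Proof.
move=> rs us; have [|||n e] := @aff_zero s (fun=> 1) => //.
- by move=> x _; exact: reg_1.
- by move=> x [/us].
by exists n => x Ux; have := e x Ux; rewrite mulr1.
Qed.

Lemma aff_stk0 x t : U x -> reg_on U t -> t x = 0 ->
  exists c, [/\ reg_on U c, isunit (c x) & forall y, U y -> c y * t y = 0].
Proof.
move=> Ux rt t0.
have t0' : \forall y \near x, t y = 0.
  by apply: reg_inj (rt _ Ux) (reg_0 x) t0.
have [s [rs [_ sx] sV]] := aff_basis (open_interior _) Ux (nbhs_singleton (nbhs_interior t0')).
have [|n e] := aff_zero rs rt.
  by move=> y /sV /interior_subset.
exists (fun y => s y ^+ n); split=> //; last exact: isunitX.
by move=> y Uy; apply: reg_exp; exact: rs.
Qed.

Lemma aff_germ V x t : open V -> V x -> U x -> reg x t ->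
  exists a s, [/\ reg_on U a, reg_on U s, isunit (s x), Dset U s `<=` V &
    forall y, Dset U s y -> s y * t y = a y].
Proof.
move=> oV Vx Ux rt; have /= r' := nbhs_interior (reg_near rt).
have [s [rs sx sV]] := @aff_basis (V `&` interior (fun y => reg y t)) x
  (openI oV (open_interior _)) Ux (conj Vx (nbhs_singleton r')).
have [|n [a [ra e]]] := @aff_frac s t rs.
  by move=> y /sV[_ /interior_subset].
exists (fun y => s y * a y), (fun y => s y * s y ^+ n); split.
- by move=> y Uy; apply: reg_mul; [exact: rs|exact: ra].
- by move=> y Uy; apply: reg_mul; [exact: rs|apply: reg_exp; exact: rs].
- by case: sx => _ ux; apply/isunitM; split=> //; exact: isunitX.
- by move=> y [Uy /isunitM[uy _]]; case: (sV y (conj Uy uy)).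
- by move=> y [Uy /isunitM[uy _]]; rewrite e // mulrA.
Qed.

Lemma aff_stk x (g : stk x) : U x ->
  exists a s, [/\ reg_on U a, reg_on U s, isunit (s x) & s x * g = a x].
Proof.
move=> Ux; have [t rt tx] := reg_germ g.
have [a [s [ra rs us _ e]]] := aff_germ aff_open Ux Ux rt.
by exists a, s; split=> //; rewrite -tx e.
Qed.

Lemma vanish_reg_on t : eq_on U t (fun=> 0) -> reg_on U t.
Proof.
move=> t0 x Ux; apply: reg_ext (reg_0 x).
near=> y; rewrite t0 //.
by near: y; exact: open_nbhs_nbhs (conj aff_open Ux).
Unshelve. all: by end_near. Qed.

(* Elements of psec x0 are not determined by their restriction to U, hence
   the hypothesis that p contains the functions that vanish on U. *)
Lemma aff_prime_in (x0 : X) (p : set (psec x0)) :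
  prime_in [set s : psec x0 | reg_on U s] p ->
  (forall s, eq_on U s (fun=> 0) -> p s) ->
  exists2 x, U x & forall s, reg_on U s -> p s <-> ~ isunit (s x).
Proof.
move=> [[pA p0 pD pM] p1 pp] pz; have [_ _ + _ _] := aU.
apply; split=> //; split=> [s ps|s t e rt ps]; first exact: pA.
rewrite (_ : t = (s : psec x0) + ((t : psec x0) - (s : psec x0))); last first.
  by rewrite addrC subrK.
by apply: pD => //; apply: pz => x Ux; rewrite psecB e // subrr.
Qed.

(** The primes of the sections over D(s) come from the primes of the sections over [U] that avoid
    [s]; a section over D(s) is handled through its numerator, a section over [U]. *)
Lemma Dset_affine s : reg_on U s -> affine_open (Dset U s).
Proof.
move=> rs; have DU : Dset U s `<=` U by move=> x [].
have DD t' : Dset (Dset U s) t' = Dset U (fun x => s x * t' x).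
  apply/seteqP; split=> x; first by move=> [[Ux us] ut]; split=> //; apply/isunitM.
  by move=> [Ux /isunitM[]].
have rst t : reg_on U t -> reg_on U (fun x => s x * t x).
  by move=> rt x Ux; apply: reg_mul; [exact: rs|exact: rt].
have lift t : reg_on (Dset U s) t -> exists n t', reg_on U t' /\ eq_on (Dset U s) t' (fun x => s x ^+ n * t x) by exact: aff_frac.
split.
- exact: Dset_open aff_open rs.
- move=> x y [Ux _] [Uy _] e; apply: aff_sep => // t rt; apply: e.
  exact: reg_onW DU rt.
- move=> p [[preg peq] p0 pD pM [p1 pp]].
  have sr : reg_on (Dset U s) s by exact: reg_onW DU rs.
  have si : reg_on (Dset U s) (sinv s) by move=> x [Ux us]; apply: reg_inv => //; exact: rs.
  have ps : ~ p s.
    move=> ps; apply: p1; have := pM _ _ si ps; apply: peq.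
      by move=> x [Ux us]; rewrite /sinv mulrC mulruV.
    by move=> x _; exact: reg_1.
  have [_ _ + _ _] := aU; move=> /(_ (fun t => reg_on U t /\ p t))[].
    split.
    + split=> [t []//|t t' e rt' [rt pt]]; split=> //.
      by apply: peq pt; [move=> x [Ux _]; exact: e|exact: reg_onW DU rt'].
    + by split=> // x _; exact: reg_0.
    + move=> t t' [rt pt] [rt' pt']; split; last exact: pD.
      by move=> x Ux; apply: reg_add; [exact: rt|exact: rt'].
    + move=> t t' rt [rt' pt']; split; last by apply: pM => //; exact: reg_onW DU rt.
      by move=> x Ux; apply: reg_mul; [exact: rt|exact: rt'].
    + split=> [[_ //]|t t' rt rt' [_ /pp]].
      by case; [exact: reg_onW DU rt|exact: reg_onW DU rt'|left|right].
  move=> x Ux px; have ux : isunit (s x).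
    by apply: contrapT => ux; apply: ps; have /(px _ rs)[] := ux.
  exists x => // t rt; have [n [t' [rt' e]]] := lift t rt.
  have rt'' := reg_onW DU rt'.
  have <- : p t' <-> p t.
    have reX m : reg_on (Dset U s) (fun x => s x ^+ m).
      by move=> y [Uy uy]; apply: reg_exp; exact: rs.
    have riX m : reg_on (Dset U s) (fun x => sinv s x ^+ m).
      by move=> y Dy; apply: reg_exp; exact: si.
    split=> [pt'|pt].
      have := pM _ _ (riX n) pt'; apply: peq => // y Dy.
      rewrite e // mulrA -exprMn [sinv s y * _]mulrC /sinv mulruV ?expr1n ?mul1r //.
      by case: Dy.
    by have := pM _ _ (reX n) pt; apply: peq => // y Dy; rewrite e.
  have -> : isunit (t x) <-> isunit (t' x).
    rewrite e //; split; first by move=> ut; apply/isunitM; split=> //; exact: isunitX.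
    by move=> /isunitM[].
  by rewrite -px //; split=> [|[]].
- move=> V x oV [Ux us] Vx.
  have [t [rt tx tV]] := aff_basis (openI oV (Dset_open aff_open rs)) Ux
    (conj Vx (conj Ux us)).
  exists t; split; first exact: reg_onW DU rt.
    by split=> //; case: tx.
  by move=> y [[Uy _] uy]; case: (tV y (conj Uy uy)).
- move=> t rt; have [m [t' [rt' e]]] := lift t rt.
  (* With t' = s^m t, the set D(t) inside D(s) is D(s t') inside [U], where the affineness of [U]
     can be used. *)
  have Dt : Dset (Dset U s) t = Dset U (fun x => s x * t' x).
    rewrite DD; apply/seteqP; split=> x [Ux /isunitM[us ut]]; split=> //;
      apply/isunitM; split=> //.
      by rewrite e //; apply/isunitM; split=> //; exact: isunitX.
    by move: ut; rewrite e // => /isunitM[].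
  have rst' := rst _ rt'; rewrite Dt; split=> [w rw|w rw w0].
    have [n [w' [rw' e']]] := aff_frac rst' rw.
    (* Since t' = s^m t, the section w' = (s t')^n w is s^n s^(mn) t^n w; the inverse powers of [s]
       undo this. *)
    exists n, (fun x => w' x * (sinv s x ^+ n * sinv s x ^+ (m * n))); split.
      move=> x [Ux us]; apply: reg_mul; first exact: rw'.
      by apply: reg_mul; apply: reg_exp; apply: reg_inv => //; exact: rs.
    move=> x Dx; have [Ux /isunitM[us _]] := Dx.
    rewrite e' // e //; have : s x * sinv s x = 1 by exact: mulruV.
    move: (sinv s x) (s x) (t x) (w x) => i a b c ai.
    rewrite !exprMn -exprM.
    rewrite (_ : _ * _ = (a * i) ^+ n * (a * i) ^+ (m * n) * (b ^+ n * c)).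
      by rewrite ai !expr1n !mul1r.
    by rewrite !exprMn; ring.
  have [l [w' [rw' ew']]] := lift w rw.
  have [|n e0] := aff_zero rst' rw'.
    by move=> x Dx; rewrite ew' ?w0 ?mulr0 //; case: Dx => Ux /isunitM[].
  exists n => x Dx; have [Ux us] := Dx.
  have := e0 x Ux; rewrite ew' // e // => e1.
  apply: (isunit_inj (isunitX (l + (n + m * n)) us)); rewrite mulr0 -{}e1.
  by rewrite !exprMn -exprM !exprD; ring.
Qed.

End AffineOpen.

(** * Affine space over a locally closed piece *)

Notation mpl := mpoly.mpoly.
Notation mcf := mpoly.mcoeff.
Notation mpC := mpoly.mpolyC.
Notation mpX := mpoly.mpolyX.

Lemma near_all (T : topologicalType) (x : T) (I : eqType) (l : seq I)
    (P : I -> T -> Prop) :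
  (forall i, i \in l -> \forall y \near x, P i y) ->
  \forall y \near x, forall i, i \in l -> P i y.
Proof.
elim: l => [|j l IH] Pl; first by apply: nearW.
have Pj := Pl j (mem_head _ _).
have {}IH := IH (fun i il => Pl i (mem_behead (s := j :: l) il)).
near=> y => i; rewrite inE => /predU1P[->|il]; first by near: y.
by move: i il; near: y.
Unshelve. all: by end_near. Qed.

Section CoefficientIdeal.
Variables (R : comNzRingType) (M : nat) (J : set R).
Hypothesis Jid : ring_ideal J.

Definition coef_ideal : set (mpl M R) := [set F | forall m, J (mcf m F)].

Lemma coef_ideal_ideal : ring_ideal coef_ideal.
Proof.
have [J0 JD JM] := Jid; split=> [m|F G JF JG m|F G JG m].
- by rewrite raddf0.
- by rewrite raddfD; apply: JD; [exact: JF|exact: JG].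
- rewrite mpoly.mcoeffM; elim/big_rec: _ => // i x _ Jx.
  by apply: JD => //; apply: JM; exact: JG.
Qed.

End CoefficientIdeal.

Arguments coef_ideal {R} M J.
Arguments coef_ideal_ideal {R} M {J}.

Section SectionPolynomials.
Variables (k : fieldType) (X : lrspace k) (x0 : X) (M : nat).
Implicit Types (U V : set X) (F G : mpl M (psec x0)).

Definition preg U F := forall m, reg_on U (mcf m F : psec x0).

Definition csec (c : k) : psec x0 := fun x => c%:A.

Definition pst (x : X) F : mpl M (stk x) := mpoly.map_mpoly (pev x) F.

Lemma preg_subring U : subring (preg U).
Proof.
have Us := reg_on_subring x0 U; split=> [m|F G rF rG m|F G rF rG m].
- rewrite mpoly.mcoeff1; have U1 : reg_on U (1 : psec x0) by case: Us.
  by case: (_ == _) => //=; exact: (subring0 Us).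
- by rewrite raddfB; have [_ UB _] := Us; apply: UB; [exact: rF|exact: rG].
- rewrite mpoly.mcoeffM; apply: (subring_sum (A := [set s : psec x0 | reg_on U s])) => //.
  by move=> i _; apply: (subringM Us); [exact: rF|exact: rG].
Qed.

Lemma pregW U V F : V `<=` U -> preg U F -> preg V F.
Proof. by move=> VU rF m; apply: reg_onW VU (rF m). Qed.

Lemma pregC U (c : psec x0) : reg_on U c -> preg U (mpC M c).
Proof.
move=> rc m; rewrite mpoly.mcoeffC; apply: (subringM (reg_on_subring x0 U)) => //.
have Us := reg_on_subring x0 U.
by case: (_ == _) => //=; [case: Us|exact: (subring0 Us)].
Qed.

Lemma pregX U m : preg U (mpX (psec x0) m).
Proof.
move=> m'; rewrite mpoly.mcoeffX; have Us := reg_on_subring x0 U.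
by case: (_ == _) => //=; [case: Us|exact: (subring0 Us)].
Qed.

Lemma pstC x (c : psec x0) : pst x (mpC M c) = mpC M (c x).
Proof. exact: mpoly.map_mpolyC. Qed.

Lemma pstX x m : pst x (mpX (psec x0) m) = mpX (stk x) m.
Proof. exact: mpoly.map_mpolyX. Qed.

Lemma pstM x F G : pst x (F * G) = pst x F * pst x G.
Proof. exact: rmorphM. Qed.
Lemma pstB x F G : pst x (F - G) = pst x F - pst x G.
Proof. exact: rmorphB. Qed.
Lemma pstD x F G : pst x (F + G) = pst x F + pst x G.
Proof. exact: rmorphD. Qed.
Lemma pst1 x : pst x 1 = 1. Proof. exact: rmorph1. Qed.
Lemma pst0 x : pst x 0 = 0. Proof. exact: rmorph0. Qed.
Lemma pst_coef x F m : mcf m (pst x F) = (mcf m F : psec x0) x.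
Proof. exact: mpoly.mcoeff_map_mpoly. Qed.

Lemma pst_lift_gen (x : X) (P : psec x0 -> Prop) (f : mpl M (stk x)) :
  (forall g : stk x, exists2 c, P c & c x = g) ->
  exists2 F, pst x F = f & exists (c : mpoly.multinom M -> psec x0),
    (forall m, P (c m)) /\ F = \sum_(m <- mpoly.msupp f) c m *: mpX (psec x0) m.
Proof.
move=> lP; have /choice[c cP] : forall m, exists c, P c /\ c x = mcf m f.
  by move=> m; have [c Pc cx] := lP (mcf m f); exists c.
exists (\sum_(m <- mpoly.msupp f) c m *: mpX (psec x0) m); last first.
  by exists c; split=> // m; case: (cP m).
rewrite [RHS]mpoly.mpolyE /pst raddf_sum; apply: eq_bigr => m _.
rewrite [LHS]mpoly.map_mpolyZ mpoly.map_mpolyX; congr (_ *: _).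
by case: (cP m).
Qed.

Lemma preg_sum U (l : seq (mpoly.multinom M)) (c : mpoly.multinom M -> psec x0) :
  (forall m, m \in l -> reg_on U (c m)) ->
  preg U (\sum_(m <- l) c m *: mpX (psec x0) m).
Proof.
move=> rc; rewrite big_seq_cond; apply: subring_sum; first exact: preg_subring.
move=> m; rewrite andbT => ml; rewrite -mpoly.mul_mpolyC.
apply: (subringM (preg_subring U)); last exact: pregX.
by apply: pregC; exact: rc.
Qed.

Lemma pst_lift (x : X) (f : mpl M (stk x)) :
  exists U F, [/\ open U, U x, preg U F & pst x F = f].
Proof.
have [F Fx [c [rc FE]]] := @pst_lift_gen x (fun c => reg x c) f
  (fun g => let: ex_intro2 s rs sx := reg_germ g in ex_intro2 _ _ s rs sx).
have := @near_all X x _ (mpoly.msupp f) (fun m y => reg y (c m))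
  (fun m _ => reg_near (rc m)).
move=> /nbhs_interior Vn; exists (interior (fun y => forall m, m \in mpoly.msupp f -> reg y (c m))), F.
split=> //; [exact: open_interior|exact: nbhs_singleton|].
by rewrite FE; apply: preg_sum => m ml y /interior_subset; apply.
Qed.

End SectionPolynomials.

(** * The affine space over a piece as a locally ringed space *)

Section Fam.
Variables (k : fieldType) (S : lrspace k) (s0 : S) (M : nat).

(* A locally closed piece of S, given by a set of points and an ideal in each
   of their stalks. *)
Record fam_data := FamData {
  fE : set S;
  fJ : forall s : S, set (stk s);
  fJ_ideal : forall s, fE s -> ring_ideal (fJ (s := s));
  fJ_nunit : forall s c, fE s -> fJ (s := s) c -> ~ isunit c;
  fJ_near : forall s (c : psec s0), fE s -> reg s c -> fJ (c s) ->
    \forall s' \near s, fE s' -> fJ (c s')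
}.

Variable D : fam_data.
Implicit Types (U V : set S) (F G H : mpl M (psec s0)).

(* The points over s of the affine M-space over this piece are the primes of
   stk s [X_1, ..., X_M] that contract to the maximal ideal. *)
Record fampt := FamPt {
  fbase : S;
  fprime : set (mpl M (stk fbase));
  fbaseE : fE D fbase;
  fprimeP : prime_ideal fprime;
  fcontr : forall c, fprime (mpC M c) <-> ~ isunit c
}.

Lemma fprime_coef (p : fampt) :
  coef_ideal M (@fJ D (fbase p)) `<=` @fprime p.
Proof.
move=> F JF; have [[q0 qD qM] _ _] := fprimeP p.
rewrite [F]mpoly.mpolyE; elim/big_rec: _ => [//|m x _ qx].
apply: qD => //; rewrite -mpoly.mul_mpolyC mulrC; apply: qM; apply/fcontr.
by apply: fJ_nunit (fbaseE p) _; exact: JF.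
Qed.

(** The stalk at [p] will be the polynomial ring over the stalk of [S] modulo the ideal of the
    piece, localised at the prime of [p]. *)
Definition fdat (p : fampt) : loc_data (mpl M (stk (fbase p))) :=
  LocData (fprimeP p) (coef_ideal_ideal M (fJ_ideal (fbaseE p)))
    (@fprime_coef p).

Definition fstalk (p : fampt) := loc (fdat p).

HB.instance Definition _ p := GRing.ComNzRing.on (fstalk p).

Definition falg (p : fampt) (a : k) : loc (fdat p) :=
  tofrac (fdat p) (mpC M a%:A).

Lemma falgM p a b : falg p (a * b) = falg p a * falg p b.
Proof.
rewrite /falg -(rmorphM (tofrac (fdat p))) -(rmorphM (@mpC M (stk (fbase p)))) /=.
by congr (tofrac _ (mpC M _)); rewrite -scalerAl mul1r scalerA.
Qed.

Lemma falgD p a b : falg p (a + b) = falg p a + falg p b.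
Proof.
by rewrite /falg scalerDl (rmorphD (@mpC M (stk (fbase p)))) (rmorphD (tofrac (fdat p))).
Qed.

Lemma falg1 p : falg p 1 = 1.
Proof.
by rewrite /falg scale1r (rmorph1 (@mpC M (stk (fbase p)))) (rmorph1 (tofrac (fdat p))).
Qed.

Definition fscal (p : fampt) (a : k) (x : fstalk p) : fstalk p :=
  (falg p a : fstalk p) * x.

Fact fscalA p a b v : @fscal p a (fscal b v) = fscal (a * b) v.
Proof. by rewrite /fscal falgM mulrA. Qed.
Fact fscal1 p : left_id 1 (@fscal p).
Proof. by move=> v; rewrite /fscal falg1 mul1r. Qed.
Fact fscalDr p : right_distributive (@fscal p) +%R.
Proof. by move=> a v w; exact: mulrDr. Qed.
Fact fscalDl p v : {morph (@fscal p)^~ v : a b / a + b}.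
Proof. by move=> a b; rewrite /fscal falgD mulrDl. Qed.

HB.instance Definition _ p := GRing.Zmodule_isLmodule.Build k (fstalk p)
  (@fscalA p) (@fscal1 p) (@fscalDr p) (@fscalDl p).

Fact fscalAl p (a : k) (v w : fstalk p) : a *: (v * w) = a *: v * w.
Proof. exact: mulrA. Qed.

HB.instance Definition _ p :=
  GRing.Lmodule_isLalgebra.Build k (fstalk p) (@fscalAl p).
HB.instance Definition _ p :=
  GRing.Lalgebra_isComAlgebra.Build k (fstalk p).

HB.instance Definition _ := gen_eqMixin fampt.
HB.instance Definition _ := gen_choiceMixin fampt.

Definition fbasic U F : set fampt :=
  [set p | U (fbase p) /\ ~ fprime (pst (fbase p) F)].

Definition fopen (A : set fampt) := forall p, A p ->
  exists U F, [/\ open U, preg U F, fbasic U F p & fbasic U F `<=` A].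

Lemma fprimeM (p : fampt) a b :
  ~ @fprime p a -> ~ @fprime p b -> ~ @fprime p (a * b).
Proof. by have [_ _ qM] := fprimeP p; move=> qa qb /qM[]. Qed.

Lemma fprimeM_inv (p : fampt) a b :
  ~ @fprime p (a * b) -> ~ @fprime p a /\ ~ @fprime p b.
Proof.
have [[_ _ qM] _ _] := fprimeP p; move=> nq; split=> q; apply: nq.
  by rewrite mulrC; exact: qM.
exact: qM.
Qed.

Lemma fbasicI U F V G : fbasic (U `&` V) (F * G) = fbasic U F `&` fbasic V G.
Proof.
apply/seteqP; split=> p; rewrite /fbasic /= pstM.
  by move=> [[Up Vp] /fprimeM_inv[]].
by move=> [[Up nF] [Vp nG]]; split=> //; exact: fprimeM.
Qed.

Lemma fprime1 (p : fampt) : ~ @fprime p 1.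
Proof. by case: (fprimeP p). Qed.

Fact fopT : fopen setT.
Proof.
move=> p _; exists setT, 1; split=> //; first exact: openT.
  by case: (preg_subring s0 M setT).
by split=> //; rewrite pst1; exact: fprime1.
Qed.

Fact fopI : setI_closed fopen.
Proof.
move=> A B oA oB p [Ap Bp].
have [U [F [oU rF pF FA]]] := oA p Ap; have [V [G [oV rG pG GB]]] := oB p Bp.
exists (U `&` V), (F * G); split; first exact: openI.
- by apply: (subringM (preg_subring s0 M _));
    [apply: pregW rF|apply: pregW rG] => x [].
- by rewrite fbasicI.
- by rewrite fbasicI => x [/FA Ax /GB Bx].
Qed.

Fact fop_bigU (I : Type) (f : I -> set fampt) :
  (forall i, fopen (f i)) -> fopen (\bigcup_i f i).
Proof.
move=> of_ p [i _ fip]; have [U [F [oU rF pF FA]]] := of_ i p fip.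
by exists U, F; split=> // x /FA fx; exists i.
Qed.

HB.instance Definition _ := isOpenTopological.Build fampt fopT fopI fop_bigU.

Lemma fopenE (A : set fampt) : open A <-> fopen A.
Proof. by []. Qed.

Lemma fbasic_open U F : open U -> preg U F -> open (fbasic U F).
Proof. by move=> oU rF; apply/fopenE => p pF; exists U, F; split. Qed.

Lemma fnbhsP (p : fampt) (A : set fampt) : nbhs p A ->
  exists U F, [/\ open U, preg U F, fbasic U F p & fbasic U F `<=` A].
Proof.
rewrite nbhsE => -[B [/fopenE oB Bp] BA].
have [U [F [oU rF pF FB]]] := oB p Bp.
by exists U, F; split=> //; apply: subset_trans BA.
Qed.

Lemma fbasic_nbhs (p : fampt) U F : open U -> preg U F -> fbasic U F p ->
  nbhs p (fbasic U F).
Proof.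
by move=> oU rF pF; exact: (open_nbhs_nbhs (conj (fbasic_open oU rF) pF)).
Qed.

Definition ffrac F G (p : fampt) : fstalk p :=
  frac (fdat p) (pst (fbase p) F) (pst (fbase p) G).

Definition fregular (p : fampt) (s : forall p, fstalk p) :=
  exists U F G, [/\ open U, preg U F, preg U G, fbasic U G p &
    forall p', fbasic U G p' -> s p' = ffrac F G p'].

Fact freg_near p s : fregular p s -> \forall p' \near p, fregular p' s.
Proof.
move=> [U [F [G [oU rF rG pG e]]]].
apply: filterS (fbasic_nbhs oU rG pG) => p' pG'.
by exists U, F, G.
Qed.

Lemma ffracMr F G H (p : fampt) : ~ @fprime p (pst _ G) -> ~ @fprime p (pst _ H) ->
  ffrac F G p = ffrac (F * H) (G * H) p.
Proof.
by move=> nG nH; rewrite /ffrac !pstM; apply/esym/(@frac_mulr _ (fdat p)).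
Qed.

Fact freg_ext p (s t : forall p, fstalk p) :
  (\forall p' \near p, s p' = t p') -> fregular p s -> fregular p t.
Proof.
move=> /fnbhsP[V [H [oV rH pH e']]] [U [F [G [oU rF rG pG e]]]].
have UVU : U `&` V `<=` U by move=> x [].
have UVV : U `&` V `<=` V by move=> x [].
have sub := subringM (preg_subring s0 M (U `&` V)).
exists (U `&` V), (F * H), (G * H); split; first exact: openI.
- by apply: sub; [exact: pregW rF|exact: pregW rH].
- by apply: sub; [exact: pregW rG|exact: pregW rH].
- by rewrite fbasicI.
- move=> p'; rewrite fbasicI => -[pG' pH'].
  rewrite -(e' p' pH') (e p' pG'); apply: ffracMr; [by case: pG'|by case: pH'].
Qed.

Fact freg_germ p (a : fstalk p) : exists2 s, fregular p s & s p = a.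
Proof.
have [f [g [qg ->]]] := fracP a.
have [U [F [oU Up rF Ff]]] := pst_lift s0 f.
have [V [G [oV Vp rG Gg]]] := pst_lift s0 g.
exists (ffrac F G); last by rewrite /ffrac Ff Gg.
exists (U `&` V), F, G; split=> //; first exact: openI.
- by apply: pregW rF => x [].
- by apply: pregW rG => x [].
- by split=> //; rewrite Gg.
Qed.

(** A polynomial has finitely many coefficients, and each of them stays in the ideal of the piece
    near the base point, by [fJ_near]. *)
Lemma fcoef_near (p : fampt) U F : open U -> preg U F -> U (fbase p) ->
  coef_ideal M (@fJ D (fbase p)) (pst (fbase p) F) ->
  exists V, [/\ open V, V (fbase p) &
    forall p' : fampt, V (fbase p') ->
      coef_ideal M (@fJ D (fbase p')) (pst (fbase p') F)].
Proof.
move=> oU rF Up JF.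
have h m : m \in mpoly.msupp F ->
    \forall y \near fbase p, fE D y -> fJ D ((mcf m F : psec s0) y).
  move=> _; apply: fJ_near (fbaseE p) (rF m _ Up) _.
  by have := JF m; rewrite pst_coef.
have Vn := nbhs_singleton (nbhs_interior (near_all h)).
exists (interior (fun y => forall m, m \in mpoly.msupp F ->
  fE D y -> fJ D ((mcf m F : psec s0) y))).
split=> [|//|p' /interior_subset Vp' m]; first exact: open_interior.
rewrite pst_coef; have [mF|mF] := boolP (m \in mpoly.msupp F).
  exact: Vp' (fbaseE p').
rewrite mpoly.memN_msupp_eq0 // psec0.
by case: (fJ_ideal (fbaseE p')).
Qed.

Lemma ffrac_eq F G F' G' (p : fampt) :
  ~ @fprime p (pst _ G) -> ~ @fprime p (pst _ G') ->
  ffrac F G p = ffrac F' G' p <-> exists2 u, ~ @fprime p u &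
    coef_ideal M (@fJ D (fbase p)) (u * pst _ (F * G' - F' * G)).
Proof.
move=> nG nG'; rewrite /ffrac pstB !pstM; exact: (@frac_inj _ (fdat p)).
Qed.

Fact freg_inj p (s t : forall p, fstalk p) :
  fregular p s -> fregular p t -> s p = t p -> \forall p' \near p, s p' = t p'.
Proof.
move=> [U [F [G [oU rF rG pG e]]]] [U' [F' [G' [oU' rF' rG' pG' e']]]].
rewrite (e p pG) (e' p pG') => /(ffrac_eq _ _ (proj2 pG) (proj2 pG'))[u + +].
have [V [H [oV Vp rH <-]]] := pst_lift s0 u; move=> nu.
rewrite -pstM => Jp.
have sub1 : (U `&` U') `&` V `<=` U by move=> x [[]].
have sub2 : (U `&` U') `&` V `<=` U' by move=> x [[]].
have sub3 : (U `&` U') `&` V `<=` V by move=> x [].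
move: (openI (openI oU oU') oV) sub1 sub2 sub3; set W := _ `&` V.
move=> oW sub1 sub2 sub3; have Ws := preg_subring s0 M W.
have [[rF1 rG1] [rF2 rG2]] := ((pregW sub1 rF, pregW sub1 rG),
  (pregW sub2 rF', pregW sub2 rG')).
have rH1 := pregW sub3 rH.
have rE : preg W (H * (F * G' - F' * G)).
  apply: (subringM Ws) => //; have [_ WB _] := Ws.
  by apply: WB; apply: (subringM Ws).
have Wp : W (fbase p) by split=> //; split; [case: pG|case: pG'].
have [V' [oV' V'p JV']] := fcoef_near oW rE Wp Jp.
have rHG : preg (W `&` V') (H * (G * G')).
  by apply: (@pregW _ _ _ _ W) => [x []//|]; do 2 apply: (subringM Ws) => //.
have pHG : fbasic (W `&` V') (H * (G * G')) p.
  split; first by split.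
  by rewrite !pstM; exact: (fprimeM nu (fprimeM (proj2 pG) (proj2 pG'))).
apply: filterS (fbasic_nbhs (openI oW oV') rHG pHG) => p' [[Wp' V'p']].
rewrite !pstM => /fprimeM_inv[nH /fprimeM_inv[nG nG']].
have [U1 U2] : U (fbase p') /\ U' (fbase p') by case: Wp' => -[].
rewrite (e p' (conj U1 nG)) (e' p' (conj U2 nG')); apply/(ffrac_eq _ _ nG nG').
by exists (pst (fbase p') H); rewrite -?pstM; [exact: nH|exact: JV'].
Qed.

Fact freg_const p (c : k) : fregular p (fun p' => c%:A).
Proof.
have rc : preg setT (mpC M (csec s0 c)).
  by apply: pregC => s _; exact: reg_const.
exists setT, (mpC M (csec s0 c)), 1; split=> //.
- exact: openT.
- by case: (preg_subring s0 M setT).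
- by split=> //; rewrite pst1; exact: fprime1.
- move=> p' _; rewrite /ffrac pst1 pstC.
  by rewrite -[LHS]/(fscal c 1) /fscal mulr1.
Qed.

Lemma fregular2 p s t : fregular p s -> fregular p t ->
  exists U F G F' G', [/\ open U, preg U F /\ preg U F', preg U G /\ preg U G',
    fbasic U G p /\ fbasic U G' p & forall p',
    fbasic U G p' -> fbasic U G' p' -> s p' = ffrac F G p' /\ t p' = ffrac F' G' p'].
Proof.
move=> [U [F [G [oU rF rG pG e]]]] [U' [F' [G' [oU' rF' rG' pG' e']]]].
exists (U `&` U'), F, G, F', G'; split; first exact: openI.
- by split; [apply: pregW rF|apply: pregW rF'] => x [].
- by split; [apply: pregW rG|apply: pregW rG'] => x [].
- by move: pG pG' => [? ?] [? ?].
- by move=> p' [[U1 U2] nG] [_ nG']; rewrite (e p' (conj U1 nG)) (e' p' (conj U2 nG')).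
Qed.

Fact freg_sub p s t : fregular p s -> fregular p t ->
  fregular p (fun p' => s p' - t p').
Proof.
move=> rs rt; have [U [F [G [F' [G' [oU [rF rF'] [rG rG'] [pG pG'] e]]]]]] :=
  fregular2 rs rt; have Us := preg_subring s0 M U.
exists U, (F * G' - F' * G), (G * G'); split.
- exact: oU.
- have [_ UB _] := Us; exact: (UB _ _ (subringM Us rF rG') (subringM Us rF' rG)).
- exact: (subringM Us rG rG').
- split; first by case: pG.
  by rewrite pstM; exact: (fprimeM (proj2 pG) (proj2 pG')).
- move=> p' [Up']; rewrite pstM => /fprimeM_inv[nG nG'].
  have [-> ->] := e p' (conj Up' nG) (conj Up' nG').
  rewrite /ffrac (@fracN _ (fdat p') _ _ nG') (@fracD _ (fdat p') _ _ _ _ nG nG').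
  by rewrite pstB !pstM mulNr.
Qed.

Fact freg_mul p s t : fregular p s -> fregular p t ->
  fregular p (fun p' => s p' * t p').
Proof.
move=> rs rt; have [U [F [G [F' [G' [oU [rF rF'] [rG rG'] [pG pG'] e]]]]]] :=
  fregular2 rs rt; have Us := preg_subring s0 M U.
exists U, (F * F'), (G * G'); split.
- exact: oU.
- exact: (subringM Us rF rF').
- exact: (subringM Us rG rG').
- split; first by case: pG.
  by rewrite pstM; exact: (fprimeM (proj2 pG) (proj2 pG')).
- move=> p' [Up']; rewrite pstM => /fprimeM_inv[nG nG'].
  have [-> ->] := e p' (conj Up' nG) (conj Up' nG').
  by rewrite /ffrac (@fracM _ (fdat p') _ _ _ _ nG nG') !pstM.
Qed.

Fact fstk_local_ p (a : fstalk p) : isunit a \/ isunit (1 - a).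
Proof. exact: (@loc_local _ (fdat p)). Qed.

(** The primes of the two points live in different types; polynomials whose coefficients are
    families of germs have a value at every base point and make them comparable. *)
Lemma fampt_eq (p p' : fampt) : fbase p = fbase p' ->
  (forall F : mpl M (psec s0), fprime (pst (fbase p) F) <-> fprime (pst (fbase p') F)) ->
  p = p'.
Proof.
case: p p' => [s q sE qP qc] [s' q' sE' qP' qc'] /= ss'; case: s' / ss' in q' sE' qP' qc' *.
move=> e; have qq' : q = q'.
  apply/seteqP; split=> F qF; have [U [G [_ _ _ GF]]] := pst_lift s0 F;
    by move: qF; rewrite -GF => /e.
case: q' / qq' in qP' qc' e *.
by congr FamPt; exact: Prop_irrelevance.
Qed.

Definition Fam : lrspace k := @LRSpace k fampt fstalk fregular
  fstk_local_ freg_near freg_ext freg_germ freg_inj freg_const freg_sub freg_mul.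

End Fam.

Section Mmap.
Variables (M : nat) (A B C : comNzRingType).
Variables (g : {rmorphism A -> B}) (f : {rmorphism B -> C}) (v : 'I_M -> C).

Lemma mmap_map (F : mpl M A) :
  mpoly.mmap f v (mpoly.map_mpoly g F) = mpoly.mmap (f \o g) v F.
Proof.
rewrite -[mpoly.map_mpoly g F]/(\sum_(m <- mpoly.msupp F)
  mpC M (g (mcf m F)) * mpoly.mmap1 (fun i => mpX B (mpoly.mnm1 i)) m).
rewrite raddf_sum; apply: eq_bigr => m _.
rewrite [LHS](rmorphM (@mpoly.mmap M B C f v)).
by rewrite [X in X * _]mpoly.mmapC mpoly.mmap1_id [X in _ * X]mpoly.mmapX.
Qed.

Definition mmapr : {rmorphism mpl M B -> C} := mpoly.mmap f v.

End Mmap.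

(** * The universal property of the affine space over a piece *)

Section FamMorphisms.
Variables (k : fieldType) (S : scheme k) (s0 : S) (M : nat).
Variable D : fam_data s0.
Local Notation L := (Fam M D).
Hypothesis Laff : forall p : L, exists2 U : set L, affine_open U & U p.

Definition FamS : scheme k := Scheme Laff.

Definition fproj_stk (p : L) : {rmorphism stk (fbase p) -> fstalk p} :=
  tofrac (fdat p) \o @mpC M (stk (fbase p)).

Program Definition fproj : mor FamS S :=
  @Mor k FamS S (fun p : L => fbase p) fproj_stk _ _ _ _.
Next Obligation.
move=> p A /= /nbhs_interior /nbhs_singleton Ap.
have r1 : preg (interior A) (1 : mpl M (psec s0)).
  by case: (preg_subring s0 M (interior A)).
have pb : fbasic (interior A) (1 : mpl M (psec s0)) p.
  by split=> //; rewrite pst1; exact: fprime1.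
apply: filterS (fbasic_nbhs (open_interior A) r1 pb) => p' [+ _].
exact: interior_subset.
Qed.
Next Obligation.
by move=> p c; rewrite /= -[RHS]/(fscal c 1) /fscal mulr1.
Qed.
Next Obligation.
move=> p a /= /(@tofrac_unit _ (fdat p)) nu; apply: contrapT => na; apply: nu.
exact/fcontr.
Qed.
Next Obligation.
move=> p s /= rs; have /nbhs_interior /nbhs_singleton Us := reg_near rs.
exists (interior (fun y => reg y s)), (mpC M (s : psec s0)), 1; split.
- exact: open_interior.
- by apply: pregC => y /interior_subset.
- by case: (preg_subring s0 M (interior (fun y => reg y s))).
- by split=> //; rewrite pst1; exact: fprime1.
- by move=> p' _; rewrite /ffrac pst1 pstC.
Qed.

Definition fcoord (j : 'I_M) : forall p : FamS, stk p :=
  fun p : L => tofrac (fdat p) (mpX _ (mpoly.mnm1 j)).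

Lemma fcoord_reg j (p : FamS) : reg p (fcoord j).
Proof.
exists setT, (mpX (psec s0) (mpoly.mnm1 j)), 1; split.
- exact: openT.
- exact: pregX.
- by case: (preg_subring s0 M setT).
- by split=> //; rewrite pst1; exact: fprime1.
- by move=> p' _; rewrite /ffrac pst1 pstX.
Qed.

Section Lift.
Variables (V : scheme k) (f : mor V S) (v : 'I_M -> forall x : V, stk x).

Definition evalp (x : V) : {rmorphism mpl M (stk (f x)) -> stk x} :=
  mmapr (fstk f x) (fun j => v j x).

Lemma evalpC x c : evalp x (mpC M c) = fstk f x c.
Proof. exact: mpoly.mmapC. Qed.

Lemma evalpX x j : evalp x (mpX (stk (f x)) (mpoly.mnm1 j)) = v j x.
Proof. by rewrite [LHS]mpoly.mmapX mpoly.mmap1U. Qed.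

(** The pullback of [F] along the morphism with coordinates [v] over [f]; it makes sense before this
    morphism is constructed. *)
Definition evals (F : mpl M (psec s0)) (x : V) : stk x := evalp x (pst (f x) F).

Lemma evalsE F x : evals F x = \sum_(m <- mpoly.msupp F)
  pull f (mcf m F : psec s0) x * \prod_(j < M) v j x ^+ m j.
Proof. exact: mmap_map. Qed.

Lemma evals_reg F x U : preg U F -> U (f x) -> (forall j, reg x (v j)) ->
  reg x (evals F).
Proof.
move=> rF Ux rv; have xs := reg_subring x x.
pose G : psec x := \sum_(m <- mpoly.msupp F)
  ((pull f (mcf m F : psec s0) : psec x) * \prod_(j < M) (v j : psec x) ^+ m j).
rewrite (_ : evals F = G); last first.
  apply: functional_extensionality_dep => y; rewrite evalsE /G psec_sum.
  apply: eq_bigr => m _; rewrite psecM psec_prod; congr (_ * _).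
  by apply: eq_bigr => j _; rewrite psecX.
change ([set s : psec x | reg x s] G).
apply: subring_sum => [//|m _]; apply: (subringM xs).
  by apply: fstk_reg; exact: rF.
by apply: subring_prod => [//|j _]; apply: (subringX _ xs); exact: rv.
Qed.

Lemma evalsM F G x : evals (F * G) x = evals F x * evals G x.
Proof. by rewrite /evals pstM rmorphM. Qed.
Lemma evalsB F G x : evals (F - G) x = evals F x - evals G x.
Proof. by rewrite /evals pstB rmorphB. Qed.
Lemma evals1 x : evals 1 x = 1.
Proof. by rewrite /evals pst1 rmorph1. Qed.
Lemma evalsC c x : evals (mpC M (c : psec s0)) x = pull f c x.
Proof. by rewrite /evals pstC evalpC. Qed.
Lemma evalsX j x : evals (mpX (psec s0) (mpoly.mnm1 j)) x = v j x.
Proof. by rewrite /evals pstX evalpX. Qed.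

Definition eval_prime (x : V) : set (mpl M (stk (f x))) :=
  [set F | ~ isunit (evalp x F)].

Lemma eval_primeP x : prime_ideal (@eval_prime x).
Proof.
split=> [||a b]; rewrite /eval_prime /=.
- split=> /= [|a b ua ub|a b ub].
  + by rewrite raddf0; exact: nunit0.
  + by rewrite raddfD; exact: nunitD.
  + by rewrite rmorphM => /isunitM[].
- by rewrite rmorph1 => /(_ (isunit1 _)).
- rewrite rmorphM => nab; have [ua|ua] := EM (isunit (evalp x a)); last by left.
  by right=> ub; apply: nab; apply/isunitM.
Qed.

Lemma eval_contr (x : V) (c : stk (f x)) :
  @eval_prime x (mpC M c) <-> ~ isunit c.
Proof.
rewrite /eval_prime /= evalpC; split=> nu u; apply: nu.
  exact: isunit_rmorph.
exact: fstk_local u.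
Qed.

Hypothesis vreg : forall j x, reg x (v j).
Hypothesis fE_ : forall x, fE D (f x).
Hypothesis fJ_ : forall x c, fJ D c -> fstk f x c = 0.

Definition lift_pt (x : V) : L :=
  FamPt (fE_ x) (eval_primeP x) (eval_contr (x := x)).

Lemma lift_J x F : loc_J (fdat (lift_pt x)) F -> evalp x F = 0.
Proof.
move=> JF; rewrite /= /mpoly.mmap big1_seq // => m _.
by rewrite fJ_ ?mul0r //; exact: JF.
Qed.

Lemma lift_q x F : ~ loc_q (fdat (lift_pt x)) F -> isunit (evalp x F).
Proof. by move=> nF; apply: contrapT => u; apply: nF. Qed.

Definition lift_stk (x : V) : {rmorphism fstalk (lift_pt x) -> stk x} :=
  loc_liftr (@lift_J x) (@lift_q x).

(** A morphism to the affine space over the piece amounts to a morphism to [S] that lands in [fE]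
    and kills [fJ], together with [M] functions; uniqueness is [flift_uniq]. *)
Program Definition flift : mor V FamS :=
  @Mor k V FamS lift_pt lift_stk _ _ _ _.
Next Obligation.
move=> x A /fnbhsP[U [F [oU rF [/= Ux nF] FA]]].
have uF : isunit (evals F x) by exact: (@lift_q x).
have r := evals_reg rF Ux (vreg^~ x).
change (\forall y \near x, A (lift_pt y)).
near=> y; apply: FA; split=> /=.
  by near: y; apply: (@fpt_continuous _ _ _ f); exact: (open_nbhs_nbhs (conj oU Ux)).
by move=> nu; apply: nu; near: y; exact: unit_near r uF.
Unshelve. all: by end_near. Qed.
Next Obligation.
move=> x c; rewrite -[c%:A]/(fscal c 1) /fscal mulr1.
rewrite [LHS](@loc_lift_tofrac _ (fdat (lift_pt x)) _ _ (@lift_J x) (@lift_q x)).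
by rewrite evalpC fstk_const.
Qed.
Next Obligation.
move=> x a; have [F [G [nG ->]]] := @fracP _ (fdat (lift_pt x)) a.
have e := @loc_liftrE _ (fdat (lift_pt x)) _ _ (@lift_J x) (@lift_q x) F G nG.
move=> u; apply/(@frac_unit _ (fdat (lift_pt x)) F G nG) => /=.
by move=> /(_ _); apply; rewrite /= -e; apply/isunitM; split=> //; exact: lift_q nG.
Qed.
Next Obligation.
move=> x s [U [F [G [oU rF rG [/= Ux nG] e]]]].
have uG : isunit (evals G x) by exact: (@lift_q x).
have rF' := evals_reg rF Ux (vreg^~ x).
have rG' := evals_reg rG Ux (vreg^~ x).
apply: reg_ext (reg_mul (reg_inv rG' uG) rF').
near=> y.
have Uy : U (f y).
  by near: y; apply: (@fpt_continuous _ _ _ f); exact: (open_nbhs_nbhs (conj oU Ux)).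
have uy : isunit (evals G y) by near: y; exact: unit_near rG' uG.
have nGy : ~ @fprime _ _ _ _ _ (lift_pt y) (pst (f y) G) by move=> /(_ uy).
rewrite e; last by split.
apply: (isunit_inj uy); rewrite mulrA [_ * sinv _ _]mulruV // mul1r.
by rewrite [RHS](@loc_liftrE _ (fdat (lift_pt y)) _ _ (@lift_J y) (@lift_q y)).
Unshelve. all: by end_near. Qed.

Lemma flift_proj : eqm (mcomp fproj flift) f.
Proof.
split=> // s x; rewrite /pull /=.
rewrite [LHS](@loc_lift_tofrac _ (fdat (lift_pt x)) _ _ (@lift_J x) (@lift_q x)).
exact: evalpC.
Qed.

Lemma flift_coord j x : pull flift (fcoord j) x = v j x.
Proof.
rewrite /pull /=.
rewrite [LHS](@loc_lift_tofrac _ (fdat (lift_pt x)) _ _ (@lift_J x) (@lift_q x)).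
exact: evalpX.
Qed.

End Lift.

Definition fpoly (F : mpl M (psec s0)) : forall p : FamS, stk p :=
  fun p : L => tofrac (fdat p) (pst (fbase p) F).

Lemma fpolyE F (p : FamS) : fpoly F p = evals fproj fcoord F p.
Proof.
rewrite evalsE /fpoly.
rewrite -[pst (fbase p) F]/(\sum_(m <- mpoly.msupp F) mpC M (pev (fbase p) (mcf m F))
  * mpoly.mmap1 (fun i => mpX (stk (fbase p)) (mpoly.mnm1 i)) m).
rewrite (rmorph_sum (tofrac (fdat p))); apply: eq_bigr => m _.
rewrite (rmorphM (tofrac (fdat p))); congr (_ * _).
rewrite /mpoly.mmap1 (rmorph_prod (tofrac (fdat p))).
by apply: eq_bigr => j _; rewrite (rmorphXn (tofrac (fdat p))).
Qed.

Lemma pull_evals (V W : scheme k) (f : mor V S) (h : mor W V)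
    (v : 'I_M -> forall x : V, stk x) F x :
  pull h (evals f v F) x = evals (mcomp f h) (fun j => pull h (v j)) F x.
Proof.
rewrite /pull !evalsE rmorph_sum; apply: eq_bigr => m _.
rewrite rmorphM rmorph_prod; congr (_ * _).
by apply: eq_bigr => j _; rewrite rmorphXn.
Qed.

Lemma evals_eqm (V : scheme k) (f f' : mor V S)
    (v v' : 'I_M -> forall x : V, stk x) F x :
  eqm f f' -> (forall j, v j x = v' j x) -> evals f v F x = evals f' v' F x.
Proof.
move=> [_ ff'] vv'; rewrite !evalsE; apply: eq_bigr => m _.
by rewrite ff'; congr (_ * _); apply: eq_bigr => j _; rewrite vv'.
Qed.

Lemma pull_fpoly (V : scheme k) (h : mor V FamS) F x :
  pull h (fpoly F) x = evals (mcomp fproj h) (fun j => pull h (fcoord j)) F x.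
Proof.
rewrite -pull_evals; congr (pull h _ x).
by apply: functional_extensionality_dep => y; exact: fpolyE.
Qed.

Lemma fpoly_unit F (p : L) : isunit (fpoly F p) <-> ~ fprime (pst (fbase p) F).
Proof. exact: (@tofrac_unit _ (fdat p)). Qed.

Lemma pull_unit (V W : scheme k) (h : mor V W) s x :
  isunit (pull h s x) <-> isunit (s (h x)).
Proof. by split=> [/fstk_local//|]; exact: isunit_rmorph. Qed.

(** Both morphisms agree on polynomials, hence on points, which polynomials determine, and on
    stalks, whose elements are fractions of polynomials. *)
Lemma flift_uniq (V : scheme k) (h h' : mor V FamS) :
  eqm (mcomp fproj h) (mcomp fproj h') ->
  (forall j x, pull h (fcoord j) x = pull h' (fcoord j) x) -> eqm h h'.
Proof.
move=> e ec; have eF F x : pull h (fpoly F) x = pull h' (fpoly F) x.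
  by rewrite !pull_fpoly; apply: evals_eqm.
have ept x : h x = h' x.
  apply: fampt_eq; first by case: e => e0 _; exact: (e0 x).
  move=> F; have := pull_unit h (fpoly F) x; rewrite eF pull_unit.
  rewrite (fpoly_unit F (h x)) (fpoly_unit F (h' x)) => nn.
  by split=> q; apply: contrapT; [move=> nq; exact: (proj1 nn nq q)|move=> nq; exact: (proj2 nn nq q)].
split=> // s x.
have [f [g [nf E]]] := @fracP _ (fdat (h x)) (s (h x)).
have [U [F [_ _ _ Ff]]] := pst_lift s0 f.
have [U' [G [_ _ _ Gg]]] := pst_lift s0 g.
have E1 : fpoly G (h x) * s (h x) = fpoly F (h x).
  rewrite E /fpoly Ff Gg; exact: (@frac_mulK _ (fdat (h x))).
have E2 : fpoly G (h' x) * s (h' x) = fpoly F (h' x).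
  by rewrite -(ept x).
have uG : isunit (pull h (fpoly G) x).
  by apply/pull_unit/fpoly_unit; rewrite Gg.
apply: (isunit_inj uG); rewrite -[LHS]rmorphM E1 eF -[RHS]rmorphM E2.
exact: eF.
Qed.

End FamMorphisms.

Section Clearing.
Variables (k : fieldType) (X : lrspace k) (x0 : X) (M : nat) (U : set X).
Hypothesis aU : affine_open U.
Local Notation S := (psec x0).

Lemma common_den (x : X) (I : eqType) (l : seq I) (Q : I -> S -> Prop) :
  (forall i, exists d, [/\ reg_on U d, isunit (d x) & Q i d]) ->
  (forall i (d e : S), reg_on U e -> Q i d -> Q i (e * d)) ->
  exists d : S, [/\ reg_on U d, isunit (d x) & forall i, i \in l -> Q i d].
Proof.
move=> Qex QM; elim: l => [|j l [d [rd ud dQ]]].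
  exists 1; split=> // [y _|]; [exact: reg_1|exact: isunit1].
have [e [re ue eQ]] := Qex j; exists (d * e); split.
- exact: (subringM (reg_on_subring x0 U)).
- by apply/isunitM.
- move=> i; rewrite inE => /predU1P[->|/dQ Qi]; first exact: QM.
  by rewrite mulrC; exact: QM.
Qed.

Lemma poly_clear_on (c : S) (F : mpl M S) : reg_on U c -> preg (Dset U c) F ->
  exists n (F' : mpl M S), preg U F' /\ forall y, Dset U c y ->
    pst y F' = mpC M (c y ^+ n) * pst y F.
Proof.
move=> rc rF.
have /choice[N NP] : forall m, exists n, exists2 t : S, reg_on U t &
    eq_on (Dset U c) t (fun y => c y ^+ n * (mcf m F : S) y).
  move=> m; have [n [t [rt e]]] := aff_frac aU rc (rF m).
  by exists n, t.
pose n := (\max_(m <- mpoly.msupp F) N m)%N.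
have /choice[t tP] : forall m, exists t : S, reg_on U t /\ (m \in mpoly.msupp F ->
    eq_on (Dset U c) t (fun y => c y ^+ n * (mcf m F : S) y)).
  move=> m; have [t rt e] := NP m.
  exists (c ^+ (n - N m) * t); split.
    have Us := reg_on_subring x0 U.
    by apply: (subringM Us) => //; exact: (subringX _ Us).
  move=> mF y Dy; rewrite psecM psecX e // mulrA -exprD subnK //.
  exact: leq_bigmax_seq.
exists n, (\sum_(m <- mpoly.msupp F) t m *: mpX S m); split.
  by apply: preg_sum => m _; case: (tP m).
move=> y Dy; rewrite -[pst y F]/(\sum_(m <- mpoly.msupp F)
  mpC M (pev y (mcf m F)) * mpoly.mmap1 (fun i => mpX (stk y) (mpoly.mnm1 i)) m).
rewrite mulr_sumr [LHS]/pst raddf_sum big_seq [RHS]big_seq; apply: eq_bigr => m mF /=.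
rewrite [LHS]mpoly.map_mpolyZ mpoly.map_mpolyX mpoly.mmap1_id mulrA.
have [_ /(_ mF) e] := tP m.
rewrite -(rmorphM (@mpC M (stk y))) mpoly.mul_mpolyC; congr (_ *: _).
exact: (e y Dy).
Qed.

Lemma poly_clear (x : X) (f : mpl M (stk x)) : U x ->
  exists (c : S) (F : mpl M S), [/\ reg_on U c, isunit (c x), preg U F &
    mpC M (c x) * f = pst x F].
Proof.
move=> Ux; have [V [F [oV Vx rF Fx]]] := pst_lift x0 f.
have [c [rc [_ cx] cV]] := aff_basis aU oV Ux Vx.
have [n [F' [rF' e]]] := poly_clear_on rc (pregW cV rF).
exists ((c : S) ^+ n), F'; split=> //.
- exact: (subringX n (reg_on_subring x0 U) (rc : [set s : S | reg_on U s] c)).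
- by rewrite psecX; exact: isunitX.
- by rewrite psecX -Fx; apply/esym/e.
Qed.

Lemma poly_zero (x : X) (F : mpl M S) : U x -> preg U F -> pst x F = 0 ->
  exists c : S, [/\ reg_on U c, isunit (c x) &
    forall y, U y -> mpC M (c y) * pst y F = 0].
Proof.
move=> Ux rF F0; have [||c [rc uc cF]] := @common_den x _ (mpoly.msupp F)
    (fun m d => forall y, U y -> d y * (mcf m F : S) y = 0).
- move=> m; have [|c [rc uc c0]] := aff_stk0 aU Ux (rF m).
    by rewrite -pst_coef F0 raddf0.
  by exists c.
- by move=> m d e _ d0 y Uy; rewrite psecM -mulrA d0 ?mulr0.
exists c; split=> // y Uy; apply/mpoly.mpolyP => m.
rewrite mpoly.mcoeffCM pst_coef raddf0.
have [/cF ->//|mF] := boolP (m \in mpoly.msupp F).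
by rewrite (mpoly.memN_msupp_eq0 mF) psec0 mulr0.
Qed.

End Clearing.

(** * Affine charts of the affine space over a piece *)

Section FamAffine.
Variables (k : fieldType) (S : lrspace k) (s0 : S) (M : nat).
Variables (D : fam_data s0) (U : set S) (Sg : set (psec s0)).
Local Notation L := (Fam M D).
Hypothesis aU : affine_open U.
Hypothesis Sg1 : Sg 1.
Hypothesis SgM : forall s t, Sg s -> Sg t -> Sg (s * t).
Hypothesis SgR : forall s, Sg s -> reg_on U s.
Hypothesis SgE : forall s x, Sg s -> U x -> fE D x -> isunit (s x).
Hypothesis Hpt : forall x, U x -> (forall s, Sg s -> isunit (s x)) ->
  (forall c : psec s0, reg_on U c -> (forall y, U y -> fE D y -> fJ D (c y)) ->
     ~ isunit (c x)) -> fE D x.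
Hypothesis HJ : forall x (c : psec s0), U x -> fE D x -> reg_on U c -> fJ D (c x) ->
  exists d : psec s0, [/\ reg_on U d, isunit (d x) &
    forall y, U y -> fE D y -> fJ D (d y * c y)].

Variable p0 : L.
Let W : set L := [set p : L | U (fbase p)].

Definition fpol (F : mpl M (psec s0)) : psec p0 :=
  fun p : L => tofrac (fdat p) (pst (fbase p) F).

Lemma fpolM F G : fpol (F * G) = fpol F * fpol G.
Proof.
apply: functional_extensionality_dep => p.
by rewrite psecM /fpol pstM (rmorphM (tofrac (fdat p))).
Qed.
Lemma fpolB F G : fpol (F - G) = fpol F - fpol G.
Proof.
apply: functional_extensionality_dep => p.
by rewrite psecB /fpol pstB (rmorphB (tofrac (fdat p))).
Qed.
Lemma fpolD F G : fpol (F + G) = fpol F + fpol G.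
Proof.
apply: functional_extensionality_dep => p.
by rewrite psecD /fpol pstD (rmorphD (tofrac (fdat p))).
Qed.
Lemma fpol1 : fpol 1 = 1.
Proof.
apply: functional_extensionality_dep => p.
by rewrite psec1 /fpol pst1 (rmorph1 (tofrac (fdat p))).
Qed.

Lemma fpolCM c d : fpol (mpC M (c * d)) = fpol (mpC M c) * fpol (mpC M d).
Proof. by rewrite (rmorphM (@mpC M (psec s0))) fpolM. Qed.

Lemma fpolMp F G p : fpol (F * G) p = fpol F p * fpol G p.
Proof. by rewrite fpolM. Qed.

Lemma fpolBp F G p : fpol (F - G) p = fpol F p - fpol G p.
Proof. by rewrite fpolB. Qed.

Lemma fpol_unit F (p : L) : isunit (fpol F p) <-> ~ fprime (pst (fbase p) F).
Proof. exact: (@tofrac_unit _ (fdat p)). Qed.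

Lemma fpolC_unit c (p : L) : isunit (fpol (mpC M c) p) <-> isunit (c (fbase p)).
Proof.
rewrite fpol_unit pstC; split=> [nq|u /fcontr //].
by apply: contrapT => nu; apply: nq; apply/fcontr.
Qed.

Lemma fpol_J F : (forall y, U y -> fE D y -> coef_ideal M (fJ D (s := y)) (pst y F)) ->
  forall p, W p -> fpol F p = 0.
Proof.
move=> JF p Wp; apply/(@tofrac_eq0 _ (fdat p)); exists 1; first exact: fprime1.
by rewrite mul1r; exact: JF Wp (fbaseE p).
Qed.

Lemma coef_ideal0 y : fE D y -> coef_ideal M (fJ D (s := y)) 0.
Proof. by move=> Ey; have [] := coef_ideal_ideal M (fJ_ideal Ey). Qed.

Lemma fpol_0 F : (forall y, U y -> pst y F = 0) -> forall p, W p -> fpol F p = 0.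
Proof. by move=> F0; apply: fpol_J => y Uy Ey; rewrite F0 //; exact: coef_ideal0. Qed.

(** The ring to which [affine_crit] is applied: polynomials with coefficients regular on [U], with
    denominators in [Sg], a multiplicative set of sections that are invertible on the piece. *)
Definition fquot : set (psec p0) :=
  [set a | exists F s, [/\ preg U F, Sg s &
     forall p, W p -> fpol (mpC M s) p * a p = fpol F p]].

Let Us := reg_on_subring s0 U.
Let Ps := preg_subring s0 M U.

Lemma SgU s p : Sg s -> W p -> isunit (fpol (mpC M s) p).
Proof. by move=> ss Wp; apply/fpolC_unit; exact: SgE ss Wp (fbaseE p). Qed.

Lemma SgP s : Sg s -> preg U (mpC M s).
Proof. by move=> ss; apply: pregC; exact: SgR. Qed.

Lemma fquot_fpol F : preg U F -> fquot (fpol F).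
Proof.
move=> rF; exists F, 1; split=> // p _.
by rewrite rmorph1 fpol1 psec1 mul1r.
Qed.

Lemma fquot_subring : subring fquot.
Proof.
split=> [|a b [F [s [rF ss e]]] [G [t [rG st e']]]|
  a b [F [s [rF ss e]]] [G [t [rG st e']]]].
- by rewrite -fpol1; apply: fquot_fpol; case: Ps.
- exists (mpC M t * F - mpC M s * G), (s * t); split; last 1 first.
  + move=> p Wp; rewrite fpolBp !fpolMp fpolCM psecM psecB.
    rewrite -(e p Wp) -(e' p Wp).
    exact: sub_frac.
  + have [_ PB _] := Ps.
    exact: (PB _ _ (subringM Ps (SgP st) rF) (subringM Ps (SgP ss) rG)).
  + exact: SgM.
- exists (F * G), (s * t); split; last 1 first.
  + move=> p Wp; rewrite fpolMp fpolCM !psecM -(e p Wp) -(e' p Wp).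
    exact: mulrACA.
  + exact: (subringM Ps).
  + exact: SgM.
Qed.

Lemma fquot_reg a : fquot a -> reg_on W a.
Proof.
move=> [F [s [rF ss e]]] p Wp; exists U, F, (mpC M s); split=> //.
- exact: aff_open aU.
- exact: SgP.
- by split=> //; apply/fpol_unit; exact: SgU.
- move=> p' [Wp' nq]; apply: (isunit_inj (SgU ss Wp')).
  by rewrite e // [RHS](@frac_mulK _ (fdat p')).
Qed.

Lemma fquot_sep (x y : L) : W x -> W y ->
  (forall a, fquot a -> isunit (a x) <-> isunit (a y)) -> x = y.
Proof.
move=> Wx Wy e.
have exy : fbase x = fbase y.
  apply: (aff_sep aU) => // c rc; rewrite -!fpolC_unit; apply: e.
  exact/fquot_fpol/pregC.
apply: fampt_eq => // F.
have [c [F' [rc uc rF' cF]]] := poly_clear s0 aU (pst (fbase x) F) Wx.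
have {}cF s : s = fbase x -> isunit (c s) /\ mpC M (c s) * pst s F = pst s F'.
  by move=> ->.
have key (z : L) : fbase z = fbase x ->
    fprime (pst (fbase z) F) <-> ~ isunit (fpol F' z).
  move=> /cF[u cF']; rewrite fpol_unit -cF'.
  have [[_ _ qM] _ _] := fprimeP z; split=> [qF nn|nn].
    by apply: nn; exact: qM.
  apply: contrapT => nF; apply: nn; apply: fprimeM => //.
  by move=> /fcontr.
by rewrite !key // e //; exact: fquot_fpol.
Qed.

Lemma fquot_basis V x : open V -> W x -> V x ->
  exists a, [/\ fquot a, Dset W a x & Dset W a `<=` V].
Proof.
move=> oV Wx Vx; have [V' [F [oV' rF [V'x nF] FV]]] := fnbhsP (open_nbhs_nbhs (conj oV Vx)).
have [c [rc [_ cx] cV]] := aff_basis aU oV' Wx V'x.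
have [n [F' [rF' e]]] := poly_clear_on aU rc (pregW cV rF).
have ucx : isunit (c (fbase x)) by [].
exists (fpol (mpC M (c : psec s0) * F')); split.
- by apply: fquot_fpol; apply: (subringM Ps) => //; exact: pregC.
- split=> //; apply/fpol_unit; rewrite pstM pstC e //.
  have nc : ~ fprime (mpC M (c (fbase x))) by move=> /fcontr.
  apply: fprimeM => //; apply: fprimeM => //.
  by move=> /fcontr; apply; exact: isunitX.
- move=> p [Wp]; rewrite fpolM psecM => /isunitM[/fpolC_unit uc /fpol_unit].
  rewrite e // => /fprimeM_inv[_ nFp]; apply: FV; split=> //.
  exact: cV.
Qed.

Lemma fquot_frac (x : L) (g : fstalk x) : W x ->
  exists a b : psec p0, [/\ fquot a, fquot b, isunit (b x) & b x * g = a x].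
Proof.
move=> Wx; have [f [h [nh ->]]] := @fracP _ (fdat x) g.
have [c [F [rc uc rF cF]]] := poly_clear s0 aU f Wx.
have [d [H [rd ud rH dH]]] := poly_clear s0 aU h Wx.
exists (fpol (mpC M d * F)), (fpol (mpC M c * H)); split.
- by apply: fquot_fpol; apply: (subringM Ps) => //; exact: pregC.
- by apply: fquot_fpol; apply: (subringM Ps) => //; exact: pregC.
- apply/fpol_unit; rewrite pstM pstC -dH.
  by do 2?apply: fprimeM => //; move=> /fcontr.
- rewrite /fpol !pstM !pstC -dH -cF.
  exact: (@frac_cross _ (fdat x)).
Qed.

Lemma fquot_zero (x : L) a : W x -> fquot a -> a x = 0 ->
  exists b, [/\ fquot b, isunit (b x) & forall y, W y -> b y * a y = 0].
Proof.
move=> Wx [F [s [rF ss e]]] a0.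
have : fpol F x = 0 by rewrite -e // a0 mulr0.
move=> /(@tofrac_eq0 _ (fdat x))[u nu Ju].
have [c [G [rc uc rG cG]]] := poly_clear s0 aU u Wx.
have JG m : fJ D ((mcf m (G * F) : psec s0) (fbase x)).
  rewrite -pst_coef pstM -cG -mulrA mpoly.mcoeffCM.
  by have [_ _ JM] := fJ_ideal (fbaseE x); apply: JM; exact: Ju.
have rGF : preg U (G * F) by exact: (subringM Ps).
have [||d [rd ud dJ]] := @common_den _ _ s0 U (fbase x) _ (mpoly.msupp (G * F))
  (fun m d => forall y, U y -> fE D y -> fJ D (d y * (mcf m (G * F) : psec s0) y)).
- by move=> m; exact: HJ Wx (fbaseE x) (rGF m) (JG m).
- move=> m d e' _ Jd y Uy Ey; rewrite psecM -mulrA.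
  by have [_ _ JM] := fJ_ideal Ey; apply: JM; exact: Jd.
exists (fpol (mpC M d * G)); split.
- by apply: fquot_fpol; apply: (subringM Ps) => //; exact: pregC.
- apply/fpol_unit; rewrite pstM pstC -cG.
  by do 2?apply: fprimeM => //; move=> /fcontr.
- move=> y Wy; apply: (isunit_inj (SgU ss Wy)); rewrite mulr0 mulrCA e //.
  rewrite -psecM -fpolM -mulrA.
  apply: fpol_J => // z Uz Ez m.
  rewrite pstM pstC mpoly.mcoeffCM pst_coef.
  have [mF|mF] := boolP (m \in mpoly.msupp (G * F)); first exact: dJ.
  rewrite (mpoly.memN_msupp_eq0 mF) psec0 mulr0.
  by case: (fJ_ideal Ez).
Qed.

Section PrimePoint.
Variable p : set (psec p0).
Hypothesis pp : prime_in fquot p.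
Hypothesis pz : forall s, fquot s -> eq_on W s (fun=> 0) -> p s.

Lemma pIn : ideal_in fquot p. Proof. by case: pp. Qed.
Lemma p_sub a : p a -> fquot a. Proof. by case: pIn => + _ _ _; apply. Qed.
Lemma p_D a b : p a -> p b -> p (a + b). Proof. by case: pIn => _ _ + _; apply. Qed.
Lemma p_M a b : fquot a -> p b -> p (a * b). Proof. by case: pIn => _ _ _; apply. Qed.
Lemma p_prime a b : fquot a -> fquot b -> p (a * b) -> p a \/ p b.
Proof. by case: pp => _ _; apply. Qed.

Lemma p_eq a b : p a -> fquot b -> eq_on W a b -> p b.
Proof.
move=> pa qb e; rewrite -(subrK a b); apply: p_D => //; apply: pz.
  by have [_ qB _] := fquot_subring; exact: (qB _ _ qb (p_sub pa)).
by move=> x Wx; rewrite psecB e // subrr.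
Qed.

(** The base point of the point to be found: the contraction of [p] to the sections over [U] is a
    prime, hence a point of the affine set [U]. *)
Lemma p_base : exists2 x, U x &
  forall c : psec s0, reg_on U c -> p (fpol (mpC M c)) <-> ~ isunit (c x).
Proof.
have [||x Ux px] := @aff_prime_in _ _ _ aU s0
    [set c : psec s0 | reg_on U c /\ p (fpol (mpC M c))].
- split=> [||a b ra rb [_]].
  + split=> [c []//||a b [ra pa] [rb pb]|a b ra [rb pb]].
    * split; first by move=> x Ux; exact: reg_0.
      rewrite rmorph0; apply: p_eq (fquot_fpol _) _; last 2 first.
      - exact: (subring0 Ps).
      - by move=> x Wx; rewrite fpol_0 // => y _; rewrite pst0.
      by case: pIn.
    * split; first exact: (subringD Us).
      by rewrite rmorphD fpolD; exact: p_D.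
    * split; first exact: (subringM Us).
      by rewrite rmorphM fpolM; apply: p_M => //; exact/fquot_fpol/pregC.
  + by move=> [_]; rewrite rmorph1 fpol1; case: pp.
  + rewrite rmorphM fpolM => /p_prime[||pa|pb]; do ?exact/fquot_fpol/pregC.
      by left.
    by right.
- move=> c c0; have rc := vanish_reg_on aU c0; split=> //.
  apply: pz; first exact/fquot_fpol/pregC.
  by apply: fpol_0 => y Uy; rewrite pstC c0 // rmorph0.
by exists x => // c rc; rewrite -px //; split=> [|[]].
Qed.

Let x := sval (cid2 p_base).
Let Ux : U x. Proof. by rewrite /x; case: cid2. Qed.
Let px (c : psec s0) : reg_on U c -> p (fpol (mpC M c)) <-> ~ isunit (c x).
Proof. by move: c; rewrite /x; case: cid2. Qed.

Lemma p_Sg s : Sg s -> isunit (s x).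
Proof.
move=> ss; apply: contrapT => /(px (SgR ss)) ps.
have [_ p1 _] := pp; apply: p1.
(* The inverse of an element of [Sg] is again in [fquot], so such an element cannot lie in a proper
   ideal. *)
pose b : psec p0 := sinv (fpol (mpC M s)).
have qb : fquot b.
  exists 1, s; split=> //; first by case: Ps.
  by move=> y Wy; rewrite [LHS]mulruV ?fpol1 ?psec1 //; exact: SgU.
apply: p_eq (p_M qb ps) _ _; first by case: fquot_subring.
by move=> y Wy; rewrite psecM mulrC [LHS]mulruV //; exact: SgU.
Qed.

Lemma p_fE : fE D x.
Proof.
apply: Hpt => // [s|c rc Jc]; first exact: p_Sg.
apply/(px rc)/pz; first exact/fquot_fpol/pregC.
apply: fpol_J => y Uy Ey m; rewrite pstC mpoly.mcoeffC mulrC.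
by have [_ _ JM] := fJ_ideal Ey; apply: JM; exact: Jc.
Qed.

(** A representation of the germ [f] as the fraction F / c, with [c] invertible at [x] and
    everything regular on [U]. *)
Definition prep (f : mpl M (stk x)) (c : psec s0) (F : mpl M (psec s0)) :=
  [/\ reg_on U c, isunit (c x), preg U F & mpC M (c x) * f = pst x F].

Lemma p_cancel (c : psec s0) F : reg_on U c -> isunit (c x) -> preg U F ->
  p (fpol (mpC M c * F)) -> p (fpol F).
Proof.
move=> rc uc rF; rewrite fpolM => pcF.
have [pc|pF] := p_prime (fquot_fpol (pregC (M := M) rc)) (fquot_fpol rF) pcF; last exact: pF.
by case: ((px rc).1 pc uc).
Qed.

Lemma prep_eq F F' : preg U F -> preg U F' -> pst x F = pst x F' ->
  p (fpol F) -> p (fpol F').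
Proof.
move=> rF rF' e pF; rewrite -(subrK F F') fpolD; apply: p_D => //.
have rG : preg U (F' - F) by case: Ps => _ PB _; exact: PB.
have [|d [rd ud d0]] := poly_zero aU Ux rG; first by rewrite pstB e subrr.
apply: (p_cancel rd ud rG); apply: pz.
  exact: (fquot_fpol (subringM Ps (pregC (M := M) rd) rG)).
by apply: fpol_0 => y Uy; rewrite pstM pstC d0.
Qed.

Lemma prep_uniq f c F c' F' : prep f c F -> prep f c' F' -> p (fpol F) -> p (fpol F').
Proof.
move=> [rc uc rF cF] [rc' uc' rF' cF'] pF.
apply: (p_cancel rc uc rF'); apply: (@prep_eq (mpC M c' * F)).
- exact: (subringM Ps (pregC (M := M) rc') rF).
- exact: (subringM Ps (pregC (M := M) rc) rF').
- by rewrite !pstM !pstC -cF -cF' mulrCA.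
- by rewrite fpolM; exact: (p_M (fquot_fpol (pregC (M := M) rc')) pF).
Qed.

Lemma prep_ex f : exists c F, prep f c F.
Proof. exact: poly_clear. Qed.

Lemma prepD f c F g d G : prep f c F -> prep g d G ->
  prep (f + g) (c * d) (mpC M d * F + mpC M c * G).
Proof.
move=> [rc uc rF cF] [rd ud rG dG]; split.
- exact: (subringM Us).
- exact/isunitM.
- by apply: (subringD Ps); apply: (subringM Ps) => //; exact: pregC.
- rewrite pstD !pstM !pstC -cF -dG psecM (rmorphM (@mpC M (stk x))).
  exact: add_frac.
Qed.

Lemma prepM f c F g d G : prep f c F -> prep g d G -> prep (f * g) (c * d) (F * G).
Proof.
move=> [rc uc rF cF] [rd ud rG dG]; split.
- exact: (subringM Us).
- exact/isunitM.
- exact: (subringM Ps).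
- by rewrite pstM -cF -dG psecM (rmorphM (@mpC M (stk x))) mulrACA.
Qed.

Lemma prep1 F : preg U F -> prep (pst x F) 1 F.
Proof.
move=> rF; split=> //.
- by case: Us.
- exact: isunit1.
- by rewrite psec1 rmorph1 mul1r.
Qed.

(** The prime over [x] attached to [p]: germs of polynomials whose numerator is in [p], for one or,
    by [pqE], for any representation. *)
Definition pq : set (mpl M (stk x)) :=
  [set f | exists c F, prep f c F /\ p (fpol F)].

Lemma pqE f c F : prep f c F -> pq f <-> p (fpol F).
Proof.
move=> r; split=> [[c' [F' [r' pF']]]|pF]; last by exists c, F.
exact: prep_uniq r' r pF'.
Qed.

Lemma pqP : prime_ideal pq.
Proof.
split=> [||f g].
- split=> [|f g|f g].
  + have r : prep 0 1 0 by rewrite -(pst0 s0 M x); apply: prep1; exact: (subring0 Ps).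
    apply/(pqE r)/pz; first by apply: fquot_fpol; exact: (subring0 Ps).
    by apply: fpol_0 => y _; exact: pst0.
  + have [c [F rF]] := prep_ex f; have [d [G rG]] := prep_ex g.
    move=> /(pqE rF) pF /(pqE rG) pG; apply/(pqE (prepD rF rG)).
    have [[rc _ _ _] [rd _ _ _]] := (rF, rG).
    by rewrite fpolD !fpolM; apply: p_D; apply: p_M => //; exact/fquot_fpol/pregC.
  + have [c [F rF]] := prep_ex f; have [d [G rG]] := prep_ex g.
    move=> /(pqE rG) pG; apply/(pqE (prepM rF rG)); rewrite fpolM; apply: p_M => //.
    by apply: fquot_fpol; case: rF.
- have r : prep 1 1 1 by rewrite -[X in prep X](pst1 s0 M x); apply: prep1; case: Ps.
  by move=> /(pqE r); rewrite fpol1; case: pp.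
- have [c [F rF]] := prep_ex f; have [d [G rG]] := prep_ex g.
  move=> /(pqE (prepM rF rG)); rewrite fpolM => /p_prime[||pF|pG].
  + by apply: fquot_fpol; case: rF.
  + by apply: fquot_fpol; case: rG.
  + by left; apply/(pqE rF).
  + by right; apply/(pqE rG).
Qed.

Lemma pq_contr c : pq (mpC M c) <-> ~ isunit c.
Proof.
have [a [b [ra rb ub e]]] := aff_stk aU c Ux.
have r : prep (mpC M c) b (mpC M (a : psec s0)).
  by split=> //; [exact: pregC|rewrite pstC -e -(rmorphM (@mpC M (stk x)))].
rewrite (pqE r) px // -e; split=> nu u; apply: nu; last by case/isunitM: u.
exact/isunitM.
Qed.

Lemma fquot_prime : exists2 y, W y & forall a, fquot a -> p a <-> ~ isunit (a y).
Proof.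
pose P : L := FamPt p_fE pqP pq_contr; exists P; first exact: Ux.
move=> a qa; have [F [s [rF ss e]]] := qa; have qs := fquot_fpol (SgP ss).
have usP : isunit (fpol (mpC M s) P) by exact: (@SgU s P ss Ux).
have -> : isunit (a P) <-> isunit (fpol F P).
  rewrite -(e P Ux); split; first by move=> ua; exact/isunitM.
  by move=> /isunitM[].
rewrite fpol_unit -[fprime _]/(pq (pst x F)) (pqE (prep1 rF)).
have -> : p a <-> p (fpol F).
  split=> [pa|pF].
    by apply: p_eq (p_M qs pa) (fquot_fpol rF) _ => y Wy; rewrite psecM e.
  have : p (fpol (mpC M s) * a).
    by apply: p_eq pF (subringM fquot_subring qs qa) _ => y Wy; rewrite psecM e.
  by move=> /p_prime[]// /(px (SgR ss)); case; exact: p_Sg.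
by split=> [pF|/contrapT].
Qed.

End PrimePoint.

Lemma fam_affine : affine_open W.
Proof.
apply: (@affine_crit _ _ p0 W fquot).
- rewrite (_ : W = fbasic U 1).
    by apply: fbasic_open; [exact: aff_open aU|case: Ps].
  apply/seteqP; split=> p; last by case.
  by split=> //; rewrite pst1; exact: fprime1.
- exact: fquot_subring.
- exact: fquot_reg.
- exact: fquot_sep.
- exact: fquot_prime.
- exact: fquot_basis.
- exact: fquot_frac.
- exact: fquot_zero.
Qed.

End FamAffine.

(** * Fibres *)

Section OpenFam.
Variables (k : fieldType) (S : scheme k) (s0 : S) (M : nat) (O : set S).
Hypothesis oO : open O.

Fact ofam_ideal (s : S) : O s -> ring_ideal [set c : stk s | c = 0].
Proof.
by move=> _; split=> //= [a b -> ->|a b ->]; rewrite ?addr0 ?mulr0.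
Qed.

Fact ofam_nunit (s : S) c : O s -> [set c : stk s | c = 0] c -> ~ isunit c.
Proof. by move=> _ ->; exact: nunit0. Qed.

Fact ofam_near (s : S) (c : psec s0) : O s -> reg s c ->
  [set c : stk s | c = 0] (c s) ->
  \forall s' \near s, O s' -> [set c : stk s' | c = 0] (c s').
Proof.
move=> _ rc c0; have := reg_inj rc (reg_0 s) c0.
by apply: filterS.
Qed.

(** With [M = 0] this gives the open subscheme on [O]; with [O] the whole space, affine M-space over
    [S]. *)
Definition ofam : fam_data s0 := FamData ofam_ideal ofam_nunit ofam_near.

Lemma ofam_affine (p : Fam M ofam) : exists2 U : set (Fam M ofam), affine_open U & U p.
Proof.
have [U0 aU0 Ux] := scheme_affine (fbase p).
have [c [rc cx cO]] := aff_basis aU0 oO Ux (fbaseE p).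
have aU := Dset_affine aU0 rc; set U := Dset U0 c in aU cx cO.
exists [set q : Fam M ofam | U (fbase q)]; last exact: cx.
apply: (@fam_affine _ _ s0 M ofam U [set s | s = 1] aU _ _ _ _ _ _ p) => //=.
- by move=> s t -> ->; rewrite mulr1.
- by move=> s ->; case: (reg_on_subring s0 U).
- by move=> s x -> _ _; exact: isunit1.
- by move=> x Ux' _ _; exact: cO.
- move=> x d Ux' _ rd d0; have [e [re ue e0]] := aff_stk0 aU Ux' rd d0.
  by exists e; split=> // y Uy _; exact: e0.
Qed.

Definition OFam : scheme k := FamS ofam_affine.

End OpenFam.

Section Factor.
Variables (A B C : comNzRingType) (u : {rmorphism A -> B}) (v : {rmorphism A -> C}).
Hypothesis usurj : forall b, exists a, u a = b.
Hypothesis uker : forall a, u a = 0 -> v a = 0.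

Definition factor (b : B) : C := v (sval (cid (usurj b))).

Lemma factorE a : factor (u a) = v a.
Proof.
rewrite /factor; case: cid => a' /= e; apply/eqP; rewrite -subr_eq0 -rmorphB.
by apply/eqP/uker; rewrite rmorphB e subrr.
Qed.

Fact factor_additive : additive factor.
Proof.
move=> x y; have [[a <-] [b <-]] := (usurj x, usurj y).
by rewrite -rmorphB !factorE rmorphB.
Qed.

Fact factor_multiplicative : multiplicative factor.
Proof.
split=> [x y|]; last by rewrite -(rmorph1 u) factorE rmorph1.
have [[a <-] [b <-]] := (usurj x, usurj y).
by rewrite -rmorphM !factorE rmorphM.
Qed.

HB.instance Definition _ := GRing.isAdditive.Build B C factor factor_additive.
HB.instance Definition _ :=
  GRing.isMultiplicative.Build B C factor factor_multiplicative.

Definition factorr : {rmorphism B -> C} := factor.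

End Factor.

Lemma pull_comp (k : fieldType) (X Y Z : scheme k) (g : mor Y Z) (f : mor X Y) s x :
  pull (mcomp g f) s x = pull f (pull g s) x.
Proof. by []. Qed.

Section PullRing.
Variables (k : fieldType) (X Y : scheme k) (f : mor X Y) (y0 : Y).

Definition pullr (x : X) : {rmorphism psec y0 -> stk x} := fstk f x \o pev (f x).

Lemma pullrE x s : pullr x s = pull f s x. Proof. by []. Qed.

Lemma pull_at (x : X) (s t : forall y : Y, stk y) y :
  f x = y -> s y = t y -> pull f s x = pull f t x.
Proof. by move=> <- e; rewrite /pull e. Qed.

Lemma pull_reg x s : reg (f x) s -> reg x (pull f s).
Proof. exact: fstk_reg. Qed.

End PullRing.

Lemma mpl0E (R : comNzRingType) (F : mpl 0 R) : F = mpC 0 (mcf (@mpoly.mnm0 0) F).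
Proof.
apply/mpoly.mpolyP => m; rewrite mpoly.mcoeffC.
suff -> : m = @mpoly.mnm0 0 by rewrite eqxx mulr1.
by apply/mpoly.mnmP => -[].
Qed.

Section Graph.
Variables (k : fieldType) (S : lrspace k) (s0 : S) (M : nat) (D : fam_data s0).

(** The prime is the inverse image of the maximal ideal under evaluation at [v]. For [M = 0] this
    says that every point of the piece underlies a point of the scheme. *)
Lemma fam_graph_ex z (v : 'I_M -> psec s0) : fE D z -> exists p : Fam M D,
  fbase p = z /\ forall j,
    fprime (mpX (stk (fbase p)) (mpoly.mnm1 j) - mpC M (v j (fbase p))).
Proof.
move=> Ez; pose ev : {rmorphism mpl M (stk z) -> stk z} := mmapr idfun (v^~ z).
have qP : prime_ideal [set F | ~ isunit (ev F)].
  split=> [||a b] /=.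
  - split=> /= [|a b ua ub|a b ub].
    + by rewrite raddf0; exact: nunit0.
    + by rewrite raddfD; exact: nunitD.
    + by rewrite rmorphM => /isunitM[].
  - by rewrite rmorph1 => /(_ (isunit1 _)).
  - rewrite rmorphM => nab; have [ua|ua] := EM (isunit (ev a)); last by left.
    by right=> ub; apply: nab; apply/isunitM.
have evC c : ev (mpC M c) = c by exact: mpoly.mmapC.
have qc c : [set F | ~ isunit (ev F)] (mpC M c) <-> ~ isunit c by rewrite /= evC.
exists (@FamPt _ _ _ _ D z _ Ez qP qc); split=> // j /=.
rewrite (rmorphB ev) evC [ev _]mpoly.mmapX mpoly.mmap1U subrr.
exact: nunit0.
Qed.

End Graph.

(** * An explicit model of the fibre over a one-point subscheme *)

Section Fibre.
Variables (k : fieldType) (Z T D : scheme k) (f : mor Z T) (g : mor D T).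
Variables (z0 : Z) (t : T) (d : D).
Hypothesis Dd : forall d' : D, d' = d.
Hypothesis gt : forall d' : D, g d' = t.
Hypothesis gsurj : forall d' (a : stk d'), exists b, fstk g d' b = a.
Hypothesis gsq : forall d' (b : stk (g d')), ~ isunit b -> fstk g d' (b * b) = 0.

Let K : set (psec t) := [set j : psec t | pull g j d = 0].

Lemma K_at (i j : psec t) : K i -> i t = j t -> K j.
Proof. by move=> Ki e; rewrite /K /= -(pull_at (gt d) e). Qed.

Definition Jgen (z : Z) : set (stk z) :=
  [set c | exists2 j : psec t, K j & c = pull f j z].

(** [K] represents the ideal of [D] in the local ring at [t], and [Jfib] is the ideal it generates
    on [Z]. Residue points and first infinitesimal neighbourhoods are treated together: in both
    cases [K] contains the squares of the non-units. *)
Definition Jfib (z : Z) : set (stk z) := idl setT (Jgen (z := z)).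

Lemma setT_subring (R : comNzRingType) : subring [set: R]. Proof. by []. Qed.

Lemma Jfib_ideal z : ring_ideal (Jfib (z := z)).
Proof.
have [_ J0 JD JM] := @idl_ideal _ [set: stk z] (Jgen (z := z))
  (setT_subring _) (@subsetT _ _).
by split=> // a b; exact: JM.
Qed.

Lemma K_nunit (j : psec t) : K j -> ~ isunit (j t).
Proof.
move=> Kj uj; have : isunit (j (g d)) by rewrite gt.
by move=> /(isunit_rmorph (fstk g d)); rewrite -[fstk g d _]/(pull g j d) Kj => /nunit0.
Qed.

Fact Jfib_nunit z c : f z = t -> Jfib (z := z) c -> ~ isunit c.
Proof.
move=> fz [n [e [c' [ec ->]]]]; apply: nunit_sum => i _ /isunitM[_].
have [_ [j Kj ->]] := ec i; rewrite /pull => /fstk_local; rewrite fz.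
exact: K_nunit.
Qed.

Fact Jfib_near z (c : psec z0) : f z = t -> reg z c -> Jfib (c z) ->
  \forall z' \near z, f z' = t -> Jfib (c z').
Proof.
move=> fz rc [n [e [c' [ec cE]]]].
have /choice[j jP] : forall i, exists j : psec t, [/\ K j, reg t j & c' i = pull f j z].
  move=> i; have [_ [j Kj ->]] := ec i; have [j' rj' e'] := reg_germ (j t).
  exists j'; split=> //; first exact: K_at Kj _.
  exact: pull_at fz _.
have /choice[h hP] : forall i, exists h : psec z0, reg z h /\ h z = e i.
  by move=> i; have [h rh <-] := reg_germ (e i); exists h.
have zs := reg_subring z0 z.
pose w : psec z0 := \sum_(i < n) h i * (pull f (j i) : psec z0).
have rw : reg z w.
  change ([set s : psec z0 | reg z s] w); apply: subring_sum => // i _.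
  apply: (subringM zs); first by case: (hP i).
  by apply: pull_reg; rewrite fz; case: (jP i).
have : c z = w z.
  rewrite cE /w psec_sum; apply: eq_bigr => i _; rewrite psecM.
  by have [[_ ->] [_ _ ->]] := (hP i, jP i).
move=> /(reg_inj rc rw); apply: filterS => z' -> fz'.
exists n, (fun i => h i z'), (fun i => pull f (j i) z'); split.
  by move=> i; split=> //; exists (j i) => //; case: (jP i).
by rewrite /w psec_sum; apply: eq_bigr.
Qed.

Definition fibfam : fam_data z0 :=
  @FamData _ _ z0 [set z | f z = t] Jfib (fun z _ => Jfib_ideal z)
    Jfib_nunit Jfib_near.

Local Notation L := (Fam 0 fibfam).

Lemma Jfib_gen z (j : psec t) : K j -> Jfib (pull f j z).
Proof. by move=> Kj; apply: idl_mem => //; exists j. Qed.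

(** On a chart of [Z] over an affine [T0], the piece is cut out by [Jfib] and by inverting the
    pullbacks of the functions on [T0] that are invertible at [t]. *)
Lemma fibfam_affine (p : L) : exists2 U : set L, affine_open U & U p.
Proof.
have [T0 aT0 tT0] := scheme_affine t; have fp : f (fbase p) = t := fbaseE p.
have oF : open (f @^-1` T0).
  by apply: open_comp; [move=> x _; exact: fpt_continuous|exact: aff_open aT0].
have [U0 aU0 Ux] := scheme_affine (fbase p).
have [|c [rc cx cO]] := aff_basis aU0 oF Ux; first by rewrite /= fp.
have aU := Dset_affine aU0 rc; set U := Dset U0 c in aU cx cO.
exists [set q : L | U (fbase q)]; last exact: cx.
have rpull s : reg_on T0 s -> reg_on U (pull f s).
  by move=> rs x Ux'; apply: pull_reg; apply: rs; exact: cO.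
have Us := reg_on_subring z0 U.
apply: (@fam_affine _ _ z0 0 fibfam U
  [set s | exists2 e, reg_on T0 e /\ isunit (e t) & s = pull f e] aU _ _ _ _ _ _ p).
- exists (fun=> 1); last by apply: functional_extensionality_dep => x;
    rewrite /pull rmorph1.
  by split=> [y _|]; [exact: reg_1|exact: isunit1].
- move=> _ _ [e [re ue] ->] [e' [re' ue'] ->]; exists (fun y => e y * e' y).
    split; last exact/isunitM.
    by move=> y Ty; apply: reg_mul; [exact: re|exact: re'].
  by apply: functional_extensionality_dep => x; rewrite psecM /pull rmorphM.
- by move=> _ [e [re _] ->]; exact: rpull.
- by move=> _ x [e [_ ue] ->] _ fx; apply: isunit_rmorph; rewrite fx.
- move=> x Ux' us cs; apply: (aff_sep aT0) => //; first exact: cO.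
  move=> s rs; split=> [ufx|ut].
    (* If [s] is not invertible at [t], its square is in [K], so the pullback of this square cannot
       be invertible at [x]. *)
    apply: contrapT => nut; pose s2 : psec t := (s : psec t) * (s : psec t).
    have rs2 : reg_on T0 s2 by exact: (subringM (reg_on_subring t T0)).
    have Ks2 : K s2.
      have nug : ~ isunit (s (g d)) by rewrite gt.
      by change (fstk g d (s (g d) * s (g d)) = 0); exact: gsq.
    apply: (cs _ (rpull _ rs2)) => [y _ _|]; first exact: Jfib_gen.
    by apply: isunit_rmorph; change (isunit (s (f x) * s (f x))); exact/isunitM.
  have : isunit (pull f s x) by apply: us; exists s.
  by move=> /fstk_local.
- move=> x c' Ux' fx rc' [n [e [w [ew c'E]]]].
  pose good (b : psec z0) := reg_on U b /\ forall y, U y -> f y = t -> Jfib (b y).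
  have goodM (a b : psec z0) : reg_on U a -> good b -> good (a * b).
    move=> ra [rb Jb]; split; first exact: (subringM Us).
    by move=> y Uy fy; have [_ _ JM] := Jfib_ideal y; apply: JM; exact: Jb.
  have goodD a b : good a -> good b -> good (a + b).
    move=> [ra Ja] [rb Jb]; split; first exact: (subringD Us).
    by move=> y Uy fy; have [_ JD _] := Jfib_ideal y; apply: JD; [exact: Ja|exact: Jb].
  (* The germ is a finite combination of generators; clearing denominators replaces it by a section
     [b] that lies in the ideal at every point of the fibre in [U]. *)
  have [a [b [ra ua gb ab]]] : exists a b : psec z0,
      [/\ reg_on U a, isunit (a x), good b & a x * c' x = b x].
    rewrite c'E; elim/big_ind: _ => [|u v|i _].
    - exists 1, 0; split; [by case: Us|exact: isunit1| |by rewrite mulr0].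
      split=> [y _|y _ _]; first exact: reg_0.
      by case: (Jfib_ideal y).
    - move=> [a [b [ra ua gb ab]]] [a' [b' [ra' ua' gb' ab']]].
      exists (a * a'), (a' * b + a * b'); split.
      + exact: (subringM Us).
      + exact/isunitM.
      + by apply: goodD; exact: goodM.
      + by rewrite psecD !psecM -ab -ab'; exact: add_frac.
    - have [_ [j Kj ->]] := ew i.
      have [dl [s [rdl rs us sd]]] := aff_stk aU (e i) Ux'.
      have [io [q [rio rq uq qj]]] := aff_stk aT0 (j t) tT0.
      exists ((s : psec z0) * (pull f q : psec z0)),
        ((dl : psec z0) * (pull f io : psec z0)); split.
      + by apply: (subringM Us) => //; exact: rpull.
      + by apply/isunitM; split=> //; apply: isunit_rmorph; rewrite fx.
      + apply: goodM => //; split; first exact: rpull.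
        move=> y Uy fy; apply: Jfib_gen.
        have Kqj : K ((q : psec t) * j).
          by rewrite /K /= -pullrE rmorphM !pullrE Kj mulr0.
        exact: K_at Kqj _.
      + rewrite !psecM -sd mulrACA; congr (_ * _).
        transitivity (pull f ((q : psec t) * j : psec t) x).
          by rewrite -[RHS](pullrE f) rmorphM.
        exact: pull_at fx _.
  have rac : reg_on U (a * c' - b).
    have [_ UB _] := Us; apply: UB; last by case: gb.
    exact: (subringM Us).
  have [|q [rq uq q0]] := aff_stk0 aU Ux' rac.
    by rewrite psecB psecM ab subrr.
  exists ((q : psec z0) * a); split; first exact: (subringM Us).
    exact/isunitM.
  move=> y Uy fy; have := q0 y Uy.
  rewrite psecB !psecM mulrBr mulrA => /eqP; rewrite subr_eq0 => /eqP ->.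
  have [_ _ JM] := Jfib_ideal y; apply: JM; case: gb => _; exact.
Qed.

Local Notation LS := (FamS fibfam_affine).

Lemma pullg_surj (a : stk d) : exists j : psec t, pullr g t d j = a.
Proof.
have [b <-] := gsurj a; have [j _ <-] := reg_germ b.
by exists j.
Qed.

Lemma fib_ker (p : LS) (j : psec t) : pullr g t d j = 0 ->
  pullr (mcomp f (fproj fibfam_affine)) t p j = 0.
Proof.
move=> Kj; change (tofrac (fdat p) (mpC 0 (pull f j (fbase p))) = 0).
apply/(@tofrac_eq0 _ (fdat p)); exists 1; first exact: fprime1.
rewrite mul1r => m; rewrite mpoly.mcoeffC mulrC.
by have [_ _ JM] := Jfib_ideal (fbase p); apply: JM; exact: Jfib_gen.
Qed.

Definition fibD_stk (p : LS) : {rmorphism stk d -> stk p} :=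
  factorr pullg_surj (@fib_ker p).

Lemma fibD_stkE (p : LS) (j : psec t) :
  fibD_stk p (pull g j d) = pull (mcomp f (fproj fibfam_affine)) j p.
Proof. exact: (factorE pullg_surj (@fib_ker p)). Qed.

Program Definition fibD : mor LS D := @Mor k LS D (fun=> d) fibD_stk _ _ _ _.
Next Obligation. by move=> p; exact: cst_continuous. Qed.
Next Obligation.
move=> p c; have -> : c%:A = pull g (fun y => c%:A : stk y) d.
  by rewrite /pull fstk_const.
by rewrite [LHS]fibD_stkE /pull fstk_const.
Qed.
Next Obligation.
move=> p a; have [j <-] := pullg_surj a; rewrite [fibD_stk _ _]fibD_stkE.
move=> /pull_unit /= u; apply/pull_unit; rewrite gt.
by have <- : f (fbase p) = t := fbaseE p.
Qed.
Next Obligation.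
move=> p s rs; have [b bs] := gsurj (s d).
have [j rj jb] := reg_germ b; have rj' : reg t j by rewrite -(gt d).
have -> : (fun y => fibD_stk y (s d)) = pull (mcomp f (fproj fibfam_affine)) j.
  apply: functional_extensionality_dep => y.
  by rewrite -fibD_stkE /pull jb bs.
apply: pull_reg => /=.
by have -> : f (fbase p) = t := fbaseE p.
Qed.

(** A morphism to [Z] whose composite with [f] factors through [D] lands over [t] and kills the
    pullback of [K], which is what [flift] asks for. *)
Lemma fib_pullback : is_pullback f g (fproj fibfam_affine) fibD.
Proof.
split.
  split=> [p|s p]; first by rewrite /= gt; exact: (fbaseE p).
  exact/esym/(fibD_stkE p (s : psec t)).
move=> V al be [e0 e]; split; last first.
  by move=> h h' eh _; apply: flift_uniq => // -[].
have fal x : f (al x) = t by rewrite -[LHS]/(mcomp f al x) e0 /= gt.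
have kill x c : Jfib (z := al x) c -> fstk al x c = 0.
  move=> [n [w [c' [wc ->]]]]; rewrite rmorph_sum big1 // => i _.
  have [_ [j Kj ->]] := wc i; rewrite rmorphM.
  have -> : fstk al x (pull f j (al x)) = 0; last by rewrite mulr0.
  rewrite -[LHS]/(pull (mcomp f al) j x) e /pull /=.
  have : pull g j (be x) = 0 by rewrite (Dd (be x)).
  by rewrite /pull => ->; rewrite rmorph0.
pose v (i : 'I_0) : forall x : V, stk x := fun x => 0.
have vr j x : reg x (v j) by exact: reg_0.
pose h := flift fibfam_affine vr fal kill; exists h.
have ph := flift_proj fibfam_affine vr fal kill.
split; first exact: ph.
split=> [x|s x]; first by rewrite /= [RHS]Dd.
have [j js] := pullg_surj (s d).
have sE d' : s d' = pull g j d' by rewrite (Dd d').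
rewrite -[LHS]/(pull h (pull fibD s) x).
have -> : pull fibD s = pull (mcomp f (fproj fibfam_affine)) j.
  apply: functional_extensionality_dep => p.
  by rewrite -fibD_stkE -sE.
have [_ ph'] := ph.
rewrite -[LHS]/(pull (mcomp (fproj fibfam_affine) h) (pull f j) x) ph'.
rewrite -[LHS]/(pull (mcomp f al) j x) e.
by rewrite -[LHS]/(pull be (pull g j) x) /pull sE.
Qed.

Variables (W : scheme k) (r : mor W Z) (r' : mor W D).
Hypothesis hW : is_pullback f g r r'.

(** Any pullback is isomorphic to the explicit model, through which its points, closed sets and
    stalks become accessible. *)
Lemma fib_maps : exists (u : mor LS W) (v : mor W LS),
  [/\ eqm (mcomp r u) (fproj fibfam_affine), eqm (mcomp (fproj fibfam_affine) v) r,
      eqm (mcomp u v) (idm W) & eqm (mcomp v u) (idm LS)].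
Proof.
have [e hL] := fib_pullback; have [eW hW'] := hW.
have [[u [ru r'u]] _] := hW' _ _ _ e; have [[v [rv r'v]] _] := hL _ _ _ eW.
exists u, v; split=> //.
  have [_ un] := hW' _ _ _ eW; apply: un.
    split=> [x|s x]; first exact: (etrans (proj1 ru (v x)) (proj1 rv x)).
    rewrite -[LHS]/(pull v (pull (mcomp r u) s) x).
    have -> : pull (mcomp r u) s = pull (fproj fibfam_affine) s.
      by apply: functional_extensionality_dep => y; rewrite (proj2 ru).
    by rewrite -[LHS]/(pull (mcomp (fproj fibfam_affine) v) s x) (proj2 rv).
  split=> [x|s x]; first exact: (etrans (proj1 r'u (v x)) (proj1 r'v x)).
  rewrite -[LHS]/(pull v (pull (mcomp r' u) s) x).
  have -> : pull (mcomp r' u) s = pull fibD s.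
    by apply: functional_extensionality_dep => y; rewrite (proj2 r'u).
  by rewrite -[LHS]/(pull (mcomp fibD v) s x) (proj2 r'v).
have [_ un] := hL _ _ _ e; apply: un.
  split=> [x|s x].
    exact: (etrans (proj1 rv (u x)) (proj1 ru x)).
  rewrite -[LHS]/(pull u (pull (mcomp (fproj fibfam_affine) v) s) x).
  have -> : pull (mcomp (fproj fibfam_affine) v) s = pull r s.
    by apply: functional_extensionality_dep => y; rewrite (proj2 rv).
  by rewrite -[LHS]/(pull (mcomp r u) s x) (proj2 ru).
split=> [x|s x]; first by [].
rewrite -[LHS]/(pull u (pull (mcomp fibD v) s) x).
have -> : pull (mcomp fibD v) s = pull r' s.
  by apply: functional_extensionality_dep => y; rewrite (proj2 r'v).
by rewrite -[LHS]/(pull (mcomp r' u) s x) (proj2 r'u).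
Qed.

Lemma fam0_eq (p p' : L) : fbase p = fbase p' -> p = p'.
Proof.
move=> e; apply: fampt_eq => // F; rewrite (mpl0E F) !pstC.
have [h h'] := (@fcontr _ _ _ _ _ p ((mcf (@mpoly.mnm0 0) F : psec z0) (fbase p)),
  @fcontr _ _ _ _ _ p' ((mcf (@mpoly.mnm0 0) F : psec z0) (fbase p'))).
by rewrite h h' e.
Qed.

Lemma fam0_ex z : f z = t -> exists p : L, fbase p = z.
Proof. by move=> fz; have [p [pz _]] := @fam_graph_ex k Z z0 0 fibfam z (fun=> 0) fz; exists p. Qed.

Lemma fam0_closed (C : set L) : closed C ->
  exists2 C' : set Z, closed C' & C = [set p : L | C' (fbase p)].
Proof.
move=> cC; pose O' := [set z : Z | exists N : set Z,
  [/\ open N, N z & forall p : L, N (fbase p) -> ~ C p]].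
have oO' : open O'.
  rewrite openE => z [N [oN Nz NC]].
  apply: filterS (open_nbhs_nbhs (conj oN Nz)) => y Ny.
  by exists N.
exists (~` O'); first exact: open_closedC.
apply/seteqP; split=> p.
  by move=> Cp [N [_ Np NC]]; exact: NC Cp.
move=> nO; apply: contrapT => nC; apply: nO.
have oC : open (~` C) by exact: closed_openC.
have [U [F [oU rF [Up nF] FC]]] := fnbhsP (open_nbhs_nbhs (conj oC nC)).
pose c := mcf (@mpoly.mnm0 0) F.
have FE : F = mpC 0 c by exact: mpl0E.
have un (q : L) : ~ fprime (pst (fbase q) F) <-> isunit (c (fbase q)).
  rewrite FE pstC; split=> [nq|u /fcontr //].
  by apply: contrapT => nu; apply: nq; apply/fcontr.
exists (Dset U c); split.
- exact: Dset_open (rF _).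
- by split=> //; apply/un.
- by move=> q [Uq uq]; apply: FC; split=> //; apply/un.
Qed.

Lemma fib_pt w : f (r w) = t.
Proof. by have [[e _] _] := hW; rewrite -[LHS]/(mcomp f r w) e /= gt. Qed.

Lemma fib_ex z : f z = t -> exists w, r w = z.
Proof.
move=> /fam0_ex[p <-]; have [u [v [ru _ _ _]]] := fib_maps; exists (u p).
by rewrite -[LHS]/(mcomp r u p) (proj1 ru).
Qed.

Lemma fib_inj : injective r.
Proof.
have [u [v [ru rv uv vu]]] := fib_maps => w w' e.
have vw : v w = v w'.
  apply: fam0_eq; have rv0 := proj1 rv.
  by rewrite -[LHS]/(mcomp (fproj fibfam_affine) v w) rv0 e -rv0.
have uv0 := proj1 uv.
by rewrite -[LHS]/(idm W w) -uv0 -[RHS]/(idm W w') -uv0 /= vw.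
Qed.

Lemma fib_closed (C : set W) : closed C ->
  exists2 C' : set Z, closed C' & C = r @^-1` C'.
Proof.
have [u [v [ru rv uv vu]]] := fib_maps => cC.
have cu : closed (u @^-1` C).
  by apply: closed_comp cC => x _; exact: fpt_continuous.
have [C' cC' e] := fam0_closed cu; exists C' => //.
have uv0 w : u (v w) = w by exact: (proj1 uv w).
have rv0 w : fbase (v w) = r w by exact: (proj1 rv w).
apply/seteqP; split=> w /= => [Cw|Cw].
  have : (u @^-1` C) (v w) by rewrite /= uv0.
  by rewrite e /= rv0.
have : (u @^-1` C) (v w) by rewrite e /= rv0.
by rewrite /= uv0.
Qed.

Lemma fam0_stk (p : L) (a : fstalk p) : exists c, a = tofrac (fdat p) (mpC 0 c).
Proof.
have [F [G [nG ->]]] := @fracP _ (fdat p) a.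
move: nG; rewrite (mpl0E F) (mpl0E G); set x := mcf _ F; set y := mcf _ G => nG.
have uy : isunit y.
  by apply: contrapT => nu; apply: nG; apply/(@fcontr _ _ _ _ _ p).
have [y' yy'] := uy; exists (x * y'); rewrite /tofrac.
apply: (@frac_eq _ (fdat p)) => //; first exact: (@locq1 _ (fdat p)).
by rewrite mulr1 -(rmorphM (@mpC 0 (stk (fbase p)))) -mulrA [y' * y]mulrC yy' mulr1.
Qed.

Lemma fib_surj w (b : stk w) : exists c, fstk r w c = b.
Proof.
have [u [v [ru rv uv vu]]] := fib_maps; have [s _ <-] := reg_germ b.
have [c e] := @fam0_stk (v w) (pull u s (v w)).
have [c' _ e'] := reg_germ c.
exists (c' (r w)); rewrite -[LHS]/(pull r c' w) -(proj2 rv).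
rewrite -[LHS]/(fstk v w (tofrac (fdat (v w)) (mpC 0 (c' (fbase (v w)))))) e'.
rewrite -e -[LHS]/(pull (mcomp u v) s w).
exact: (proj2 uv).
Qed.

Lemma fib_kernel w c : fstk r w c = 0 -> Jfib (z := r w) c.
Proof.
have [u [v [ru rv uv vu]]] := fib_maps; have [c' _ <-] := reg_germ c => c0.
have uv0 : u (v w) = w by exact: (proj1 uv w).
have rv0 : fbase (v w) = r w by exact: (proj1 rv w).
have : pull r c' (u (v w)) = 0 by rewrite uv0.
move=> /(congr1 (fstk u (v w))); rewrite rmorph0.
rewrite -[LHS]/(pull (mcomp r u) c' (v w)) (proj2 ru).
rewrite -[LHS]/(tofrac (fdat (v w)) (mpC 0 (c' (fbase (v w))))).
move=> /(@tofrac_eq0 _ (fdat (v w)))[F].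
rewrite (mpl0E F); set y := mcf _ F => nF /(_ (@mpoly.mnm0 0)).
rewrite -(rmorphM (@mpC 0 _)) mpoly.mcoeffC eqxx mulr1 -[fJ _ _]/(Jfib (y * c' _)).
have [y' yy'] : isunit y.
  by apply: contrapT => nu; apply: nF; apply/(@fcontr _ _ _ _ _ (v w)).
rewrite -rv0 => Jc; have [_ _ JM] := Jfib_ideal (fbase (v w)).
by have := JM y' _ Jc; rewrite mulrA [y' * y]mulrC yy' mul1r.
Qed.

End Fibre.

(** * Closed graphs over a proper base *)

Section MorphismsToAffine.
Variables (k : fieldType) (P V : scheme k) (U : set P) (p0 : P).
Hypothesis aU : affine_open U.

Lemma mor_affine_ext (h h' : mor V P) :
  (forall v, U (h v)) -> (forall v, U (h' v)) ->
  (forall s v, reg_on U s -> pull h s v = pull h' s v) -> eqm h h'.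
Proof.
move=> Uh Uh' e; have e0 v : h v = h' v.
  apply: (aff_sep aU) => // s rs.
  by rewrite -(pull_unit h s v) e // pull_unit.
split=> // s v; have [a [b [ra rb ub E]]] := aff_stk aU (s (h v)) (Uh v).
have E' : b (h' v) * s (h' v) = a (h' v) by rewrite -(e0 v).
have ub' : isunit (pull h b v) by exact/pull_unit.
apply: (isunit_inj ub'); rewrite -[LHS]rmorphM E [fstk h v _](e _ _ ra) [pull h b v]e //.
by rewrite -[RHS]rmorphM E'.
Qed.

Variable rho : psec p0 -> forall v : V, stk v.
Hypothesis rhoD : forall (s t : psec p0) v, reg_on U s -> reg_on U t ->
  rho (s + t) v = rho s v + rho t v.
Hypothesis rhoM : forall (s t : psec p0) v, reg_on U s -> reg_on U t ->
  rho (s * t) v = rho s v * rho t v.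
Hypothesis rhoC : forall (c : k) v, rho (csec p0 c) v = c%:A.
Hypothesis rhoE : forall (s t : psec p0) v, reg_on U s -> reg_on U t -> eq_on U s t ->
  rho s v = rho t v.
Hypothesis rhoR : forall (s : psec p0) v, reg_on U s -> reg v (rho s).

Let Us := reg_on_subring p0 U.

Lemma csec_reg c : reg_on U (csec p0 c). Proof. by move=> x _; exact: reg_const. Qed.

Lemma rho1 v : rho 1 v = 1.
Proof.
rewrite -[1 in RHS]scale1r -(rhoC 1); apply: rhoE; [by case: Us|exact: csec_reg|].
by move=> x _; rewrite /csec scale1r.
Qed.

Lemma rho0 v : rho 0 v = 0.
Proof.
rewrite -[RHS](scale0r 1) -(rhoC 0); apply: rhoE; [exact: (subring0 Us)|exact: csec_reg|].
by move=> x _; rewrite /csec scale0r.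
Qed.

(** The morphism attached to the ring map [rho] sends [v] to the prime of the sections [s] for which
    [rho s] is not invertible at [v]; [U] being affine, this prime is a point. *)
Lemma rho_pt_ex v : exists2 x, U x &
  forall s : psec p0, reg_on U s -> isunit (s x) <-> isunit (rho s v).
Proof.
have [||x Ux px] := @aff_prime_in _ _ _ aU p0
    [set s : psec p0 | reg_on U s /\ ~ isunit (rho s v)].
- split=> [||a b ra rb [_]].
  + split=> [s []//||a b [ra pa] [rb pb]|a b ra [rb pb]].
    * split; first by exact: (subring0 Us).
      by rewrite rho0; exact: nunit0.
    * by split; [exact: (subringD Us)|rewrite rhoD //; exact: nunitD].
    * by split; [exact: (subringM Us)|rewrite rhoM // => /isunitM[]].
  + by move=> [_]; rewrite rho1; case; exact: isunit1.
  + rewrite rhoM // => nab; have [ua|ua] := EM (isunit (rho a v)); last by left.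
    by right; split=> // ub; apply: nab; apply/isunitM.
- move=> s s0; have rs := vanish_reg_on aU s0; split=> //.
  rewrite (@rhoE _ 0) //; last exact: (subring0 Us).
  by rewrite rho0; exact: nunit0.
exists x => // s rs; split=> us; apply: contrapT => nu.
  by have /(px _ rs) := conj rs nu; apply.
by have /(px _ rs)[_] := nu; apply.
Qed.

Definition rho_pt v : P := sval (cid2 (rho_pt_ex v)).
Lemma rho_ptU v : U (rho_pt v). Proof. by rewrite /rho_pt; case: cid2. Qed.
Lemma rho_ptP v (s : psec p0) : reg_on U s -> isunit (s (rho_pt v)) <-> isunit (rho s v).
Proof. by move: s; rewrite /rho_pt; case: cid2. Qed.

Lemma rho_rep v (g : stk (rho_pt v)) : exists as_ : psec p0 * psec p0,
  [/\ reg_on U as_.1, reg_on U as_.2, isunit (as_.2 (rho_pt v)) &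
      as_.2 (rho_pt v) * g = as_.1 (rho_pt v)].
Proof. by have [a [s [ra rs us e]]] := aff_stk aU g (rho_ptU v); exists (a, s). Qed.

Definition rho_stk v (g : stk (rho_pt v)) : stk v :=
  rho (sval (cid (rho_rep g))).1 v * uinv (rho (sval (cid (rho_rep g))).2 v).

Lemma rho_eq0 v (a : psec p0) : reg_on U a -> a (rho_pt v) = 0 -> rho a v = 0.
Proof.
move=> ra a0; have [c [rc uc c0]] := aff_stk0 aU (rho_ptU v) ra a0.
have uc' : isunit (rho c v) by exact/rho_ptP.
apply: (isunit_inj uc'); rewrite mulr0 -rhoM // -(rho0 v); apply: rhoE.
- exact: (subringM Us).
- exact: (subring0 Us).
- by move=> x Ux; rewrite psecM c0.
Qed.

Lemma rhoB (s t : psec p0) v : reg_on U s -> reg_on U t -> rho (s - t) v = rho s v - rho t v.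
Proof.
move=> rs rt; have rd : reg_on U (s - t) by case: Us => _ UB _; exact: UB.
by apply/eqP; rewrite eq_sym subr_eq -rhoD // subrK.
Qed.

Lemma rho_at v (a b : psec p0) : reg_on U a -> reg_on U b -> a (rho_pt v) = b (rho_pt v) ->
  rho a v = rho b v.
Proof.
move=> ra rb e; apply/eqP; rewrite -subr_eq0 -rhoB //; apply/eqP/rho_eq0.
  by case: Us => _ UB _; exact: UB.
by rewrite psecB e subrr.
Qed.

Lemma rho_stkE v (g : stk (rho_pt v)) (a s : psec p0) : reg_on U a -> reg_on U s ->
  isunit (s (rho_pt v)) -> s (rho_pt v) * g = a (rho_pt v) ->
  rho s v * rho_stk g = rho a v.
Proof.
move=> ra rs us e; rewrite /rho_stk; case: cid => -[a' s'] /= [ra' rs' us' e'].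
have uv := mulruV ((rho_ptP v rs').1 us').
have E : rho (s' * a) v = rho (s * a') v.
  apply: rho_at; [exact: (subringM Us)|exact: (subringM Us)|].
  by rewrite !psecM -e -e' mulrCA.
move: E; rewrite !rhoM // => E.
by rewrite mulrA -E mulrAC uv mul1r.
Qed.

Lemma rho_stk_sec v (s : psec p0) : reg_on U s -> rho_stk (s (rho_pt v)) = rho s v.
Proof.
move=> rs; rewrite -[LHS]mul1r -{1}(rho1 v); apply: rho_stkE => //.
- by case: Us.
- exact: isunit1.
- by rewrite psec1 mul1r.
Qed.

Fact rho_stk_additive v : additive (@rho_stk v).
Proof.
move=> g g'; have [[a s] /= [ra rs us e]] := rho_rep g.
have [[a' s'] /= [ra' rs' us' e']] := rho_rep g'.
have rss : reg_on U (s * s') by exact: (subringM Us).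
have uss : isunit ((s * s') (rho_pt v)) by exact/isunitM.
have [r1 r2] : reg_on U (s' * a) /\ reg_on U (s * a').
  by split; exact: (subringM Us).
apply: (isunit_inj ((rho_ptP v rss).1 uss)).
rewrite (@rho_stkE _ _ (s' * a - s * a')) //; last 2 first.
- by case: Us => _ UB _; exact: UB.
- by rewrite psecB !psecM -e -e'; exact: sub_frac.
rewrite rhoB // !rhoM // -(rho_stkE ra rs us e) -(rho_stkE ra' rs' us' e').
exact/esym/sub_frac.
Qed.

Fact rho_stk_multiplicative v : multiplicative (@rho_stk v).
Proof.
split=> [g g'|]; last first.
  have := @rho_stk_sec v 1; rewrite psec1 rho1; apply; by case: Us.
have [[a s] /= [ra rs us e]] := rho_rep g.
have [[a' s'] /= [ra' rs' us' e']] := rho_rep g'.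
have rss : reg_on U (s * s') by exact: (subringM Us).
have raa : reg_on U (a * a') by exact: (subringM Us).
have uss : isunit ((s * s') (rho_pt v)) by exact/isunitM.
apply: (isunit_inj ((rho_ptP v rss).1 uss)).
rewrite (@rho_stkE _ _ (a * a')) //; last by rewrite !psecM -e -e' mulrACA.
by rewrite !rhoM // -(rho_stkE ra rs us e) -(rho_stkE ra' rs' us' e') mulrACA.
Qed.

HB.instance Definition _ v := GRing.isAdditive.Build _ _ (@rho_stk v) (@rho_stk_additive v).
HB.instance Definition _ v :=
  GRing.isMultiplicative.Build _ _ (@rho_stk v) (@rho_stk_multiplicative v).

Definition rho_stkr v : {rmorphism stk (rho_pt v) -> stk v} := @rho_stk v.

Program Definition rho_mor : mor V P := @Mor k V P rho_pt rho_stkr _ _ _ _.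
Next Obligation.
move=> v A /nbhs_interior /nbhs_singleton Av.
have [s [rs [_ us] sA]] := aff_basis aU (open_interior A) (rho_ptU v) Av.
change (\forall y \near v, A (rho_pt y)).
apply: filterS (unit_near (rhoR v rs) ((rho_ptP v rs).1 us)) => y uy.
by apply: interior_subset; apply: sA; split; [exact: rho_ptU|exact/rho_ptP].
Qed.
Next Obligation.
move=> v c; rewrite -[c%:A]/(csec p0 c (rho_pt v)) [LHS]rho_stk_sec ?rhoC //.
exact: csec_reg.
Qed.
Next Obligation.
move=> v g ug; have [[a s] /= [ra rs us e]] := rho_rep g.
have /(rho_ptP v ra) : isunit (rho a v).
  rewrite -(rho_stkE ra rs us e); apply/isunitM; split; last exact: ug.
  exact/rho_ptP.
by rewrite -e => /isunitM[].
Qed.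
Next Obligation.
move=> v s rs; have [a [c [ra rc uc _ e]]] := aff_germ aU (aff_open aU) (rho_ptU v)
  (rho_ptU v) rs.
have rc' := rhoR v (rc : reg_on U (c : psec p0)).
have uc' : isunit (rho c v) by exact/rho_ptP.
apply: reg_ext (reg_mul (reg_inv rc' uc') (rhoR v (ra : reg_on U (a : psec p0)))).
near=> y; have uy : isunit (rho c y) by near: y; exact: unit_near rc' uc'.
apply: (isunit_inj uy); rewrite mulrA [_ * sinv _ _]mulruV // mul1r.
have ucy : isunit (c (rho_pt y)) by exact/rho_ptP.
apply/esym/rho_stkE => //; apply: e; split=> //; exact: rho_ptU.
Unshelve. all: by end_near. Qed.

Lemma mor_to_affine : exists h : mor V P, (forall v, U (h v)) /\
  forall (s : psec p0) v, reg_on U s -> pull h s v = rho s v.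
Proof.
exists rho_mor; split=> [v|s v rs]; first exact: rho_ptU.
exact: rho_stk_sec.
Qed.

End MorphismsToAffine.

Lemma Spec_pt (k : fieldType) (a b : Spec k) : a = b.
Proof. by case: a; case: b. Qed.

Lemma to_Spec_eqm (k : fieldType) (V : scheme k) (f g : mor V (Spec k)) : eqm f g.
Proof.
have e0 x : f x = g x by exact: Spec_pt.
have key (h : mor V (Spec k)) x s : pull h s x = (s (h x) : k^o)%:A.
  rewrite /pull -(@fstk_const _ _ _ h x); congr (fstk _ _ _).
  by rewrite -[RHS]/(s (h x) * 1) mulr1.
by split=> // s x; rewrite !key; congr (_ *: _); rewrite (e0 x).
Qed.

(** * Closures of graphs and universal closedness *)

Section ProperSeparation.
Variables (k : fieldType) (XX T : scheme k) (p : mor XX T).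
Hypothesis puc : universally_closed p.
Variables (x0 : XX) (t0 : T) (M : nat).

Definition AX : scheme k := @OFam k XX x0 M setT openT.
Definition AT : scheme k := @OFam k T t0 M setT openT.
Definition prX : mor AX XX := fproj (@ofam_affine k XX x0 M setT openT).
Definition prA : mor AT T := fproj (@ofam_affine k T t0 M setT openT).
Definition cX (j : 'I_M) : forall y : AX, stk y :=
  fcoord (Laff := @ofam_affine k XX x0 M setT openT) j.
Definition cA (j : 'I_M) : forall y : AT, stk y :=
  fcoord (Laff := @ofam_affine k T t0 M setT openT) j.

Section LiftA.
Variables (V : scheme k) (f : mor V T) (v : 'I_M -> forall x : V, stk x).
Hypothesis vreg : forall j x, reg x (v j).

Definition liftA : mor V AT :=
  flift (@ofam_affine k T t0 M setT openT) vreg (fun _ => I)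
    (fun x c (c0 : c = 0) => etrans (congr1 (fstk f x) c0) (rmorph0 (fstk f x))).

Lemma liftA_pr : eqm (mcomp prA liftA) f. Proof. exact: flift_proj. Qed.
Lemma liftA_c j x : pull liftA (cA j) x = v j x. Proof. exact: flift_coord. Qed.
End LiftA.

Section LiftX.
Variables (V : scheme k) (f : mor V XX) (v : 'I_M -> forall x : V, stk x).
Hypothesis vreg : forall j x, reg x (v j).

Definition liftX : mor V AX :=
  flift (@ofam_affine k XX x0 M setT openT) vreg (fun _ => I)
    (fun x c (c0 : c = 0) => etrans (congr1 (fstk f x) c0) (rmorph0 (fstk f x))).

Lemma liftX_pr : eqm (mcomp prX liftX) f. Proof. exact: flift_proj. Qed.
Lemma liftX_c j x : pull liftX (cX j) x = v j x. Proof. exact: flift_coord. Qed.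
End LiftX.

Lemma cX_reg j (y : AX) : reg y (cX j). Proof. exact: fcoord_reg. Qed.
Lemma cA_reg j (y : AT) : reg y (cA j). Proof. exact: fcoord_reg. Qed.

Definition Ap : mor AX AT := liftA (mcomp p prX) cX_reg.

Lemma eqm_sym (V W : scheme k) (f g : mor V W) : eqm f g -> eqm g f.
Proof. by move=> [e e']; split=> *; rewrite ?e ?e'. Qed.

Lemma eqm_trans (V W : scheme k) (f g h : mor V W) : eqm f g -> eqm g h -> eqm f h.
Proof. by move=> [e e'] [d d']; split=> *; rewrite ?e ?d ?e' ?d'. Qed.

Lemma eqm_compl (V W Z : scheme k) (f g : mor V W) (h : mor W Z) :
  eqm f g -> eqm (mcomp h f) (mcomp h g).
Proof.
move=> [e e']; split=> [x|s x]; first by rewrite /= e.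
exact: (e' (pull h s) x).
Qed.

Lemma eqm_compr (V W Z : scheme k) (f g : mor W Z) (h : mor V W) :
  eqm f g -> eqm (mcomp f h) (mcomp g h).
Proof.
move=> [e e']; split=> [x|s x]; first exact: e.
rewrite -[LHS]/(pull h (pull f s) x) -[RHS]/(pull h (pull g s) x).
by congr (pull h _ x); apply: functional_extensionality_dep => y; exact: e'.
Qed.

Lemma eqm_assoc (V W Z Z' : scheme k) (f : mor V W) (g : mor W Z) (h : mor Z Z') :
  eqm (mcomp h (mcomp g f)) (mcomp (mcomp h g) f).
Proof. by split. Qed.

(** This is the base change to which universal closedness will be applied: affine M-space over [XX]
    above affine M-space over [T]. *)
Lemma Ap_pullback : is_pullback p prA prX Ap.
Proof.
split; first exact/eqm_sym/liftA_pr.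
move=> V al be e; split; last first.
  move=> h h' e1 e2; apply: flift_uniq => // j x.
  have cE : cX j = pull Ap (cA j).
    by apply: functional_extensionality_dep => y; rewrite /Ap liftA_c.
  change (pull h (cX j) x = pull h' (cX j) x); rewrite cE; exact: (proj2 e2).
have vr j x : reg x (pull be (cA j)) by apply: fstk_reg; exact: cA_reg.
exists (liftX al vr); split; first exact: liftX_pr.
apply: flift_uniq => [|j x].
  apply: eqm_trans (eqm_assoc _ _ _) _.
  apply: eqm_trans (eqm_compr _ (liftA_pr (mcomp p prX) cX_reg)) _.
  apply: eqm_trans (eqm_sym (eqm_assoc _ _ _)) _.
  exact: eqm_trans (eqm_compl p (liftX_pr al vr)) e.
change (pull (liftX al vr) (pull Ap (cA j)) x = pull be (cA j) x).
have -> : pull Ap (cA j) = cX j.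
  by apply: functional_extensionality_dep => y; rewrite /Ap liftA_c.
exact: liftX_c.
Qed.

Lemma evals_cong (V S : scheme k) (s0 : S) (f : mor V S)
    (v v' : 'I_M -> forall x : V, stk x) (F : mpl M (psec s0)) x :
  (forall j, ~ isunit (v j x - v' j x)) ->
  ~ isunit (evals f v F x - evals f v' F x).
Proof.
move=> vv'; have main (n : nat) (a b : stk x) : ~ isunit (a - b) -> ~ isunit (a ^+ n - b ^+ n).
  by move=> nu; rewrite subrXX => /isunitM[].
rewrite !evalsE -sumrB; apply: nunit_sum => m _; rewrite -mulrBr => /isunitM[_].
elim: (index_enum _) => [|j l IH]; first by rewrite !big_nil subrr; exact: nunit0.
rewrite !big_cons; set a := v j x ^+ _; set b := v' j x ^+ _.
set A := \prod_(i <- l) _; set B := \prod_(i <- l) _.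
have -> : a * A - b * B = a * (A - B) + B * (a - b) by ring.
by apply: nunitD => /isunitM[_] => [/IH|/main]; apply.
Qed.

Lemma isunit_cong (V : scheme k) (x : V) (a b : stk x) :
  ~ isunit (a - b) -> isunit a <-> isunit b.
Proof.
move=> nu; split=> u; apply: contrapT => nu'.
  by have := nunitD nu nu'; rewrite subrK.
have nu2 : ~ isunit (b - a) by rewrite -opprB -mulN1r => /isunitM[].
by have := nunitD nu2 nu'; rewrite subrK.
Qed.

Variables (T1 : set T) (C : set XX) (v : 'I_M -> psec x0).
Hypothesis oT1 : open T1.
Hypothesis Cl : forall z, T1 (p z) ->
  ((forall j, reg z (v j)) /\ (C z \/ \forall z' \near z, ~ C z')) \/
  exists j c, [/\ reg z c, ~ isunit (c z) &
    \forall z' \near z, C z' -> c z' * v j z' = 1].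

Let Gam : set AX := [set y | C (prX y) /\
  forall j, ~ isunit (cX j y - pull prX (v j) y)].

(** On the graph each X_j is congruent to v_j modulo the maximal ideal, hence so are all polynomials
    in them. *)
Lemma Gam_unit (F : mpl M (psec t0)) (y : AX) : (forall j, ~ isunit (cX j y - pull prX (v j) y)) ->
  isunit (evals p v F (prX y)) <-> ~ fprime (pst (fbase (Ap y)) F).
Proof.
move=> yG; rewrite -(pull_unit prX (evals p v F)) pull_evals.
rewrite -(fpoly_unit (@ofam_affine k T t0 M setT openT) F (Ap y)) -(pull_unit Ap).
have -> : pull Ap (fpoly (Laff := @ofam_affine k T t0 M setT openT) F) y =
    evals (mcomp p prX) cX F y.
  apply: etrans (pull_fpoly _ _ _) _; apply: evals_eqm.
    exact: liftA_pr.
  by move=> j; exact: liftA_c.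
apply: iff_sym; apply: isunit_cong; apply: evals_cong => j; exact: yG.
Qed.

(** The closure of the graph of [v] over [C] has closed image in affine M-space over [T]. By [Cl]
    the closure adds no point over [T1], so that [w] is outside the image and some basic
    neighbourhood D(h) of [w] avoids it. *)
Lemma proper_sep (w : AT) : T1 (prA w) ->
  (forall z, C z -> p z = prA w -> ~ (forall F : mpl M (psec t0),
     fprime (pst (fbase w) F) <-> ~ isunit (evals p v F z))) ->
  exists T2 (h : mpl M (psec t0)), [/\ open T2, T2 (prA w) /\ preg T2 h, T2 `<=` T1,
    ~ fprime (pst (fbase w) h) &
    forall z, C z -> T2 (p z) -> ~ isunit (evals p v h z)].
Proof.
move=> wT1 hw; have cl := puc Ap_pullback (@closed_closure _ Gam).
have nw : ~ (Ap @` closure Gam) w.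
  move=> [y yG yw]; have pz : p (prX y) = prA w.
    by rewrite -yw -[RHS]/(mcomp prA Ap y) (proj1 (liftA_pr (mcomp p prX) cX_reg)).
  have meet (N : set XX) (F : mpl M (psec x0)) : nbhs (prX y) N ->
      (forall j, reg (prX y) (mcf j F : psec x0)) -> ~ fprime (pst (fbase y) F) ->
      exists y', [/\ N (prX y'), Gam y' & ~ fprime (pst (fbase y') F)].
    move=> nN rF nF; have := near_all (fun m (_ : m \in mpoly.msupp F) => reg_near (rF m)).
    move=> /(filterI nN)/nbhs_interior/nbhs_singleton; set N' := interior _ => N'y.
    have rF' : preg N' F.
      move=> m z /interior_subset[_ h].
      have [/h//|mF] := boolP (m \in mpoly.msupp F).
      by rewrite (mpoly.memN_msupp_eq0 mF); exact: reg_0.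
    have [y' [Gy' [N'y' nF']]] := yG _ (fbasic_nbhs (open_interior _) rF' (conj N'y nF)).
    by exists y'; split=> //; case: (interior_subset N'y').
  have rX (j : 'I_M) m : reg (prX y) (mcf m (mpX (psec x0) (mpoly.mnm1 j)) : psec x0).
    exact: (@pregX k XX x0 M setT (mpoly.mnm1 j) m (prX y) I).
  have rC (c : psec x0) m : reg (prX y) c -> reg (prX y) (mcf m (mpC M c) : psec x0).
    move=> rc; have [N [oN Ny rN]] : exists N, [/\ open N, N (prX y) & reg_on N c].
      have /nbhs_interior /nbhs_singleton := reg_near rc.
      by exists (interior (fun z => reg z c)); split=> //;
        [exact: open_interior|move=> z /interior_subset].
    exact: (pregC (M := M) rN m Ny).
  have xs := reg_subring x0 (prX y).
  have r1 m : reg (prX y) (mcf m (1 : mpl M (psec x0)) : psec x0).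
    have [P1 _ _] := preg_subring x0 M setT.
    exact: (P1 m (prX y) I).
  have tounit F : ~ isunit (tofrac (fdat y) (pst (fbase y) F)) -> fprime (pst (fbase y) F).
    by move=> nu; apply: contrapT => nq; apply: nu; apply/(@tofrac_unit _ (fdat y)).
  have [[vr Cy]|[j [c [rc nc c1]]]] := Cl (z := prX y) ltac:(by rewrite pz).
    have Cz : C (prX y).
      case: Cy => // nC; have [||y' [nC' [Cy' _] _]] := meet _ 1 nC.
      - exact: r1.
      - by rewrite pst1; exact: fprime1.
      by case: nC'.
    (* If X_j - v_j were invertible at [y], it would be so at a nearby point of the graph, where it
       is not. *)
    have vG j : ~ isunit (cX j y - pull prX (v j) y).
      move=> uj; pose F := mpX (psec x0) (mpoly.mnm1 j) - mpC M (v j).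
      have FE (y' : AX) : tofrac (fdat y') (pst (fbase y') F) = cX j y' - pull prX (v j) y'.
        by rewrite /F pstB pstX pstC (rmorphB (tofrac (fdat y'))).
      have [||y' [_ [_ /(_ j)]]] := meet setT F filterT.
      - move=> m; rewrite raddfB; have [_ xB _] := xs; apply: xB; first exact: rX.
        exact: rC.
      - by apply/(@tofrac_unit _ (fdat y)); rewrite FE.
      by move=> + /(@tofrac_unit _ (fdat y')); rewrite FE.
    apply: (hw _ Cz pz) => F; rewrite -yw (Gam_unit F vG).
    by split=> [q nq|]; [exact: nq|move/contrapT].
  (* At a boundary point [c] is not invertible, so c X_j - 1 is; but nearby points of the graph
     satisfy c v_j = 1, and there c X_j - 1 = c (X_j - v_j) is not invertible. *)
  pose F := mpC M (c : psec x0) * mpX (psec x0) (mpoly.mnm1 j) - 1.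
  have FE (y' : AX) : tofrac (fdat y') (pst (fbase y') F) = pull prX c y' * cX j y' - 1.
    rewrite /F pstB pst1 pstM pstX pstC (rmorphB (tofrac (fdat y'))).
    by rewrite (rmorphM (tofrac (fdat y'))) (rmorph1 (tofrac (fdat y'))).
  have [||y' [c1' [Cy' vG] nF]] := meet _ F c1.
  - move=> m; rewrite raddfB; have [_ xB _] := xs; apply: xB; last exact: r1.
    change (reg (prX y) (mcf m (mpC M (c : psec x0) * mpX (psec x0) (mpoly.mnm1 j)) : psec x0)).
    rewrite mpoly.mcoeffCM; exact: (subringM xs rc (rX j m)).
  - apply/(@tofrac_unit _ (fdat y)); rewrite FE.
    apply: (@nunit_sub1 k AX y (pull prX c y * cX j y)).
    by move=> /isunitM[/pull_unit uc _]; exact: nc.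
  move: nF => /(@tofrac_unit _ (fdat y')); rewrite FE.
  have ab : pull prX c y' * pull prX (v j) y' = 1.
    by have := congr1 (fstk prX y') (c1' Cy'); rewrite rmorphM rmorph1.
  rewrite (mulr_sub1 (cX j y') ab) => /isunitM[_]; exact: vG.
have oc : open (~` (Ap @` closure Gam)) by exact: closed_openC.
have [T2 [h [oT2 rh [T2w nh] hG]]] := fnbhsP (open_nbhs_nbhs (conj oc nw)).
exists (T1 `&` T2), h; split=> //.
- exact: openI.
- by split=> //; apply: pregW rh => x [].
move=> z Cz [_ T2z] u.
have [y [yz yv]] := @fam_graph_ex _ _ _ M (@ofam k XX x0 setT) z v I.
have vG j : ~ isunit (cX j y - pull prX (v j) y).
  have -> : cX j y - pull prX (v j) y =
      tofrac (fdat y) (mpX (stk (fbase y)) (mpoly.mnm1 j) - mpC M (v j (fbase y))).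
    by rewrite (rmorphB (tofrac (fdat y))).
  by move=> /(@tofrac_unit _ (fdat y)); apply; exact: yv.
have yz' : prX y = z by exact: yz.
have uy : isunit (evals p v h (prX y)) by rewrite yz'.
have ny : ~ fprime (pst (fbase (Ap y)) h) by exact/(Gam_unit h vG).
have pA : fbase (Ap y) = p z.
  by rewrite -yz'; exact: (proj1 (liftA_pr (mcomp p prX) cX_reg) y).
have : fbasic T2 h (Ap y) by split=> //; rewrite pA.
move=> /hG; apply; exists y => //; apply: subset_closure; split=> //.
by rewrite yz'.
Qed.

End ProperSeparation.

(** * Projective space *)

Section ProjSpace.
Variables (k : fieldType) (N : nat) (P : scheme k).
Variables (U : 'I_N.+1 -> set P) (x : 'I_N.+1 -> 'I_N.+1 -> forall p : P, stk p).
Hypothesis aU : forall i, affine_open (U i).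
Hypothesis covU : forall p, exists i, U i p.
Hypothesis xreg : forall i j, reg_on (U i) (x i j).
Hypothesis x1 : forall i, eq_on (U i) (x i i) (fun=> 1).
Hypothesis xunit : forall i j p, U i p -> (U j p <-> isunit (x i j p)).
Hypothesis xmul : forall i j l p, U i p -> U j p -> x i j p * x j l p = x i l p.
Hypothesis xpoly : forall i s, reg_on (U i) s ->
  exists! q : mpl N k, eq_on (U i) s (fun p =>
    mpoly.mmap (in_alg (stk p)) (fun j => x i (lift i j) p) q).

Section Eval.
Variables (V : scheme k) (w : V).

Definition keval (h : 'I_N -> stk w) : {rmorphism mpl N k -> stk w} :=
  mmapr (in_alg (stk w)) h.

Lemma kevalC h c : keval h (mpC N c) = c%:A.
Proof. exact: mpoly.mmapC. Qed.

Lemma kevalE h q : keval h q = \sum_(m <- mpoly.msupp q)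
  (mcf m q)%:A * \prod_(j < N) h j ^+ m j.
Proof. by []. Qed.

Lemma keval_ext h h' q : (forall j, h j = h' j) -> keval h q = keval h' q.
Proof.
by move=> e; rewrite !kevalE; apply: eq_bigr => m _; congr (_ * _);
  apply: eq_bigr => j _; rewrite e.
Qed.

Lemma pull_keval (W : scheme k) (f : mor V W) (h : 'I_N -> stk (f w)) q :
  fstk f w (mpoly.mmap (in_alg (stk (f w))) h q) = keval (fun j => fstk f w (h j)) q.
Proof.
rewrite kevalE rmorph_sum; apply: eq_bigr => m _.
rewrite rmorphM rmorph_prod /= fstk_const; congr (_ * _).
by apply: eq_bigr => j _; rewrite rmorphXn.
Qed.

End Eval.

Lemma keval_reg (V : scheme k) (h : 'I_N -> forall w : V, stk w) q w :
  (forall j, reg w (h j)) -> reg w (fun w' : V => keval (h^~ w') q).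
Proof.
move=> rh; have xs := reg_subring w w.
pose G : psec w := \sum_(m <- mpoly.msupp q)
  csec w (mcf m q) * \prod_(j < N) (h j : psec w) ^+ m j.
rewrite (_ : (fun _ => _) = G); last first.
  apply: functional_extensionality_dep => y; rewrite kevalE /G psec_sum.
  apply: eq_bigr => m _; rewrite psecM psec_prod; congr (_ * _).
  by apply: eq_bigr => j _; rewrite psecX.
change ([set s : psec w | reg w s] G).
apply: subring_sum => [//|m _]; apply: (subringM xs); first exact: reg_const.
by apply: subring_prod => [//|j _]; apply: (subringX _ xs); exact: rh.
Qed.

(* The equation c X_j = 1 keeps the graph of the affine coordinates away from
   the points over z. *)
Lemma chart_boundary (V : scheme k) (f : mor V P) z l : ~ U l (f z) ->
  exists (j : 'I_N) c, [/\ reg z c, ~ isunit (c z) & \forall z' \near z,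
    U l (f z') -> c z' * pull f (x l (lift l j)) z' = 1].
Proof.
move=> nU; have [l' Ul'] := covU (f z).
have ll' : l' != l by apply/eqP => e; apply: nU; rewrite -e.
have [j jl'|] := unliftP l l'; last by move=> e; case/eqP: ll'.
exists j, (pull f (x l' l)); split.
- by apply: pull_reg; exact: xreg.
- by move=> /pull_unit /(xunit l Ul').
near=> z' => Uz'.
have Ul'z' : U l' (f z').
  near: z'; apply: (@fpt_continuous _ _ _ f).
  exact: (open_nbhs_nbhs (conj (aff_open (aU l')) Ul')).
by rewrite -jl' -[LHS]rmorphM xmul // x1 // rmorph1.
Unshelve. all: by end_near. Qed.

Section Chart.
Variables (l : 'I_N.+1) (p0 : P).

Definition cpoly (s : psec p0) : mpl N k :=
  if pselect (reg_on (U l) s) is left h then sval (cid (xpoly h)) else 0.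

Lemma cpolyE (s : psec p0) y : reg_on (U l) s -> U l y ->
  s y = mpoly.mmap (in_alg (stk y)) (fun j => x l (lift l j) y) (cpoly s).
Proof.
by rewrite /cpoly; case: pselect => // h _ Uy; case: cid => q /= [e _]; exact: e.
Qed.

Lemma cpoly_uniq (s : psec p0) q : reg_on (U l) s -> (forall y, U l y ->
  s y = mpoly.mmap (in_alg (stk y)) (fun j => x l (lift l j) y) q) -> cpoly s = q.
Proof.
rewrite /cpoly; case: pselect => // h _ e; case: cid => q' /= [_ un].
by apply: un => y Uy; exact: e.
Qed.

Variable V : scheme k.

Lemma pull_cpoly (f : mor V P) (s : psec p0) w : reg_on (U l) s -> U l (f w) ->
  pull f s w = keval (fun j => pull f (x l (lift l j)) w) (cpoly s).
Proof. by move=> rs Uw; rewrite /pull (cpolyE rs Uw) pull_keval. Qed.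

Variable c : 'I_N -> forall w : V, stk w.
Hypothesis creg : forall j w, reg w (c j).

(** The sections over [U l] are the polynomials in the affine coordinates, so substituting [c] for
    the coordinates is a ring map to the functions on [V]. *)
Lemma chart_mor : exists h : mor V P, (forall w, U l (h w)) /\
  forall (s : psec p0) w, reg_on (U l) s -> pull h s w = keval (c^~ w) (cpoly s).
Proof.
have Us := reg_on_subring p0 (U l).
have ev (y : P) : exists g : {rmorphism mpl N k -> stk y},
    forall q, g q = mpoly.mmap (in_alg (stk y)) (fun j => x l (lift l j) y) q.
  by exists (mmapr (in_alg (stk y)) (fun j => x l (lift l j) y)).
apply: (@mor_to_affine k P V (U l) p0 (aU l) (fun s w => keval (c^~ w) (cpoly s))).
- move=> s t w rs rt; rewrite (@cpoly_uniq _ (cpoly s + cpoly t)) ?rmorphD //.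
    exact: (subringD Us).
  move=> y Uy; have [g gE] := ev y.
  by rewrite psecD (cpolyE rs Uy) (cpolyE rt Uy) -!gE rmorphD.
- move=> s t w rs rt; rewrite (@cpoly_uniq _ (cpoly s * cpoly t)) ?rmorphM //.
    exact: (subringM Us).
  move=> y Uy; have [g gE] := ev y.
  by rewrite psecM (cpolyE rs Uy) (cpolyE rt Uy) -!gE rmorphM.
- move=> a w; rewrite (@cpoly_uniq _ (mpC N a)) ?kevalC //.
    exact: csec_reg.
  by move=> y Uy; rewrite mpoly.mmapC.
- move=> s t w rs rt e; congr (keval _ _); apply: cpoly_uniq => // y Uy.
  by rewrite e //; exact: cpolyE.
- by move=> s w rs; apply: keval_reg => j; exact: creg.
Qed.

End Chart.

Variables (T PT : scheme k) (prP : mor PT P) (prT : mor PT T).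
Hypothesis hPT : is_product prP prT.
Variables (XX : scheme k) (p : mor XX T) (Phi : mor XX PT).
Hypothesis puc : universally_closed p.
Hypothesis hPhi : eqm (mcomp prT Phi) p.

(** Over a chart of P^N the point [u] has affine coordinates, and [proper_sep], applied to the
    coordinates of the points of [C] lying over this chart, yields an equation that separates [u]
    from the image of [C]. *)
Lemma product_mor_closed : closed_map Phi.
Proof.
move=> C cC; rewrite -(setCK (_ @` _)); apply: open_closedC.
rewrite openE => u nu; rewrite /interior.
have [[z1 Cz1]|C0] := EM (C !=set0); last first.
  by apply: filterE => y [z Cz _]; apply: C0; exists z.
have [l Ul] := covU (prP u).
have oV : open (prP @^-1` (U l)).
  by apply: open_comp; [move=> y _; exact: fpt_continuous|exact: aff_open (aU l)].
pose t1 := p z1; pose p1 := prP u.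
(* [O] is the open subscheme of [PT] over the chart. *)
have [O [io [Oin Oex]]] : exists (O : scheme k) (io : mor O PT),
    (forall o, U l (prP (io o))) /\ (forall y, U l (prP y) -> exists o, io o = y).
  exists (@OFam k PT u 0 _ oV), (fproj (ofam_affine oV)).
  split=> [o|y Uy]; first exact: (@fbaseE _ _ _ _ _ o).
  have [o [oy _]] := @fam_graph_ex k PT u 0 (ofam u (prP @^-1` (U l))) y (fun=> 0) Uy.
  by exists o.
pose xi (j : 'I_N) : forall y : PT, stk y := pull prP (x l (lift l j)).
have vr j (o : O) : reg o (pull io (xi j)).
  by apply: pull_reg; apply: pull_reg; apply: xreg; exact: Oin.
have [psi [psiT psic]] : exists psi : mor O (AT t1 N),
    eqm (mcomp (prA t1 N) psi) (mcomp prT io) /\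
    forall j o, pull psi (cA (t0 := t1) (M := N) j) o = pull io (xi j) o.
  exists (liftA t1 (mcomp prT io) vr); split; first exact: liftA_pr.
  by move=> j o; exact: liftA_c.
have [chi [Uchi chiE]] := chart_mor l p1 (@cA_reg k T t1 N).
have [_ univ] := hPT.
have [[th [thP thT]] _] := univ _ chi (prA t1 N) (to_Spec_eqm _ _).
(* Up to the inclusion [io], [th] is a left inverse of [psi]; so a point over the chart is
   determined by its image in affine N-space over T. *)
have thpsi : eqm (mcomp th psi) io.
  have [_ un] := univ O (mcomp prP io) (mcomp prT io) (to_Spec_eqm _ _).
  apply: un; apply: eqm_trans (eqm_assoc _ _ _) _.
    apply: eqm_trans (eqm_compr psi thP) _.
    apply: (mor_affine_ext (aU l)) => [o|o|s o rs]; [exact: Uchi|exact: Oin|].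
    rewrite (pull_comp chi psi).
    have -> : pull chi s = fun w => keval (fun j => cA (t0 := t1) (M := N) j w)
        (cpoly l (s : psec p1)).
      by apply: functional_extensionality_dep => w; exact: chiE.
    rewrite (@pull_cpoly l p1 O (mcomp prP io) s o rs (Oin o)).
    apply: etrans (pull_keval _ _) _.
    apply: keval_ext => j.
    exact: (etrans (psic j o) (esym (pull_comp prP io (x l (lift l j)) o))).
  exact: eqm_trans (eqm_compr psi thT) psiT.
have psiU o (F : mpl N (psec t1)) :
    ~ fprime (pst (fbase (psi o)) F) <-> isunit (evals prT xi F (io o)).
  rewrite -(fpoly_unit (@ofam_affine k T t1 N setT openT) F (psi o)) -(pull_unit psi).
  rewrite -(pull_unit io) pull_evals.
  have -> : pull psi (fpoly (Laff := @ofam_affine k T t1 N setT openT) F) o =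
      evals (mcomp prT io) (fun j => pull io (xi j)) F o.
    apply: etrans (pull_fpoly _ _ _) _; apply: evals_eqm; first exact: psiT.
    by move=> j; exact: psic.
  by [].
have [ou iou] := Oex u Ul; pose w := psi ou.
pose v (j : 'I_N) : psec z1 := pull Phi (xi j).
have PhiU z F : isunit (evals prT xi F (Phi z)) <-> isunit (evals p v F z).
  rewrite -(pull_unit Phi) pull_evals.
  by rewrite (evals_eqm (v' := v) F hPhi).
have wT : prA t1 N w = prT u by rewrite -iou; exact: (proj1 psiT ou).
pose C' := [set z | C z /\ U l (prP (Phi z))].
have Cl z : [set: T] (p z) ->
  ((forall j, reg z (v j)) /\ (C' z \/ \forall z' \near z, ~ C' z')) \/
  exists j c, [/\ reg z c, ~ isunit (c z) &
    \forall z' \near z, C' z' -> c z' * v j z' = 1].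
  move=> _; have [Uz|nUz] := EM (U l (prP (Phi z))).
    left; split=> [j|].
      by apply: pull_reg; apply: pull_reg; exact: xreg.
    have [Cz|nCz] := EM (C z); [by left|right].
    have : nbhs z (~` C) by exact: (open_nbhs_nbhs (conj (closed_openC cC) nCz)).
    by apply: filterS => z' nC' [].
  right; have [j [c [rc nc c1]]] := @chart_boundary XX (mcomp prP Phi) z l nUz.
  by exists j, c; split=> //; apply: filterS c1 => z' c1 [_ /c1].
have [|T2 [h [oT2 [T2w rh] _ nh hC]]] := proper_sep puc openT Cl (w := w) I.
- move=> z [Cz Uz] pz Fz; apply: nu; exists z => //.
  have [oz ioz] := Oex _ Uz.
  have e : psi oz = w.
    apply: fampt_eq => [|F].
      apply: etrans (proj1 psiT oz) _; apply: etrans (congr1 prT ioz) _.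
      rewrite -[RHS]pz.
      exact: (proj1 hPhi z).
    rewrite Fz -PhiU -ioz -psiU.
    by split=> [? ?|/contrapT].
  have th0 o : th (psi o) = io o by exact: (proj1 thpsi o).
  by rewrite -ioz -th0 e /w th0 iou.
have uh : isunit (evals prT xi h u) by rewrite -iou; exact/psiU.
have T2u : T2 (prT u) by rewrite -wT.
have rhu : reg u (evals prT xi h).
  by apply: evals_reg rh T2u _ => j; apply: pull_reg; exact: xreg.
near=> y => -[z Cz yz]; apply: (hC z).
- split=> //; rewrite yz; near: y; exact: (open_nbhs_nbhs (conj oV Ul)).
- have -> : p z = prT y by rewrite -yz -(proj1 hPhi z).
  near: y; apply: (@fpt_continuous _ _ _ prT).
  exact: (open_nbhs_nbhs (conj oT2 T2u)).
- apply/PhiU; rewrite yz; near: y; exact: unit_near rhu uh.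
Unshelve. all: by end_near. Qed.

End ProjSpace.

(** * Chains of primes in noetherian rings *)

Section DeterminantTrick.
Variable R : comNzRingType.

Lemma det_trick n (B : 'M[R]_n) (v a : 'I_n -> R) :
  (forall i, \sum_j B i j * v j = a i) ->
  forall i, \det B * v i = \sum_j (\adj B) i j * a j.
Proof.
move=> e i; pose V : 'cV[R]_n := \col_j v j; pose A : 'cV[R]_n := \col_j a j.
have BV : B *m V = A.
  apply/matrixP => s t; rewrite !mxE -e; apply: eq_bigr => j _.
  by rewrite !mxE.
have : \adj B *m (B *m V) = \det B *: V by rewrite mulmxA mul_adj_mx mul_scalar_mx.
move=> /matrixP/(_ i ord0); rewrite BV !mxE => <-.
by apply: eq_bigr => j _; rewrite !mxE.
Qed.

Variables (I : set R).
Hypothesis Iid : ring_ideal I.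

Lemma ring_idealB a b : I a -> I b -> I (a - b).
Proof.
have [_ ID IM] := Iid; move=> Ia Ib; apply: ID => //.
by rewrite -mulN1r; exact: IM.
Qed.

Lemma ring_ideal_sum (J : Type) (r : seq J) (P : pred J) (F : J -> R) :
  (forall i, P i -> I (F i)) -> I (\sum_(i <- r | P i) F i).
Proof.
move=> IF; have [I0 ID _] := Iid; elim/big_rec: _ => [//|i x Pi Ix].
by apply: ID => //; exact: IF.
Qed.

Lemma prod_cong (J : Type) (r : seq J) (P : pred J) (F G : J -> R) :
  (forall i, P i -> I (F i - G i)) ->
  I (\prod_(i <- r | P i) F i - \prod_(i <- r | P i) G i).
Proof.
have [I0 ID IM] := Iid; move=> FG.
apply: (big_ind2 (fun x y => I (x - y))) => //; first by rewrite subrr.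
move=> x1 x2 y1 y2 Ix Iy.
have -> : x1 * y1 - x2 * y2 = y1 * (x1 - x2) + x2 * (y1 - y2) by ring.
by apply: ID; exact: IM.
Qed.

Lemma det_cong n (A B : 'M[R]_n) :
  (forall i j, I (A i j - B i j)) -> I (\det A - \det B).
Proof.
move=> AB; have [_ _ IM] := Iid; rewrite /determinant -sumrB; apply: ring_ideal_sum => s _.
by rewrite -mulrBr; apply: IM; apply: prod_cong => i _; exact: AB.
Qed.

Lemma det_diag n (u : 'I_n -> R) :
  \det (\matrix_(i, j) (u i *+ (i == j))) = \prod_i u i.
Proof.
have -> : \matrix_(i, j) (u i *+ (i == j)) = diag_mx (\row_j u j).
  by apply/matrixP => i j; rewrite !mxE.
by rewrite det_diag; apply: eq_bigr => i _; rewrite mxE.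
Qed.

(** Cramer's rule for diag(u) - c, whose determinant is the product of the [u i] modulo [I]. The
    [u i] stand for denominators outside a prime, which spares the passage to a localisation. *)
Lemma nakayama n (u v a : 'I_n -> R) (c : 'I_n -> 'I_n -> R) :
  (forall i j, I (c i j)) ->
  (forall i, u i * v i = a i + \sum_j c i j * v j) ->
  exists D (b : 'I_n -> 'I_n -> R), I (D - \prod_i u i) /\
    forall i, D * v i = \sum_j b i j * a j.
Proof.
move=> Ic e; pose B : 'M[R]_n := \matrix_(i, j) (u i *+ (i == j) - c i j).
exists (\det B), (fun i j => (\adj B) i j); split.
  rewrite -det_diag; apply: det_cong => i j; rewrite !mxE addrAC subrr add0r -mulN1r.
  by have [_ _ IM] := Iid; exact: IM.
apply: det_trick => i.
rewrite (eq_bigr (fun j => u i *+ (i == j) * v j - c i j * v j)); last first.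
  by move=> j _; rewrite !mxE mulrBl.
rewrite sumrB (bigD1 i) //= eqxx mulr1n big1 ?addr0; last first.
  by move=> j ji; rewrite eq_sym (negbTE ji) mulr0n mul0r.
by rewrite e addrK.
Qed.

End DeterminantTrick.

Section Noetherian.
Variable R : comNzRingType.
Hypothesis Rn : noetherian R.
Implicit Types (I J P Q : set R).

Lemma spanned_mem n (g : 'I_n -> R) i : spanned g (g i).
Proof.
exists (fun j => (j == i)%:R); rewrite (bigD1 i) //= eqxx mul1r big1 ?addr0 //.
by move=> j /negbTE ->; rewrite mul0r.
Qed.

Lemma spanned_sub n (g : 'I_n -> R) I : ring_ideal I -> (forall i, I (g i)) ->
  spanned g `<=` I.
Proof.
move=> Iid Ig _ [c ->]; apply: ring_ideal_sum => // i _.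
by case: Iid => _ _; apply.
Qed.

(* A directed union of ideals, being finitely generated, is one of them. *)
Lemma noeth_union (F : set (set R)) : F !=set0 -> (forall I, F I -> ring_ideal I) ->
  total_on F subset -> exists2 I, F I & forall J, F J -> J `<=` I.
Proof.
move=> [I0 FI0] Fid Ftot; pose U := \bigcup_(X in F) X.
have Uid : ring_ideal U.
  split.
  - by exists I0 => //; case: (Fid _ FI0).
  - move=> a b [I FI Ia] [J FJ Jb]; have [IJ|JI] := Ftot _ _ FI FJ.
      by exists J => //; have [_ JD _] := Fid _ FJ; apply: JD => //; exact: IJ.
    by exists I => //; have [_ ID _] := Fid _ FI; apply: ID => //; exact: JI.
  - by move=> a b [I FI Ib]; exists I => //; have [_ _ IM] := Fid _ FI; exact: IM.
have [n [g Ug]] := Rn Uid.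
have [I FI Ig] : exists2 I, F I & forall i, I (g i).
  have : forall m, (m <= n)%N -> exists2 I, F I & forall i : 'I_n, (i < m)%N -> I (g i).
    elim=> [_|m IH mn]; first by exists I0.
    have [I FI Ig] := IH (ltnW mn); pose i : 'I_n := Ordinal mn.
    have [J FJ Jg] : U (g i) by rewrite Ug; exact: spanned_mem.
    have [IJ|JI] := Ftot _ _ FI FJ.
      exists J => // j; rewrite ltnS leq_eqVlt => /orP[/eqP ji|/Ig/IJ//].
      by have -> : j = i by exact: val_inj.
    exists I => // j; rewrite ltnS leq_eqVlt => /orP[/eqP ji|/Ig//].
    by have -> : j = i; [exact: val_inj|exact: JI].
  by move=> /(_ n (leqnn n))[I FI Ig]; exists I => // i; exact: Ig.
exists I => // J FJ a Ja; apply: (spanned_sub (Fid _ FI) Ig).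
by rewrite -Ug; exists J.
Qed.

Lemma noeth_max (Phi : set R -> Prop) : (exists2 I, ring_ideal I & Phi I) ->
  exists I, [/\ ring_ideal I, Phi I &
    forall J, ring_ideal J -> Phi J -> I `<=` J -> J `<=` I].
Proof.
move=> [I1 I1id PhiI1].
have [] := @Zorn_bigcup R [set X | X = set0 \/ ring_ideal X /\ Phi X].
  move=> F FP Ftot; pose F' := [set X | F X /\ X !=set0].
  have [[X F'X]|F0] := EM (F' !=set0); last first.
    left; apply/seteqP; split=> x // [X FX Xx]; apply: F0; exists X; split=> //.
    by exists x.
  have F'P Y : F' Y -> ring_ideal Y /\ Phi Y.
    by move=> [FY [y Yy]]; have [Y0|//] := FP _ FY; rewrite Y0 in Yy.
  have [||Y F'Y Ymax] := @noeth_union F' (ex_intro _ _ F'X).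
  - by move=> Y /F'P[].
  - by move=> Y Z [FY _] [FZ _]; exact: Ftot.
  right; have -> : \bigcup_(X in F) X = Y; last exact: F'P.
  apply/seteqP; split=> x; last by move=> Yx; exists Y => //; case: F'Y.
  by move=> [Z FZ Zx]; apply: (Ymax Z) => //; split=> //; exists x.
move=> A [[A0|[Aid PhiA]] Amax].
  exfalso; apply: (Amax I1); last by right.
  rewrite A0; split; first exact: sub0set.
  by move=> /(_ 0); apply; case: I1id.
exists A; split=> // J Jid PhiJ AJ; apply: contrapT => nJA.
by apply: (Amax J); [split|right].
Qed.

Lemma noeth_acc (K : nat -> set R) : (forall n, ring_ideal (K n)) ->
  (forall n, K n `<=` K n.+1) -> exists n, forall m, K m `<=` K n.
Proof.
move=> Kid Kup; have Kle n m : (n <= m)%N -> K n `<=` K m.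
  by move=> /subnK <-; elim: (m - n)%N => [|l IH] //; apply: (subset_trans IH); exact: Kup.
have [||| I [n _ <-] nmax] := @noeth_union [set K n | n in setT].
- by exists (K 0%N), 0%N.
- by move=> _ [n _ <-].
- move=> _ _ [n _ <-] [m _ <-]; have [nm|mn] := leqP n m.
    by left; exact: Kle.
  by right; apply: Kle; exact: ltnW.
by exists n => m; apply: nmax; exists m.
Qed.

(** * Descending chains at a minimal prime *)

Section Dcc.
Variables (Q I0 : set R).
Hypothesis Qp : prime_ideal Q.
Hypothesis Qmin : forall P, prime_ideal P -> I0 `<=` P -> P `<=` Q -> Q `<=` P.

(** For a prime [P], the saturated ideals are the contractions of the ideals of the localisation at
    [P], which is never formed. *)
Definition sat P I := forall u a, ~ P u -> I (u * a) -> I a.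

(** The localisation of R / I0 at [Q] is Artinian because [Q] is minimal over [I0]. By noetherian
    induction, take a saturated [F] maximal such that the traces of the [L n] on [F] become
    stationary; were [F] proper, one more step of a composition series could be added to it. *)
Lemma dcc (L : nat -> set R) :
  (forall n, [/\ ring_ideal (L n), sat Q (L n), I0 `<=` L n & L n.+1 `<=` L n]) ->
  exists n, L n `<=` L n.+1.
Proof.
move=> hL; have [[Q0 QD QM] Q1 Qpr] := Qp.
have Lle n m : (n <= m)%N -> L m `<=` L n.
  move=> /subnK <-; elim: (m - n)%N => [|l IH] //.
  by apply: subset_trans IH; have [_ _ _] := hL (l + n)%N.
pose stab F := exists n, forall m, (n <= m)%N -> L n `&` F `<=` L m.
have [|F [Fid [Fs FI Fst] Fmax]] := @noeth_max
    (fun F => [/\ sat Q F, I0 `<=` F & stab F]).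
  (* The smallest saturated ideal containing [I0]: it lies in all the [L n]. *)
  pose F a := exists2 u, ~ Q u & forall I, ring_ideal I -> I0 `<=` I -> sat Q I -> I (u * a).
  exists F.
    split.
    - by exists 1 => // I [I00 _ _] _ _; rewrite mulr0.
    - move=> a b [u nu ua] [v nv vb]; exists (u * v) => [/Qpr[]//|I Iid I0I sI].
      have [_ ID IM] := Iid; rewrite mulrDr; apply: ID.
        by rewrite mulrAC mulrC; apply: IM; exact: ua.
      by rewrite -mulrA; apply: IM; exact: vb.
    - move=> a b [u nu ub]; exists u => // I Iid I0I sI.
      by rewrite mulrCA; have [_ _ IM] := Iid; apply: IM; exact: ub.
  split.
  - move=> u a nu [v nv va]; exists (v * u) => [/Qpr[]//|I Iid I0I sI].
    by rewrite -mulrA; exact: va.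
  - by move=> a I0a; exists 1 => // I Iid I0I sI; rewrite mul1r; exact: I0I.
  - exists 0%N => m _ a [_ [u nu ua]]; have [Lid Ls LI _] := hL m.
    by apply: (Ls u) => //; exact: ua.
have [F1|nF1] := EM (F 1).
  have [n nst] := Fst; exists n => a Lna; apply: nst => //.
  by split=> //; rewrite -(mulr1 a); have [_ _ FM] := Fid; exact: FM.
exfalso; pose col a := [set r | F (r * a)].
have colid a : ring_ideal (col a).
  have [F0 FD FM] := Fid; split=> [|r s|r s]; rewrite /col /=.
  - by rewrite mul0r.
  - by rewrite mulrDl; exact: FD.
  - by rewrite -mulrA; exact: FM.
(* An ideal quotient (F : v) that is maximal for [v] outside [F] is prime; it lies in [Q] and
   contains [I0], so it is [Q]. *)
have [|V [Vid [v nFv VE] Vmax]] := @noeth_max (fun V => exists2 v, ~ F v & V = col v).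
  by exists (col 1); [exact: colid|exists 1].
have Vp : prime_ideal V.
  split=> //; first by rewrite VE /col /= mul1r.
  move=> a b; rewrite VE /col /= => abv.
  have [Fbv|nFbv] := EM (F (b * v)); [by right|left].
  have : col (b * v) `<=` V.
    apply: Vmax => //; first by exists (b * v).
    by rewrite VE => r; rewrite /col /= mulrCA; have [_ _ FM] := Fid; exact: FM.
  by rewrite VE => /(_ a); rewrite /col /= mulrA; apply.
have VQ : V `<=` Q.
  by move=> r; rewrite VE => rv; apply: contrapT => nr; apply: nFv; exact: Fs nr rv.
have QV : Q `<=` V.
  apply: Qmin => // a /FI Fa; rewrite VE /col /= mulrC.
  by have [_ _ FM] := Fid; exact: FM.
have Qv r : Q r -> F (r * v) by move=> /QV; rewrite VE.
(* The saturation of F + (v). As Q v is in [F], the quotient F' / F has length one after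
   localisation, and any element with a coefficient [r] outside [Q] generates it. *)
pose F' a := exists u f r, [/\ ~ Q u, F f & u * a = f + r * v].
apply: nFv; apply: (Fmax F'); last first.
- by exists 1, 0, 1; split=> //; [case: Fid|rewrite add0r].
- by move=> a Fa; exists 1, a, 0; split=> //; rewrite mul1r mul0r addr0.
- have [F0 FD FM] := Fid; split.
  + move=> u a nu [w [f [r [nw Ff e]]]]; exists (w * u), f, r; split=> //.
      by move=> /Qpr[].
    by rewrite -mulrA.
  + by move=> a /FI Fa; exists 1, a, 0; split=> //; rewrite mul1r mul0r addr0.
  + have [n nst] := Fst.
    have [[n' [nn' n'F]]|big] :=
      EM (exists n', (n <= n')%N /\ L n' `&` F' `<=` F).
      exists n' => m n'm a [Ln'a F'a]; apply: (nst m (leq_trans nn' n'm)).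
      by split; [exact: Lle Ln'a|exact: n'F].
    (* An element [a] of L_(m+1) that generates F' / F divides, up to denominators and modulo [F],
       every [b] in L_m and F'; the difference lies in L_n and [F], hence in L_(m+1). *)
    have step m : (n <= m)%N -> L m `&` F' `<=` L m.+1.
      move=> nm b [Lb [u' [f' [r' [nu' Ff' e']]]]].
      have [a [La Fa nFa]] : exists a, [/\ L m.+1 a, F' a & ~ F a].
        apply: contrapT => na; apply: big; exists m.+1; split; first exact: leqW.
        move=> a [La F'a]; apply: contrapT => nFa; apply: na; exists a.
        by split.
      have [u [f [r [nu Ff e]]]] := Fa.
      have nr : ~ Q r.
        move=> Qr; apply: nFa; apply: (Fs u) => //; rewrite e.
        by apply: FD => //; exact: Qv.
      have [Lid Ls _ Ldec] := hL m.+1; have [_ LD LM] := Lid.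
      have [Lmid _ _ LmS] := hL m; have [_ LmD LmM] := Lmid.
      have E : (r * u') * b - (r' * u) * a = r * f' - r' * f.
        by rewrite -mulrA e' -[r' * u * a]mulrA e; ring.
      apply: (Ls (r * u')) => [/Qpr[]//|].
      rewrite -(subrK ((r' * u) * a) ((r * u') * b)); apply: LD; last exact: LM.
      have : L n ((r * u') * b - (r' * u) * a).
        apply: (Lle _ _ nm); apply: ring_idealB => //; first exact: LmM.
        by apply: LmM; exact: LmS.
      rewrite E => Ln; apply: (nst m.+1 (leqW nm)); split=> //.
      by apply: ring_idealB => //; exact: FM.
    exists n => m /subnK <-; elim: (m - n)%N => [a [//]|l IH a [Lna F'a]].
    by apply: (step (l + n)%N (leq_addl _ _)); split=> //; exact: IH.
- have [F0 FD FM] := Fid; split.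
  + by exists 1, 0, 0; split=> //; rewrite mulr0 mul0r addr0.
  + move=> a b [u [f [r [nu Ff e]]]] [u' [f' [r' [nu' Ff' e']]]].
    exists (u * u'), (u' * f + u * f'), (u' * r + u * r'); split.
    * by move=> /Qpr[].
    * by apply: FD; exact: FM.
    * have -> : u * u' * (a + b) = u' * (u * a) + u * (u' * b) by ring.
      by rewrite e e'; ring.
  + move=> a b [u [f [r [nu Ff e]]]]; exists u, (a * f), (a * r).
    by split=> //; [exact: FM|rewrite mulrCA e; ring].
Qed.

End Dcc.

(** * Krull's principal ideal theorem for chains of primes *)

Section ChainMove.
Variables (P0 P1 P2 : set R) (x : R).
Hypotheses (p0 : prime_ideal P0) (p1 : prime_ideal P1) (p2 : prime_ideal P2).
Hypotheses (s01 : P0 `<` P1) (s12 : P1 `<` P2) (x2 : P2 x) (nx1 : ~ P1 x).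

Fixpoint ipow n : set R :=
  if n is n'.+1 then idl setT [set c | exists a b, [/\ P1 a, ipow n' b & c = a * b]]
  else setT.

Lemma idlT_ideal (G : set R) : ring_ideal (idl setT G).
Proof.
have Ts : subring [set: R] by [].
have [_ I0 ID IM] := idl_ideal Ts (@subsetT _ G).
by split=> // a b; exact: IM.
Qed.

Lemma ipow_ideal n : ring_ideal (ipow n).
Proof. by case: n => [//|n]; exact: idlT_ideal. Qed.

Lemma ipowS n : ipow n.+1 `<=` ipow n.
Proof.
move=> _ [m [d [c [dc ->]]]]; apply: (ring_ideal_sum (ipow_ideal n)) => i _.
have [_ [a [b [_ pb ->]]]] := dc i; have [_ _ IM] := ipow_ideal n.
by rewrite mulrA; exact: IM.
Qed.

Lemma ipowX n a : P1 a -> ipow n (a ^+ n).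
Proof.
move=> Pa; elim: n => [//|n IH]; apply: idl_mem => //.
by exists a, (a ^+ n); rewrite exprS.
Qed.

(* The symbolic power S n of P1 modulo P0; if P2 were minimal over P0 + (x),
   the ideals S n + (x) would be stationary at P2 and Nakayama would give
   P1 = P0. *)
Let S n : set R := [set a | exists s b c, [/\ ~ P1 s, ipow n b, P0 c & s * a = b + c]].

Let S_ideal n : ring_ideal (S n).
Proof.
have [[z0 D0 M0] _ _] := p0; have [_ o1 q1] := p1; have [zi Di Mi] := ipow_ideal n.
split.
- by exists 1, 0, 0; split=> //; rewrite mulr0 addr0.
- move=> a a' [s [b [c [ns ib pc e]]]] [s' [b' [c' [ns' ib' pc' e']]]].
  exists (s * s'), (s' * b + s * b'), (s' * c + s * c'); split.
  + by move=> /q1[].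
  + by apply: Di; exact: Mi.
  + by apply: D0; exact: M0.
  + have -> : s * s' * (a + a') = s' * (s * a) + s * (s' * a') by ring.
    by rewrite e e'; ring.
- move=> r a [s [b [c [ns ib pc e]]]]; exists s, (r * b), (r * c).
  by split=> //; [exact: Mi|exact: M0|rewrite mulrCA e; ring].
Qed.

Let S_sat n u a : ~ P1 u -> S n (u * a) -> S n a.
Proof.
have [_ _ q1] := p1; move=> nu [s [b [c [ns ib pc e]]]].
by exists (s * u), b, c; split=> //; [move=> /q1[]|rewrite -mulrA].
Qed.

Let S_P0 n : P0 `<=` S n.
Proof.
move=> a Pa; exists 1, 0, a; split=> //; [by case: p1|by case: (ipow_ideal n)|].
by rewrite mul1r add0r.
Qed.

Let SS n : S n.+1 `<=` S n.
Proof.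
by move=> a [s [b [c [ns ib pc e]]]]; exists s, b, c; split=> //; exact: ipowS.
Qed.

(** Krull's principal ideal theorem modulo [P0]: with the chain P0 < P1 below it, [P2] cannot be
    minimal over P0 + (x). *)
Lemma chain_move : exists P', [/\ prime_ideal P', P0 `<=` P', P' x & P' `<` P2].
Proof.
apply: contrapT => nP'; have [[z2 D2 M2] o2 q2] := p2; have [_ o1 q1] := p1.
pose I0 := [set a | P0 a \/ a = x].
have Qmin P : prime_ideal P -> I0 `<=` P -> P `<=` P2 -> P2 `<=` P.
  move=> Pp I0P PP2; apply: contrapT => nP2; apply: nP'; exists P; split=> //.
  - by move=> a Pa; apply: I0P; left.
  - by apply: I0P; right.
(* The saturation at [P2] of S n + (x); [dcc] applies because [P2] is now assumed minimal over P0 +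
   (x). *)
pose J n := [set a | exists u b r, [/\ ~ P2 u, S n b & u * a = b + x * r]].
have [n Jn] : exists n, J n `<=` J n.+1.
  apply: (@dcc P2 I0 p2 Qmin) => n; have [zs Ds Ms] := S_ideal n; split.
  - split.
    + by exists 1, 0, 0; split=> //; rewrite !mulr0 addr0.
    + move=> a a' [u [b [r [nu Sb e]]]] [u' [b' [r' [nu' Sb' e']]]].
      exists (u * u'), (u' * b + u * b'), (u' * r + u * r'); split.
      * by move=> /q2[].
      * by apply: Ds; exact: Ms.
      * have -> : u * u' * (a + a') = u' * (u * a) + u * (u' * a') by ring.
        by rewrite e e'; ring.
    + move=> t a [u [b [r [nu Sb e]]]]; exists u, (t * b), (t * r).
      by split=> //; [exact: Ms|rewrite mulrCA e; ring].
  - move=> u a nu [w [b [r [nw Sb e]]]]; exists (w * u), b, r; split=> //.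
      by move=> /q2[].
    by rewrite -mulrA.
  - move=> a [P0a|->].
      by exists 1, a, 0; split=> //; [exact: S_P0|rewrite mul1r mulr0 addr0].
    by exists 1, 0, 1; split=> //; rewrite mul1r mulr1 add0r.
  - by move=> a [u [b [r [nu Sb e]]]]; exists u, b, r; split=> //; exact: SS.
have sub12 : P1 `<=` P2 by case: s12.
(* Up to a denominator, an element of [S n] is in S (n+1) + x S n, because [x] is outside [P1] and
   [S n] is saturated at [P1]; Nakayama removes the second term. *)
have SnS : S n `<=` S n.+1.
  have [m [s Ss]] := Rn (S_ideal n).
  have Smem i : S n (s i) by rewrite Ss; exact: spanned_mem.
  have /choice[w wP] : forall i, exists w : R * R * ('I_m -> R),
      [/\ ~ P2 w.1.1, S n.+1 w.1.2 &
          w.1.1 * s i = w.1.2 + \sum_j (x * w.2 j) * s j].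
    move=> i; have [|u [b [r [nu Sb e]]]] := Jn (s i).
      by exists 1, (s i), 0; split=> //; rewrite mul1r mulr0 addr0.
    have : S n r.
      apply: (S_sat nx1); have -> : x * r = u * s i - b by rewrite e [b + _]addrC addrK.
      have [_ _ Ms] := S_ideal n; apply: (ring_idealB (S_ideal n)); last exact: SS.
      exact: Ms.
    rewrite Ss => -[c rc]; exists (u, b, c); split=> //=.
    by rewrite e rc mulr_sumr; congr (_ + _); apply: eq_bigr => j _; rewrite mulrA.
  have [|||d [b [dP dE]]] := @nakayama R P2 _ m (fun i => (w i).1.1) s (fun i => (w i).1.2)
    (fun i j => x * (w i).2 j).
  - by case: p2.
  - by move=> i j; rewrite mulrC; exact: M2.
  - by move=> i; case: (wP i).
  have nd : ~ P2 d.
    move=> Pd; have : P2 (\prod_i (w i).1.1).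
      have -> : \prod_i (w i).1.1 = d + (-1) * (d - \prod_i (w i).1.1) by ring.
      by apply: D2 => //; exact: M2.
    elim/big_ind: _ => [//|a b' na nb /q2[/na|/nb]//|i _].
    by case: (wP i).
  rewrite Ss; apply: spanned_sub => [|i]; first exact: S_ideal.
  apply: (@S_sat _ d) => [/sub12//|]; rewrite dE.
  apply: (ring_ideal_sum (S_ideal _)) => j _; have [_ _ Ms] := S_ideal n.+1.
  by apply: Ms; case: (wP j).
have [[z0 D0 M0] o0 q0] := p0; have sub01 : P0 `<=` P1 by case: s01.
(* After localisation at [P1], P1^n is now contained in P1^(n+1) + P0, and Nakayama puts P1^n into
   the prime [P0]. *)
have ipP0 : ipow n `<=` P0.
  have [m [s Ss]] := Rn (ipow_ideal n).
  have /choice[w wP] : forall i, exists w : R * R * ('I_m -> R),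
      [/\ ~ P1 w.1.1, P0 w.1.2, forall j, P1 (w.2 j) &
          w.1.1 * s i = w.1.2 + \sum_j w.2 j * s j].
    move=> i; have [|u [b [c [nu ib Pc e]]]] := SnS (s i).
      exists 1, (s i), 0; split=> //; first by rewrite Ss; exact: spanned_mem.
      by rewrite mul1r addr0.
    have [c' [Pc' bE]] : exists c' : 'I_m -> R, (forall j, P1 (c' j)) /\
        b = \sum_j c' j * s j.
      have [l [d [g [dg ->]]]] := ib; have [[z1 D1 M1] _ _] := p1.
      elim/big_ind: _ => [|y1 y2 [c1 [Pc1 ->]] [c2 [Pc2 ->]]|t _].
      - by exists (fun=> 0); split=> //; rewrite big1 // => j _; rewrite mul0r.
      - exists (fun j => c1 j + c2 j); split=> [j|]; first exact: D1.
        by rewrite -big_split; apply: eq_bigr => j _; rewrite mulrDl.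
      - have [_ [y1 [y2 [Py1 iy2 ->]]]] := dg t.
        have : ipow n y2 by exact: iy2.
        rewrite Ss => -[c1 ->]; exists (fun j => d t * c1 j * y1); split=> [j|].
          exact: M1.
        rewrite mulr_sumr mulr_sumr; apply: eq_bigr => j _; ring.
    by exists (u, c, c'); split=> //=; rewrite e bE addrC.
  have [|||d [b [dP dE]]] := @nakayama R P1 _ m (fun i => (w i).1.1) s (fun i => (w i).1.2)
    (fun i j => (w i).2 j).
  - by case: p1.
  - by move=> i j; case: (wP i).
  - by move=> i; case: (wP i).
  have nd : ~ P1 d.
    move=> Pd; have [[z1 D1 M1] _ _] := p1.
    have : P1 (\prod_i (w i).1.1).
      have -> : \prod_i (w i).1.1 = d + (-1) * (d - \prod_i (w i).1.1) by ring.
      by apply: D1 => //; exact: M1.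
    elim/big_ind: _ => [//|a b' na nb /q1[/na|/nb]//|i _].
    by case: (wP i).
  rewrite Ss; apply: spanned_sub => [//|i].
  have : P0 (d * s i).
    rewrite dE; apply: (ring_ideal_sum (I := P0)) => // j _.
    by apply: M0; case: (wP j).
  by move=> /q0[/sub01//|].
case: s01 => _; apply=> g P1g.
have := ipP0 _ (ipowX n P1g); elim: (n) => [|l IH]; first by rewrite expr0.
by rewrite exprS => /q0[].
Qed.

End ChainMove.

(** Passing to R / (x) shortens a chain by at most one: [x] is moved down the chain, one prime at a
    time, by [chain_move]. *)
Lemma chain_drop d (P : nat -> set R) x :
  (forall i, (i <= d.+1)%N -> prime_ideal (P i)) ->
  (forall i, (i < d.+1)%N -> P i `<` P i.+1) -> P d.+1 x ->
  exists P' : nat -> set R, [/\ forall i, (i <= d)%N -> prime_ideal (P' i),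
    forall i, (i < d)%N -> P' i `<` P' i.+1, P' 0%N x, P 0%N `<` P' 0%N &
    P' d `<=` P d.+1].
Proof.
elim: d P => [|d IH] P Pp Ps Px.
  by exists (fun=> P 1%N); split=> // [i _|]; [exact: Pp|exact: Ps].
have [Q [Qp PQ QP Qx]] : exists Q, [/\ prime_ideal Q, P d `<` Q, Q `<` P d.+2 & Q x].
  have [Px'|nPx] := EM (P d.+1 x); first by exists (P d.+1); split=> //;
    [exact: Pp|exact: Ps|exact: Ps].
  have [|||||||Q [Qp PQ Qx QP]] := @chain_move (P d) (P d.+1) (P d.+2) x => //.
  - by apply: Pp; do 2 apply: leqW.
  - exact: Pp.
  - exact: Pp.
  - exact: Ps.
  - exact: Ps.
  exists Q; split=> //; split=> // QPd; apply: nPx.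
  by have [+ _] := Ps d (leqnSn _); apply; apply: QPd.
have [|||P' [P'p P's P'x P0P' P'd]] := IH (fun i => if (i <= d)%N then P i else Q).
- by move=> i _; case: ifP => // id; apply: Pp; apply: leqW; apply: leqW.
- move=> i; rewrite ltnS => id; rewrite id; case: ifP => [id'|/negbT].
    by apply: Ps; apply: leqW.
  by rewrite -ltnNge ltnS => di; have -> : i = d by apply/eqP; rewrite eqn_leq id.
- by rewrite ltnn.
rewrite ltnn in P'd; rewrite leq0n in P0P'.
exists (fun i => if (i <= d)%N then P' i else P d.+2); split.
- by move=> i _; case: ifP => [/P'p//|_]; exact: Pp.
- move=> i; rewrite ltnS => id; rewrite id; case: ifP => [id'|/negbT]; first exact: P's.
  rewrite -ltnNge ltnS => di; have -> : i = d by apply/eqP; rewrite eqn_leq id.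
  case: QP => QP nPQ; split; first exact: subset_trans P'd QP.
  by move=> PP'; apply: nPQ; exact: subset_trans PP' P'd.
- by rewrite leq0n.
- by rewrite leq0n.
- by rewrite ltnn.
Qed.

End Noetherian.

(** * Regular local rings are normal *)

Section CompletelyIntegrallyClosed.
Variable R : comNzRingType.
Hypothesis Rn : noetherian R.
Implicit Types (I J : set R) (a b c r x : R).

(** Krull's intersection theorem for the powers of [x] in R / I. *)
Lemma krull_int I x a : ring_ideal I -> (forall r, isunit (1 - x * r)) ->
  (forall n, exists r, I (a - x ^+ n * r)) -> I a.
Proof.
move=> Iid xu aI; have [I0 ID IM] := Iid.
pose K n := [set r | I (x ^+ n * r)].
have Kid n : ring_ideal (K n).
  split=> [|r s|r s]; rewrite /K /=; first by rewrite mulr0.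
    by rewrite mulrDr; exact: ID.
  by rewrite mulrCA; exact: IM.
(* The ideals (I : x^n) are stationary, which plays the role of the Artin-Rees lemma: the
   intersection [L] of the I + (x^m) is contained in I + x L, and Nakayama concludes. *)
have [|n Kn] := noeth_acc Rn Kid.
  by move=> n r; rewrite /K /= exprS -mulrA; exact: IM.
pose L := [set r | forall m, exists s, I (r - x ^+ m * s)].
have Lid : ring_ideal L.
  split=> [m|r r' Lr Lr' m|r r' Lr' m].
  - by exists 0; rewrite mulr0 subrr.
  - have [s Is] := Lr m; have [s' Is'] := Lr' m; exists (s + s').
    have -> : r + r' - x ^+ m * (s + s') = (r - x ^+ m * s) + (r' - x ^+ m * s') by ring.
    exact: ID.
  - have [s' Is'] := Lr' m; exists (r * s').
    have -> : r * r' - x ^+ m * (r * s') = r * (r' - x ^+ m * s') by ring.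
    exact: IM.
have Lx r : L r -> exists2 r', L r' & I (r - x * r').
  move=> Lr; have [s Is] := Lr n.+1; exists (x ^+ n * s); last by rewrite mulrA -exprS.
  move=> m; have [s' Is'] := Lr (n.+1 + m)%N; exists (x ^+ n * s').
  have -> : x ^+ n * s - x ^+ m * (x ^+ n * s') = x ^+ n * (s - x ^+ m * s') by ring.
  apply: (Kn n.+1); rewrite /K /=.
  have -> : x ^+ n.+1 * (s - x ^+ m * s') =
    (r - x ^+ (n.+1 + m) * s') - (r - x ^+ n.+1 * s) by rewrite exprD; ring.
  exact: ring_idealB.
have [m [g Lg]] := Rn Lid.
have /choice[w wP] : forall i, exists w : R * ('I_m -> R),
    I w.1 /\ 1 * g i = w.1 + \sum_j (x * w.2 j) * g j.
  move=> i; have [|r' Lr' Ir] := Lx (g i); first by rewrite Lg; exact: spanned_mem.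
  move: Lr'; rewrite Lg => -[d rE]; exists (g i - x * r', d); split=> //=.
  rewrite mul1r rE mulr_sumr -[LHS](subrK (\sum_(i0 < m) x * (d i0 * g i0))).
  by congr (_ + _); apply: eq_bigr => j _; rewrite mulrA.
have xid : ring_ideal [set r | exists s, r = x * s].
  split=> [|_ _ [r ->] [s ->]|r _ [s ->]]; first by exists 0; rewrite mulr0.
    by exists (r + s); rewrite mulrDr.
  by exists (r * s); rewrite mulrCA.
have [||d [b [[s dE] db]]] := nakayama xid (u := fun=> 1) (v := g) (a := fun i => (w i).1)
    (c := fun i j => x * (w i).2 j).
- by move=> i j; exists ((w i).2 j).
- by move=> i; case: (wP i).
have [v dv] : isunit d.
  have := xu (- s); rewrite mulrN opprK -dE big1 // addrC subrK; exact.
have : L a by exact: aI.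
rewrite Lg; apply: spanned_sub => // i.
rewrite -(mul1r (g i)) -dv mulrAC mulrC db; apply: (IM).
by apply: ring_ideal_sum => // j _; apply: (IM); case: (wP j).
Qed.

(* J is the kernel of a map onto a completely integrally closed domain: a/b
   is in the domain as soon as its powers have a common denominator. *)
Definition cic J := forall a b c, ~ J b -> ~ J c ->
  (forall n, exists r, J (c * a ^+ n - b ^+ n * r)) -> exists r, J (a - b * r).

Section Step.
Variables (J : set R) (x : R).
Hypothesis xu : forall r, isunit (1 - x * r).
Hypothesis Jp : prime_ideal J.
Hypothesis nJx : ~ J x.
Let J' := [set r | exists j s, J j /\ r = j + x * s].
Hypothesis J'p : prime_ideal J'.
Hypothesis J'c : cic J'.

Let Jid : ring_ideal J. Proof. by case: Jp. Qed.

Let cancelX n r : J (x ^+ n * r) -> J r.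
Proof.
have [_ _ Jpr] := Jp; elim: n => [|n IH]; first by rewrite expr0 mul1r.
by rewrite exprS -mulrA => /Jpr[].
Qed.

Let J'E r : J' r -> exists s, J (r - x * s).
Proof. by move=> [j [s [Jj ->]]]; exists s; rewrite addrK. Qed.

Let J'I r s : J (r - x * s) -> J' r.
Proof. by move=> Jr; exists (r - x * s), s; rewrite subrK. Qed.

(** As J' = J + (x) is prime and does not contain [b], each factor [x] of b^m r modulo [J] comes
    from [r]. *)
Let divX b n r s m : ~ J' b -> J (b ^+ m * r - x ^+ n * s) ->
  exists r', J (r - x ^+ n * r').
Proof.
have [[J0 JD JM] _ Jpr] := Jp; have [_ _ J'pr] := J'p.
move=> nb; elim: n r s => [|n IH] r s h.
  by exists r; rewrite expr0 mul1r subrr.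
have /J'E[r1 Jr1] : J' r.
  have : J' (b ^+ m * r).
    by apply: (@J'I _ (x ^+ n * s)); rewrite mulrA -exprS.
  move: (m) => l {h}; elim: l => [|l IHl]; first by rewrite mul1r.
  by rewrite exprS -mulrA => /J'pr[].
have [|r' Jr'] := IH r1 s.
  apply: (@cancelX 1%N); rewrite expr1.
  have -> : x * (b ^+ m * r1 - x ^+ n * s) =
    (b ^+ m * r - x ^+ n.+1 * s) - b ^+ m * (r - x * r1) by rewrite exprS; ring.
  by apply: ring_idealB => //; exact: JM.
exists r'; have -> : r - x ^+ n.+1 * r' = (r - x * r1) + x * (r1 - x ^+ n * r').
  by rewrite exprS; ring.
by apply: JD => //; exact: JM.
Qed.

Let order r : ~ J r -> exists n, ~ exists s, J (r - x ^+ n * s).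
Proof.
move=> nr; apply: contrapT => h; apply: nr; apply: (krull_int Jid xu) => n.
by apply: contrapT => hn; apply: h; exists n.
Qed.

(** The order of [c] along [x] is finite by Krull's intersection theorem; c' is the leading
    coefficient. *)
Let leading c : ~ J c -> exists n c', ~ J' c' /\ J (c - x ^+ n * c').
Proof.
have [[J0 JD JM] _ _] := Jp.
move=> nc; have [n] := order nc.
elim: n => [|n IH] nn; first by case: nn; exists c; rewrite mul1r subrr.
have [[s Js]|ns] := EM (exists s, J (c - x ^+ n * s)); last exact: IH.
exists n, s; split=> // /J'E[s' Js']; apply: nn; exists s'.
have -> : c - x ^+ n.+1 * s' = (c - x ^+ n * s) + x ^+ n * (s - x * s').
  by rewrite exprSr; ring.
by apply: JD => //; exact: JM.
Qed.

Let hyp a b c := forall n, exists r, J (c * a ^+ n - b ^+ n * r).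

(** Modulo [J], the mixed products c a^m (a - b r)^n are divisible by b^(m+n), by induction on
    [n]. *)
Let hypB a b c r : hyp a b c -> hyp (a - b * r) b c.
Proof.
have [[J0 JD JM] _ _] := Jp.
move=> h n; have : forall m, exists s, J (c * a ^+ m * (a - b * r) ^+ n - b ^+ (m + n) * s).
  elim: n => [m|n IH m]; first by have [s Js] := h m; exists s; rewrite mulr1 addn0.
  have [s1 Js1] := IH m.+1; have [s2 Js2] := IH m; exists (s1 - r * s2).
  have -> : c * a ^+ m * (a - b * r) ^+ n.+1 - b ^+ (m + n.+1) * (s1 - r * s2) =
     (c * a ^+ m.+1 * (a - b * r) ^+ n - b ^+ (m.+1 + n) * s1) -
     (r * b) * (c * a ^+ m * (a - b * r) ^+ n - b ^+ (m + n) * s2).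
    by rewrite addSn addnS !exprS; ring.
  by apply: ring_idealB => //; exact: JM.
by move=> /(_ 0%N)[s]; rewrite mulr1 add0n; exists s.
Qed.

(* By induction on the order of b along x; when b is not in J', a is divided
   by b with remainder in x R over and over, and Krull's intersection theorem
   concludes. *)
Lemma cic_step : cic J.
Proof.
have [[J0 JD JM] _ Jpr] := Jp; have [_ _ J'pr] := J'p.
move=> a b c nb nc; have [f [c' [nc' Jc']]] := leading nc.
have [N] := order nb; elim: N a b nb => [|N IH] a b nb nN h.
  by case: nN; exists b; rewrite mul1r subrr.
have low n r : J (c * a ^+ n - b ^+ n * r) -> J (x ^+ f * (c' * a ^+ n) - b ^+ n * r).
  move=> Jr; have -> : x ^+ f * (c' * a ^+ n) - b ^+ n * r =
    (c * a ^+ n - b ^+ n * r) - a ^+ n * (c - x ^+ f * c') by ring.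
  by apply: ring_idealB => //; exact: JM.
have [/J'E[b1 Jb1]|nJ'b] := EM (J' b).
  have bn n : exists t, J (b ^+ n - x ^+ n * t) /\ t = b1 ^+ n.
    exists (b1 ^+ n); split=> //; rewrite -exprMn.
    elim: n => [|n IHn]; first by rewrite subrr.
    have -> : b ^+ n.+1 - (x * b1) ^+ n.+1 =
      b * (b ^+ n - (x * b1) ^+ n) + (x * b1) ^+ n * (b - x * b1) by rewrite !exprS; ring.
    by apply: JD; exact: JM.
  (* The exponent f + 1 exceeds the order [f] of [c]: modulo [J], x^(f+1) divides x^f c' a^(f+1),
     which forces [a] into J'. *)
  have /J'E[a1 Ja1] : J' a.
    have [r /low Jr] := h f.+1; have [t [Jt _]] := bn f.+1.
    have : J' (c' * a ^+ f.+1).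
      apply: (@J'I _ (t * r)); apply: (@cancelX f).
      have -> : x ^+ f * (c' * a ^+ f.+1 - x * (t * r)) =
        (x ^+ f * (c' * a ^+ f.+1) - b ^+ f.+1 * r) + r * (b ^+ f.+1 - x ^+ f.+1 * t).
        by rewrite [x ^+ f.+1]exprSr; ring.
      by apply: JD => //; exact: JM.
    move=> /J'pr[//|]; elim: (f.+1) => [|m IHm]; first by rewrite expr0; case: J'p.
    by rewrite exprS => /J'pr[].
  have an n : J (a ^+ n - x ^+ n * a1 ^+ n).
    rewrite -exprMn; elim: n => [|n IHn]; first by rewrite subrr.
    have -> : a ^+ n.+1 - (x * a1) ^+ n.+1 =
      a * (a ^+ n - (x * a1) ^+ n) + (x * a1) ^+ n * (a - x * a1) by rewrite !exprS; ring.
    by apply: JD; exact: JM.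
  have [||| r Jr] := IH a1 b1.
  - move=> Jb; apply: nb; rewrite -(subrK (x * b1) b); apply: JD => //; exact: JM.
  - move=> [r Jr]; apply: nN; exists r.
    have -> : b - x ^+ N.+1 * r = (b - x * b1) + x * (b1 - x ^+ N * r).
      by rewrite exprS; ring.
    by apply: JD => //; exact: JM.
  - move=> n; have [r Jr] := h n; exists r; apply: (@cancelX n).
    have [t [Jt tE]] := bn n; rewrite tE in Jt.
    have -> : x ^+ n * (c * a1 ^+ n - b1 ^+ n * r) =
      (c * a ^+ n - b ^+ n * r) - c * (a ^+ n - x ^+ n * a1 ^+ n) +
      r * (b ^+ n - x ^+ n * b1 ^+ n) by ring.
    by apply: JD; [apply: ring_idealB => //|]; exact: JM.
  exists r; have -> : a - b * r = (a - x * a1) + x * (a1 - b1 * r) - r * (b - x * b1) by ring.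
  by apply: ring_idealB => //; [apply: JD => //|]; exact: JM.
have red a2 : hyp a2 b c -> exists r a3, J (a2 - b * r - x * a3) /\ hyp a3 b c.
  move=> h2; have [|r /J'E[a3 Ja3]] := J'c (a := a2) (b := b) (c := c') nJ'b nc'.
    move=> n; have [r Jr] := h2 n.
    have Jr2 : J (b ^+ n * r - x ^+ f * (c' * a2 ^+ n)).
      have -> : b ^+ n * r - x ^+ f * (c' * a2 ^+ n) =
         (-1) * (c * a2 ^+ n - b ^+ n * r) + a2 ^+ n * (c - x ^+ f * c') by ring.
      by apply: JD; exact: JM.
    have [r' Jr'] := divX nJ'b Jr2; exists r'; apply: (@J'I _ 0); rewrite mulr0 subr0.
    apply: (@cancelX f).
    have -> : x ^+ f * (c' * a2 ^+ n - b ^+ n * r') =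
      b ^+ n * (r - x ^+ f * r') - (b ^+ n * r - x ^+ f * (c' * a2 ^+ n)) by ring.
    by apply: ring_idealB => //; exact: JM.
  exists r, a3; split=> // n; have [s Js] := hypB r h2 n.
  have an : J ((a2 - b * r) ^+ n - x ^+ n * a3 ^+ n).
    rewrite -exprMn; elim: (n) => [|l IHl]; first by rewrite subrr.
    have -> : (a2 - b * r) ^+ l.+1 - (x * a3) ^+ l.+1 =
      (a2 - b * r) * ((a2 - b * r) ^+ l - (x * a3) ^+ l) +
      (x * a3) ^+ l * (a2 - b * r - x * a3) by rewrite !exprS; ring.
    by apply: JD; exact: JM.
  have Js2 : J (b ^+ n * s - x ^+ n * (c * a3 ^+ n)).
    have -> : b ^+ n * s - x ^+ n * (c * a3 ^+ n) =
      c * ((a2 - b * r) ^+ n - x ^+ n * a3 ^+ n) -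
      (c * (a2 - b * r) ^+ n - b ^+ n * s) by ring.
    by apply: ring_idealB => //; exact: JM.
  have [s' Js'] := divX nJ'b Js2; exists s'; apply: (@cancelX n).
  have -> : x ^+ n * (c * a3 ^+ n - b ^+ n * s') =
    b ^+ n * (s - x ^+ n * s') - (b ^+ n * s - x ^+ n * (c * a3 ^+ n)) by ring.
  by apply: ring_idealB => //; exact: JM.
pose I := [set r | exists s, J (r - b * s)].
have Iid : ring_ideal I.
  split=> [|r r' [s Js] [s' Js']|r r' [s Js]].
  - by exists 0; rewrite mulr0 subrr.
  - exists (s + s'); have -> : r + r' - b * (s + s') = (r - b * s) + (r' - b * s') by ring.
    exact: JD.
  - exists (r * s); have -> : r * r' - b * (r * s) = r * (r' - b * s) by ring.
    exact: JM.
apply: (krull_int (I := I) Iid xu) => n.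
suff [r [a3 [Ja3 _]]] : exists r a3, J (a - b * r - x ^+ n * a3) /\ hyp a3 b c.
  by exists a3, r; rewrite addrAC.
elim: n => [|n [r [a3 [Ja3 h3]]]].
  by exists 0, a; split=> //; rewrite mulr0 subr0 mul1r subrr.
have [r' [a4 [Ja4 h4]]] := red _ h3; exists (r + x ^+ n * r'), a4; split=> //.
have -> : a - b * (r + x ^+ n * r') - x ^+ n.+1 * a4 =
  (a - b * r - x ^+ n * a3) + x ^+ n * (a3 - b * r' - x * a4) by rewrite exprSr; ring.
by apply: JD => //; exact: JM.
Qed.

End Step.

(** * Regular local rings *)

Section Regular.
Hypothesis Rloc : forall a, isunit a \/ isunit (1 - a).
Let M : set R := nonunits R.

Lemma nonunits_prime : prime_ideal M.
Proof.
split.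
- split; first exact: nunit0.
    move=> a b ua ub [c abc]; have [|] := Rloc (a * c); first by case/isunitM.
    by rewrite -abc mulrDl [a * c + _]addrC addrK => /isunitM[].
  by move=> a b nb [c e]; apply: nb; exists (a * c); rewrite mulrCA mulrA.
- by apply; exact: isunit1.
- move=> a b nab; have [ua|//] := EM (isunit a); last by left.
  right=> -[b' bb']; apply: nab; have [a' aa'] := ua.
  by exists (a' * b'); rewrite mulrACA aa' bb' mulr1.
Qed.

Lemma prime_nonunits I : prime_ideal I -> I `<=` M.
Proof.
move=> [[_ _ IM] I1 _] a Ia [b ab]; apply: I1; rewrite -ab mulrC; exact: IM.
Qed.

Let J d (g : 'I_d -> R) m : set R :=
  [set a | exists c : 'I_d -> R, a = \sum_(i < d | (i < m)%N) c i * g i].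

(** A chain of maximal length is pushed up until its i-th prime contains the first [i] generators:
    for each step lost, [chain_drop] absorbs one generator. *)
Lemma regular_flag d (g : 'I_d -> R) : M = spanned g -> prime_chain R d ->
  exists B : nat -> set R, [/\ forall i, (i <= d)%N -> prime_ideal (B i),
    forall i, (i < d)%N -> B i `<` B i.+1 &
    forall i (j : 'I_d), (i <= d)%N -> (j < i)%N -> B i (g j)].
Proof.
move=> Mg [P [Pp Ps]].
have gM j : M (g j) by rewrite Mg; exact: spanned_mem.
have key e : forall m (P : nat -> set R), (m + e = d)%N ->
    (forall i, (i <= e)%N -> prime_ideal (P i)) ->
    (forall i, (i < e)%N -> P i `<` P i.+1) ->
    (forall j : 'I_d, (j < m)%N -> P 0%N (g j)) ->
    exists B : nat -> set R, [/\ B m = P 0%N, forall i, (m <= i <= d)%N -> prime_ideal (B i),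
      forall i, (m <= i < d)%N -> B i `<` B i.+1 &
      forall i (j : 'I_d), (m <= i <= d)%N -> (j < i)%N -> B i (g j)].
  elim: e => [|e IH] m {P Pp Ps}P me Pp Ps Pg.
    rewrite addn0 in me; exists (fun=> P 0%N); split=> //.
    - by move=> i _; exact: Pp.
    - by move=> i /andP[mi id]; move: (leq_ltn_trans mi id); rewrite me ltnn.
    - move=> i j /andP[_ id] ji; apply: Pg; rewrite me; exact: leq_trans ji id.
  have md : (m < d)%N by rewrite -me -addSnnS leq_addr.
  (* The top prime is replaced by the maximal ideal, so that it contains the next generator. *)
  pose P1 i := if i == e.+1 then M else P i.
  have [|||P' [P'p P's P'x P0P' _]] := @chain_drop R Rn e P1 (g (Ordinal md)).
  - by move=> i ie; rewrite /P1; case: eqP => [_|_]; [exact: nonunits_prime|exact: Pp].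
  - move=> i ie; rewrite /P1 eqSS (ltn_eqF ie).
    case: eqP => [ie'|_]; last exact: Ps.
    have [sub nsub] := Ps i ie; split.
      by apply: subset_trans sub _; apply: prime_nonunits; exact: Pp.
    move=> MP; apply: nsub; apply: subset_trans _ MP; apply: prime_nonunits; exact: Pp.
  - by rewrite /P1 eqxx; exact: gM.
  have P10 : P1 0%N = P 0%N by [].
  rewrite P10 in P0P'.
  have [||B [B0 Bp Bs Bg]] := IH m.+1 P' _ P'p P's.
  - by rewrite addSnnS.
  - move=> j; rewrite ltnS leq_eqVlt => /orP[/eqP jm|jm].
      by have -> : j = Ordinal md by exact: val_inj.
    by case: P0P' => + _; apply; exact: Pg.
  exists (fun i => if i == m then P 0%N else B i); split.
  - by rewrite eqxx.
  - move=> i /andP[mi id]; case: eqP => [_|/eqP im]; first exact: Pp.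
    by apply: Bp; rewrite id ltn_neqAle eq_sym im mi.
  - move=> i /andP[mi id]; have -> : (i.+1 == m) = false by apply/eqP => im; move: mi; rewrite -im ltnn.
    case: eqP => [->|/eqP im]; first by rewrite B0.
    by apply: Bs; rewrite id ltn_neqAle eq_sym im mi.
  - move=> i j /andP[mi id] ji; case: eqP => [im|/eqP im]; first by apply: Pg; rewrite -im.
    by apply: Bg => //; rewrite id ltn_neqAle eq_sym im mi.
have [|B [_ Bp Bs Bg]] := key d 0%N P (add0n d) Pp Ps; first by [].
by exists B; split.
Qed.

(** By descending induction on m from the maximal ideal, the first [m] generators generate the prime
    [B m] of the flag, and [cic_step] lifts complete integral closedness; m = 0 is the ring
    itself. *)
Lemma regular_cic : regular_local_ring R -> prime_ideal [set (0 : R)] /\ cic [set (0 : R)].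
Proof.
move=> [_ [d [g [[Pch _] Mg']]]]; have Mg : M = spanned g := Mg'.
have [B [Bp Bs Bg]] := regular_flag Mg Pch.
have Jid m : ring_ideal (J g m).
  split.
  - by exists (fun=> 0); rewrite big1 // => i _; rewrite mul0r.
  - move=> _ _ [c ->] [c' ->]; exists (fun i => c i + c' i); rewrite -big_split.
    by apply: eq_bigr => i _; rewrite mulrDl.
  - move=> a _ [c ->]; exists (fun i => a * c i); rewrite mulr_sumr.
    by apply: eq_bigr => i _; rewrite mulrA.
have JB m : (m <= d)%N -> J g m `<=` B m.
  move=> md _ [c ->]; have [Bid _ _] := Bp m md; apply: ring_ideal_sum => // i im.
  by have [_ _ BM] := Bid; apply: BM; exact: Bg.
have key e : forall m, (m + e = d)%N -> B m = J g m /\ cic (J g m).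
  elim: e => [m|e IH m me].
    rewrite addn0 => ->; have JM : J g d = M.
      rewrite Mg; apply/seteqP; split=> _ [c ->]; exists c; last by apply: eq_bigl => i; rewrite ltn_ord.
      by apply: eq_bigl => i; rewrite ltn_ord.
    split.
      apply/seteqP; split; last exact: JB.
      by rewrite JM; apply: prime_nonunits; exact: Bp.
    rewrite JM => a b c nb _ _.
    have [b' bb'] : isunit b by apply: contrapT.
    by exists (b' * a); rewrite mulrA bb' mul1r subrr; exact: nunit0.
  have md : (m < d)%N by rewrite -me -addSnnS leq_addr.
  have [BJ' cJ'] := IH m.+1 (etrans (addSnnS m e) me).
  set x := g (Ordinal md); have BSm := Bs m md.
  have J'E : J g m.+1 = [set r | exists j s, J g m j /\ r = j + x * s].
    apply/seteqP; split=> r.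
      move=> [c ->]; exists (\sum_(i < d | (i < m)%N) c i * g i), (c (Ordinal md)).
      split; first by exists c.
      rewrite (bigD1 (Ordinal md)) //= addrC [x * _]mulrC; congr (_ + _).
      apply: eq_bigl => i; rewrite ltnS [RHS]ltn_neqAle andbC; congr (_ && _).
    move=> [_ [s [[c ->] ->]]]; exists (fun i => if i == Ordinal md then s else c i).
    rewrite [RHS](bigD1 (Ordinal md)) //= eqxx addrC [x * _]mulrC; congr (_ + _).
    apply: eq_big => [i|i im]; last by rewrite (ltn_eqF im : i == Ordinal md = false).
    by rewrite ltnS [LHS]ltn_neqAle andbC; congr (_ && _).
  have xM : M x by rewrite Mg; exact: spanned_mem.
  have xu r : isunit (1 - x * r).
    by have [|//] := Rloc (x * r) => -[s e']; case: xM; exists (r * s); rewrite mulrA.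
  have nBx : ~ B m x.
    move=> Bx; case: BSm => _; apply; rewrite BJ' J'E => _ [j [s [Jj ->]]].
    have [[_ BD BM] _ _] := Bp m (ltnW md); apply: BD; first by apply: JB => //; exact: ltnW.
    by rewrite mulrC; exact: BM.
  (* An element of [B m] is in J_m + x B_m, since B_(m+1) = J_m + (x) and [x] is outside the prime
     [B m]; after iteration, Krull's intersection theorem puts it in J_m. *)
  have BJ : B m = J g m.
    apply/seteqP; split; last by apply: JB; exact: ltnW.
    move=> r Br; apply: (krull_int (Jid m) xu) => n.
    have [[_ BD BM] _ Bpr] := Bp m (ltnW md).
    suff [s [Js _]] : exists s, J g m (r - x ^+ n * s) /\ B m s by exists s.
    elim: n => [|n [s [Js Bs']]]; first by exists r; rewrite mul1r subrr; split=> //; case: (Jid m).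
    have [j [t [Jj sE]]] : exists j t, J g m j /\ s = j + x * t.
      have : B m.+1 s by case: BSm => + _; apply.
      by rewrite BJ' J'E.
    exists t; split; last first.
      have : B m (x * t).
        have -> : x * t = s - j by rewrite sE addrAC subrr add0r.
        apply: ring_idealB => //; first by have [] := Bp m (ltnW md).
        by apply: JB => //; exact: ltnW.
      by move=> /Bpr[].
    have -> : r - x ^+ n.+1 * t = (r - x ^+ n * s) + x ^+ n * j by rewrite sE exprSr; ring.
    by have [_ JD JM] := Jid m; apply: JD => //; exact: JM.
  split=> //; apply: (@cic_step _ x) => //.
  - by rewrite -BJ; apply: Bp; exact: ltnW.
  - by rewrite -BJ.
  - by rewrite -J'E -BJ'; exact: Bp.
  - by rewrite -J'E.
have J0 : J g 0 = [set 0].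
  apply/seteqP; split=> [_ [c ->]|_ ->]; first by rewrite big_pred0.
  by exists (fun=> 0); rewrite big_pred0.
have [B0 c0] := key d 0%N (add0n d); rewrite J0 in B0 c0; split=> //.
by rewrite -B0; exact: Bp.
Qed.

End Regular.
End CompletelyIntegrallyClosed.

(** * Finiteness and traces *)

Section HilbertBasis.

Lemma field_noetherian (F : fieldType) : noetherian F.
Proof.
move=> I [I0 ID IM]; have [[a Ia a0]|h] := EM (exists2 a, I a & a != 0).
  exists 1%N, (fun=> 1); apply/seteqP; split=> [b _|_ [c ->]].
    by exists (fun=> b); rewrite big_ord1 mulr1.
  by rewrite big_ord1 mulr1 -(mulr1 (c ord0)) -(mulVf a0) mulrA; exact: IM.
exists 0%N, (fun=> 0); apply/seteqP; split=> [b Ib|_ [c ->]]; last by rewrite big_ord0.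
exists (fun=> 0); rewrite big_ord0; apply/eqP; apply/negPn/negP => b0.
by apply: h; exists b.
Qed.

(** Hilbert's argument: each f_m is an element of [I] of least size outside the span of the previous
    ones; once the leading coefficients of f_0, ..., f_(m-1) generate that of f_m, cancelling it
    gives a smaller element outside the span. *)
Lemma poly_noetherian (R : comNzRingType) : noetherian R -> noetherian {poly R}.
Proof.
move=> Rn I Iid; apply: contrapT => nI; have [I0 ID IM] := Iid.
pose Sp (s : seq {poly R}) := spanned (fun i : 'I_(size s) => nth 0 s i).
have /choice[pick pickP] : forall s : seq {poly R}, exists p, (forall f, f \in s -> I f) ->
    [/\ I p, ~ Sp s p & forall q, I q -> ~ Sp s q -> (size p <= size q)%N].
  move=> s; have [sI|nsI] := EM (forall f, f \in s -> I f); last by exists 0.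
  have [p0 [Ip0 Sp0]] : exists p, I p /\ ~ Sp s p.
    apply: contrapT => h; apply: nI; exists (size s), (fun i : 'I_(size s) => nth 0 s i).
    apply/seteqP; split=> [p Ip|]; first by apply: contrapT => np; apply: h; exists p.
    by apply: spanned_sub => // i; apply: sI; exact: mem_nth.
  pose Q m := `[< exists2 p, I p /\ ~ Sp s p & size p = m >].
  have exQ : exists m, Q m by exists (size p0); apply/asboolP; exists p0.
  case: (ex_minnP exQ) => m /asboolP[p [Ip np] pm] mmin; exists p => _; split=> // q Iq nq.
  by rewrite pm; apply: mmin; apply/asboolP; exists q.
pose fix s (m : nat) : seq {poly R} := if m is m'.+1 then rcons (s m') (pick (s m')) else [::].
pose f m := pick (s m).
have sE m : s m = mkseq f m by elim: m => [//|m IH]; rewrite /= {1}IH -mkseqS.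
have sI m : forall g, g \in s m -> I g.
  elim: m => [//|m IH] g /=; rewrite mem_rcons inE => /orP[/eqP ->|/IH//].
  by have [] := pickP _ IH.
have fP m : [/\ I (f m), ~ Sp (s m) (f m) &
    forall q, I q -> ~ Sp (s m) q -> (size (f m) <= size q)%N] := pickP _ (sI m).
have sf m i : (i < m)%N -> (s m)`_i = f i by move=> im; rewrite sE nth_mkseq.
have SpE m g : Sp (s m) g <-> exists c : nat -> {poly R}, g = \sum_(i < m) c i * f i.
  have sz : size (s m) = m by rewrite sE size_mkseq.
  split=> [[c ->]|[c ->]].
    exists (fun i => if insub i is Some j then c j else 0).
    rewrite -(big_mkord xpredT (fun i => (if insub i is Some j then c j else 0) * f i)).
    rewrite -[X in \sum_(0 <= i < X) _]sz big_mkord; apply: eq_bigr => i _.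
    by rewrite valK sf // -[X in (_ < X)%N]sz.
  exists (fun i => c i); rewrite -(big_mkord xpredT (fun i => c i * f i)).
  rewrite -[X in \sum_(0 <= i < X) _]sz big_mkord; apply: eq_bigr => i _.
  by rewrite sf // -[X in (_ < X)%N]sz.
have fmono i m : (i <= m)%N -> (size (f i) <= size (f m))%N.
  move=> im; have [_ _ fmin] := fP i; have [Im nm _] := fP m; apply: fmin => //.
  move=> /SpE[c e]; apply: nm; apply/SpE; exists (fun j => if (j < i)%N then c j else 0).
  rewrite e -(subnKC im) big_split_ord /= [X in _ = _ + X]big1 ?addr0 => [|j _].
    by apply: eq_bigr => j _; rewrite ltn_ord.
  by rewrite ltnNge leq_addr mul0r.
pose K m := [set a : R | exists c : nat -> R, a = \sum_(i < m) c i * lead_coef (f i)].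
have [||m Km] := @noeth_acc R Rn K.
- move=> m; split.
  + by exists (fun=> 0); rewrite big1 // => i _; rewrite mul0r.
  + move=> _ _ [c ->] [c' ->]; exists (fun i => c i + c' i); rewrite -big_split.
    by apply: eq_bigr => i _; rewrite mulrDl.
  + move=> a _ [c ->]; exists (fun i => a * c i); rewrite mulr_sumr.
    by apply: eq_bigr => i _; rewrite mulrA.
- move=> m _ [c ->]; exists (fun i => if (i < m)%N then c i else 0).
  rewrite big_ord_recr /= ltnn mul0r addr0.
  by apply: eq_bigr => i _; rewrite ltn_ord.
have [c cE] : K m (lead_coef (f m)).
  apply: (Km m.+1); exists (fun i => (i == m)%:R).
  rewrite big_ord_recr /= eqxx mul1r big1 ?add0r // => i _.
  by rewrite ltn_eqF // mul0r.
have [Im nm fmin] := fP m.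
have fm0 : f m != 0.
  apply/eqP => f0; apply: nm; rewrite f0; apply/SpE; exists (fun=> 0).
  by rewrite big1 // => i _; rewrite mul0r.
pose g := \sum_(i < m) (c i *: 'X^(size (f m) - size (f i))) * f i.
have gE : (f m)`_(size (f m)).-1 = g`_(size (f m)).-1.
  rewrite -lead_coefE cE coef_sum; apply: eq_bigr => i _.
  rewrite -scalerAl coefZ coefXnM.
  have [fi0|fi0] := eqVneq (f i) 0; first by rewrite fi0 lead_coef0 coef0 if_same.
  have h := fmono i m (ltnW (ltn_ord i)).
  have hi : (0 < size (f i))%N by rewrite size_poly_gt0.
  rewrite ltnNge -[X in (_ <= X)%N]subn1 leq_sub2l //=.
  have aux u v : (0 < u)%N -> (u <= v)%N -> u.-1 = (v.-1 - (v - u))%N by lia.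
  by rewrite lead_coefE; congr (_ * (f i)`_ _); exact: aux.
have := fmin (f m - g); rewrite leqNgt => /(_ _ _)/negP; apply.
- apply: ring_idealB => //; apply: ring_ideal_sum => // i _.
  by apply: IM; have [] := fP i.
- move=> /SpE[d dE]; apply: nm; apply/SpE.
  exists (fun i => d i + c i *: 'X^(size (f m) - size (f i))).
  rewrite -[LHS](subrK g) dE -big_split; apply: eq_bigr => i _.
  by rewrite /= mulrDl.
rewrite ltnNge; apply/negP => le.
have szg : (size g <= size (f m))%N.
  rewrite (leq_trans (size_sum _ _ _)) //; apply/bigmax_leqP => i _.
  rewrite (leq_trans (size_polyMleq _ _)) //.
  have h := fmono i m (ltnW (ltn_ord i)).
  have := size_scale_leq (c i) 'X^(size (f m) - size (f i)).
  have aux u v w : (u <= v)%N -> (w <= (v - u).+1)%N -> ((w + u).-1 <= v)%N by lia.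
  by rewrite size_polyXn => /(aux _ _ _ h).
have szD : (size (f m - g)%R <= size (f m))%N.
  by rewrite (leq_trans (size_polyD _ _)) // size_polyN geq_max leqnn.
have sz : size (f m - g) = size (f m) by apply/eqP; rewrite eqn_leq szD.
have nz : f m - g != 0 by rewrite -size_poly_gt0 sz size_poly_gt0.
have := nz; rewrite -lead_coef_eq0 lead_coefE sz coefB gE subrr.
by rewrite eqxx.
Qed.

(** [Q] is an iterated polynomial ring over [F] and [f] the evaluation at [y]; ideals of the subring
    generated by [y] will be studied through their inverse images in [Q]. *)
Lemma fingen_noetherian (F : fieldType) (A : comNzRingType) (h : {rmorphism F -> A})
    m (y : 'I_m -> A) :
  exists (Q : comNzRingType) (f : {rmorphism Q -> A}),
    [/\ noetherian Q, forall c, exists q, f q = h c, forall i, exists q, f q = y i &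
      forall S, subring S -> (forall c, S (h c)) -> (forall i, S (y i)) -> forall q, S (f q)].
Proof.
elim: m y => [|m IH] y.
  by exists F, h; split=> [|c|[]//|S Ss Sh _ q]; [exact: field_noetherian|exists c|].
have [Q [f [Qn fF fy fS]]] := IH (fun i => y (widen_ord (leqnSn m) i)).
have cfy : commr_rmorph f (y ord_max) by move=> a; exact: mulrC.
exists {poly Q}, (horner_morph cfy); split; first exact: poly_noetherian.
- by move=> c; have [q <-] := fF c; exists q%:P; rewrite /= horner_morphC.
- move=> i; case: (unliftP ord_max i) => [j ->|->]; last by exists 'X; rewrite /= horner_morphX.
  have [q qE] := fy j; exists q%:P; rewrite /= horner_morphC qE; congr y; apply: val_inj.
  by rewrite /= /bump leqNgt ltn_ord.
move=> S Ss Sh Sy q; elim/poly_ind: q => [|p c Sp]; first by rewrite rmorph0; exact: subring0.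
rewrite rmorphD rmorphM /= horner_morphX horner_morphC; apply: subringD => //.
  by apply: subringM => //; exact: Sy.
by apply: fS.
Qed.

End HilbertBasis.

(** * Traces of matrices whose powers have a common denominator *)

Section Trace.

Definition setrow (K : Type) n (A : 'M[K]_n) (j : 'I_n) (r : 'rV[K]_n) : 'M[K]_n :=
  \matrix_(s, t) (if s == j then r 0 t else A s t).

(** Expand each determinant along its new row; in the sum over the rows the cofactors recombine into
    the product of the adjugate of [A] with [A]. *)
Lemma sum_det_setrow (K : comNzRingType) n (A M : 'M[K]_n) :
  \sum_j \det (setrow A j (row j (A *m M))) = \det A * \tr M.
Proof.
have e j : \det (setrow A j (row j (A *m M))) = \sum_l \sum_s M s l * (A j s * cofactor A j l).
  rewrite (expand_det_row _ j); apply: eq_bigr => l _; rewrite !mxE eqxx mulr_suml.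
  apply: eq_bigr => s _; rewrite mulrA [M s l * _]mulrC; congr (_ * _).
  rewrite /cofactor; congr (_ * \det _); apply/matrixP => u v; rewrite !mxE.
  by rewrite eq_sym (negbTE (neq_lift _ _)).
rewrite (eq_bigr _ (fun j _ => e j)) exchange_big /= /mxtrace mulr_sumr.
under eq_bigr do rewrite exchange_big.
rewrite [LHS]exchange_big /=; apply: eq_bigr => s _.
have f l : \sum_j M s l * (A j s * cofactor A j l) = M s l * (\det A *+ (l == s)).
  rewrite -mulr_sumr; congr (_ * _); have /matrixP/(_ l s) := mul_adj_mx A.
  by rewrite !mxE => <-; apply: eq_bigr => j _; rewrite !mxE mulrC.
rewrite (eq_bigr _ (fun l _ => f l)) (bigD1 s) //= eqxx mulr1n mulrC big1 ?addr0 //.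
by move=> l /negbTE ->; rewrite mulr0n mulr0.
Qed.

Variables (R K : comNzRingType) (h : {rmorphism R -> K}).
Hypothesis h_inj : injective h.
Hypothesis R_dom : prime_ideal [set (0 : R)].
Hypothesis R_cic : cic [set (0 : R)].
Hypothesis K_unit : forall z : K, z <> 0 -> isunit z.
Hypothesis K_frac : forall z : K, exists a b, b <> 0 /\ h b * z = h a.

Lemma common_denom (I : finType) (z : I -> K) :
  exists2 b, b <> 0 & forall i, exists a, h b * z i = h a.
Proof.
have [_ _ dom] := R_dom.
have /choice[w wP] : forall i, exists w : R * R, w.2 <> 0 /\ h w.2 * z i = h w.1.
  by move=> i; have [a [b ab]] := K_frac (z i); exists (a, b).
exists (\prod_i (w i).2).
  elim/big_ind: _ => [|x y x0 y0 /dom[/x0|/y0]//|i _]; last by case: (wP i).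
  by move/eqP; rewrite oner_eq0.
move=> i; exists (\prod_(j | j != i) (w j).2 * (w i).1).
by rewrite (bigD1 i) //= !rmorphM; case: (wP i) => _ <-; ring.
Qed.

(* The trace of M acts on K^n /\ ... /\ K^n as the derivation induced by M;
   the powers of M have a common denominator c, hence those of the trace have
   the common denominator c^n. *)
Lemma trace_cic n (M : 'M[K]_n) m (E : 'I_m -> 'M[K]_n) (Mp : nat -> 'M[K]_n) :
  Mp 0%N = 1%:M -> (forall l, Mp l.+1 = Mp l *m M) ->
  (forall l, exists r, Mp l = \sum_i h (r i) *: E i) ->
  exists a, \tr M = h a.
Proof.
move=> Mp0 MpS MpE.
have [c c0 cE] := common_denom (fun x : 'I_m * 'I_n * 'I_n => E x.1.1 x.1.2 x.2).
have cM l i j : exists a, h c * Mp l i j = h a.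
  have [r ->] := MpE l; have /choice[a aP] := fun t => cE (t, i, j).
  exists (\sum_t r t * a t); rewrite summxE mulr_sumr rmorph_sum; apply: eq_bigr => t _.
  by rewrite rmorphM -aP !mxE mulrCA.
(* Row vectors whose images under all powers of [M] have the denominator [c]: a set stable under [M]
   that contains the standard basis. *)
pose W (v : 'rV[K]_n) := forall l i, exists a, h c * (v *m Mp l) 0 i = h a.
have MpSl l : M *m Mp l = Mp l *m M.
  elim: l => [|l IH]; first by rewrite Mp0 mulmx1 mul1mx.
  by rewrite MpS mulmxA IH.
have WM v : W v -> W (v *m M) by move=> Wv l i; rewrite -mulmxA MpSl -MpS; exact: Wv.
have key l (A : 'M[K]_n) : (forall i, W (row i A)) ->
    exists a, h c ^+ n * (\det A * \tr M ^+ l) = h a.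
  elim: l A => [|l IH] A WA.
    have /choice[a aP] : forall x : 'I_n * 'I_n, exists a, h c * A x.1 x.2 = h a.
      by move=> [i j]; have := WA i 0%N j; rewrite Mp0 mulmx1 !mxE.
    exists (\det (\matrix_(i, j) a (i, j))).
    rewrite mulr1 -detZ -det_map_mx; congr (\det _); apply/matrixP => i j.
    by rewrite !mxE -aP.
  rewrite exprS [\det A * _]mulrA -sum_det_setrow mulr_suml mulr_sumr.
  have /choice[a aP] : forall j, exists a, h c ^+ n *
      (\det (setrow A j (row j (A *m M))) * \tr M ^+ l) = h a.
    move=> j; apply: IH => i.
    have [->|ij] := eqVneq i j.
      have -> : row j (setrow A j (row j (A *m M))) = row j A *m M.
        by apply/rowP => t; rewrite -row_mul !mxE eqxx.
      exact: WM.
    have -> : row i (setrow A j (row j (A *m M))) = row i A.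
      by apply/rowP => t; rewrite !mxE (negbTE ij).
    exact: WA.
  by exists (\sum_j a j); rewrite rmorph_sum; apply: eq_bigr => j _.
have [a [b [b0 ab]]] := K_frac (\tr M).
have [_ _ dom] := R_dom.
have [||| r] := R_cic (a := a) (b := b) (c := c ^+ n).
- exact: b0.
- elim: (n) => [/eqP|l IH]; first by rewrite oner_eq0.
  by rewrite exprS => /dom[/c0|/IH].
- move=> l; have [|r rE] := key l 1%:M.
    move=> i t j; rewrite -row_mul mul1mx mxE; exact: cM.
  exists r; apply/eqP; rewrite subr_eq0; apply/eqP; apply: h_inj.
  rewrite !rmorphM !rmorphXn -rE det1 mul1r -ab exprMn; ring.
move=> /eqP; rewrite subr_eq0 => /eqP aE; exists r.
have [b' bb'] : isunit (h b).
  by apply: K_unit => hb0; apply: b0; apply: h_inj; rewrite hb0 rmorph0.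
by rewrite -[LHS]mul1r -bb' mulrAC ab aE rmorphM mulrAC bb' mul1r.
Qed.

End Trace.

(** * Integral algebras over local rings *)

Section IntegralNakayama.
Variables (B : comNzRingType) (A : set B).
Hypothesis As : subring A.

Definition integral_elt (c : B) := exists d (q : 'I_d -> B),
  (forall k, A (q k)) /\ c ^+ d = \sum_k q k * c ^+ k.

Definition gen_subring (I : Type) (b : I -> B) : set B :=
  [set s | forall S, subring S -> A `<=` S -> (forall i, S (b i)) -> S s].

Definition lspan (I : finType) (mu : I -> B) : set B :=
  [set s | exists2 c : I -> B, (forall i, A (c i)) & s = \sum_i c i * mu i].

Lemma integral_unit_lead u c d (q : 'I_d -> B) : A u ->
  (forall a b, A a -> a * b = 1 -> A b) -> isunit u ->
  (forall k, A (q k)) -> u * c ^+ d = \sum_k q k * c ^+ k -> integral_elt c.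
Proof.
move=> Au Ainv [w uw] Aq e; have Aw := Ainv _ _ Au uw.
exists d, (fun k => w * q k); split=> [k|]; first exact: subringM.
rewrite -[LHS]mul1r -uw mulrAC mulrC e mulr_sumr.
by apply: eq_bigr => k _; rewrite mulrA.
Qed.

Lemma subring_det n (M : 'M[B]_n) : (forall i j, A (M i j)) -> A (\det M).
Proof.
move=> AM; rewrite /determinant; apply: subring_sum => // s _; apply: subringM => //.
  by apply: subringX => //; apply: subringN => //; case: As.
by apply: subring_prod => // i _.
Qed.

Lemma subring_adj n (M : 'M[B]_n) i j : (forall i j, A (M i j)) -> A ((\adj M) i j).
Proof.
move=> AM; rewrite !mxE; apply: subringM => //.
  by apply: subringX => //; apply: subringN => //; case: As.
by apply: subring_det => s t; rewrite !mxE.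
Qed.

Section Adjoin.
Variables (C : set B) (b : B) (d : nat) (q : 'I_d.+1 -> B).
Hypothesis Cs : subring C.
Hypothesis Cq : forall k, C (q k).
Hypothesis bq : b ^+ d.+1 = \sum_k q k * b ^+ k.

(** The polynomials in [b] of degree at most [d] over [C]; they form a ring because [b] satisfies a
    monic equation of degree d + 1. *)
Definition adjoin : set B :=
  [set s | exists2 c : 'I_d.+1 -> B, (forall k, C (c k)) & s = \sum_k c k * b ^+ k].

Lemma adjoinD s t : adjoin s -> adjoin t -> adjoin (s + t).
Proof.
move=> [c Cc ->] [c' Cc' ->]; exists (fun k => c k + c' k) => [k|].
  exact: subringD.
by rewrite -big_split; apply: eq_bigr => k _; rewrite mulrDl.
Qed.

Lemma adjoinZ a s : C a -> adjoin s -> adjoin (a * s).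
Proof.
move=> Ca [c Cc ->]; exists (fun k => a * c k) => [k|]; first exact: subringM.
by rewrite mulr_sumr; apply: eq_bigr => k _; rewrite mulrA.
Qed.

Lemma adjoin_sum (J : Type) (r : seq J) (P : pred J) (F : J -> B) :
  (forall i, P i -> adjoin (F i)) -> adjoin (\sum_(i <- r | P i) F i).
Proof.
move=> PF; elim/big_rec: _ => [|i x Pi ax]; last by apply: adjoinD => //; exact: PF.
exists (fun=> 0) => [_|]; first exact: subring0.
by rewrite big1 // => k _; rewrite mul0r.
Qed.

Lemma adjoinX_low e : (e <= d)%N -> adjoin (b ^+ e).
Proof.
move=> ed; have ed' : (e < d.+1)%N by [].
exists (fun k => (k == Ordinal ed')%:R) => [k|].
  by case: eqP => _; [case: Cs|exact: subring0].
rewrite (bigD1 (Ordinal ed')) //= eqxx mul1r big1 ?addr0 // => k /negbTE ->.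
by rewrite mul0r.
Qed.

Lemma adjoin1 : adjoin 1.
Proof. by rewrite -(expr0 b); exact: adjoinX_low. Qed.

Lemma adjoin_mulb s : adjoin s -> adjoin (b * s).
Proof.
move=> [c Cc ->]; rewrite mulr_sumr big_ord_recr /=.
have e k : b * (c k * b ^+ k) = c k * b ^+ k.+1 by rewrite exprS mulrCA.
rewrite e bq; apply: adjoinD.
  apply: adjoin_sum => k _; rewrite e.
  exists (fun l : 'I_d.+1 => if l == k.+1 :> nat then c (widen_ord (leqnSn d) k) else 0) => [l|].
    by case: eqP => _; [|exact: subring0].
  have kd : (k.+1 < d.+1)%N by rewrite ltnS.
  rewrite (bigD1 (Ordinal kd)) //= eqxx big1 ?addr0 // => l lk.
  by case: eqP => [lk'|_]; [case/eqP: lk; apply: val_inj|rewrite mul0r].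
by apply: adjoinZ => //; exists q.
Qed.

Lemma adjoinX e : adjoin (b ^+ e).
Proof. by elim: e => [|e IH]; [exact: adjoin1|rewrite exprS; exact: adjoin_mulb]. Qed.

Lemma adjoin_subring : subring adjoin.
Proof.
have N s t : adjoin s -> adjoin t -> adjoin (s - t).
  move=> as_ at_; apply: adjoinD => //; rewrite -mulN1r; apply: adjoinZ => //.
  by apply: subringN => //; case: Cs.
split=> //; first exact: adjoin1.
move=> _ _ [c Cc ->] [c' Cc' ->]; rewrite mulr_suml; apply: adjoin_sum => k _.
rewrite mulr_sumr; apply: adjoin_sum => l _; rewrite mulrACA -exprD.
by apply: adjoinZ; [exact: subringM|exact: adjoinX].
Qed.

End Adjoin.

Lemma fin_subring r (b : 'I_r -> B) : (forall j, integral_elt (b j)) ->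
  exists (I : finType) (mu : I -> B), [/\ subring (lspan mu), A `<=` lspan mu &
    forall j, lspan mu (b j)].
Proof.
elim: r b => [|r IH] b bi.
  have e : lspan (fun _ : 'I_1 => 1) = A.
    apply/seteqP; split=> [_ [c Ac ->]|a Aa]; first by rewrite big_ord1 mulr1.
    by exists (fun=> a) => //; rewrite big_ord1 mulr1.
  by exists 'I_1, (fun=> 1); rewrite e; split=> // -[].
have [I [mu [Cs AC Cb]]] := IH (fun j => b (widen_ord (leqnSn r) j)) (fun j => bi _).
have [[|d] [q [Aq bq]]] := bi ord_max.
  by move: bq => /eqP; rewrite expr0 big_ord0 oner_eq0.
pose nu (x : I * 'I_d.+1) := mu x.1 * b ord_max ^+ x.2.
have E : lspan nu = adjoin (lspan mu) (b ord_max) d.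
  apply/seteqP; split=> [_ [c Ac ->]|_ [c Cc ->]].
    exists (fun k => \sum_i c (i, k) * mu i) => [k|]; first by exists (fun i => c (i, k)).
    have -> : \sum_i c i * nu i = \sum_i \sum_k c (i, k) * nu (i, k).
      by rewrite pair_bigA; apply: eq_bigr => -[].
    rewrite exchange_big /=.
    by apply: eq_bigr => k _; rewrite mulr_suml; apply: eq_bigr => i _; rewrite /nu mulrA.
  have /choice[a aP] : forall k, exists a : I -> B, (forall i, A (a i)) /\
      c k = \sum_i a i * mu i by move=> k; have [a Aa e] := Cc k; exists a.
  exists (fun x => a x.2 x.1) => [x|]; first by case: (aP x.2).
  have -> : \sum_x a x.2 x.1 * nu x = \sum_i \sum_k a k i * nu (i, k).
    by rewrite pair_bigA; apply: eq_bigr => -[].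
  rewrite exchange_big /=.
  apply: eq_bigr => k _; have [_ ->] := aP k; rewrite mulr_suml.
  by apply: eq_bigr => i _; rewrite /nu mulrA.
have Cq k : lspan mu (q k) by exact: AC.
have sub s : lspan mu s -> adjoin (lspan mu) (b ord_max) d s.
  by move=> Cs'; rewrite -(mulr1 s); apply: adjoinZ => //; exact: adjoin1.
exists (I * 'I_d.+1)%type, nu; rewrite E; split.
- exact: adjoin_subring.
- by move=> a /AC/sub.
- move=> j; case: (unliftP ord_max j) => [j' ->|->].
    apply: sub; have := Cb j'; congr (lspan _ (b _)); apply: val_inj.
    by rewrite /= /bump leqNgt ltn_ord.
  by have := adjoinX Cs Cq bq 1%N; rewrite expr1.
Qed.

Hypothesis Ainv : forall a b, A a -> a * b = 1 -> A b.
Hypothesis Bint : forall c, integral_elt c.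
Hypothesis Bloc : ring_ideal (nonunits B).
Variables (r : nat) (b : 'I_r -> B) (t : B).
Hypothesis Bgen : forall c, exists s1 s2,
  [/\ isunit s2, s2 * c = s1, gen_subring b s1 & gen_subring b s2].
Hypothesis At : A t.
Hypothesis nt : ~ isunit t.
Hypothesis Bt : forall c, exists a e, A a /\ c = a + t * e.

(* A fraction s1 / s2 of elements of the finite A-algebra A[b] is in A[b],
   because 1 / s2 is integral over A; so B = A[b] is finite over A. *)
Lemma integral_nakayama c : A c.
Proof.
have [I [mu [Cs AC Cb]]] := fin_subring (fun j => Bint (b j)).
(* The integral equation of the inverse s', multiplied by s^d, expresses s' as a polynomial in [s]
   over [A]. *)
have C_inv s s' : lspan mu s -> s * s' = 1 -> lspan mu s'.
  move=> Cs1 ss'; have [[|d] [q [Aq e]]] := Bint s'.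
    by move: e => /eqP; rewrite expr0 big_ord0 oner_eq0.
  have -> : s' = \sum_(k < d.+1) q k * s ^+ (d - k).
    have -> : s' = s ^+ d * s' ^+ d.+1 by rewrite exprSr mulrA -exprMn ss' expr1n mul1r.
    rewrite e mulr_sumr; apply: eq_bigr => k _; rewrite mulrCA; congr (_ * _).
    by rewrite -{1}(subnK (leq_ord k)) exprD -mulrA -exprMn ss' expr1n mulr1.
  apply: subring_sum => // k _; apply: subringM => //; first exact: AC.
  exact: subringX.
have CT s : lspan mu s.
  have [s1 [s2 [[s3 s23] e g1 g2]]] := Bgen s.
  have -> : s = s3 * s1 by rewrite -e mulrA [s3 * s2]mulrC s23 mul1r.
  by apply: subringM => //; [apply: C_inv s23; exact: g2|exact: g1].
pose n := #|I|; pose nu (i : 'I_n) := mu (enum_val i).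
have CE s : exists2 m : 'I_n -> B, (forall j, A (m j)) & s = \sum_j m j * nu j.
  have [m Am ->] := CT s; exists (fun j => m (enum_val j)) => [j|]; first exact: Am.
  rewrite [LHS](@reindex _ _ _ _ _ (fun j : 'I_n => enum_val j)) //=.
  by exists enum_rank => i _; rewrite ?enum_valK ?enum_rankK.
have /choice[w wP] : forall i, exists w : B * ('I_n -> B),
    [/\ A w.1, forall j, A (w.2 j) & nu i = w.1 + t * \sum_j w.2 j * nu j].
  move=> i; have [a [e [Aa ->]]] := Bt (nu i); have [m Am ->] := CE e.
  by exists (a, m).
(* This matrix is the identity modulo the maximal ideal, so its determinant is a unit of [B]; as the
   determinant is in [A], so is its inverse, by [Ainv]. *)
pose M : 'M[B]_n := \matrix_(i, j) ((i == j)%:R - t * (w i).2 j).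
have AM i j : A (M i j).
  rewrite !mxE; case: As => A1 AB AM'; apply: AB; last by apply: AM' => //; case: (wP i).
  by case: eqP => _; [|exact: subring0].
have Mnu i : \sum_j M i j * nu j = (w i).1.
  rewrite (eq_bigr (fun j => (i == j)%:R * nu j - t * ((w i).2 j * nu j))); last first.
    by move=> j _; rewrite !mxE mulrBl mulrA.
  rewrite sumrB -mulr_sumr (bigD1 i) //= eqxx mul1r big1 ?addr0; last first.
    by move=> j ji; rewrite eq_sym (negbTE ji) mul0r.
  by case: (wP i) => _ _ {1}->; rewrite addrK.
have [d Md] : isunit (\det M).
  apply: contrapT => nM; have [_ ND NM] := Bloc.
  have : nonunits B (\det M - \prod_(i < n) 1).
    rewrite -det_diag; apply: det_cong => // i j; rewrite !mxE.
    rewrite -[1 *+ _]/((i == j)%:R) addrAC subrr add0r -mulrN mulrC; exact: NM.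
  rewrite big1 // => nM1.
  have := ND _ _ (NM (-1) _ nM1) nM; apply.
  by exists 1; rewrite mulr1; ring.
have Ad := Ainv (subring_det AM) Md.
have Anu i : A (nu i).
  have := det_trick Mnu i => e; rewrite -[nu i]mul1r -Md mulrAC mulrC e.
  apply: subringM => //; apply: subring_sum => // j _; apply: subringM => //.
    exact: subring_adj.
  by case: (wP j).
have [m Am ->] := CE c; apply: subring_sum => // j _; exact: subringM.
Qed.

End IntegralNakayama.

(** * The parameter of the curve *)

(** Multiplication by [t] is an injective endomorphism of [A] and sends 1 tensor b to 1 tensor tb =
    0; by flatness 1 tensor b is zero, that is, [b] is zero. *)
Lemma flat_nzd (A B : comNzRingType) (f : {rmorphism A -> B}) (t : A) : flat_ring f ->
  (forall x, t * x = 0 -> x = 0) -> forall b, f t * b = 0 -> b = 0.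
Proof.
move=> ff tnz b tb.
pose g : A^o -> A^o := fun x => t * x.
have gl : linear g by move=> a x y; rewrite /g mulrDr; congr (_ + _); exact: mulrCA.
pose gL : {linear A^o -> A^o} := HB.pack g (GRing.isLinear.Build _ _ _ _ g gl).
have ginj : injective gL.
  move=> x y /eqP; rewrite -subr_eq0 -raddfB => /eqP /tnz/eqP.
  by rewrite subr_eq0 => /eqP.
have tz : tensor_zero f (fun i : 'I_1 => gL ((fun=> 1) i)) (fun=> b).
  move=> Z beta [bD bD' bZ]; rewrite big_ord1.
  have -> : gL 1 = t *: (1 : A^o) by [].
  rewrite bZ tb; have := bD' 1 0 0; rewrite addr0 => /esym/eqP.
  by rewrite -subr_eq0 addrK => /eqP.
have hb : balanced f (fun (m : A^o) c => f m * c).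
  split=> [m m' c|m c c'|a m c]; [by rewrite rmorphD mulrDl|by rewrite mulrDr|].
  by rewrite rmorphM mulrA [f a * _]mulrC.
have := ff _ _ gL ginj 1%N (fun=> 1) (fun=> b) tz B _ hb.
by rewrite big_ord1 rmorph1 mul1r.
Qed.

Section Reduced.
Variables (k : fieldType) (X : scheme k).
Hypothesis Xred : reduced_scheme X.

(** On an affine set, a section that is nowhere invertible is nilpotent. *)
Lemma reduced_zero (O : set X) s : open O -> reg_on O s ->
  (forall z, O z -> ~ isunit (s z)) -> forall z, O z -> s z = 0.
Proof.
move=> oO rs ns z Oz; have [U aU Uz] := scheme_affine z.
have [t [rt tz tO]] := aff_basis aU oO Uz Oz.
have [||n sn] := @aff_nil _ _ _ (Dset_affine aU rt) s.
- by move=> y /tO/rs.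
- by move=> y /tO/ns.
exact: Xred (sn z tz).
Qed.

End Reduced.

Section Constants.
Variables (k : fieldType) (X : scheme k) (x0 : X).

Fact csec_additive : additive (@csec k X x0).
Proof.
by move=> c d; apply: functional_extensionality_dep => x; rewrite /csec scalerBl.
Qed.

Fact csec_multiplicative : multiplicative (@csec k X x0).
Proof.
split; last by apply: functional_extensionality_dep => x; rewrite /csec scale1r.
move=> c d; apply: functional_extensionality_dep => x.
by rewrite /csec -scalerA -mulr_algl.
Qed.

HB.instance Definition _ := GRing.isAdditive.Build k (psec x0) (@csec k X x0) csec_additive.
HB.instance Definition _ :=
  GRing.isMultiplicative.Build k (psec x0) (@csec k X x0) csec_multiplicative.

Definition csecr : {rmorphism k -> psec x0} := @csec k X x0.

End Constants.

Section Curve.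
Variables (k : fieldType) (T : scheme k).

(** [tau] lifts the parameter [eps] of the first infinitesimal neighbourhood. The maximal ideal at
    t0 is then (tau) plus its own square, and Nakayama makes [tau] a generator. *)
Lemma curve_param (t0 : T) (D : scheme k) (j : mor D T) (eps : forall d : D, stk d) :
  noetherian (stk t0) -> first_inf_nbhd t0 j -> dual_param eps ->
  exists tau : forall t : T, stk t, [/\ reg t0 tau, forall d, pull j tau d = eps d,
    ~ isunit (tau t0) & forall c : stk t0, ~ isunit c -> exists c', c = c' * tau t0].
Proof.
move=> noe [[d0 Dd] jt jsurj jker] heps.
have e := jt d0; subst t0.
have [c0 jc0] := jsurj d0 (eps d0); have [tau rtau tauc] := reg_germ c0.
exists tau; split=> //.
- by move=> d; rewrite (Dd d) /pull tauc.
- move=> u; have [_ Me] := heps d0.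
  have : nonunits (stk d0) (eps d0) by rewrite Me; exists 1; rewrite mul1r.
  by apply; rewrite -jc0 -tauc; exact: isunit_rmorph.
have [Mid _ _] := nonunits_prime (@stk_local _ _ (j d0)).
have [n [g Mg]] := noe _ Mid; have [M0 MD MM] := Mid.
have gM i : nonunits (stk (j d0)) (g i) by rewrite Mg; exact: spanned_mem.
have /choice[w wP] : forall i, exists w : stk (j d0) * ('I_n -> stk (j d0)),
    (forall l, nonunits (stk (j d0)) (w.2 l)) /\
    1 * g i = w.1 * tau (j d0) + \sum_l w.2 l * g l.
  move=> i; have [_ Me] := heps d0.
  have : nonunits (stk d0) (fstk j d0 (g i)) by move=> /fstk_local; exact: gM.
  rewrite Me => -[c]; have [c1 <-] := jsurj d0 c; rewrite -jc0 -tauc -rmorphM => ec.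
  have /jker[m [u [v [uv E]]]] : fstk j d0 (g i - c1 * tau (j d0)) = 0.
    by rewrite rmorphB ec subrr.
  have /choice[f fP] : forall l, exists f : 'I_n -> stk (j d0), v l = \sum_s f s * g s.
    by move=> l; have [_] := uv l; rewrite Mg.
  exists (c1, fun s => \sum_l f l s * u l); split=> [s|] /=.
    by apply: ring_ideal_sum => // l _; apply: MM; case: (uv l).
  rewrite mul1r -[LHS](subrK (c1 * tau (j d0))) E addrC; congr (_ + _).
  under [RHS]eq_bigr do rewrite mulr_suml.
  rewrite exchange_big /=; apply: eq_bigr => l _; rewrite fP mulr_sumr.
  by apply: eq_bigr => s _; rewrite mulrA [u l * _]mulrC.
have [||d [b [dE db]]] := nakayama Mid (u := fun=> 1) (v := g)
   (a := fun i => (w i).1 * tau (j d0)) (c := fun i => (w i).2).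
- by move=> i l; case: (wP i).
- by move=> i; case: (wP i).
have [v dv] : isunit d.
  apply: contrapT => nd; rewrite big1 // in dE.
  have := MD _ _ (MM (-1) _ dE) nd; apply.
  by exists 1; rewrite mulr1; ring.
move=> c nc; have : nonunits (stk (j d0)) c by [].
rewrite Mg => -[f ->]; exists (\sum_i f i * (v * \sum_l b i l * (w l).1)).
rewrite mulr_suml; apply: eq_bigr => i _; rewrite -mulrA; congr (_ * _).
rewrite -[LHS]mul1r -dv mulrAC mulrC db -mulrA; congr (_ * _).
by rewrite mulr_suml; apply: eq_bigr => l _; rewrite mulrA.
Qed.

(* The residue fields of k[y] at t0 need not be known to be k: it is enough
   that the polynomials in the coordinates y that vanish at t0 are spanned by
   finitely many of them, all multiples of tau near t0. *)
Lemma curve_isolated (t0 : T) (tau : forall t : T, stk t) :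
  closed [set t0] -> finite_type_mor (to_Spec T) ->
  (forall c : stk t0, ~ isunit c -> exists c', c = c' * tau t0) -> reg t0 tau ->
  exists O : set T, [/\ open O, O t0 & forall t, O t -> t <> t0 -> isunit (tau t)].
Proof.
move=> ct0 ft tauM rtau; have [V [_ Vt [r [U [hU cov]]]]] := ft tt.
have [i _ Ui] : (\bigcup_(i in [set: 'I_r]) U i) t0 by rewrite -cov.
have [aU [m [g [rg gP]]]] := hU i.
have [Q [f [Qn fk fg fS]]] := fingen_noetherian (csecr t0) (fun i => g i : psec t0).
have Us := reg_on_subring t0 (U i).
have fU q : reg_on (U i) (f q).
  apply: (fS [set s : psec t0 | reg_on (U i) s]) => // c x _; exact: reg_const.
have fsurj (s : psec t0) : reg_on (U i) s -> exists q, eq_on (U i) s (f q).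
  move=> /gP[n [c [e [_ sE]]]].
  have /choice[a aP] : forall l, exists q, f q = csecr t0 (c l tt) by move=> l; exact: fk.
  have /choice[b bP] := fg.
  exists (\sum_l a l * \prod_s b s ^+ e l s) => x Ux; rewrite sE //.
  rewrite rmorph_sum psec_sum; apply: eq_bigr => l _; rewrite rmorphM psecM aP.
  rewrite rmorph_prod psec_prod; congr (_ * _); apply: eq_bigr => u _.
  by rewrite rmorphXn psecX bP.
pose I : set Q := [set q | ~ isunit ((f q : psec t0) t0)].
have [Mid _ _] := nonunits_prime (@stk_local _ _ t0); have [M0 MD MM] := Mid.
have Iid : ring_ideal I.
  split=> [|a b|a b]; rewrite /I /=; first by rewrite rmorph0; exact: nunit0.
    by rewrite rmorphD; exact: MD.
  by rewrite rmorphM; exact: MM.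
have [n [q Iq]] := Qn _ Iid.
have /choice[h hP] : forall l, exists h : psec t0, reg t0 h /\
    (f (q l) : psec t0) t0 = h t0 * tau t0.
  move=> l; have [|c' e] := tauM ((f (q l) : psec t0) t0).
    have : I (q l) by rewrite Iq; exact: spanned_mem.
    exact.
  by have [h rh hc] := reg_germ c'; exists h; rewrite hc.
have near_ : \forall t \near t0, forall l, l \in enum 'I_n ->
    (f (q l) : psec t0) t = h l t * tau t.
  apply: near_all => l _; have [rh e] := hP l; apply: (reg_inj (x := t0)).
  - exact: fU.
  - exact: reg_mul.
  - exact: e.
have := near_ => /nbhs_interior/nbhs_singleton near0.
exists (interior (fun t => forall l, l \in enum 'I_n ->
    (f (q l) : psec t0) t = h l t * tau t) `&` U i); split=> //.
- by apply: openI; [exact: open_interior|exact: aff_open].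
move=> t [/interior_subset ht Ut] tt0; apply: contrapT => ntau.
have sub a : I a -> ~ isunit ((f a : psec t0) t).
  rewrite Iq => -[c ->]; rewrite rmorph_sum psec_sum; apply: nunit_sum => l _.
  rewrite rmorphM psecM ht ?mem_enum // mulrA => /isunitM[_ u]; exact: ntau.
have oV : open (~` [set t0]) by exact: closed_openC.
have [s [rs [_ us] sV]] := aff_basis aU oV Ut (tt0 : (~` [set t0]) t).
have [a sE] := fsurj _ rs; have [ua|na] := EM (isunit ((f a : psec t0) t0)).
  by have := sV t0; apply=> //; split=> //; rewrite sE.
by apply: (sub a na); rewrite -sE.
Qed.

End Curve.

(** * The trace-zero decomposition *)

Section Generic.
Variables (k : fieldType) (Y : scheme k).

Lemma generic_open (eta : Y) (O : set Y) y : generic_point eta -> open O -> O y -> O eta.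
Proof.
move=> ge oO Oy; have : closure [set eta] y by rewrite ge.
by move=> /(_ O (open_nbhs_nbhs (conj oO Oy)))[z [-> ]].
Qed.

Lemma generic_uniq (x x' : Y) : generic_point x -> generic_point x' -> x = x'.
Proof.
move=> gx gx'; have [U aU Ux] := scheme_affine x.
have Ux' := generic_open gx' (aff_open aU) Ux.
apply: (aff_sep aU Ux Ux') => s rs; split=> us.
  have : Dset U s x' := generic_open gx' (Dset_open (aff_open aU) rs) (conj Ux us).
  by case.
have : Dset U s x := generic_open gx (Dset_open (aff_open aU) rs) (conj Ux' us).
by case.
Qed.

Hypothesis Ydom : forall y : Y, prime_ideal [set (0 : stk y)].
Variable eta : Y.
Hypothesis geta : generic_point eta.

Lemma stk_dom (y : Y) (a b : stk y) : a * b = 0 -> a = 0 \/ b = 0.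
Proof. by case: (Ydom y) => _ _; apply. Qed.

(** If the germ is not invertible at the generic point, a representative is invertible nowhere,
    hence nilpotent, hence zero in a domain. *)
Lemma generic_unit (a : stk eta) : a <> 0 -> isunit a.
Proof.
move=> a0; apply: contrapT => na; have [U aU Ue] := scheme_affine eta.
have [s rs sa] := reg_germ a.
have [s1 [c [rs1 rc uc _ e]]] := aff_germ aU (aff_open aU) Ue Ue rs.
have ce : c eta * a = s1 eta by rewrite -sa; apply: e.
have [|m sm] := aff_nil aU rs1 (_ : forall x, U x -> ~ isunit (s1 x)).
  move=> x Ux u; apply: na.
  have : Dset U s1 eta := generic_open geta (Dset_open (aff_open aU) rs1) (conj Ux u).
  by move=> [_]; rewrite -ce => /isunitM[].
apply: a0; have : s1 eta = 0.
  have := sm _ Ue; elim: m {sm} => [/eqP|m IH]; first by rewrite oner_eq0.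
  by rewrite exprS => /stk_dom[|/IH].
rewrite -ce => /stk_dom[c0|//]; case: (@nunit0 (stk eta)); by rewrite -c0.
Qed.

Section Specialisation.
Variable y : Y.

(** The generisation map from the stalk at [y] to the function field. *)
Definition spec (a : stk y) : stk eta := sval (cid2 (reg_germ a)) eta.

Lemma near_generic (P : Y -> Prop) : (\forall z \near y, P z) -> P eta.
Proof.
move=> /nbhs_interior/nbhs_singleton Py.
exact: (@interior_subset _ P) (generic_open geta (open_interior _) Py).
Qed.

Lemma specE s : reg y s -> spec (s y) = s eta.
Proof.
move=> rs; rewrite /spec; case: cid2 => t /= rt ts.
exact: (near_generic (reg_inj rt rs ts)).
Qed.

Fact spec_additive : additive spec.
Proof.
move=> a b; have [s rs <-] := reg_germ a; have [t rt <-] := reg_germ b.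
by rewrite (specE rs) (specE rt) (specE (reg_sub rs rt)).
Qed.

Fact spec_multiplicative : multiplicative spec.
Proof.
split=> [a b|]; last exact: (specE (reg_1 y)).
have [s rs <-] := reg_germ a; have [t rt <-] := reg_germ b.
by rewrite (specE rs) (specE rt) (specE (reg_mul rs rt)).
Qed.

HB.instance Definition _ := GRing.isAdditive.Build _ _ spec spec_additive.
HB.instance Definition _ := GRing.isMultiplicative.Build _ _ spec spec_multiplicative.

Definition specr : {rmorphism stk y -> stk eta} := spec.

Lemma spec_inj : injective specr.
Proof.
move=> a b /eqP; rewrite -subr_eq0 -rmorphB => /eqP; set c := a - b => c0.
suff : c = 0 by move/eqP; rewrite subr_eq0 => /eqP.
have [s rs sc] := reg_germ c; rewrite -sc in c0 *; rewrite [specr _](specE rs) in c0.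
have [U aU Uy] := scheme_affine y; have Ue := generic_open geta (aff_open aU) Uy.
have [s1 [d [rs1 rd ud _ e]]] := aff_germ aU (aff_open aU) Uy Uy rs.
have s1e : s1 eta = 0.
  rewrite -e ?c0 ?mulr0 //.
  exact: (generic_open geta (Dset_open (aff_open aU) rd) (conj Uy ud)).
have [c1 [rc1 uc1 cs]] := aff_stk0 aU Ue rs1 s1e.
have dz : d y * s y = s1 y by apply: e.
have := cs y Uy => /stk_dom[c10|s10].
  have r0 := reg_0 y; have := specE (rc1 _ Uy); rewrite c10.
  rewrite -/(spec 0) [spec 0](rmorph0 specr) => e0.
  by case: (@nunit0 (stk eta)); rewrite e0.
move: dz; rewrite s10 => /stk_dom[d0|//].
by case: (@nunit0 (stk y)); rewrite -d0.
Qed.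

Lemma spec_frac (z : stk eta) : exists a b, b <> 0 /\ specr b * z = specr a.
Proof.
have [U aU Uy] := scheme_affine y; have Ue := generic_open geta (aff_open aU) Uy.
have [a [c [ra rc uc e]]] := aff_stk aU z Ue.
exists (a y), (c y); rewrite [specr (c y)](specE (rc _ Uy)) [specr (a y)](specE (ra _ Uy)).
split=> // c0; case: (@nunit0 (stk eta)).
by rewrite -[0](rmorph0 specr) -c0 [specr _](specE (rc _ Uy)).
Qed.

Lemma vanish_generic s : reg y s -> s eta = 0 -> s y = 0.
Proof.
move=> rs s0; apply: spec_inj.
by rewrite [specr (s y)](specE rs) s0 rmorph0.
Qed.

End Specialisation.
End Generic.

Section MatrixOfMultiplication.
Variables (K L : comNzRingType) (f : {rmorphism K -> L}) (n : nat) (eps : 'I_n -> L).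

Definition mult_mx (a : L) (M : 'M[K]_n) :=
  forall j, a * eps j = \sum_i f (M i j) * eps i.

Lemma mult_mx1 : mult_mx 1 1%:M.
Proof.
move=> j; rewrite mul1r (bigD1 j) //= !mxE eqxx rmorph1 mul1r big1 ?addr0 // => i ij.
by rewrite !mxE (negbTE ij) rmorph0 mul0r.
Qed.

Lemma mult_mxM a b M N : mult_mx a M -> mult_mx b N -> mult_mx (a * b) (M *m N).
Proof.
move=> hM hN j; rewrite -mulrA hN mulr_sumr.
under eq_bigr do rewrite mulrCA hM mulr_sumr.
rewrite exchange_big /=; apply: eq_bigr => i _; rewrite !mxE rmorph_sum mulr_suml.
by apply: eq_bigr => l _; rewrite rmorphM mulrA [f (N l j) * _]mulrC.
Qed.

Lemma mult_mxB a b M N : mult_mx a M -> mult_mx b N -> mult_mx (a - b) (M - N).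
Proof.
move=> hM hN j; rewrite mulrBl hM hN -sumrB; apply: eq_bigr => i _.
by rewrite !mxE rmorphB mulrBl.
Qed.

Lemma mult_mx_scalar c : mult_mx (f c) c%:M.
Proof.
move=> j; rewrite (bigD1 j) //= !mxE eqxx mulr1n big1 ?addr0 // => i ij.
by rewrite !mxE (negbTE ij) mulr0n rmorph0 mul0r.
Qed.

Lemma mult_mx_lin m (c : 'I_m -> K) (a : 'I_m -> L) (M : 'I_m -> 'M[K]_n) :
  (forall t, mult_mx (a t) (M t)) ->
  mult_mx (\sum_t f (c t) * a t) (\sum_t c t *: M t).
Proof.
move=> hM j; rewrite mulr_suml; under eq_bigr do rewrite -mulrA hM mulr_sumr.
rewrite exchange_big /=; apply: eq_bigr => i _; rewrite summxE rmorph_sum mulr_suml.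
by apply: eq_bigr => t _; rewrite !mxE rmorphM mulrA.
Qed.

Hypothesis basis : forall a, exists! c : {ffun 'I_n -> K}, a = \sum_i f (c i) * eps i.

Lemma mult_mx_ex a : exists M, mult_mx a M.
Proof.
have /choice[c cP] : forall j, exists c : {ffun 'I_n -> K},
    a * eps j = \sum_i f (c i) * eps i by move=> j; have [c [h _]] := basis (a * eps j); exists c.
by exists (\matrix_(i, j) c j i) => j; rewrite cP; apply: eq_bigr => i _; rewrite mxE.
Qed.

Lemma mult_mx_uniq a M N : mult_mx a M -> mult_mx a N -> M = N.
Proof.
move=> hM hN; apply/matrixP => i j; have [c [_ cu]] := basis (a * eps j).
have cM : c = [ffun i => M i j].
  by apply: cu; rewrite hM; apply: eq_bigr => l _; rewrite ffunE.
have cN : c = [ffun i => N i j].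
  by apply: cu; rewrite hN; apply: eq_bigr => l _; rewrite ffunE.
by move: cM; rewrite cN => /ffunP/(_ i); rewrite !ffunE => ->.
Qed.

End MatrixOfMultiplication.

(** * Regularity of the trace and the splitting of functions on X *)

Section TraceDecomposition.
Variables (k : fieldType) (X Y : scheme k) (pi : mor X Y).
Hypothesis char0 : [pchar k] =i pred0.
Hypothesis Yreg : forall y : Y, regular_local_ring (stk y).
Variables (n : nat) (x0 : X).
Hypothesis n0 : (0 < n)%N.
Hypothesis gx : generic_point x0.
Hypothesis gy : generic_point (pi x0).
Variable eps : 'I_n -> stk x0.
Hypothesis basis : field_basis pi eps.

Lemma regular_dom (y : Y) : prime_ideal [set (0 : stk y)].
Proof. by case: (regular_cic (Yreg y).1 (@stk_local _ _ y) (Yreg y)). Qed.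

Variables (V : set Y) (y : Y) (m : nat) (e : 'I_m -> forall x : X, stk x).
Hypothesis aV : affine_open V.
Hypothesis Vy : V y.
Hypothesis egen : forall s, reg_on (pi @^-1` V) s ->
  exists c : 'I_m -> forall y : Y, stk y, (forall j, reg_on V (c j)) /\
    eq_on (pi @^-1` V) s (fun x => \sum_(j < m) pull pi (c j) x * e j x).

(** All powers of [g] are combinations of the finitely many [e t] with coefficients regular at [y];
    so [trace_cic] applies, the stalk at [y] being completely integrally closed. *)
Lemma trace_integral g M : reg_on (pi @^-1` V) g ->
  mult_mx (fstk pi x0) eps (g x0) M ->
  exists2 s : forall z : Y, stk z, reg y s & \tr M = s (pi x0).
Proof.
move=> rg gM; have Vx : V (pi x0) := generic_open gy (aff_open aV) Vy.
pose h := specr gy y; have dom := regular_dom.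
have /choice[E EP] : forall t, exists N, mult_mx (fstk pi x0) eps (e t x0) N.
  by move=> t; exact: mult_mx_ex basis _.
pose Mp := fix Mp l := if l is l'.+1 then Mp l' *m M else 1%:M.
have gMp l : mult_mx (fstk pi x0) eps (g x0 ^+ l) (Mp l).
  elim: l => [|l IH]; first exact: mult_mx1.
  by rewrite exprSr; exact: mult_mxM.
have [||||||a aP] := @trace_cic _ _ h (@spec_inj _ _ dom _ gy y) (dom y) _ _ _ n M m E Mp.
- by case: (regular_cic (Yreg y).1 (@stk_local _ _ y) (Yreg y)).
- by move=> z; exact: (generic_unit dom gy).
- by move=> z; exact: (spec_frac gy y z).
- by [].
- by [].
- move=> l; have [|c [rc gE]] := egen (_ : reg_on (pi @^-1` V) (fun x => g x ^+ l)).
    by move=> x Vx'; apply: reg_exp; exact: rg.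
  exists (fun t => c t y); apply: (mult_mx_uniq basis (gMp l)).
  rewrite [g x0 ^+ l](gE x0 Vx).
  have -> : \sum_i h (c i y) *: E i = \sum_i c i (pi x0) *: E i.
    by apply: eq_bigr => t _; rewrite [h _](specE gy (rc t y Vy)).
  exact: mult_mx_lin.
have [s rs sa] := reg_germ a; exists s => //.
by rewrite aP -sa; exact: specE.
Qed.

Lemma natk_neq0 : (n%:R : k) != 0.
Proof. by rewrite ((pcharf0P k).1 char0) -lt0n. Qed.

Lemma trace_decomp g : reg_on (pi @^-1` V) g ->
  exists (V1 : set Y) (b : forall z : Y, stk z), [/\ open V1, V1 y, V1 `<=` V, reg_on V1 b &
    trace_zero pi V1 (fun x => g x - pull pi b x)].
Proof.
move=> rg; have [M gM] := mult_mx_ex basis (g x0).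
have [s rs sE] := trace_integral rg gM.
(* The trace divided by the degree, which is invertible in characteristic 0: a function [b] on Y has
   trace n b. *)
pose b z : stk z := (n%:R^-1 : k)%:A * s z.
pose V1 := V `&` interior (fun z => reg z s).
have V1V : V1 `<=` V by move=> z [].
have rb : reg_on V1 b.
  by move=> z [_ /interior_subset rz]; apply: reg_mul => //; exact: reg_const.
have V1y : V1 y by split=> //; exact: nbhs_singleton (nbhs_interior (reg_near rs)).
have oV1 : open V1 by apply: openI; [exact: aff_open|exact: open_interior].
exists V1, b; split=> //; split=> [x Vx|x gx' Vx].
  apply: reg_sub; first exact: rg (V1V _ Vx).
  by apply: pull_reg; exact: rb.
have ex := generic_uniq gx' gx; subst x.
exists n, eps, (M - (b (pi x0))%:M); split=> //.
- apply: mult_mxB => //; exact: mult_mx_scalar.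
rewrite raddfB /= mxtrace_scalar sE /b.
have -> : ((n%:R^-1 : k)%:A * s (pi x0)) *+ n = (((n%:R : k) * n%:R^-1)%:A) * s (pi x0).
  by rewrite -mulrnAl -scaler_nat scalerA.
by rewrite mulfV ?natk_neq0 // scale1r mul1r subrr.
Qed.

End TraceDecomposition.

(** * Functions on X as values of Psi plus functions on Y *)

Section PsiDecomposition.
Variables (k : fieldType) (X Y P : scheme k) (i : mor Y P) (pi : mor X Y).
Variable nu : H0_normal (mcomp i pi).

Lemma Psi_germ (s t : forall p : P, stk p) x : s (i (pi x)) = t (i (pi x)) ->
  Psi nu s x = Psi nu t x.
Proof. by rewrite /Psi => e; case: cid => D' _ /=; congr (D' x _). Qed.

(** By the Leibniz rule, whose other term vanishes because [s] is in the ideal of Y. *)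
Lemma Psi_mul W u s x : ideal_section i W s -> W (i (pi x)) -> reg (i (pi x)) u ->
  Psi nu (fun p => u p * s p) x = pull (mcomp i pi) u x * Psi nu s x.
Proof.
move=> Is Wx ru; have [D [U lD Ux]] := lifts_cover nu x.
have Ius : ideal_section i (W `&` [set z | reg z u]) (fun p => u p * s p).
  have [rs s0] := Is; split=> [z [Wz rz]|y [Wy _]]; first by apply: reg_mul => //; exact: rs.
  by rewrite /pull rmorphM -[fstk i y (s _)]/(pull i s y) s0 // mulr0.
rewrite (PsiE Ius _ lD Ux) // (PsiE Is Wx lD Ux).
have [_ /(_ x Ux)[_ _ DM _]] := lifts_der lD.
rewrite DM -[RHS]addr0; congr (_ + _).
have -> : fstk (mcomp i pi) x (s (mcomp i pi x)) = fstk pi x (pull i s (pi x)) by [].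
by rewrite (Is.2 _ Wx) rmorph0 mul0r.
Qed.

Hypothesis hi : closed_immersion i.
Hypothesis char0 : [pchar k] =i pred0.
Hypothesis Yreg : forall y : Y, regular_local_ring (stk y).
Variable n : nat.
Hypothesis n0 : (0 < n)%N.
Hypothesis hdeg : degree_mor pi n.
Hypothesis hPsi2 : Psi2_surjective nu.

Variables (V : set Y) (y : Y) (m : nat) (e : 'I_m -> forall x : X, stk x).
Hypothesis aV : affine_open V.
Hypothesis Vy : V y.
Hypothesis egen : forall s, reg_on (pi @^-1` V) s ->
  exists c : 'I_m -> forall y : Y, stk y, (forall j, reg_on V (c j)) /\
    eq_on (pi @^-1` V) s (fun x => \sum_(j < m) pull pi (c j) x * e j x).
Variable U : set P.
Hypothesis aU : affine_open U.

Lemma stk_lift (b : stk y) : U (i y) -> exists c1 c2 : forall p : P, stk p,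
  [/\ reg_on U c1, reg_on U c2, isunit (c2 (i y)) &
      pull i c2 y * b = pull i c1 y].
Proof.
move=> Uy; have [_ _ /(_ y b)[b' <-]] := hi.
have [c1 [c2 [r1 r2 u2 E]]] := aff_stk aU b' Uy.
by exists c1, c2; split=> //; rewrite /pull -E rmorphM.
Qed.

(** On the fibre over [y] this reads g = Psi(f) / h + c1 / c2, with all four functions regular on a
    whole chart of P^N; the denominators come from extending germs to the chart. *)
Lemma Psi_decomp g : U (i y) -> reg_on (pi @^-1` V) g ->
  exists f h c1 c2 : forall p : P, stk p,
  [/\ [/\ reg_on U f, reg_on U h, reg_on U c1 & reg_on U c2],
      eq_on (i @^-1` U) (pull i f) (fun=> 0),
      isunit (h (i y)), isunit (c2 (i y)) &
      forall x, pi x = y ->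
        pull (mcomp i pi) h x * pull (mcomp i pi) c2 x * g x =
        pull (mcomp i pi) c2 x * Psi nu f x +
        pull (mcomp i pi) h x * pull (mcomp i pi) c1 x].
Proof.
move=> Uy rg; have [x0 [gx gy [eps basis]]] := hdeg.
have [V1 [b [oV1 V1y V1V rb tz]]] := trace_decomp char0 Yreg n0 gx gy basis aV Vy egen rg.
have [W [V' [s [[oW Is] oV' V'y V'sub [_ [b' rb' E]]]]]] := hPsi2 oV1 V1y tz.
have Wy : W (i y) by have [] := V'sub _ V'y.
have [f [h [rf rh uh DW fE]]] := aff_germ aU oW Wy Uy (Is.1 _ Wy).
have [c1 [c2 [r1 r2 u2 cE]]] := stk_lift (b y - b' y) Uy.
exists f, h, c1, c2; split=> //.
(* So far [f] is known to vanish on Y only over D(h); this open set contains the generic point of Y,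
   and the stalks of Y are domains. *)
- have dom := regular_dom Yreg.
  move=> y' Uy'; apply: (vanish_generic dom gy); first by apply: pull_reg; exact: rf.
  have oD : open (i @^-1` (Dset U h)).
    move/continuousP: (@fpt_continuous _ _ _ i); apply.
    exact: Dset_open (aff_open aU) rh.
  have De : Dset U h (i (pi x0)) := generic_open gy oD (conj Uy uh).
  have := Is.2 _ (DW _ De); rewrite /pull -fE // rmorphM => ->.
  by rewrite mulr0.
move=> x px; subst y.
(* Psi_2 of [s] is g - b, so Psi of [s] is g - b + b'. *)
have gE : g x = Psi nu s x + pull pi (fun z => b z - b' z) x.
  have -> : pull pi (fun z => b z - b' z) x = pull pi b x - pull pi b' x.
    exact: (rmorphB (fstk pi x)).
  by rewrite E //; ring.
have fP : Psi nu f x = pull (mcomp i pi) h x * Psi nu s x.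
  rewrite -(Psi_mul Is Wy) //; last exact: rh.
  by apply: Psi_germ; rewrite fE.
have cP : pull (mcomp i pi) c2 x * pull pi (fun z => b z - b' z) x = pull (mcomp i pi) c1 x.
  rewrite -[LHS](rmorphM (fstk pi x)).
  by have := congr1 (fstk pi x) cE.
rewrite gE fP -cP; ring.
Qed.

End PsiDecomposition.

(** * The special fibre and its first order neighbourhood *)

Section Kernels.
Variables (k : fieldType) (XX T : scheme k) (p : mor XX T) (t0 : T).
Variable tau : forall t : T, stk t.
Hypothesis tauM : forall c : stk t0, ~ isunit c -> exists c', c = c' * tau t0.

Lemma residue_fibre S (t : T) (g : mor S T) : residue_point t g ->
  exists d : S, [/\ forall d', d' = d, forall d', g d' = t,
    forall d' (a : stk d'), exists b, fstk g d' b = a &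
    forall d' (b : stk (g d')), ~ isunit b -> fstk g d' (b * b) = 0].
Proof.
move=> [[d Dd] gt gs gk]; exists d; split=> // d' b /gk b0.
by rewrite rmorphM b0 mul0r.
Qed.

Lemma thick_fibre D (g : mor D T) : first_inf_nbhd t0 g ->
  exists d : D, [/\ forall d', d' = d, forall d', g d' = t0,
    forall d' (a : stk d'), exists b, fstk g d' b = a &
    forall d' (b : stk (g d')), ~ isunit b -> fstk g d' (b * b) = 0].
Proof.
move=> [[d Dd] gt gs gk]; exists d; split=> // d' b nb; apply/gk.
by exists 1%N, (fun=> b), (fun=> b); split=> //; rewrite big_ord1.
Qed.

Lemma Jfib_multiple S (g : mor S T) d z (c : stk z) (s : forall t : T, stk t) :
  p z = t0 -> (forall f : psec t0, pull g f d = 0 -> exists c', f t0 = s t0 * c') ->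
  Jfib p g t0 d c -> exists c', c = pull p s z * c'.
Proof.
move=> pz sP [n [e [h [ch ->]]]].
have /choice[w wP] : forall l, exists w, h l = pull p s z * w.
  move=> l; have [_ [f /sP[c' fE] ->]] := ch l.
  have [r _ rc] := reg_germ c'; exists (pull p r z).
  have fE' : f t0 = s t0 * r t0 by rewrite fE rc.
  apply: etrans (pull_at (t := fun t => s t * r t) pz fE') _.
  exact: (rmorphM (fstk p z)).
exists (\sum_l e l * w l); rewrite mulr_sumr; apply: eq_bigr => l _.
by rewrite wP mulrCA.
Qed.

(** The ideal of the special fibre is generated by the maximal ideal at t0, whose elements are
    multiples of [tau]. *)
Lemma special_kernel S X (g : mor S T) (a : mor X XX) (q : mor X S) x (c : stk (a x)) :
  residue_point t0 g -> is_pullback p g a q -> fstk a x c = 0 ->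
  exists c', c = pull p tau (a x) * c'.
Proof.
move=> hg hq c0; have [d [Dd gt gs gq]] := residue_fibre hg.
have pz := fib_pt gt hq x.
apply: (Jfib_multiple pz _ (fib_kernel (a x) Dd gt gs gq hq c0)) => f f0.
have [_ _ _ /(_ d (f (g d)))[/(_ f0) + _]] := hg.
by rewrite gt => /tauM[c' ->]; exists c'; rewrite mulrC.
Qed.

(** The ideal of the thickening is generated by the square of the maximal ideal at t0, whose
    elements are multiples of the square of [tau]. *)
Lemma thick_kernel D X (g : mor D T) (a : mor X XX) (q : mor X D) x (c : stk (a x)) :
  first_inf_nbhd t0 g -> is_pullback p g a q -> fstk a x c = 0 ->
  exists c', c = pull p tau (a x) * (pull p tau (a x) * c').
Proof.
move=> hg hq c0; have [d [Dd gt gs gq]] := thick_fibre hg.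
have pz := fib_pt gt hq x.
have [c' ->] : exists c', c = pull p (fun t => tau t * tau t) (a x) * c'.
  apply: (Jfib_multiple pz _ (fib_kernel (a x) Dd gt gs gq hq c0)) => f f0.
  have [_ _ _ /(_ d (f (g d)))[/(_ f0) + _]] := hg.
  rewrite gt => -[n [u [v [uv ->]]]].
  have /choice[w wP] : forall l, exists w, u l * v l = tau t0 * tau t0 * w.
    move=> l; have [/tauM[u' ->] /tauM[v' ->]] := uv l; exists (u' * v'); ring.
  by exists (\sum_l w l); rewrite mulr_sumr; apply: eq_bigr.
exists c'; rewrite mulrA; congr (_ * _); exact: (rmorphM (fstk p (a x))).
Qed.

Lemma special_param S X (g : mor S T) (a : mor X XX) (q : mor X S) x :
  ~ isunit (tau t0) -> residue_point t0 g -> is_pullback p g a q ->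
  pull a (pull p tau) x = 0.
Proof.
move=> ntau hg [[e1 e2] _].
have g0 : pull g tau (q x) = 0.
  by case: hg => _ gt _ /(_ (q x) (tau (g (q x))))[_ gk]; apply: gk; rewrite gt.
apply: etrans (esym (pull_comp p a tau x)) _; apply: etrans (e2 tau x) _.
apply: etrans (pull_comp g q tau x) _; apply: etrans (congr1 (fstk q x) g0) _.
exact: rmorph0.
Qed.

(** * The class nu as a quotient by the parameter *)

Section Deformation.
Hypothesis ntau : ~ isunit (tau t0).
Hypothesis nzd : forall z, p z = t0 -> forall c, pull p tau z * c = 0 -> c = 0.
Variables (X Y P : scheme k) (i : mor Y P) (pi : mor X Y) (F : mor XX P).
Variables (S0 : scheme k) (tau0 : mor S0 T) (a : mor X XX) (q0 : mor X S0).
Hypothesis htau0 : residue_point t0 tau0.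
Hypothesis ha : is_pullback p tau0 a q0.
Hypothesis hFa : forall s x, pull a (pull F s) x = pull pi (pull i s) x.
Variables (D : scheme k) (j : mor D T) (eps : forall d : D, stk d).
Hypothesis hj : first_inf_nbhd t0 j.
Hypothesis tau_eps : forall d, pull j tau d = eps d.
Variables (Xtil : scheme k) (b : mor Xtil XX) (q : mor Xtil D).
Hypothesis hXtil : is_pullback p j b q.
Variables (c : mor X Xtil) (hc : eqm (mcomp b c) a).
Variables (phit : mor Xtil P) (nu : H0_normal (mcomp i pi)).
Hypothesis hphit : forall s x, pull phit s x = pull b (pull F s) x.
Hypothesis hnu : corresponds c phit (pull q eps) nu.

(* On the first order thickening, F^# f = tau G reads as eps G, while it is
   eps times the lift of nu applied to f. *)
Lemma Psi_quotient x W f (G : forall z : XX, stk z) :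
  ideal_section i W f -> W (i (pi x)) ->
  pull F f (a x) = pull p tau (a x) * G (a x) -> pull a G x = Psi nu f x.
Proof.
move=> If Wx FG; have [D' [U lD Ux]] := lifts_cover nu x.
rewrite (PsiE If Wx lD Ux).
have [_ _ /(_ x Ux)[V [sg [_ Vx sp hV]]]] := (hnu U D').1 lD.
have [sgK [sgD _] _ _] := sp x Vx.
set Df := D' x _; have h := hV x Vx Ux f.
have pf0 : pull (mcomp i pi) f x = 0.
  by apply: etrans (congr1 (fstk pi x) (If.2 _ Wx)) _; exact: rmorph0.
have sg0 : sg x 0 = 0.
  by have := sgD 0 0; rewrite addr0 => /esym/eqP; rewrite -subr_eq0 addrK => /eqP.
rewrite pf0 sg0 add0r hphit -[D' x _]/Df in h.
have bc : a x = b (c x) by case: hc => /(_ x).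
have E : pull F f (b (c x)) = pull p tau (b (c x)) * G (b (c x)) by rewrite -bc.
have te : pull b (pull p tau) (c x) = pull q eps (c x).
  have [[_ e2] _] := hXtil; apply: etrans (esym (pull_comp p b tau _)) _.
  apply: etrans (e2 tau (c x)) _; apply: etrans (pull_comp j q tau _) _.
  exact: (congr1 (fstk q (c x)) (tau_eps _)).
have h2 : pull q eps (c x) * pull b G (c x) = pull q eps (c x) * sg x Df.
  rewrite -h -te; apply: etrans (esym (rmorphM (fstk b (c x)) _ _)) _.
  exact: (congr1 (fstk b (c x)) (esym E)).
have [d [Dd gt gs gq]] := thick_fibre hj.
(* [w] lifts to XX the difference between [G] and the trivialised value of D on [f]. As tau w
   vanishes on the thickening, it is in (tau^2); [tau] being a nonzerodivisor, [w] is in (tau) and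
   vanishes on X. *)
have [w wE] := fib_surj (a x) Dd gt gs gq hXtil (w := c x) (pull b G (c x) - sg x Df).
have [c' c'E] : exists c', pull p tau (b (c x)) * w =
    pull p tau (b (c x)) * (pull p tau (b (c x)) * c').
  apply: (thick_kernel hj hXtil); apply: etrans (rmorphM (fstk b (c x)) _ _) _.
  apply: etrans (congr1 (fun u => u * fstk b (c x) w) te) _.
  by rewrite wE mulrBr h2 subrr.
have pz : p (b (c x)) = t0 by exact: (fib_pt gt hXtil).
have {c'E}wt : w = pull p tau (b (c x)) * c'.
  apply/eqP; rewrite -subr_eq0; apply/eqP; apply: (nzd pz).
  by rewrite mulrBr c'E subrr.
have ct0 : pull c (pull b (pull p tau)) x = 0.
  have [_ e2] := hc; apply: etrans (esym (pull_comp b c _ x)) _.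
  have h0 := special_param x ntau htau0 ha.
  exact: etrans (e2 (pull p tau) x) h0.
have cw0 : fstk c x (fstk b (c x) w) = 0.
  rewrite wt; apply: etrans (congr1 (fstk c x) (rmorphM (fstk b (c x)) _ _)) _.
  apply: etrans (rmorphM (fstk c x) _ _) _.
  by apply: etrans (congr1 (fun u => u * _) ct0) _; exact: mul0r.
rewrite wE rmorphB sgK in cw0.
have [_ e2] := hc; apply: etrans (esym (e2 G x)) _; apply: etrans (pull_comp b c G x) _.
by apply/eqP; rewrite -subr_eq0; apply/eqP.
Qed.

Lemma tau_divides x f : pull pi (pull i f) x = 0 ->
  exists g, pull F f (a x) = pull p tau (a x) * g.
Proof.
move=> f0; apply: (special_kernel htau0 ha).
by apply: etrans (hFa f x) _.
Qed.

End Deformation.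
End Kernels.

(** * Integrality of the germs over the coordinates *)

Lemma mulr_unit_r (R : comNzRingType) (x y z : R) : y * z = 1 -> x * y * z = x.
Proof. by move=> yz; rewrite -mulrA yz mulr1. Qed.

Section GraphClosed.
Variables (k : fieldType) (XX T : scheme k) (p : mor XX T) (x0 : XX) (t0 : T).

(* Outside of C, the graph of the functions v on C is closed: at a boundary
   point of C, some v_j has a pole. *)
Definition graph_closed (T1 : set T) (C : set XX) M (v : 'I_M -> psec x0) :=
  forall z, T1 (p z) ->
  ((forall j, reg z (v j)) /\ (C z \/ \forall z' \near z, ~ C z')) \/
  exists j c, [/\ reg z c, ~ isunit (c z) &
    \forall z' \near z, C z' -> c z' * v j z' = 1].

Definition extend M (v : 'I_M -> psec x0) (s : psec x0) (j : 'I_M.+1) : psec x0 :=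
  if unlift ord_max j is Some j' then v j' else s.

Lemma extend_lift M (v : 'I_M -> psec x0) s j : extend v s (lift ord_max j) = v j.
Proof. by rewrite /extend liftK. Qed.

Lemma extend_max M (v : 'I_M -> psec x0) s : extend v s ord_max = s.
Proof. by rewrite /extend unlift_none. Qed.

(** Adjoining 1/s shrinks [C] to the locus where [s] is invertible; at a new boundary point [s] is
    not invertible, and the equation s (1/s) = 1 shows the pole. *)
Lemma graph_closed_ext T1 C M (v : 'I_M -> psec x0) (s : psec x0) :
  graph_closed T1 C v -> (forall z, T1 (p z) -> C z -> reg z s) ->
  graph_closed T1 [set z | C z /\ isunit (s z)] (extend v (sinv s)).
Proof.
move=> h rs z Tz; have [[rv [Cz|nC]]|[j [c [rc nc e]]]] := h z Tz.
- have [us|nus] := EM (isunit (s z)).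
    left; split; last by left.
    move=> j; rewrite /extend; case: unlift => [j'|//]; first exact: rv.
    by apply: reg_inv => //; exact: rs.
  right; exists ord_max, s; split=> //; first exact: rs.
  by apply: filterE => z' [_ us]; rewrite extend_max; exact: mulruV.
(* No point of [C] is near [z]: the pole condition holds vacuously, with [c = 0]. *)
- right; exists ord_max, (fun=> 0); split; [exact: reg_0|exact: nunit0|].
  by apply: filterS nC => z' nC [].
- right; exists (lift ord_max j), c; split=> //; rewrite extend_lift.
  by apply: filterS e => z' + [Cz _]; apply.
Qed.

Lemma graph_closedD T1 C O M (v : 'I_M -> psec x0) : open O ->
  graph_closed T1 C v -> graph_closed T1 (C `\` O) v.
Proof.
move=> oO h z Tz; have [[rv CnC]|[j [c [rc nc e]]]] := h z Tz; last first.
  right; exists j, c; split=> //.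
  by apply: filterS e => z' + [Cz _]; apply.
left; split=> //; case: CnC => [Cz|nC]; last by right; apply: filterS nC => z' + [].
have [Oz|nO] := EM (O z); [right|by left].
by apply: filterS (open_nbhs_nbhs (conj oO Oz)) => z' Oz' [].
Qed.

Section EvalSubring.
Variables (M : nat) (v : 'I_M -> psec x0) (z : XX).
Local Notation ev F := (evals (s0 := t0) p v F z).

(* The image in stk z of the local ring of affine M-space over T at the point
   with coordinates v. *)
Definition evset : set (stk z) :=
  [set c | exists F G : mpl M (psec t0), isunit (ev G) /\ ev G * c = ev F].

Lemma evset_ev F : evset (ev F).
Proof.
exists F, 1; have e : ev (1 : mpl M (psec t0)) = 1 := evals1 t0 p v z.
by rewrite e mul1r; split=> //; exact: isunit1.
Qed.

Lemma evset_pull (s : psec t0) : evset (pull p s z).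
Proof.
have e : ev (mpC M s) = pull p s z := evalsC p v s z.
by rewrite -e; exact: evset_ev.
Qed.

Lemma evset_var j : evset (v j z).
Proof.
have e : ev (mpX (psec t0) (mpoly.mnm1 j)) = v j z := evalsX t0 p v j z.
by rewrite -e; exact: evset_ev.
Qed.

Lemma evset_subring : subring evset.
Proof.
split.
- have e : ev (1 : mpl M (psec t0)) = 1 := evals1 t0 p v z.
  by rewrite -e; exact: evset_ev.
- move=> a b [F [G [uG Fa]]] [F' [G' [uG' Fb]]].
  exists (G' * F - G * F'), (G * G').
  have e1 : ev (G * G') = ev G * ev G' := evalsM p v G G' z.
  have e2 : ev (G' * F - G * F') = ev (G' * F) - ev (G * F') := evalsB p v _ _ z.
  have e3 : ev (G' * F) = ev G' * ev F := evalsM p v G' F z.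
  have e4 : ev (G * F') = ev G * ev F' := evalsM p v G F' z.
  rewrite e1 e2 e3 e4 -Fa -Fb; split; first exact/isunitM.
  exact: sub_frac.
- move=> a b [F [G [uG Fa]]] [F' [G' [uG' Fb]]].
  exists (F * F'), (G * G').
  have e1 : ev (G * G') = ev G * ev G' := evalsM p v G G' z.
  have e2 : ev (F * F') = ev F * ev F' := evalsM p v F F' z.
  rewrite e1 e2 -Fa -Fb; split; first exact/isunitM.
  exact: mulrACA.
Qed.

Lemma evset_inv a b : evset a -> a * b = 1 -> evset b.
Proof.
move=> [F [G [uG Fa]]] ab; exists G, F; rewrite -Fa; split.
  by apply/isunitM; split=> //; exists b.
exact: mulr_unit_r.
Qed.

End EvalSubring.

Lemma evset_ext M (v : 'I_M -> psec x0) s z : evset v (s z) ->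
  evset (extend v s) (z := z) `<=` evset v (z := z).
Proof.
move=> As; have Sv := evset_subring v z.
have key (F : mpl M.+1 (psec t0)) : evset v (evals p (extend v s) F z).
  rewrite evalsE; apply: subring_sum => // m _; apply: subringM => //.
    exact: evset_pull.
  apply: subring_prod => // j _; apply: subringX => //.
  by rewrite /extend; case: unlift => [j'|//]; exact: evset_var.
move=> c [F [G [[d uG] e]]].
have -> : c = evals p (extend v s) F z * d by rewrite -e mulrAC uG mul1r.
by apply: subringM => //; apply: evset_inv uG; exact: key.
Qed.

End GraphClosed.

Section Separation.
Variables (k : fieldType) (XX T : scheme k) (p : mor XX T) (x0 : XX) (t0 : T).
Hypothesis puc : universally_closed p.
Local Notation ev v F := (evals (s0 := t0) p v F).

Definition graph_pt M (v : 'I_M -> psec x0) (z : XX) : AT t0 M :=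
  @FamPt k T t0 M (@ofam k T t0 setT) (p z) (fun F => ~ isunit (evalp p v z F)) I
    (eval_primeP p v z) (eval_contr v (x := z)).

(** [proper_sep] at the point of affine M-space over T whose coordinates are the values of [w] at
    [z0]; as [w] may differ from [v], the value 0 can be prescribed for a coordinate 1/b. *)
Lemma separate T1 C M (v w : 'I_M -> psec x0) z0 : open T1 -> T1 (p z0) ->
  graph_closed p T1 C v ->
  (forall z, C z -> p z = p z0 ->
     ~ (forall F, isunit (ev w F z0) <-> isunit (ev v F z))) ->
  exists T2 (h : mpl M (psec t0)), [/\ open T2, T2 (p z0) /\ preg T2 h, T2 `<=` T1,
    isunit (ev w h z0) & forall z, C z -> T2 (p z) -> ~ isunit (ev v h z)].
Proof.
move=> oT1 Tz0 gc sep.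
have [|z Cz pz h|T2 [h [oT2 T2z T21 nh hC]]] :=
  @proper_sep k XX T p puc x0 t0 M T1 C v oT1 gc (graph_pt w z0).
- exact: Tz0.
- apply: (sep z Cz pz) => F; have := h F => hF; split.
    by move=> u; apply: contrapT => nu; apply: (hF.2 nu).
  move=> u; apply: contrapT => nu; exact: (hF.1 nu).
exists T2, h; split=> //; exact: contrapT.
Qed.

Hypothesis XXred : reduced_scheme XX.

(* The closed graph of (v, 1/b) avoids the point with coordinates (v z0, 0):
   an equation h (v, 1/b) = 0 with h (v z0, 0) a unit is, up to a power of b,
   an equation of integral dependence of b. *)
Lemma integral_germ T1 C M (v : 'I_M -> psec x0) z0 (b : psec x0) :
  open T1 -> T1 (p z0) -> open C -> C z0 -> (forall z j, C z -> reg z (v j)) ->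
  graph_closed p T1 C v -> reg_on C b ->
  integral_elt (evset p t0 v (z := z0)) (b z0).
Proof.
move=> oT1 Tz0 oC Cz0 rv gc rb.
have rb' z : T1 (p z) -> C z -> reg z b by move=> _; exact: rb.
have gc2 := graph_closed_ext gc rb'.
have [z [Cz ub] pz|T2 [h [oT2 [T2z rh] T21 uh hC]]] :=
  @separate T1 _ _ _ (extend v (0 : psec x0)) z0 oT1 Tz0 gc2.
- move=> /(_ (mpX (psec t0) (mpoly.mnm1 ord_max))) [_].
  rewrite (evalsX t0 p (extend v (sinv b)) ord_max z) (evalsX t0 p (extend v 0) ord_max z0).
  rewrite !extend_max => h; apply: (@nunit0 (stk z0)); apply: h.
  by exists (b z); rewrite mulrC; exact: mulruV.
have Sv := evset_subring p t0 v z0.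
pose d := \max_(m <- mpoly.msupp h) m ord_max.
have dm m : m \in mpoly.msupp h -> (m ord_max <= d)%N.
  by move=> ms; exact: (@leq_bigmax_seq _ _ xpredT (fun m : mpoly.multinom M.+1 => m ord_max)).
pose co (m : mpoly.multinom M.+1) : psec x0 := (pull p (mcf m h) : psec x0) *
  \prod_(j < M) v j ^+ m (lift ord_max j).
have coE m z : co m z = pull p (mcf m h : psec t0) z * \prod_(j < M) v j z ^+ m (lift ord_max j).
  by rewrite /co psecM psec_prod; congr (_ * _); apply: eq_bigr => j _; rewrite psecX.
have evE s z : ev (extend v s) h z = \sum_(m <- mpoly.msupp h) co m z * s z ^+ m ord_max.
  rewrite evalsE; apply: eq_bigr => m _; rewrite coE -mulrA; congr (_ * _).
  rewrite big_ord_recr /= extend_max; congr (_ * _); apply: eq_bigr => j _.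
  have -> : widen_ord (leqnSn M) j = lift ord_max j by apply: val_inj; rewrite /= /bump leqNgt ltn_ord.
  by rewrite extend_lift.
(* This is b^(d+1) h(v, 1/b), where [d] bounds the degree of [h] in the last variable. The exponent
   d + 1, rather than [d], leaves a factor [b] in every term, so that the sum is not invertible
   where [b] is not. *)
pose S : psec x0 := \sum_(m <- mpoly.msupp h) co m * b ^+ (d.+1 - m ord_max).
have SE z : S z = \sum_(m <- mpoly.msupp h) co m z * b z ^+ (d.+1 - m ord_max).
  by rewrite /S psec_sum; apply: eq_bigr => m _; rewrite psecM psecX.
pose O := C `&` p @^-1` T2.
have oO : open O.
  by apply: openI => //; move/continuousP: (@fpt_continuous _ _ _ p); apply.
have rS : reg_on O S.
  move=> z [Cz Tz]; have Rz := reg_subring x0 z.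
  apply: (subring_sum (A := [set s : psec x0 | reg z s])) => // m _.
  apply: (subringM Rz); last by apply: (subringX _ Rz); exact: rb.
  apply: (subringM Rz); first by apply: pull_reg; exact: rh.
  by apply: (subring_prod (A := [set s : psec x0 | reg z s])) => // j _; apply: (subringX _ Rz); exact: rv.
have SO z : O z -> ~ isunit (S z).
  move=> [Cz Tz]; have [ub|nb] := EM (isunit (b z)).
    have -> : S z = b z ^+ d.+1 * ev (extend v (sinv b)) h z.
      rewrite SE evE mulr_sumr big_seq [RHS]big_seq; apply: eq_bigr => m ms.
      rewrite mulrCA; congr (_ * _).
      rewrite -{2}(subnK (leqW (dm _ ms))) exprD -mulrA -exprMn mulruV //.
      by rewrite expr1n mulr1.
    by move=> /isunitM[_]; apply: hC.
  rewrite SE big_seq; apply: nunit_sum => m ms; rewrite subSn ?dm // exprS mulrCA.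
  by move=> /isunitM[].
have S0 := reduced_zero XXred oO rS SO (conj Cz0 T2z).
have Aw : evset p t0 v (ev (extend v 0) h z0).
  have sub := @evset_ext _ _ _ p x0 t0 M v (0 : psec x0) z0 (subring0 Sv).
  by apply: sub; exact: evset_ev.
pose nz (m : mpoly.multinom M.+1) := m ord_max != 0%N.
(* The monomials free of the last variable contribute h(v, 0) b^(d+1); the others have degree at
   most [d] in [b], and the total S is zero at [z0]. *)
have [q Aq qE] : adjoin (evset p t0 v (z := z0)) (b z0) d
    (ev (extend v 0) h z0 * b z0 ^+ d.+1).
  have -> : ev (extend v 0) h z0 * b z0 ^+ d.+1 = - \sum_(m <- mpoly.msupp h | nz m)
      co m z0 * b z0 ^+ (d.+1 - m ord_max).
    have e : ev (extend v 0) h z0 * b z0 ^+ d.+1 = \sum_(m <- mpoly.msupp h | ~~ nz m)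
        co m z0 * b z0 ^+ (d.+1 - m ord_max).
      rewrite evE (bigID nz) /= big1 ?add0r; last first.
        by move=> m /negbTE m0; rewrite psec0 expr0n m0 mulr0.
      rewrite mulr_suml; apply: eq_bigr => m /negPn/eqP m0.
      by rewrite m0 expr0 mulr1 subn0.
    have e2 : S z0 = \sum_(m <- mpoly.msupp h | nz m) co m z0 * b z0 ^+ (d.+1 - m ord_max) +
        \sum_(m <- mpoly.msupp h | ~~ nz m) co m z0 * b z0 ^+ (d.+1 - m ord_max).
      by rewrite SE (bigID nz).
    by apply/eqP; rewrite -addr_eq0 e addrC -e2 S0.
  rewrite -mulN1r; apply: (adjoinZ Sv); first by apply: (subringN Sv); case: Sv.
  apply: adjoin_sum => // m m0; apply: (adjoinZ Sv).
    rewrite coE; apply: (subringM Sv); first exact: evset_pull.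
    by apply: subring_prod => // j _; apply: (subringX _ Sv); exact: evset_var.
  apply: (adjoinX_low _ Sv); rewrite leq_subLR; move: m0; rewrite /nz; case: (m ord_max) => // l _.
  by rewrite addSn ltnS leq_addl.
exact: (integral_unit_lead Sv Aw (@evset_inv _ _ _ p x0 t0 M v z0) uh Aq qE).
Qed.

End Separation.

(** * Stalks generated by the coordinates *)

Section LocalStructure.
Variables (k : fieldType) (XX T : scheme k) (p : mor XX T) (x0 : XX) (t0 : T).
Hypothesis puc : universally_closed p.
Hypothesis XXred : reduced_scheme XX.
Variables (T1 : set T) (Z0 : set XX) (M : nat) (v : 'I_M -> psec x0).
Hypothesis oT1 : open T1.
Hypothesis oZ0 : open Z0.
Hypothesis Z0T : forall z, Z0 z -> T1 (p z).
Hypothesis rv : forall z j, Z0 z -> reg z (v j).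
Hypothesis gc : graph_closed p T1 Z0 v.
Local Notation ev F := (evals (s0 := t0) p v F).
Variable z0 : XX.
Hypothesis Zz0 : Z0 z0.
Hypothesis sep : forall z, Z0 z -> p z = p z0 ->
  (forall F, isunit (ev F z0) <-> isunit (ev F z)) -> z = z0.

(** The graph over the points of [Z0] outside [O] is still closed, and by [sep] none of these points
    in the fibre of [z0] has the coordinates of [z0]; so an equation in the coordinates separates
    them from [z0]. *)
Lemma shrink (O : set XX) : open O -> O z0 ->
  exists T2 (h : mpl M (psec t0)), [/\ open T2, T2 (p z0), preg T2 h,
    isunit (ev h z0) & forall z, Z0 z -> T2 (p z) -> isunit (ev h z) -> O z].
Proof.
move=> oO Oz0.
have [z [Zz nO] pz h|T2 [h [oT2 [T2z rh] _ uh hC]]] :=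
  @separate k XX T p x0 t0 puc T1 _ _ _ v z0 oT1 (Z0T Zz0) (graph_closedD oO gc).
  by apply: nO; rewrite (sep Zz pz h).
exists T2, h; split=> // z Zz Tz u; apply: contrapT => nO.
by apply: (hC z).
Qed.

Lemma open_over (T2 : set T) : open T2 -> open (p @^-1` T2).
Proof. by move/continuousP: (@fpt_continuous _ _ _ p); apply. Qed.

(** The germ is a function only near [z0]. By [shrink], the locus where a polynomial [H] in the
    coordinates is invertible lies in this neighbourhood, up to shrinking T; the extra coordinate
    1/H keeps the graph closed and its germ at [z0] is already in [evset]. *)
Lemma germ_integral (c : stk z0) : integral_elt (evset p t0 v (z := z0)) c.
Proof.
have [b rb <-] := reg_germ c.
have [||T2 [h [oT2 T2z rh uh hO]]] := shrink (O := interior (fun z => reg z b)).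
- exact: open_interior.
- exact: nbhs_singleton (nbhs_interior (reg_near rb)).
pose C1 := Z0 `&` p @^-1` (T1 `&` T2).
have oT12 : open (T1 `&` T2) by exact: openI.
have oC1 : open C1 by apply: openI => //; exact: open_over.
pose H : psec x0 := fun z => ev h z.
have rH z : C1 z -> reg z H.
  by move=> [Zz [_ Tz]]; apply: (evals_reg rh Tz) => j; exact: rv.
have gc1 : graph_closed p (T1 `&` T2) C1 v.
  move=> z Tz; have [[rvz CnC]|[j [d [rd nd e]]]] := gc Tz.1; [left|right].
    split=> //; case: CnC => [Zz|nC]; [by left|right].
    by apply: filterS nC => z' + [].
  by exists j, d; split=> //; apply: filterS e => z' + [Zz _]; apply.
have gc2 := graph_closed_ext gc1 (fun z _ => rH z).
have uH : isunit (H z0) by [].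
have Tz : (T1 `&` T2) (p z0) by split; [exact: Z0T|].
have [||||d [q [Aq e]]] := @integral_germ k XX T p x0 t0 puc XXred _ _ _ _ z0 b oT12 Tz _ _ _ gc2.
- exact: (Dset_open oC1 rH).
- by split.
- move=> z j [C1z uz]; rewrite /extend; case: unlift => [j'|]; first exact: rv C1z.1.
  by apply: reg_inv => //; exact: rH.
- by move=> z [[Zz [_ T2z']] uz]; have := hO z Zz T2z' uz; exact: interior_subset.
exists d, q; split=> // l.
apply: (evset_ext _ (Aq l)).
by apply: (@evset_inv _ _ _ p x0 t0 M v z0 (H z0)); [exact: evset_ev|exact: mulruV].
Qed.

Variables (U : set XX) (V : set T) (r : nat) (g : 'I_r -> forall z : XX, stk z).
Hypothesis aU : affine_open U.
Hypothesis Uz0 : U z0.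
Hypothesis rg : forall j, reg_on U (g j).
Hypothesis gen : forall s, reg_on U s ->
  exists l (c : 'I_l -> forall y : T, stk y) (e : 'I_l -> 'I_r -> nat),
    (forall i, reg_on V (c i)) /\
    eq_on U s (fun x => \sum_(i < l) pull p (c i) x * \prod_(j < r) g j x ^+ e i j).
Variable tau : forall t : T, stk t.
Hypothesis ntau : ~ isunit (pull p tau z0).
Hypothesis hmod : forall c : stk z0, exists a d, evset p t0 v a /\ c = a + pull p tau z0 * d.

Lemma evset_all (c : stk z0) : evset p t0 v c.
Proof.
apply: (@integral_nakayama _ _ (evset_subring p t0 v z0) (@evset_inv _ _ _ p x0 t0 M v z0)
  germ_integral _ r (fun j => g j z0) (pull p tau z0)) => //.
- by case: (nonunits_prime (@stk_local _ _ z0)).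
- move=> d; have [s1 [s2 [r1 r2 u2 e]]] := aff_stk aU d Uz0.
  have key s : reg_on U s -> gen_subring (evset p t0 v (z := z0)) (fun j => g j z0) (s z0).
    move=> /gen[l [cf [ex [_ sE]]]] S Ss AS gS; rewrite sE //.
    apply: subring_sum => // i _; apply: subringM => //.
      by apply: AS; exact: evset_pull.
    by apply: subring_prod => // j _; apply: subringX => //; exact: gS.
  by exists (s1 z0), (s2 z0); split=> //; exact: key.
- exact: evset_pull.
Qed.

(** Finitely many generators are fractions in the coordinates near [z0]; by [shrink] this
    neighbourhood may be cut out by a polynomial in the coordinates and an open set of T, a
    condition that can later be read on the image under Phi. *)
Lemma good_nbhd : exists (T2 : set T) (h : mpl M (psec t0)) (F G : 'I_r -> mpl M (psec t0)),
  [/\ open T2, T2 (p z0), preg T2 h, isunit (ev h z0) &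
   forall z, Z0 z -> T2 (p z) -> isunit (ev h z) ->
     U z /\ forall j, isunit (ev (G j) z) /\ ev (G j) z * g j z = ev (F j) z].
Proof.
have /choice[w wP] : forall j, exists w : mpl M (psec t0) * mpl M (psec t0),
    \forall z \near z0, isunit (ev w.2 z) /\ ev w.2 z * g j z = ev w.1 z.
  move=> j; have [F [G [uG e]]] := evset_all (g j z0).
  have [W1 [F' [oW1 W1z rF eF]]] := pst_lift t0 (pst (p z0) F).
  have [W2 [G' [oW2 W2z rG eG]]] := pst_lift t0 (pst (p z0) G).
  have eF' : ev F' z0 = ev F z0 := congr1 (evalp p v z0) eF.
  have eG' : ev G' z0 = ev G z0 := congr1 (evalp p v z0) eG.
  have rF' : reg z0 (ev F') by apply: (evals_reg rF W1z) => l; exact: rv.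
  have rG' : reg z0 (ev G') by apply: (evals_reg rG W2z) => l; exact: rv.
  exists (F', G') => /=.
  have uG' : isunit (ev G' z0) by rewrite eG'.
  have E : ev G' z0 * g j z0 = ev F' z0 by rewrite eG' eF'.
  have := reg_inj (reg_mul rG' (rg j Uz0)) rF' E.
  have := unit_near rG' uG'.
  by apply: filterS2 => z uz ez; split.
pose O := U `&` interior (fun z => forall j, j \in enum 'I_r ->
  isunit (ev (w j).2 z) /\ ev (w j).2 z * g j z = ev (w j).1 z).
have [||T2 [h [oT2 T2z rh uh hO]]] := shrink (O := O).
- by apply: openI; [exact: aff_open|exact: open_interior].
- split=> //; apply: nbhs_singleton; apply: nbhs_interior.
  by apply: near_all => j _; exact: wP.
exists T2, h, (fun j => (w j).1), (fun j => (w j).2); split;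
  [exact: oT2|exact: T2z|exact: rh|exact: uh|move=> z Zz Tz uz].
have [Uz h'] := hO z Zz Tz uz; split; first exact: Uz.
by move=> j; apply: (interior_subset h'); rewrite mem_enum.
Qed.

End LocalStructure.

(** * The divided coordinates *)

(** One pair [F], [G] serves for all [i]. The index will run over the points of a fibre, where a
    common fraction turns functions on the source into tests expressed in the coordinates. *)
Definition frac_set (R S : comNzRingType) (I : Type) (B : I -> comNzRingType)
    (e : forall i, {rmorphism R -> B i}) (s : forall i, {rmorphism S -> B i}) : set S :=
  [set c | exists F G : R, forall i, isunit (e i G) /\ e i G * s i c = e i F].

Lemma frac_set_subring (R S : comNzRingType) (I : Type) (B : I -> comNzRingType)
    (e : forall i, {rmorphism R -> B i}) (s : forall i, {rmorphism S -> B i}) :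
  subring (frac_set e s).
Proof.
split.
- by exists 1, 1 => i; rewrite !rmorph1 mulr1; split=> //; exact: isunit1.
- move=> a b [F [G h]] [F' [G' h']]; exists (G' * F - G * F'), (G * G') => i.
  have [uG _] := h i; have [uG' _] := h' i.
  by rewrite !(rmorphM, rmorphB) -(h i).2 -(h' i).2; split; [exact/isunitM|exact: sub_frac].
- move=> a b [F [G h]] [F' [G' h']]; exists (F * F'), (G * G') => i.
  have [uG _] := h i; have [uG' _] := h' i.
  by rewrite !rmorphM -(h i).2 -(h' i).2; split; [exact/isunitM|exact: mulrACA].
Qed.

Section LocalFamily.
Variables (k : fieldType) (XX T P PT : scheme k) (N : nat).
Variables (U : 'I_N.+1 -> set P) (x : 'I_N.+1 -> 'I_N.+1 -> forall p : P, stk p).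
Hypothesis aU : forall i, affine_open (U i).
Hypothesis xreg : forall i j, reg_on (U i) (x i j).
Hypothesis x1 : forall i, eq_on (U i) (x i i) (fun=> 1).
Hypothesis covU : forall p, exists i, U i p.
Hypothesis xunit : forall i j p, U i p -> (U j p <-> isunit (x i j p)).
Hypothesis xmul : forall i j l p, U i p -> U j p -> x i j p * x j l p = x i l p.
Hypothesis xpoly : forall i s, reg_on (U i) s ->
  exists! q : mpl N k, eq_on (U i) s (fun p =>
    mpoly.mmap (in_alg (stk p)) (fun j => x i (lift i j) p) q).
Variables (p : mor XX T) (F : mor XX P) (t0 : T) (x0 : XX).
Variables (tau : forall t : T, stk t) (T1 : set T).
Hypothesis tauT : reg_on T1 tau.
Hypothesis nzd : forall z, T1 (p z) -> forall c, pull p tau z * c = 0 -> c = 0.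
Variables (l : 'I_N.+1) (m : nat) (f : 'I_m -> forall p : P, stk p).
Hypothesis fU : forall j, reg_on (U l) (f j).

Definition chart_dom : set XX := [set z | U l (F z) /\ T1 (p z)].

Hypothesis div_tau : forall z j, chart_dom z -> exists g, pull F (f j) z = pull p tau z * g.

(** The division by [tau] is made germ by germ; since [tau] is a nonzerodivisor the quotients fit
    together into a regular function ([quot_reg]). *)
Definition quot (j : 'I_m) : psec x0 := fun z =>
  if pselect (exists g, pull F (f j) z = pull p tau z * g) is left h
  then sval (cid h) else 0.

Lemma quotE j z : chart_dom z -> pull F (f j) z = pull p tau z * quot j z.
Proof.
move=> Zz; rewrite /quot; case: pselect => [h|[]]; last exact: div_tau.
by case: cid.
Qed.

Lemma tauX_reg z : T1 (p z) -> reg z (pull p tau).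
Proof. by move=> /tauT/pull_reg. Qed.

Lemma near_pre (Y : scheme k) (h : mor XX Y) (O : set Y) z : open O -> O (h z) ->
  \forall z' \near z, O (h z').
Proof.
move=> oO Oz; apply: (@fpt_continuous _ _ _ h).
exact: (open_nbhs_nbhs (conj oO Oz)).
Qed.

Hypothesis oT1 : open T1.

Lemma near_chart z : chart_dom z -> \forall z' \near z, chart_dom z'.
Proof.
move=> [Uz Tz]; have n1 := near_pre (aff_open (aU l)) Uz; have n2 := near_pre oT1 Tz.
by apply: filterS2 n1 n2 => z'; split.
Qed.

Lemma chart_open : open chart_dom.
Proof.
apply: openI.
  move/continuousP: (@fpt_continuous _ _ _ F); apply; exact: aff_open.
by move/continuousP: (@fpt_continuous _ _ _ p); apply.
Qed.

Lemma quot_reg j z : chart_dom z -> reg z (quot j).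
Proof.
move=> Zz; have [Uz Tz] := Zz.
have [g gE] := div_tau j Zz; have [kap rk kE] := reg_germ g.
have e0 : pull F (f j) z = pull p tau z * kap z by rewrite kE.
have near1 := reg_inj (pull_reg (fU j Uz)) (reg_mul (tauX_reg Tz) rk) e0.
apply: reg_ext rk; apply: filterS2 near1 (near_chart Zz) => z' e1 Zz'.
apply/eqP; rewrite -subr_eq0; apply/eqP; apply: (nzd Zz'.2).
by rewrite mulrBr -e1 -quotE // subrr.
Qed.

Definition coords (t : 'I_(N + m)) : psec x0 :=
  match split t with
  | inl j => pull F (x l (lift l j))
  | inr j => quot j
  end.

Lemma coords_l j : coords (lshift m j) = pull F (x l (lift l j)).
Proof. by rewrite /coords; case: split_ordP => j' /eqP; rewrite ?eq_shift // => /eqP <-. Qed.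

Lemma coords_r j : coords (rshift N j) = quot j.
Proof. by rewrite /coords; case: split_ordP => j' /eqP; rewrite ?eq_shift // => /eqP <-. Qed.

Lemma coords_reg z t : chart_dom z -> reg z (coords t).
Proof.
move=> Zz; rewrite /coords; case: split => j; last exact: quot_reg.
by apply: pull_reg; apply: xreg; case: Zz.
Qed.

(** The quotients are regular on the whole chart; at its boundary an affine coordinate of P^N
    already has a pole, by [chart_boundary]. *)
Lemma coords_closed : graph_closed p T1 chart_dom coords.
Proof.
move=> z Tz; have [Uz|nU] := EM (U l (F z)).
  by left; split; [move=> t; exact: coords_reg|left].
right; have [j [c [rc nc e]]] := chart_boundary aU covU xreg x1 xunit xmul nU.
exists (lshift m j), c; split=> //; rewrite coords_l.
by apply: filterS e => z' + [Uz' _]; apply.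
Qed.

Local Notation ev G := (evals (s0 := t0) p coords G).

Definition polyset : set (psec x0) :=
  [set s | exists G : mpl (N + m) (psec t0), forall z, chart_dom z -> ev G z = s z].

Lemma polyset_subring : subring polyset.
Proof.
split.
- by exists 1 => z _; exact: (evals1 t0 p coords z).
- move=> s t [G hG] [H hH]; exists (G - H) => z Zz.
  by apply: etrans (evalsB p coords G H z) _; rewrite hG // hH.
- move=> s t [G hG] [H hH]; exists (G * H) => z Zz.
  by apply: etrans (evalsM p coords G H z) _; rewrite hG // hH.
Qed.

Lemma polyset_coord t : polyset (coords t).
Proof.
exists (mpX (psec t0) (mpoly.mnm1 t)) => z _; exact: (evalsX t0 p coords t z).
Qed.

Lemma polyset_pull (s : forall q : P, stk q) : reg_on (U l) s -> polyset (pull F s).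
Proof.
move=> rs; have Ps := polyset_subring.
have p0 : P := F x0.
pose q := cpoly xpoly l (s : psec p0).
have [G hG] : polyset (\sum_(d <- mpoly.msupp q) csecr x0 (mcf d q) *
    \prod_(j < N) coords (lshift m j) ^+ d j).
  apply: subring_sum => // d _; apply: subringM => //.
    exists (mpC _ (csecr t0 (mcf d q))) => z _; apply: etrans (evalsC p coords _ z) _.
    exact: fstk_const.
  by apply: subring_prod => // j _; apply: subringX => //; exact: polyset_coord.
exists G => z Zz; rewrite hG // psec_sum.
rewrite (pull_cpoly xpoly (s := s : psec p0) rs Zz.1) kevalE.
apply: eq_bigr => d _; rewrite psecM psec_prod; congr (_ * _).
by apply: eq_bigr => j _; rewrite psecX coords_l.
Qed.

End LocalFamily.

(** * The morphism Phi near a point of the special fibre *)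

Section LocalEmbedding.
Variables (k : fieldType) (X Y XX T P PT : scheme k) (N : nat).
Variables (U : 'I_N.+1 -> set P) (x : 'I_N.+1 -> 'I_N.+1 -> forall p : P, stk p).
Hypothesis aU : forall i, affine_open (U i).
Hypothesis covU : forall p, exists i, U i p.
Hypothesis xreg : forall i j, reg_on (U i) (x i j).
Hypothesis x1 : forall i, eq_on (U i) (x i i) (fun=> 1).
Hypothesis xunit : forall i j p, U i p -> (U j p <-> isunit (x i j p)).
Hypothesis xmul : forall i j l p, U i p -> U j p -> x i j p * x j l p = x i l p.
Hypothesis xpoly : forall i s, reg_on (U i) s ->
  exists! q : mpl N k, eq_on (U i) s (fun p =>
    mpoly.mmap (in_alg (stk p)) (fun j => x i (lift i j) p) q).
Variables (i : mor Y P) (pi : mor X Y) (nu : H0_normal (mcomp i pi)).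
Hypothesis hi : closed_immersion i.
Variables (p : mor XX T) (prP : mor PT P) (prT : mor PT T) (Phi : mor XX PT).
Hypothesis hPhi : eqm (mcomp prT Phi) p.
Hypothesis puc : universally_closed p.
Hypothesis pft : finite_type_mor p.
Hypothesis XXred : reduced_scheme XX.
Local Notation F := (mcomp prP Phi).
Variables (t0 : T) (tau : forall t : T, stk t) (T1 : set T).
Hypothesis oT1 : open T1.
Hypothesis T1t0 : T1 t0.
Hypothesis tauT : reg_on T1 tau.
Hypothesis tauU : forall t, T1 t -> t <> t0 -> isunit (tau t).
Hypothesis ntau : ~ isunit (tau t0).
Hypothesis nzd : forall z, T1 (p z) -> forall c, pull p tau z * c = 0 -> c = 0.
Variable a : mor X XX.
Hypothesis apt : forall w, p (a w) = t0.
Hypothesis aex : forall z, p z = t0 -> exists w, a w = z.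
Hypothesis aker : forall w c, fstk a w c = 0 -> exists c', c = pull p tau (a w) * c'.
Hypothesis Fpt : forall w, F (a w) = i (pi w).
Hypothesis hFa : forall s w, pull a (pull F s) w = pull (mcomp i pi) s w.
Hypothesis div_a : forall w f, pull pi (pull i f) w = 0 ->
  exists g, pull F f (a w) = pull p tau (a w) * g.
Hypothesis quot_a : forall w W f (G : forall z : XX, stk z),
  ideal_section i W f -> W (i (pi w)) ->
  pull F f (a w) = pull p tau (a w) * G (a w) -> pull a G w = Psi nu f w.

Variable w0 : X.
Variables (V : set Y) (m : nat) (e : 'I_m -> forall w : X, stk w).
Hypothesis aVX : affine_open (pi @^-1` V).
Hypothesis Vw0 : V (pi w0).
Hypothesis egen : forall s, reg_on (pi @^-1` V) s ->
  exists c : 'I_m -> forall y : Y, stk y, (forall j, reg_on V (c j)) /\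
    eq_on (pi @^-1` V) s (fun x => \sum_(j < m) pull pi (c j) x * e j x).
Variable l : 'I_N.+1.
Hypothesis Ul : U l (i (pi w0)).
Variables f h c1 c2 : 'I_m -> forall q : P, stk q.
Hypothesis fU : forall j, reg_on (U l) (f j).
Hypothesis hU : forall j, reg_on (U l) (h j).
Hypothesis c1U : forall j, reg_on (U l) (c1 j).
Hypothesis c2U : forall j, reg_on (U l) (c2 j).
Hypothesis f0 : forall j, eq_on (i @^-1` (U l)) (pull i (f j)) (fun=> 0).
Hypothesis uh : forall j, isunit (h j (i (pi w0))).
Hypothesis uc2 : forall j, isunit (c2 j (i (pi w0))).
Hypothesis eE : forall j w, pi w = pi w0 ->
  pull (mcomp i pi) (h j) w * pull (mcomp i pi) (c2 j) w * e j w =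
  pull (mcomp i pi) (c2 j) w * Psi nu (f j) w +
  pull (mcomp i pi) (h j) w * pull (mcomp i pi) (c1 j) w.

Let x0 := a w0.
Local Notation Z0 := (chart_dom U p F T1 l).
Local Notation v := (coords x p F x0 tau l f).
Local Notation ev G := (evals (s0 := t0) p v G).

(** Over t0, [f j] vanishes on Y and [div_a] applies; elsewhere [tau] is invertible. *)
Lemma div_tau z j : Z0 z -> exists g, pull F (f j) z = pull p tau z * g.
Proof.
move=> [Uz Tz]; have [pz|pz] := EM (p z = t0).
  have [w wz] := aex pz; subst z; apply: div_a.
  have Uw : U l (i (pi w)) by rewrite -Fpt.
  apply: etrans (congr1 (fstk pi w) (f0 j Uw)) _; exact: rmorph0.
have [d ud] : isunit (pull p tau z) by apply/pull_unit; exact: tauU.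
by exists (d * pull F (f j) z); rewrite mulrA ud mul1r.
Qed.

Lemma fibre_dom w : pi w = pi w0 -> Z0 (a w).
Proof. by move=> pw; split; [rewrite Fpt pw|rewrite apt]. Qed.

Definition evalr (z : XX) : {rmorphism mpl (N + m) (psec t0) -> stk z} :=
  evalp p v z \o mpoly.map_mpoly (pev (p z)).

Definition fibre_frac : set (psec w0) :=
  frac_set (I := {w | pi w = pi w0})
    (fun w => fstk a (sval w) \o evalr (a (sval w)) : {rmorphism _ -> stk (sval w)})
    (fun w => pev (sval w)).

Lemma polysetP (s : forall q : P, stk q) : reg_on (U l) s ->
  exists G, forall z, Z0 z -> ev G z = pull F s z.
Proof. by move=> rs; exact: (polyset_pull xpoly p F t0 x0 tau T1 f rs). Qed.

Lemma fibre_ev s G w : (forall z, Z0 z -> ev G z = pull F s z) -> pi w = pi w0 ->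
  fstk a w (evalr (a w) G) = pull (mcomp i pi) s w.
Proof.
move=> hG pw; apply: etrans (hFa s w).
exact: (congr1 (fstk a w) (hG _ (fibre_dom pw))).
Qed.

Lemma fibre_frac_pull (b : forall y : Y, stk y) : fibre_frac (pull pi b : psec w0).
Proof.
have [d1 [d2 [r1 r2 u2 E]]] := stk_lift hi (aU l) (b (pi w0)) Ul.
have [G1 h1] := polysetP r1; have [G2 h2] := polysetP r2.
exists G1, G2 => -[w pw].
change (isunit (fstk a w (evalr (a w) G2)) /\
  fstk a w (evalr (a w) G2) * pull pi b w = fstk a w (evalr (a w) G1)).
rewrite (fibre_ev h2 pw) (fibre_ev h1 pw).
split; first by apply/pull_unit; rewrite -[mcomp i pi w]/(i (pi w)) pw.
have E' y : y = pi w0 -> pull i d2 y * b y = pull i d1 y by move=> ->.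
apply: etrans (esym (rmorphM (fstk pi w) _ _)) _.
exact: (congr1 (fstk pi w) (E' _ pw)).
Qed.

Lemma fibre_quot j w : pi w = pi w0 -> pull a (quot p F x0 tau f j) w = Psi nu (f j) w.
Proof.
move=> pw; apply: (@quot_a w (U l)).
- by split; [exact: fU|exact: f0].
- by rewrite pw.
- exact: (quotE x0 div_tau j (fibre_dom pw)).
Qed.

Lemma morph_decomp (R S : comNzRingType) (E : {rmorphism R -> S}) u1 u2 u3 u4 :
  E (u1 * u2 + u3 * u4) = E u1 * E u2 + E u3 * E u4.
Proof. by rewrite rmorphD !rmorphM. Qed.

(** By [eE], the generator [e j] is a fraction in the coordinates of P^N and the divided coordinate
    that restricts to Psi of [f j]. *)
Lemma fibre_frac_gen j : fibre_frac (e j : psec w0).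
Proof.
have [Gh hGh] := polysetP (hU j); have [G1 hG1] := polysetP (c1U j).
have [G2 hG2] := polysetP (c2U j).
pose Gq := mpX (psec t0) (mpoly.mnm1 (rshift N j)).
exists (G2 * Gq + Gh * G1), (Gh * G2) => -[w pw].
pose E : {rmorphism _ -> stk w} := fstk a w \o evalr (a w).
change (isunit (E (Gh * G2)) /\ E (Gh * G2) * e j w = E (G2 * Gq + Gh * G1)).
have e1 : E (G2 * Gq + Gh * G1) = E G2 * E Gq + E Gh * E G1 := morph_decomp E _ _ _ _.
have e2 : E (Gh * G2) = E Gh * E G2 := rmorphM E _ _.
have eh : E Gh = pull (mcomp i pi) (h j) w := fibre_ev hGh pw.
have ec1 : E G1 = pull (mcomp i pi) (c1 j) w := fibre_ev hG1 pw.
have ec2 : E G2 = pull (mcomp i pi) (c2 j) w := fibre_ev hG2 pw.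
have eq : E Gq = Psi nu (f j) w.
  rewrite -(fibre_quot j pw); apply: (congr1 (fstk a w)).
  apply: etrans (evalsX t0 p v (rshift N j) (a w)) _.
  by rewrite coords_r.
rewrite e1 e2 eh ec1 ec2 eq; split; last exact: (eE j pw).
by apply/isunitM; split; apply/pull_unit; rewrite -[mcomp i pi w]/(i (pi w)) pw.
Qed.

Lemma fibre_frac_all g : reg_on (pi @^-1` V) g -> fibre_frac (g : psec w0).
Proof.
move=> /egen[c [_ gE]]; have Fs : subring fibre_frac by exact: frac_set_subring.
have [G1 [G2 hG]] : fibre_frac (\sum_(j < m) (pull pi (c j) : psec w0) * (e j : psec w0)).
  apply: subring_sum => // j _; apply: subringM => //; first exact: fibre_frac_pull.
  exact: fibre_frac_gen.
exists G1, G2 => w; have [uG E] := hG w; split; first exact: uG.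
rewrite -E; congr (_ * _); case: w {uG E} => w pw /=.
rewrite /pev gE; last by rewrite /preimage /= pw.
by rewrite psec_sum.
Qed.

(** The coordinates of P^N separate the images in Y; on a common fibre of [pi], the functions on X
    are fractions in all the coordinates, which therefore separate the points of X as well. *)
Lemma chart_sep z : Z0 z -> p z = p x0 ->
  (forall G, isunit (ev G x0) <-> isunit (ev G z)) -> z = x0.
Proof.
move=> Zz pz hz; rewrite /x0 apt in pz; have [w wz] := aex pz; subst z.
have pw : pi w = pi w0.
  have [inj_i _ _] := hi; apply: inj_i; apply: (aff_sep (aU l)) => //.
    by rewrite -Fpt; case: Zz.
  move=> s rs; have [G hG] := polysetP rs; have hw := hz G.
  rewrite !hG // in hw; last exact: fibre_dom.
  by rewrite -!Fpt; split=> u; apply/(pull_unit F); apply/hw; apply/(pull_unit F).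
suff -> : w = w0 by [].
apply: (aff_sep aVX) => [|//|s rs]; first by rewrite /preimage /= pw.
have [G1 [G2 hG]] := fibre_frac_all rs.
have [uG E] := hG (exist _ w pw); have [uG' E'] := hG (exist _ w0 erefl).
have hw := hz G1; have unitE (w' : X) : isunit (fstk a w' (ev G1 (a w'))) <-> isunit (ev G1 (a w')).
  exact: (pull_unit a (ev G1) w').
have s1 : isunit (s w) <-> isunit (ev G1 (a w)).
  split=> [u|/unitE]; first by apply/unitE; rewrite -[fstk _ _ _]E; apply/isunitM.
  by rewrite -[fstk _ _ _]E => /isunitM[].
have s2 : isunit (s w0) <-> isunit (ev G1 (a w0)).
  split=> [u|/unitE]; first by apply/unitE; rewrite -[fstk _ _ _]E'; apply/isunitM.
  by rewrite -[fstk _ _ _]E' => /isunitM[].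
by split=> [/s1/hw/s2|/s2/hw/s1].
Qed.

Lemma frac_mix (R : comNzRingType) (c s1 s2 F1 F2 G1 G2 : R) :
  s2 * c = s1 -> G1 * s1 = F1 -> G2 * s2 = F2 -> (G1 * F2) * c = F1 * G2.
Proof. by move=> <- <- <-; ring. Qed.

(** A germ on XX restricts to a germ on X, which is a fraction in the coordinates; the kernel of the
    restriction consists of multiples of [tau]. *)
Lemma fibre_mod (c : stk x0) : exists b d, evset p t0 v b /\ c = b + pull p tau x0 * d.
Proof.
have [s1 [s2 [r1 r2 u2 sE]]] := aff_stk aVX (fstk a w0 c) Vw0.
pose E : {rmorphism _ -> stk w0} := fstk a w0 \o evalr (a w0).
have fr s : reg_on (pi @^-1` V) s -> exists F G, isunit (E G) /\ E G * s w0 = E F.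
  by move=> /fibre_frac_all[G [H hG]]; exists G, H; exact: (hG (exist _ w0 erefl)).
have [F1 [G1 [uG1 E1]]] := fr _ r1; have [F2 [G2 [uG2 E2]]] := fr _ r2.
have mix := frac_mix sE E1 E2.
have uF2 : isunit (E F2) by rewrite -E2; apply/isunitM.
have uGF : isunit (ev (G1 * F2) x0).
  have u : isunit (E (G1 * F2)) by rewrite (rmorphM E); apply/isunitM.
  exact: (fstk_local u).
have [d dE] := uGF; pose b := d * ev (F1 * G2) x0.
have bE : ev (G1 * F2) x0 * b = ev (F1 * G2) x0 by rewrite /b mulrA dE mul1r.
have [c' cE] : exists c', c - b = pull p tau x0 * c'.
  apply: aker; rewrite rmorphB; apply/eqP; rewrite subr_eq0; apply/eqP.
  have u : isunit (E (G1 * F2)) by exact: isunit_rmorph uGF.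
  apply: (isunit_inj u); rewrite {1}(rmorphM E); apply: etrans mix _.
  rewrite -(rmorphM E); apply: etrans (congr1 (fstk a w0) (esym bE)) _.
  exact: (rmorphM (fstk a w0)).
exists b, c'; split; last by rewrite -cE addrC subrK.
by exists (F1 * G2), (G1 * F2).
Qed.

(** Where [tau] is invertible, the quotients are the functions f_j / tau on P^N_T, so that all
    coordinates are pulled back along Phi. *)
Definition PTcoords (t : 'I_(N + m)) : forall q : PT, stk q :=
  match split t with
  | inl j => pull prP (x l (lift l j))
  | inr j => fun q => sinv (pull prT tau) q * pull prP (f j) q
  end.

Lemma pull_PTcoords t z : Z0 z -> p z <> t0 -> pull Phi (PTcoords t) z = v t z.
Proof.
move=> Zz pz; rewrite /PTcoords /coords; case: split => j.
  exact: (esym (pull_comp prP Phi _ z)).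
have [hp ht] := hPhi; have pp : prT (Phi z) = p z := hp z.
have [_ Tz] := Zz.
have ut : isunit (pull prT tau (Phi z)).
  by apply/pull_unit; rewrite pp; exact: tauU.
have te : pull p tau z = pull Phi (pull prT tau) z.
  by apply: etrans (esym (ht tau z)) _; exact: pull_comp.
apply/eqP; rewrite -subr_eq0; apply/eqP; apply: (nzd Tz); rewrite mulrBr.
apply/eqP; rewrite subr_eq0; apply/eqP; apply: etrans (quotE x0 div_tau j Zz).
rewrite te; apply: etrans (esym (rmorphM (fstk Phi z) _ _)) _.
apply: etrans (esym (pull_comp prP Phi (f j) z)).
apply: (congr1 (fstk Phi z)); rewrite mulrA [_ * sinv _ _]mulruV //.
exact: mul1r.
Qed.

Lemma ev_PT G z : Z0 z -> p z <> t0 ->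
  ev G z = pull Phi (evals (s0 := t0) prT PTcoords G) z.
Proof.
move=> Zz pz; apply: etrans (esym (pull_evals prT Phi PTcoords G z)).
exact: (evals_eqm G (eqm_sym hPhi) (fun t => esym (pull_PTcoords t Zz pz))).
Qed.

Lemma local_embedding : exists O : set XX, [/\ open O, O x0 &
  forall z, O z -> p z <> t0 -> (forall z', Phi z' = Phi z -> z' = z) /\
    forall c : stk z, exists b, fstk Phi z b = c].
Proof.
have [VT [aVT VTt [r [U0 [hU0 cov]]]]] := pft t0.
have [s _ U0s] : (\bigcup_(s in [set: 'I_r]) U0 s) x0 by rewrite -cov /preimage /= apt.
have [aU0 [r' [g [rg gen]]]] := hU0 s.
have Zx0 : Z0 x0 by exact: fibre_dom.
have Z0T z : Z0 z -> T1 (p z) by case.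
have rv z t : Z0 z -> reg z (v t) by exact: (coords_reg aU xreg x0 tauT nzd fU div_tau oT1).
have oZ0 : open Z0 by exact: chart_open.
have gc : graph_closed p T1 Z0 v.
  exact: (coords_closed aU xreg x1 covU xunit xmul x0 tauT nzd fU div_tau oT1).
have ntau' : ~ isunit (pull p tau x0) by move/pull_unit; rewrite apt.
have [T2 [H [A [B [oT2 T2x rH uH hO]]]]] := @good_nbhd k XX T p x0 t0 puc XXred T1 Z0 _ v
  oT1 oZ0 Z0T rv gc x0 Zx0 chart_sep (U0 s) VT r' g aU0 U0s rg gen tau ntau' fibre_mod.
pose C1 := Z0 `&` p @^-1` T2.
have oC1 : open C1 by apply: openI => //; exact: open_over.
have rH1 : reg_on C1 (ev H).
  by move=> z [Zz Tz]; apply: (evals_reg rH Tz) => t; exact: rv.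
exists (Dset C1 (ev H)); split; [exact: Dset_open|by split|].
move=> z [[Zz Tz] uz] pz.
pose O1 z1 := [/\ Z0 z1, p z1 <> t0, Phi z1 = Phi z & U0 s z1 /\
   forall j, isunit (ev (B j) z1) /\ ev (B j) z1 * g j z1 = ev (A j) z1].
(* All the conditions defining the neighbourhood can be read on Phi z, since off t0 the coordinates
   come from P^N_T. Hence a point of XX with the same image, wherever it lies, satisfies them
   too. *)
have O1P z1 : Phi z1 = Phi z -> O1 z1.
  move=> e1; have [hp _] := hPhi.
  have p1 : p z1 = p z by rewrite -(hp z1) -(hp z) /= e1.
  have Zz1 : Z0 z1.
    by case: Zz => Uz T1z; split; rewrite ?p1 // -[mcomp prP Phi z1]/(prP (Phi z1)) e1.
  have pz1 : p z1 <> t0 by rewrite p1.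
  split=> //; apply: hO => //; first by rewrite p1.
  rewrite (ev_PT _ Zz1 pz1); apply/pull_unit; rewrite e1; apply/(pull_unit Phi).
  by rewrite -(ev_PT _ Zz pz).
pose E (z1 : {z1 | Phi z1 = Phi z}) := pullr Phi (Phi z) (sval z1).
(* Functions given by one and the same fraction of pulled-back functions at all points with image
   Phi z: none of them is invertible at one such point and not at another. *)
pose Q : set (psec x0) := frac_set E (fun z1 => pev (sval z1)).
have Qs : subring Q by exact: frac_set_subring.
have Qp (d : forall t : T, stk t) : Q (pull p d).
  exists (pull prT d), 1 => z1; rewrite [E z1 1]rmorph1 mul1r.
  split; first exact: isunit1.
  have [_ hs] := hPhi; apply: etrans (esym (hs d (sval z1))) _.
  exact: pull_comp.
have Qg j : Q (g j).
  exists (evals (s0 := t0) prT PTcoords (A j)), (evals (s0 := t0) prT PTcoords (B j)).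
  move=> [z1 e1]; have [Zz1 pz1 _ [_ /(_ j)]] := O1P z1 e1.
  by rewrite (ev_PT _ Zz1 pz1) (ev_PT _ Zz1 pz1).
have Qall d : reg_on (U0 s) d -> Q d.
  move=> /gen[n1 [cf [ex [_ dE]]]].
  have [G1 [G2 hG]] : Q (\sum_(i1 < n1) (pull p (cf i1) : psec x0) *
      \prod_(j < r') (g j : psec x0) ^+ ex i1 j).
    apply: subring_sum => // i1 _; apply: subringM => //.
    by apply: subring_prod => // j _; apply: subringX => //; exact: Qg.
  exists G1, G2 => z1; have [uG e1] := hG z1; split; first exact: uG.
  rewrite -e1; congr (_ * _); case: z1 {uG e1} => z1 e1.
  have [_ _ _ [U1 _]] := O1P z1 e1.
  change (d z1 = (\sum_(i1 < n1) (pull p (cf i1) : psec x0) *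
      \prod_(j < r') (g j : psec x0) ^+ ex i1 j) z1).
  rewrite dE // psec_sum; apply: eq_bigr => i1 _; rewrite psecM psec_prod.
  by congr (_ * _); apply: eq_bigr => j _; rewrite psecX.
have Uz : U0 s z by have [_ _ _ []] := O1P z erefl.
split=> [z' e1|c].
  have [_ _ _ [Uz' _]] := O1P z' e1; apply: (aff_sep aU0 Uz' Uz) => d rd.
  have [G1 [G2 hG]] := Qall d rd.
  have key z1 : Phi z1 = Phi z -> isunit (d z1) <-> isunit ((G1 : psec (Phi z)) (Phi z)).
    move=> e2; have [uG eG] := hG (exist _ z1 e2); split=> [u|u].
      have : isunit (pull Phi G1 z1) by rewrite -[pull _ _ _]eG; apply/isunitM.
      by move/pull_unit; rewrite e2.
    have : isunit (pull Phi G1 z1) by apply/pull_unit; rewrite e2.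
    by rewrite -[pull _ _ _]eG => /isunitM[].
  by split=> [/(key z' e1)/(key z erefl)|/(key z erefl)/(key z' e1)].
have [s1 [s2 [r1 r2 u2 sE]]] := aff_stk aU0 c Uz.
have fr d : reg_on (U0 s) d -> exists A1 B1 : stk (Phi z),
    isunit B1 /\ fstk Phi z B1 * d z = fstk Phi z A1.
  move=> /Qall[G1 [G2 hG]]; have [uG eG] := hG (exist _ z erefl).
  exists (G1 (Phi z)), (G2 (Phi z)); split; last exact: eG.
  exact: (fstk_local uG).
have [A1 [B1 [uB1 E1]]] := fr _ r1; have [A2 [B2 [uB2 E2]]] := fr _ r2.
have mix := frac_mix sE E1 E2.
have uA2 : isunit A2.
  apply: (@fstk_local _ _ _ Phi); rewrite -E2; apply/isunitM; split=> //.
  exact: isunit_rmorph.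
have [d dE] : isunit (B1 * A2) by apply/isunitM.
exists (d * (A1 * B2)).
have u : isunit (fstk Phi z (B1 * A2)) by apply: isunit_rmorph; exists d.
apply: (isunit_inj u); rewrite -rmorphM mulrA dE mul1r !rmorphM.
exact: esym mix.
Qed.

End LocalEmbedding.

(** * The nearby fibres *)

Section Descent.
Variable k : fieldType.

Lemma universally_closed_map (X Y : scheme k) (f : mor X Y) :
  universally_closed f -> closed_map f.
Proof.
move=> uf; apply: (uf Y X (idm Y) (idm X) f); split; first by split.
move=> V a b [e1 e2]; split; last first.
  move=> h h' [h1 h2] _; split=> [v|s v]; first exact: h1.
  exact: h2.
exists a; split; first by split.
by split=> [v|s v]; [exact: e1|exact: e2].
Qed.

Variables (XX T PT : scheme k) (p : mor XX T) (prT : mor PT T) (Phi : mor XX PT).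
Hypothesis hPhi : eqm (mcomp prT Phi) p.
Hypothesis Phi_closed : closed_map Phi.
Variables (t : T) (S Xt Pt : scheme k) (g : mor S T).
Variables (inclX : mor Xt XX) (qX : mor Xt S) (inclP : mor Pt PT) (qP : mor Pt S).
Variable Phit : mor Xt Pt.
Hypothesis hg : residue_point t g.
Hypothesis hX : is_pullback p g inclX qX.
Hypothesis hP : is_pullback prT g inclP qP.
Hypothesis hPhit : eqm (mcomp inclP Phit) (mcomp Phi inclX).
Hypothesis Phi_inj : forall z z', p z = t -> Phi z' = Phi z -> z' = z.
Hypothesis Phi_surj : forall z, p z = t -> forall c : stk z, exists b, fstk Phi z b = c.

(** Inclusions of fibres are injective and surjective on stalks, and a closed subset of a fibre is
    the trace of a closed subset; so each clause descends from the properties of Phi. *)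
Lemma fibre_closed_immersion : closed_immersion Phit.
Proof.
have [d [Dd gt gs gq]] := residue_fibre hg.
have [h1 h2] := hPhit.
have pX w : p (inclX w) = t := fib_pt gt hX w.
split.
- move=> w w' e; have z0 := inclX w.
  apply: (fib_inj (inclX w) Dd gt gs gq hX); apply/esym; apply: Phi_inj; first exact: pX.
  apply: etrans (esym (h1 w')) _; apply: etrans (h1 w); exact: (congr1 inclP (esym e)).
- move=> C cC; have [[u Cu]|nC] := EM (C !=set0); last first.
    have -> : Phit @` C = set0; last exact: closed0.
    by apply/seteqP; split=> // v [u Cu _]; apply: nC; exists u.
  have [C' cC' CE] := fib_closed (inclX u) Dd gt gs gq hX cC.
  have -> : Phit @` C = inclP @^-1` (Phi @` C').
    apply/seteqP; split=> [_ [w Cw <-]|v [z C'z e]].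
      exists (inclX w); last exact: (esym (h1 w)).
      by move: Cw; rewrite CE.
    have pz : p z = t.
      have [hp _] := hPhi; rewrite -[LHS]hp /= e; exact: (fib_pt gt hP v).
    have [w wz] := fib_ex z Dd gt gs gq hX pz.
    exists w; first by rewrite CE /preimage /= wz.
    apply: (fib_inj (inclP v) Dd gt gs gq hP).
    apply: etrans (h1 w) _; apply: etrans (congr1 Phi wz) e.
  apply: closed_comp; last exact: Phi_closed.
  by move=> w _; exact: fpt_continuous.
- move=> w c; have [c' <-] := fib_surj (inclX w) Dd gt gs gq hX c.
  have [b <-] := Phi_surj (pX w) c'; have [s _ <-] := reg_germ b.
  exists (pull inclP s (Phit w)).
  apply: etrans (esym (pull_comp inclP Phit s w)) _.
  by apply: etrans (h2 s w) _; exact: pull_comp.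
Qed.

End Descent.

Theorem proposition1p4 (k : closedFieldType) (char0 : [pchar k] =i pred0)
  (* phi = i o pi : X -> Y -> P = P^N *)
  (X Y : scheme k) (hX : smooth_proj_var X) (hY : smooth_proj_var Y)
  (N : nat) (P : scheme k) (hP : proj_space N P)
  (i : mor Y P) (hi : closed_immersion i)
  (n : nat) (hn : (2 <= n)%N)
  (pi : mor X Y) (hpi : finite_mor pi) (hdeg : degree_mor pi n)
  (* the curve T, the closed point 0 and P^N_T = PT *)
  (T : scheme k) (hT : smooth_curve T) (t0 : T) (ht0 : closed [set t0])
  (PT : scheme k) (prP : mor PT P) (prT : mor PT T)
  (hPT : is_product prP prT)
  (* the flat family of morphisms Phi : XX -> P^N_T *)
  (XX : scheme k) (p : mor XX T) (Phi : mor XX PT)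
  (hPhi : eqm (mcomp prT Phi) p)
  (p_proper : proper_mor p) (p_flat : flat_mor p) (p_surj : surjective_mor p)
  (* (1) *)
  (XX_irr : irreducible_scheme XX) (XX_red : reduced_scheme XX)
  (* (2) *)
  (hfib : forall (t : T) (S Xt : scheme k) (tau : mor S T)
            (incl : mor Xt XX) (q : mor Xt S),
     residue_point t tau -> is_pullback p tau incl q ->
     [/\ smooth_mor q, irreducible_scheme Xt & projective_mor q])
  (* (3) *)
  (S0 : scheme k) (tau0 : mor S0 T) (htau0 : residue_point t0 tau0)
  (a : mor X XX) (q0 : mor X S0) (ha : is_pullback p tau0 a q0)
  (hPhi0 : eqm (mcomp prP (mcomp Phi a)) (mcomp i pi))
  (* Delta = D, its parameter, the deformation Xtil and the class nu *)
  (D : scheme k) (j : mor D T) (hj : first_inf_nbhd t0 j)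
  (eps : forall d : D, stk d) (heps : dual_param eps)
  (Xtil : scheme k) (b : mor Xtil XX) (q : mor Xtil D)
  (hXtil : is_pullback p j b q)
  (c : mor X Xtil) (hc : eqm (mcomp b c) a)
  (nu : H0_normal (mcomp i pi))
  (hnu : corresponds c (mcomp prP (mcomp Phi b)) (pull q eps) nu)
  (hPsi2 : Psi2_surjective nu) :
  exists T' : set T, [/\ open T', T' t0 &
    forall t : T, T' t -> t <> t0 ->
    forall (S Xt Pt : scheme k) (tau : mor S T)
      (inclX : mor Xt XX) (qX : mor Xt S)
      (inclP : mor Pt PT) (qP : mor Pt S) (Phit : mor Xt Pt),
    residue_point t tau ->
    is_pullback p tau inclX qX -> is_pullback prT tau inclP qP ->
    eqm (mcomp inclP Phit) (mcomp Phi inclX) -> eqm (mcomp qP Phit) qX ->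
    closed_immersion Phit].
Proof.
have [U [x [[aU covU] xreg x1 [xunit xmul] xpoly]]] := hP.
have [_ [ftT Treg] _ _ _] := hT; have [[_ Yreg] _ _] := hY.
have [_ pft puc] := p_proper.
have [tau [rtau tau_eps ntau tauM]] := curve_param (Treg t0).1 hj heps.
have [O1 [oO1 O1t0 tauU1]] := curve_isolated ht0 ftT tauM rtau.
(* On [T1] the section [tau] is regular, and invertible except at t0. *)
pose T1 := O1 `&` interior (fun t => reg t tau).
have oT1 : open T1 by apply: openI => //; exact: open_interior.
have T1t0 : T1 t0.
  by split=> //; apply: nbhs_singleton; apply: nbhs_interior; exact: reg_near.
have tauT : reg_on T1 tau by move=> t [_ /interior_subset].
have tauU t : T1 t -> t <> t0 -> isunit (tau t) by move=> [O1t _]; exact: tauU1.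
have tau0_neq : tau t0 <> 0.
  have [[d _] jt _ _] := hj; have [e0 _] := heps d; move=> t00; apply: e0.
  have h t : t = t0 -> tau t = 0 by move=> ->.
  by rewrite -tau_eps /pull h ?rmorph0.
have nzdT t (s : stk t) : t = t0 -> tau t * s = 0 -> s = 0.
  move=> tt0; subst t; have [_ _ dom] := regular_dom Treg t0.
  by move=> /dom[].
(* The local ring at t0 is a domain in which [tau] is not zero; by flatness [tau] remains a
   nonzerodivisor on XX. *)
have nzd0 z : p z = t0 -> forall s, pull p tau z * s = 0 -> s = 0.
  by move=> pz; apply: (flat_nzd (p_flat z)) => s; exact: nzdT.
have nzd z : T1 (p z) -> forall s, pull p tau z * s = 0 -> s = 0.
  move=> Tz; have [pz|pz] := EM (p z = t0); first exact: nzd0.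
  have ut : isunit (pull p tau z) by apply/pull_unit; exact: tauU.
  by move=> s s0; apply: (isunit_inj ut); rewrite s0 mulr0.
have [d0 [Dd0 gt0 gs0 gq0]] := residue_fibre htau0.
have apt w : p (a w) = t0 := fib_pt gt0 ha w.
have aex z : p z = t0 -> exists w, a w = z := fib_ex z Dd0 gt0 gs0 gq0 ha (z := z).
have aker w (s : stk (a w)) : fstk a w s = 0 -> exists s', s = pull p tau (a w) * s'.
  exact: (special_kernel tauM htau0 ha).
have [hP1 hP2] := hPhi0.
have Fpt w : mcomp prP Phi (a w) = i (pi w) by exact: hP1.
have pullF (V : scheme k) (h : mor V XX) s w :
    pull (mcomp prP (mcomp Phi h)) s w = pull h (pull (mcomp prP Phi) s) w.
  apply: etrans (pull_comp prP (mcomp Phi h) s w) _.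
  apply: etrans (pull_comp Phi h _ w) _.
  exact: (congr1 (fstk h w) (esym (pull_comp prP Phi s (h w)))).
have hFa s w : pull a (pull (mcomp prP Phi) s) w = pull (mcomp i pi) s w.
  by apply: etrans (esym (pullF _ a s w)) _; exact: hP2.
have hFa' s w : pull a (pull (mcomp prP Phi) s) w = pull pi (pull i s) w.
  by apply: etrans (hFa s w) _; exact: pull_comp.
have div_a w f : pull pi (pull i f) w = 0 ->
    exists g, pull (mcomp prP Phi) f (a w) = pull p tau (a w) * g.
  exact: (tau_divides tauM htau0 ha hFa').
have quot_a w W f (G : forall z : XX, stk z) : ideal_section i W f -> W (i (pi w)) ->
    pull (mcomp prP Phi) f (a w) = pull p tau (a w) * G (a w) -> pull a G w = Psi nu f w.
  exact: (Psi_quotient tauM ntau nzd0 htau0 ha hj tau_eps hXtil hc (pullF _ b) hnu).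
have local w : exists O : set XX, [/\ open O, O (a w) &
    forall z, O z -> p z <> t0 -> (forall z', Phi z' = Phi z -> z' = z) /\
    forall s : stk z, exists s', fstk Phi z s' = s].
  have [V [aV Vw aVX [m [e [er egen]]]]] := hpi (pi w).
  have [l Ul] := covU (i (pi w)).
  (* One section of the ideal of Y for each generator [e u] of pi_*O_X over [V]: these will be
     divided by [tau]. *)
  have /choice[f fP] : forall u, exists f : (forall s : P, stk s) * (forall s : P, stk s) *
      (forall s : P, stk s) * (forall s : P, stk s),
    [/\ [/\ reg_on (U l) f.1.1.1, reg_on (U l) f.1.1.2, reg_on (U l) f.1.2 &
            reg_on (U l) f.2],
      eq_on (i @^-1` (U l)) (pull i f.1.1.1) (fun=> 0),
      isunit (f.1.1.2 (i (pi w))), isunit (f.2 (i (pi w))) &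
      forall x, pi x = pi w ->
        pull (mcomp i pi) f.1.1.2 x * pull (mcomp i pi) f.2 x * e u x =
        pull (mcomp i pi) f.2 x * Psi nu f.1.1.1 x +
        pull (mcomp i pi) f.1.1.2 x * pull (mcomp i pi) f.1.2 x].
    move=> u; have [f [h [c1 [c2 h1]]]] :=
      Psi_decomp hi char0 Yreg (ltnW hn) hdeg hPsi2 aV Vw egen (aU l) Ul (er u).
    by exists (f, h, c1, c2).
  apply: (local_embedding aU covU xreg x1 xunit xmul xpoly hi hPhi puc pft XX_red oT1 T1t0
    tauT tauU ntau nzd apt aex aker Fpt hFa div_a quot_a aVX Vw egen Ul
    (f := fun u => (f u).1.1.1) (h := fun u => (f u).1.1.2)
    (c1 := fun u => (f u).1.2) (c2 := fun u => (f u).2)).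
  - by move=> u; have [[]] := fP u.
  - by move=> u; have [[]] := fP u.
  - by move=> u; have [[]] := fP u.
  - by move=> u; have [[]] := fP u.
  - by move=> u; have [] := fP u.
  - by move=> u; have [] := fP u.
  - by move=> u; have [] := fP u.
  - by move=> u; have [] := fP u.
have /choice[O OP] := local.
(* The union contains the special fibre; as [p] is closed, it contains all the fibres over a
   neighbourhood of t0. *)
pose OO := \bigcup_w O w.
have oOO : open OO by apply: bigcup_open => w _; case: (OP w).
have cl : closed (p @` (~` OO)).
  by apply: (universally_closed_map puc); exact: open_closedC.
exists (~` (p @` (~` OO))); split; first exact: closed_openC.
  move=> [z nO pz]; have [w wz] := aex z pz; apply: nO; exists w => //.
  by rewrite -wz; case: (OP w).
move=> t T't tt0 S Xt Pt g inclX qX inclP qP Phit hg hXt hPt hPhit _.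
have inO z : p z = t -> exists2 w, O w z & p z <> t0.
  move=> pz; have [[w _ Oz]|nO] := EM (OO z); first by exists w => //; rewrite pz.
  by case: T't; exists z.
have Phi_closed : closed_map Phi.
  by move=> C; exact: (product_mor_closed aU covU xreg x1 xunit xmul xpoly hPT puc hPhi).
apply: (fibre_closed_immersion hPhi Phi_closed hg hXt hPt hPhit).
- move=> z z' /inO[w Oz pz]; have [_ _ /(_ z Oz pz)[h _]] := OP w; exact: h.
- by move=> z /inO[w Oz pz]; have [_ _ /(_ z Oz pz)[_ h]] := OP w.
Qed.
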